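(* Let $w\in\mathcal V$ be the weak solution of Problem $\mathcal P^s_Q$ with datum $g\in L^2(\Omega)$, let $\widetilde w\in\mathcal V$ and ${\rm e}_w:=\widetilde w-w$. For any $\mathbf y\in Y^s_{\rm div}$ and any $\eta\in\mathcal V$ it holds $$M_\ominus(\widetilde w;\eta)\le|||\nabla_{xt}{\rm e}_w|||\le M_\oplus(\widetilde w;\mathbf y),$$ where $$M_\oplus(\widetilde w;\mathbf y):=|||\nabla_{xt}\widetilde w-t^{2s-1}\mathbf y|||+C_F\,|||t^{2s-1}{\rm div}_{xt}\mathbf y|||+C_F^s\kappa_s\|y_{d+1}(\cdot,0)+g\|$$ and $$M_\ominus^2(\widetilde w;\eta):=2\int_Q t^{1-2s}\nabla_{xt}\widetilde w\cdot\nabla_{xt}\eta\,dxdt-2\int_\Omega g\,\eta(x,0)\,dx-|||\nabla_{xt}\eta|||^2.$$ Moreover, $$\sup_{\eta\in\mathcal V}M_\ominus(\widetilde w;\eta)=|||\nabla_{xt}{\rm e}_w|||=\inf_{\mathbf y\in Y^s_{\rm div}}M_\oplus(\widetilde w;\mathbf y).$$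
   Context: $\Omega\subset\mathbb R^d$, $d\ge1$, is an open, bounded and connected domain with Lipschitz boundary, $0<s<1$, $Q:=\Omega\times(0,+\infty)$, $\Gamma:=\partial\Omega\times(0,+\infty)$. Points of $Q$ are $(x,t)$, $\nabla_{xt}w=\{\nabla_xw,w_t\}$, and ${\rm div}_{xt}$ is the divergence in all $d+1$ variables. $\|\cdot\|$ is the norm of $L^2(\Omega)$. For scalar or vector valued functions on $Q$, $|||v|||^2:=\int_Q t^{1-2s}|v|^2\,dxdt$. The space $\mathcal V$ is the closure of smooth functions with bounded support vanishing on $\Gamma$ with respect to the norm $|||\nabla_{xt}w|||$. The notation $(x,0)$ or $(\cdot,0)$ refers to values on the part $\Omega\times\{0\}$ of the boundary of $Q$. Constants: $C_F=C_F(\Omega):=\lambda_1^{-1/2}$, where $\lambda_1$ is the minimal eigenvalue of the Dirichlet Laplacian in $\Omega$; $C_s:=2^{1-2s}\frac{\Gamma(1-s)}{\Gamma(s)}$ (here $\Gamma(\cdot)$ is the Gamma function); $\kappa_s:=C_s^{-1/2}$. Problem $\mathcal P^s_Q$: for given $g\in L^2(\Omega)$ find $w\in\mathcal V$ with $w_{tt}+\frac{1-2s}{t}w_t+\Delta_xw=0$ in $Q$, $-\lim_{t\to0+}t^{1-2s}w_t=g$ in $\Omega$, $w=0$ on $\Gamma$, understood in the weak sense $$\int_Q t^{1-2s}(w_t\eta_t+\nabla_xw\cdot\nabla_x\eta)\,dxdt-\int_\Omega g\,\eta(x,0)\,dx=0\qquad\forall\eta\in\mathcal V.$$ Fluxes: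 the space $Y^s$ consists of vector valued functions $\mathbf y=\{y_1,\dots,y_d,y_{d+1}\}$ on $Q$ such that $|||\mathbf y|||<\infty$, and $Y^s_{\rm div}:=\{\mathbf y\in Y^s:\int_Q t^{2s-1}|{\rm div}_{xt}\mathbf y|^2\,dxdt<+\infty\}$. *)

(* Defs.v *)
From HB Require Import structures.
From mathcomp Require Import all_boot all_order all_algebra.
From mathcomp Require Import all_classical all_reals all_analysis.
Set Implicit Arguments.
Unset Strict Implicit.
Unset Printing Implicit Defensive.
Import Order.TTheory GRing.Theory Num.Theory.
Import numFieldNormedType.Exports.
Local Open Scope classical_set_scope.
Local Open Scope ring_scope.

(* The sigma-algebra of R^n generated by the coordinates (the Borel one). *)
Section measurable_rV.
Context {R : realType} (n : nat).

Let coors : 'I_n -> 'rV[R]_n -> R := fun i x => x ord0 i.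

Let rV_set0 : g_sigma_preimage coors set0.
Proof. exact: sigma_algebra0. Qed.

Let rV_setC A : g_sigma_preimage coors A -> g_sigma_preimage coors (~` A).
Proof. exact: sigma_algebraC. Qed.

Let rV_bigcup (F : _^nat) : (forall i, g_sigma_preimage coors (F i)) ->
  g_sigma_preimage coors (\bigcup_i (F i)).
Proof. exact: sigma_algebra_bigcup. Qed.

HB.instance Definition _ := @isMeasurable.Build default_measure_display
  'rV[R]_n (g_sigma_preimage coors) rV_set0 rV_setC rV_bigcup.

Lemma measurable_coor (i : 'I_n) :
  measurable_fun [set: 'rV[R]_n] (fun x => x ord0 i).
Proof.
move=> _ Y mY; rewrite setTI; apply: sub_sigma_algebra => /=.
rewrite -bigcup_seq/=; exists i => /=; first by rewrite mem_index_enum.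
by exists Y => //; rewrite setTI.
Qed.

Lemma measurable_fun_rV d (T : measurableType d) (f : T -> 'rV[R]_n) :
  (forall i, measurable_fun [set: T] (fun x => f x ord0 i)) ->
  measurable_fun [set: T] f.
Proof.
move=> mf.
suff H : g_sigma_preimage (fun i => (fun x : 'rV[R]_n => x ord0 i) \o f)
    `<=` measurable.
  move=> _ A mA; apply: H.
  by rewrite g_sigma_preimage_comp; exists A.
apply: smallest_sub; first exact: sigma_algebra_measurable.
rewrite -bigcup_seq; apply: bigcup_sub => i _ A [B mB <-].
exact: mf.
Qed.

End measurable_rV.

Section lebesgue_rV.
Context {R : realType}.
Local Open Scope ereal_scope.

Definition consrV (m : nat) (p : R * 'rV[R]_m) : 'rV[R]_m.+1 :=
  row_mx (p.1)%:M p.2.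

Definition unconsrV (m : nat) (v : 'rV[R]_m.+1) : R * 'rV[R]_m :=
  (v ord0 ord0, \row_i v ord0 (lift ord0 i)).

Lemma consrV0 m (p : R * 'rV[R]_m) : consrV p ord0 ord0 = p.1.
Proof.
rewrite /consrV mxE; case: splitP => // j _.
by rewrite mxE !ord1 eqxx mulr1n.
Qed.

Lemma consrVS m (p : R * 'rV[R]_m) i : consrV p ord0 (lift ord0 i) = p.2 ord0 i.
Proof.
rewrite /consrV mxE; case: splitP => [[j /= jlt] /=|k].
  by move: (jlt) => /[swap] <-; rewrite /bump /= add1n.
by rewrite /= /bump /= !add1n => -[/val_inj ->].
Qed.

Lemma consrVK m : cancel (@consrV m) (@unconsrV m).
Proof.
move=> [x v]; rewrite /unconsrV consrV0; congr pair.
by apply/rowP => i; rewrite mxE consrVS.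
Qed.

Lemma measurable_consrV m : measurable_fun [set: R * 'rV[R]_m] (@consrV m).
Proof.
apply: measurable_fun_rV => i.
have [j ->|->] := unliftP ord0 i.
  under eq_fun do rewrite consrVS.
  exact: (measurableT_comp (measurable_coor j) measurable_snd).
under eq_fun do rewrite consrV0.
exact: measurable_fst.
Qed.

Lemma measurable_unconsrV m : measurable_fun [set: 'rV[R]_m.+1] (@unconsrV m).
Proof.
apply: measurable_fun_pair; first exact: measurable_coor.
apply: measurable_fun_rV => i.
under eq_fun do rewrite mxE.
exact: measurable_coor.
Qed.

(* n-dimensional Lebesgue measure, as an iterated product of the measure on R;
   R^0 is one point of mass 1. *)
Fixpoint leb (n : nat) : set 'rV[R]_n -> \bar R :=
  match n with
  | 0 => dirac (0%R : 'rV[R]_0)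
  | m.+1 => pushforward ((@lebesgue_measure R) \x (@leb m)) (@consrV m)
  end.

Let sigma_finite_prod d1 d2 (T1 : measurableType d1) (T2 : measurableType d2)
  (m1 : {sigma_finite_measure set T1 -> \bar R})
  (m2 : {sigma_finite_measure set T2 -> \bar R}) :
  sigma_finite setT (m1 \x m2).
Proof.
have /sigma_finiteP[F [TF ndF Foo]] := sigma_finiteT m1.
have /sigma_finiteP[G [TG ndG Goo]] := sigma_finiteT m2.
exists (fun n => F n `*` G n).
  rewrite -setXTT TF TG predeqE => -[x y]; split.
    move=> [/= [n _ Fnx] [k _ Gky]]; exists (maxn n k) => //; split.
    - by move: x Fnx; exact/subsetPset/ndF/leq_maxl.
    - by move: y Gky; exact/subsetPset/ndG/leq_maxr.
  by move=> [n _ []/= ? ?]; split; exists n.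
move=> k; have [? ?] := Foo k; have [? ?] := Goo k.
split; first exact: measurableX.
by rewrite product_measure1E// lte_mul_pinfty// ge0_fin_numE.
Qed.

Section step.
Context (m : nat) (mu : {sigma_finite_measure set 'rV[R]_m -> \bar R}).

Let step : exists2 nu' : {measure set 'rV[R]_m.+1 -> \bar R},
  sigma_finite setT nu' &
  pushforward ((@lebesgue_measure R) \x mu) (@consrV m) = nu'.
Proof.
exists (measure_function_pushforward__canonical__measure_function_Measure
  [the measure _ _ of (@lebesgue_measure R) \x mu] (@measurable_consrV m)) => //.
have [F FT Foo] := sigma_finite_prod (@lebesgue_measure R) mu.
exists (fun i => @unconsrV m @^-1` F i).
  by rewrite -preimage_bigcup -FT preimage_setT.
move=> i; have [mF Fioo] := Foo i; split.
  by rewrite -[X in measurable X]setTI; exact: measurable_unconsrV.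
rewrite /= /pushforward -comp_preimage (_ : _ @^-1` _ = F i)//.
by apply/seteqP; split => p /=; rewrite consrVK.
Qed.

Lemma leb_step (f : set 'rV[R]_m -> \bar R) : f = mu ->
  exists2 nu' : {measure set 'rV[R]_m.+1 -> \bar R},
  sigma_finite setT nu' &
  pushforward ((@lebesgue_measure R) \x f) (@consrV m) = nu'.
Proof. by move=> ->; exact: step. Qed.

End step.

Lemma leb_measureP n :
  exists2 mu : {measure set 'rV[R]_n -> \bar R},
    sigma_finite setT mu & @leb n = mu.
Proof.
elim: n => [|m [mu smu ih]].
  exists (dirac (0%R : 'rV[R]_0)) => //.
  apply: fin_num_fun_sigma_finite; first by rewrite measure0 ltry.
  by move=> A mA; rewrite /= diracE.
pose H1 := isSFinite.Build _ _ _ _ (sfinite_measure_sigma_finite smu).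
pose H2 := isSigmaFinite.Build _ _ _ _ smu.
pose mu' := HB.pack_for (SigmaFiniteMeasure.type 'rV[R]_m R)
  (Measure.sort mu) H1 H2.
by apply: (@leb_step m mu').
Qed.

Lemma leb0 n : @leb n set0 = 0.
Proof. by have [mu _ ->] := leb_measureP n; rewrite measure0. Qed.

Lemma leb_ge0 n A : 0 <= @leb n A.
Proof. by have [mu _ ->] := leb_measureP n; exact: measure_ge0. Qed.

Lemma leb_semi_sigma_additive n : semi_sigma_additive (@leb n).
Proof.
by have [mu _ ->] := leb_measureP n; exact: measure_semi_sigma_additive.
Qed.

HB.instance Definition _ n := isMeasure.Build _ _ _ (@leb n)
  (@leb0 n) (@leb_ge0 n) (@leb_semi_sigma_additive n).

Lemma leb_sigma_finite n : sigma_finite setT (@leb n).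
Proof. by have [mu smu ->] := leb_measureP n. Qed.

HB.instance Definition _ n := Measure_isSigmaFinite.Build _ _ _ (@leb n)
  (@leb_sigma_finite n).

End lebesgue_rV.
Arguments leb {R} n A.

Section calculus.
Context {R : realType}.

(* C^oo: every iterated directional derivative exists and is continuous. *)
Definition iter_derive (V : normedModType R) (f : V -> R) (vs : seq V) : V -> R :=
  foldr (fun v h => 'D_v h) f vs.

Definition smooth (V : normedModType R) (f : V -> R) : Prop :=
  forall vs : seq V, continuous (iter_derive f vs) /\
    (forall v x, derivable (iter_derive f vs) x v).

Definition test_fun (V : normedModType R) (U : set V) (f : V -> R) : Prop :=
  smooth f /\
  exists K : set V, [/\ compact K, K `<=` U & forall x, ~ K x -> f x = 0].

Definition Gamma_fun (a : R) : R :=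
  \int[@lebesgue_measure R]_(t in `]0, +oo[) (t `^ (a - 1) * expR (- t)).

Definition sqrte (x : \bar R) : \bar R := poweR x (2^-1).

End calculus.

Section domain.
Context {R : realType} {d : nat}.
Implicit Types (x : 'rV[R]_d).

(* Euclidean scalar product; the norm `|x| of 'rV[R]_d is the sup norm. *)
Definition dot (a b : 'rV[R]_d) : R := \sum_i a ord0 i * b ord0 i.

Definition boundary (A : set 'rV[R]_d) : set 'rV[R]_d := closure A `\` A^°.

(* Near each boundary point, Omega is the part above the graph of a Lipschitz
   function gam over the hyperplane orthogonal to a unit vector nu: the
   coordinate of x along nu is dot x nu, its projection x - (dot x nu) nu. *)
Definition lipschitz_boundary (Omega : set 'rV[R]_d) : Prop :=
  forall x0, boundary Omega x0 ->
  exists (nu : 'rV[R]_d) (gam : 'rV[R]_d -> R) (L r : R),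
    [/\ dot nu nu = 1, L.-lipschitz gam, 0 < r &
      forall x, `|x - x0| < r ->
        (Omega x <-> gam (x - dot x nu *: nu) < dot x nu)].

Context (Omega : set 'rV[R]_d).

(* The norm of L^2(Omega), for scalar and for vector valued functions. *)
Definition normO (f : 'rV[R]_d -> R) : \bar R :=
  sqrte (\int[leb d]_(x in Omega) ((f x) ^+ 2)%:E)%E.

Definition normOv (F : 'rV[R]_d -> 'rV[R]_d) : \bar R :=
  sqrte (\int[leb d]_(x in Omega) (dot (F x) (F x))%:E)%E.

Definition L2 (f : 'rV[R]_d -> R) : Prop :=
  measurable_fun Omega f /\ (normO f < +oo)%E.

Definition gradx (f : 'rV[R]_d -> R) x : 'rV[R]_d :=
  \row_i 'D_(delta_mx ord0 i) f x.

(* u belongs to H^1_0(Omega), the closure of C_c^oo(Omega) in H^1(Omega),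
   and G is its gradient. *)
Definition H10 (u : 'rV[R]_d -> R) (G : 'rV[R]_d -> 'rV[R]_d) : Prop :=
  [/\ measurable_fun Omega u, measurable_fun Omega G &
  exists phi : nat -> 'rV[R]_d -> R,
    [/\ forall n, test_fun Omega (phi n),
      normO (fun x => phi n x - u x) @[n --> \oo] --> 0%E &
      normOv (fun x => gradx (phi n) x - G x) @[n --> \oo] --> 0%E]].

Definition dirichlet_eigenvalue (l : R) : Prop :=
  exists u Gu, [/\ H10 u Gu, normO u != 0%E &
    forall v Gv, H10 v Gv ->
      \int[leb d]_(x in Omega) dot (Gu x) (Gv x) =
      l * \int[leb d]_(x in Omega) (u x * v x)].

(* For bounded Omega the infimum is attained. *)
Definition lambda1 : R := inf [set l | dirichlet_eigenvalue l].

Definition C_F : R := lambda1 `^ (- 2^-1).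

End domain.

Definition C_s {R : realType} (s : R) : R :=
  2 `^ (1 - 2 * s) * (Gamma_fun (1 - s) / Gamma_fun s).

Definition kappa {R : realType} (s : R) : R := C_s s `^ (- 2^-1).

Section cylinder.
Context {R : realType} {d : nat} (Omega : set 'rV[R]_d) (s : R).

(* Points (x, t) of R^d x R; a vector field y = (y_1, ..., y_(d+1)) is stored
   as the pair of its x-part y.1 and its last component y.2. *)
Local Notation Z := ('rV[R]_d * R)%type.

Implicit Types (w eta : Z -> R) (y : Z -> Z) (g h : 'rV[R]_d -> R).

Definition cyl : set Z := Omega `*` `]0, +oo[.

Definition lebQ : set ('rV[R]_d * measurableTypeR R) -> \bar R :=
  (leb d \x @lebesgue_measure R)%E.

Definition dotz (p q : Z) : R := dot p.1 q.1 + p.2 * q.2.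

(* The norm |||.||| for scalar and for vector valued functions. *)
Definition normQ (f : Z -> R) : \bar R :=
  sqrte (\int[lebQ]_(z in cyl) (z.2 `^ (1 - 2 * s) * (f z) ^+ 2)%:E)%E.

Definition normQv (F : Z -> Z) : \bar R :=
  sqrte (\int[lebQ]_(z in cyl) (z.2 `^ (1 - 2 * s) * dotz (F z) (F z))%:E)%E.

Definition gradz (f : Z -> R) (z : Z) : Z :=
  (\row_i 'D_((delta_mx ord0 i, 0) : Z) f z, 'D_((0, 1) : Z) f z).

(* Smooth means smooth up to the boundary of Q, i.e. the restriction to Q of a
   smooth function on R^(d+1). *)
Definition admissible (phi : Z -> R) : Prop :=
  [/\ smooth phi, bounded_set [set z | phi z != 0] &
    forall x t, boundary Omega x -> 0 < t -> phi (x, t) = 0].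

(* The closure of the admissible functions, realised by functions on Q: by
   Friedrichs' inequality in x a Cauchy sequence for |||grad .||| is also one
   for |||.|||. The limit G of the gradients is the (weak) gradient of w. *)
Definition V_approx w (G : Z -> Z) (phi : nat -> Z -> R) : Prop :=
  [/\ forall n, admissible (phi n),
    normQ (fun z => phi n z - w z) @[n --> \oo] --> 0%E &
    normQv (fun z => gradz (phi n) z - G z) @[n --> \oo] --> 0%E].

Definition V_grad w (G : Z -> Z) : Prop :=
  [/\ measurable_fun cyl w, measurable_fun cyl G &
    exists phi, V_approx w G phi].

Definition inV w : Prop := exists G, V_grad w G.

(* The gradient of w in V, unique up to null sets. *)
Definition gradQ w : Z -> Z := xget (fun=> 0) [set G | V_grad w G].

(* w(., 0): the L^2(Omega) limit of the traces of approximating functions. *)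
Definition V_trace w (u : 'rV[R]_d -> R) : Prop :=
  L2 Omega u /\ exists phi, V_approx w (gradQ w) phi /\
    normO Omega (fun x => phi n (x, 0) - u x) @[n --> \oo] --> 0%E.

Definition traceV w : 'rV[R]_d -> R := xget (fun=> 0) [set u | V_trace w u].

Definition weak_solution g w : Prop :=
  inV w /\ forall eta, inV eta ->
    \int[lebQ]_(z in cyl)
        (z.2 `^ (1 - 2 * s) * dotz (gradQ w z) (gradQ eta z)) -
    \int[leb d]_(x in Omega) (g x * traceV eta x) = 0.

Definition loc_integrable (f : Z -> R) : Prop :=
  measurable_fun cyl f /\
  forall K : set Z, compact K -> K `<=` cyl -> lebQ.-integrable K (EFin \o f).

(* The x,t-divergence in the sense of distributions on Q. *)
Definition weak_div y (delta : Z -> R) : Prop :=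
  loc_integrable delta /\
  forall psi : Z -> R, test_fun cyl psi ->
    \int[lebQ]_(z in cyl) dotz (y z) (gradz psi z) =
    - \int[lebQ]_(z in cyl) (delta z * psi z).

Definition divQ y : Z -> R := xget (fun=> 0) [set delta | weak_div y delta].

Definition inY y : Prop := measurable_fun cyl y /\ (normQv y < +oo)%E.

Definition inYdiv y : Prop :=
  [/\ inY y, exists delta, weak_div y delta &
    (\int[lebQ]_(z in cyl) (z.2 `^ (2 * s - 1) * (divQ y z) ^+ 2)%:E < +oo)%E].

(* y_(d+1)(., 0) = h, in the weak sense given by Green's formula; the outward
   normal to Q on Omega x {0} is (0, -1). *)
Definition flux_trace y h : Prop :=
  L2 Omega h /\ forall eta, admissible eta ->
    \int[lebQ]_(z in cyl) (dotz (y z) (gradz eta z) + divQ y z * eta z) =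
    - \int[leb d]_(x in Omega) (h x * eta (x, 0)).

(* || y_(d+1)(., 0) + g ||; the trace is unique up to null sets, and the value
   is +oo when y_(d+1)(., 0) is not in L^2(Omega). *)
Definition flux_residual y g : \bar R :=
  ereal_inf [set normO Omega (fun x => h x + g x) | h in flux_trace y].

Definition M_plus g w y : \bar R :=
  (normQv (fun z => (gradQ w z - z.2 `^ (2 * s - 1) *: y z)%R)
   + (C_F Omega)%:E * normQ (fun z => (z.2 `^ (2 * s - 1) * divQ y z)%R)
   + (C_F Omega `^ s * kappa s)%:E * flux_residual y g)%E.

Definition M_minus_sq g w eta : R :=
  2 * \int[lebQ]_(z in cyl)
        (z.2 `^ (1 - 2 * s) * dotz (gradQ w z) (gradQ eta z))
  - 2 * \int[leb d]_(x in Omega) (g x * traceV eta x)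
  - (fine (normQv (gradQ eta))) ^+ 2.

(* Num.sqrt makes M_minus 0 where M_minus_sq is negative. *)
Definition M_minus g w eta : R := Num.sqrt (M_minus_sq g w eta).

End cylinder.

(* Main.v *)
(* Write e = wt - w, and omega(t) = t^(1-2s). Subtracting the weak equation of w
   from the definition of M_minus gives
     M_minus^2 = 2 <grad e, grad eta> - |||grad eta|||^2 <= |||grad e|||^2,
   with equality at eta = e.

   For the upper bound, Green's formula gives, for admissible phi,
     <grad e, grad phi> = <grad wt - y/omega, grad phi> - (div y, phi)
                          - (y_(d+1) + g, phi(.,0)),
   and the last two terms are estimated by Friedrichs' inequality on the slices
   t = const and by the trace inequality
     C_s lambda_1^s ||phi(.,0)||^2 <= |||grad phi|||^2.
   On each line x = const the latter is a one-dimensional inequality for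
   omega (v'^2 + lambda_1 v^2), which is a completed square minus the derivative
   of a v^2 as soon as a solves a Riccati equation; the solution with
   a(0) = C_s lambda_1^s is the quotient of two Bessel type integrals.

   The optimal flux omega grad w need not belong to Y^s when omega is too
   singular at t = 0 or grows at infinity. It is approximated by
   a_eps G, where a_eps = omega / (1 + eps omega^2) and G minimises the energy
   with weight a_eps. This flux is divergence free, has the exact trace -g, and
   |||y/omega - grad w|||^2 is at most the difference of the two energies. That
   difference tends to 0 because every admissible phi can be modified, at small
   cost in energy and trace, so that the two weights are comparable where it
   matters: cut it off at large t, then replace it by phi(x, t + c), with c in
   [tau, K] chosen by averaging against dc/c. *)

Require Import Defs.
From HB Require Import structures.
From mathcomp Require Import all_boot all_order all_algebra.
From mathcomp Require Import all_classical all_reals all_analysis.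
From mathcomp Require Import measurable_realfun ring lra.
Set Implicit Arguments.
Unset Strict Implicit.
Unset Printing Implicit Defensive.
Import Order.TTheory GRing.Theory Num.Theory.
Import numFieldNormedType.Exports.
Local Open Scope classical_set_scope.
Local Open Scope ring_scope.

(** * Smooth functions *)

Section smooth_calculus.
Context {R : realType}.
Implicit Types V W : normedModType R.

(** [gradQ], [traceV] and [divQ] pick representatives by choice, and real integrals that diverge
    take default values. Identities therefore live on sets of square integrable functions with a
    semidefinite form, and each choice is shown to be harmless up to null sets. [lambda1] is an
    infimum of weak eigenvalues, not of Rayleigh quotients: the sharp constant [C_F] rests on the
    existence of a first eigenfunction, hence on Rellich's compactness. Slices of admissible
    functions vanish on the boundary without having compact support, which is bridged by truncating
    their values. The weight [aeps] meets two demands: om0 aeps <= 1/e puts the flux into Y^s, and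
    1/aeps = om1 + e om0 is integrable near 0, so traces vary little over short shifts, uniformly in
    e <= 1. The measure dc/c is scale invariant: [K exp(-M), K] has mass M however small K is, so
    the averaging loses an arbitrarily small fraction while the shifts stay short. The comparison of
    energies enters in dual form, as a bound for the functional phi -> (g, phi(.,0)) in the energy
    with weight [aeps]. *)

Fixpoint Ck V (n : nat) (f : V -> R) : Prop :=
  match n with
  | 0 => continuous f
  | m.+1 => continuous f /\
      forall v, (forall x, derivable f x v) /\ Ck m ('D_v f)
  end.

Lemma CkS V n (f : V -> R) : Ck n.+1 f -> Ck n f.
Proof.
elim: n f => [|n IH] f; first by case.
by move=> [cf df]; split => // v; have [dv /IH Dv] := df v.
Qed.

Lemma smooth_cont V (f : V -> R) : smooth f -> continuous f.
Proof. by move=> /(_ [::])[]. Qed.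

Lemma smooth_derivable V (f : V -> R) x v : smooth f -> derivable f x v.
Proof. by move=> /(_ [::])[]. Qed.

Lemma smooth_derive V (f : V -> R) v : smooth f -> smooth ('D_v f).
Proof.
move=> sf vs; have := sf (rcons vs v).
by rewrite /iter_derive foldr_rcons.
Qed.

(** [iter_derive] folds from the right, so the last direction of the list is applied first, as in
    [Ck]; hence the induction from the end of the list. Regularity graded by order is what lets the
    product and chain rules be proved by induction: they mix a function with its own derivatives. *)
Lemma smoothP V (f : V -> R) : smooth f <-> forall n, Ck n f.
Proof.
split=> [sf n|Cf vs].
  elim: n f sf => [|n IH] f sf; first exact: smooth_cont.
  split; first exact: smooth_cont.
  by move=> v; split=> [x|]; [exact: smooth_derivable|exact/IH/smooth_derive].
elim/last_ind: vs f Cf => [|vs v IH] f Cf.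
  split; first exact: (Cf 0%N).
  by move=> v x; have [_ /(_ v)[]] := Cf 1%N.
rewrite /iter_derive foldr_rcons; apply: IH => n.
by have [_ /(_ v)[]] := Cf n.+1.
Qed.

Lemma Ck_cst V n (c : R) : Ck n (cst c : V -> R).
Proof.
elim: n c => [|n IH] c; first exact: cst_continuous.
split; first exact: cst_continuous.
move=> v; split=> [x|]; first exact: derivable_cst.
rewrite (_ : 'D_v _ = cst 0); first exact: IH.
by apply/funext => x; rewrite derive_cst.
Qed.

Lemma CkD V n (f g : V -> R) : Ck n f -> Ck n g -> Ck n (f \+ g).
Proof.
elim: n f g => [|n IH] f g.
  by move=> cf cg x; apply: continuousD; [exact: cf|exact: cg].
move=> [cf df] [cg dg]; split.
  by move=> x; apply: continuousD; [exact: cf|exact: cg].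
move=> v; have [df1 df2] := df v; have [dg1 dg2] := dg v; split=> [x|].
  exact: (derivableD (df1 x) (dg1 x)).
rewrite (_ : 'D_v _ = 'D_v f \+ 'D_v g); first exact: IH.
by apply/funext => x; rewrite [LHS](deriveD (df1 x) (dg1 x)).
Qed.

Lemma CkM V n (f g : V -> R) : Ck n f -> Ck n g -> Ck n (f \* g).
Proof.
elim: n f g => [|n IH] f g.
  by move=> cf cg x; apply: continuousM; [exact: cf|exact: cg].
move=> Cf Cg; have [cf df] := Cf; have [cg dg] := Cg; split.
  by move=> x; apply: continuousM; [exact: cf|exact: cg].
move=> v; have [df1 df2] := df v; have [dg1 dg2] := dg v; split=> [x|].
  exact: (derivableM (df1 x) (dg1 x)).
rewrite (_ : 'D_v _ = (f \* 'D_v g) \+ (g \* 'D_v f)).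
  by apply: CkD; apply: IH => //; exact: CkS.
by apply/funext => x; rewrite [LHS](deriveM (df1 x) (dg1 x)).
Qed.

(** Only directional derivatives of [f] are given, so the chain rule for differentiable maps does
    not apply on [V]. Along the line through [x] the composition is one of real functions, where
    derivability at a point is differentiability. *)
Lemma is_derive_comp_line V (g : R -> R) (f : V -> R) x v :
  derivable f x v -> derivable g (f x) 1 ->
  is_derive x v (g \o f) (derive1 g (f x) * 'D_v f x).
Proof.
move=> df dg.
pose h := fun t : R => f (t *: v + x).
have h0 : h 0 = f x by rewrite /h scale0r add0r.
have dh : derivable h 0 1.
  by rewrite /h; move/derivable1P : df.
have dg0 : derivable g (h 0) 1 by rewrite h0.
have dgh : derivable (g \o h) 0 1.
  move/derivable1_diffP : dh => dh; move/derivable1_diffP : dg0 => dg0.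
  by apply/derivable1_diffP; exact: (differentiable_comp dh dg0).
have E1 (k : V -> R) : 'D_v k x = 'D_1 (fun s : R => k (s *: v + x)) 0.
  rewrite /derive; set g1 := fun h => h^-1 *: _; set g2 := fun h => h^-1 *: _.
  suff -> : g1 = g2 by [].
  by apply/funext => t; rewrite /g1 /g2 /= addr0 scale0r add0r [t *: 1]mulr1.
split.
  exact/derivable1P.
have := derive1_comp dh dg0; rewrite h0 => Dc.
by rewrite (E1 (g \o f)) (E1 f) -[in RHS]derive1E -Dc derive1E.
Qed.

Lemma Ck_comp V n (g : R -> R) (f : V -> R) :
  smooth g -> Ck n f -> Ck n (g \o f).
Proof.
elim: n g f => [|n IH] g f sg.
  by move=> cf x; apply: continuous_comp; [exact: cf|exact: smooth_cont].
move=> Cf; have [cf df] := Cf; split.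
  by move=> x; apply: continuous_comp; [exact: cf|exact: smooth_cont].
move=> v; have [df1 df2] := df v.
have D x := is_derive_comp_line (df1 x) (smooth_derivable sg).
split=> [x|]; first by case: (D x).
rewrite (_ : 'D_v _ = ('D_1 g \o f) \* 'D_v f).
  by apply: CkM => //; apply: IH; [exact: smooth_derive|exact: CkS].
by apply/funext => x; case: (D x) => _ ->; rewrite derive1E.
Qed.

(** The difference quotients of [f \o A] along [v] and of [f] along [w] are literally the same
    function of [h]. *)
Lemma derive_affine V W (f : W -> R) (A : V -> W) (v : V) (w : W) x :
  (forall h : R, A (h *: v + x) = h *: w + A x) ->
  (derivable f (A x) w -> derivable (f \o A) x v) /\
  'D_v (f \o A) x = 'D_w f (A x).
Proof.
move=> HA.
have E : (fun h : R => h^-1 *: (((f \o A) \o shift x) (h *: v) - (f \o A) x)) =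
         (fun h : R => h^-1 *: ((f \o shift (A x)) (h *: w) - f (A x))).
  by apply/funext => h /=; rewrite HA.
by split; [rewrite /derivable E|rewrite /derive E].
Qed.

Lemma Ck_affine V W n (f : W -> R) (A : V -> W) (L : V -> W) :
  continuous A -> (forall (h : R) v x, A (h *: v + x) = h *: L v + A x) ->
  Ck n f -> Ck n (f \o A).
Proof.
move=> cA HA; elim: n f => [|n IH] f.
  by move=> cf x; apply: continuous_comp; [exact: cA|exact: cf].
move=> [cf df]; split.
  by move=> x; apply: continuous_comp; [exact: cA|exact: cf].
move=> v; have [df1 df2] := df (L v); split=> [x|].
  by have [+ _] := derive_affine f (fun h => HA h v x); apply.
rewrite (_ : 'D_v _ = ('D_(L v) f) \o A); first exact: IH.
by apply/funext => x; have [_ ->] := derive_affine f (fun h => HA h v x).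
Qed.

Lemma smooth_cst V (c : R) : smooth (cst c : V -> R).
Proof. by apply/smoothP => n; exact: Ck_cst. Qed.

Lemma smoothD V (f g : V -> R) : smooth f -> smooth g -> smooth (f \+ g).
Proof. by move=> /smoothP sf /smoothP sg; apply/smoothP => n; exact: CkD. Qed.

Lemma smoothM V (f g : V -> R) : smooth f -> smooth g -> smooth (f \* g).
Proof. by move=> /smoothP sf /smoothP sg; apply/smoothP => n; exact: CkM. Qed.

Lemma smoothZ V (c : R) (f : V -> R) : smooth f -> smooth (fun x => c * f x).
Proof. by move=> sf; exact: (smoothM (smooth_cst c) sf). Qed.

Lemma smooth_comp V (g : R -> R) (f : V -> R) :
  smooth g -> smooth f -> smooth (g \o f).
Proof. by move=> sg /smoothP sf; apply/smoothP => n; exact: Ck_comp. Qed.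

Lemma smooth_affine V W (f : W -> R) (A : V -> W) (L : V -> W) :
  continuous A -> (forall (h : R) v x, A (h *: v + x) = h *: L v + A x) ->
  smooth f -> smooth (f \o A).
Proof.
by move=> cA HA /smoothP sf; apply/smoothP => n; exact: (Ck_affine cA HA).
Qed.

Lemma smooth_prod V (I : Type) (r : seq I) (f : I -> V -> R) :
  (forall i, smooth (f i)) -> smooth (fun x => \prod_(i <- r) f i x).
Proof.
move=> sf; elim: r => [|i r IH].
  by under eq_fun do rewrite big_nil; exact: smooth_cst.
by under eq_fun do rewrite big_cons; exact: (smoothM (sf i) IH).
Qed.

Lemma smooth_id : smooth (id : R -> R).
Proof.
apply/smoothP => -[|n]; first by move=> x; exact: cvg_id.
split; first by move=> x; exact: cvg_id.
move=> v; split=> [x|]; first exact: derivable_id.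
rewrite (_ : 'D_v _ = cst v); first exact: Ck_cst.
by apply/funext => x; rewrite derive_id.
Qed.

Lemma derive_scale (f : R -> R) x v : derivable f x 1 ->
  derivable f x v /\ 'D_v f x = v * 'D_1 f x.
Proof.
move=> /derivable1_diffP df; split; first exact: diff_derivable.
by rewrite !deriveE// -[X in 'd f x X]mulr1 -[X in 'd f x X]/(v *: 1) linearZ.
Qed.

(** On R the derivative in direction [v] is [v] times the ordinary one, so closure under derivation
    and scaling keeps all iterated directional derivatives in the class. *)
Lemma smooth_from_family (P : (R -> R) -> Prop) :
  (forall f, P f -> forall x, derivable f x 1) ->
  (forall f, P f -> P (derive1 f)) -> (forall f c, P f -> P (fun x => c * f x)) ->
  forall f, P f -> smooth f.
Proof.
move=> H1 H2 H3 f Pf; apply/smoothP => n.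
have Pc h : P h -> continuous h.
  by move=> Ph x; apply/differentiable_continuous/derivable1_diffP/H1.
elim: n f Pf => [|n IH] f Pf; first exact: Pc.
split; first exact: Pc.
move=> v; split=> [x|]; first by have [] := derive_scale v (H1 _ Pf x).
rewrite (_ : 'D_v f = fun x => v * (derive1 f x)); first exact/IH/H3/H2.
by apply/funext => x; rewrite derive1E; have [] := derive_scale v (H1 _ Pf x).
Qed.

End smooth_calculus.

(** * A smooth step function *)

Section smooth_step.
Context {R : realType}.

(** Differentiating x^(-k) exp(-1/x) raises [k] but stays in the linear span of this family;
    smoothness at 0 then follows for all members at once. *)
Definition expf (k : nat) (x : R) : R :=
  if 0 < x then (x^-1) ^+ k * expR (- x^-1) else 0.

(** From 1 + u <= exp u with u = 1/(x (k+2)) follows exp(1/x) >= u^(k+2). The two orders beyond [k]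
    leave the factor x^2, which makes the derivative at 0 vanish. *)
Lemma expf_bound k x : `|expf k x| <= (k.+2)%:R ^+ k.+2 * x ^+ 2.
Proof.
rewrite /expf; case: ifPn => [x0|_]; last first.
  by rewrite normr0 mulr_ge0// ?sqr_ge0// exprn_ge0.
rewrite ger0_norm; last by rewrite mulr_ge0 ?expR_ge0// exprn_ge0// invr_ge0 ltW.
have n0 : 0 < (k.+2)%:R :> R by rewrite ltr0n.
have H : (x^-1 / k.+2%:R) ^+ k.+2 <= expR (x^-1).
  rewrite [leRHS](_ : _ = expR (x^-1 / k.+2%:R) ^+ k.+2); last first.
    by rewrite -expRM_natl mulrCA mulfV ?mulr1// gt_eqF.
  rewrite lerXn2r// ?nnegrE ?expR_ge0//.
    by rewrite divr_ge0 ?invr_ge0 ?ltW.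
  by apply: le_trans (expR_ge1Dx _); rewrite lerDr.
rewrite expRN ler_pdivrMr ?expR_gt0//.
apply: le_trans (ler_wpM2l _ H); last by rewrite mulr_ge0 ?sqr_ge0// exprn_ge0// ltW.
rewrite exprMn !exprVn.
have -> : k.+2%:R ^+ k.+2 * x ^+ 2 * (x ^- k.+2 / k.+2%:R ^+ k.+2) = x ^- k :> R.
  have x2 : x ^+ k.+2 = x ^+ k * x ^+ 2 by rewrite -addn2 exprD.
  have nn : k.+2%:R ^+ k.+2 != 0 :> R by rewrite expf_neq0// gt_eqF.
  rewrite x2; set m := _ ^+ k.+2 in nn *.
  by field; rewrite nn expf_neq0 ?(gt_eqF x0)// lt0r_neq0.
by [].
Qed.

Lemma quadratic_derivable0 (f : R -> R) (C : R) :
  (forall x, `|f x| <= C * x ^+ 2) -> is_derive (0 : R) (1:R) f 0.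
Proof.
move=> fC.
have f0 : f 0 = 0 by apply/eqP; rewrite -normr_le0 (le_trans (fC 0))// expr0n mulr0.
have cv : h^-1 *: ((f \o shift 0) (h *: (1:R)) - f 0) @[h --> 0^'] --> (0:R).
  apply/cvgr0Pnorm_le => e e0 /=.
  near=> h.
  have h0 : h != 0 by near: h; exact: nbhs_dnbhs_neq.
  rewrite /= addr0 f0 subr0 [h *: 1]mulr1 normrZ normfV.
  rewrite ler_pdivrMl ?normr_gt0//.
  rewrite (le_trans (fC h))// -real_normK ?num_real// expr2 mulrA [leRHS]mulrC.
  rewrite ler_wpM2r// (@le_trans _ _ (`|C| * `|h|))//.
    by rewrite ler_wpM2r// ler_norm.
  rewrite (@le_trans _ _ ((`|C| + 1) * `|h|))//; first by rewrite ler_wpM2r// lerDl.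
  rewrite -ler_pdivlMl ?ltr_wpDl//.
  near: h; apply: dnbhs0_le; rewrite mulr_gt0// invr_gt0 ltr_wpDl//.
by split; [apply/cvg_ex; exists 0|exact/cvg_lim].
Unshelve. all: by end_near. Qed.

Lemma is_derive_expf k x :
  is_derive x (1:R) (expf k) (expf k.+2 x - k%:R * expf k.+1 x).
Proof.
have [x0|x0|x0] := ltgtP 0 x; last (rewrite -x0; clear x x0).
- have nx : \forall z \near x, (z^-1) ^+ k * expR (- z^-1) = expf k z.
    near=> z; rewrite /expf ifT//; near: z; exact: lt_nbhsr.
  apply: (@near_eq_is_derive R R R (fun z => (z^-1) ^+ k * expR (- z^-1)) (expf k) x 1 _ nx).
  rewrite /expf x0.
  have dV : is_derive x (1:R) (fun z : R => z^-1) (- x ^- 2).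
    have := @is_deriveV R id x 1 1 (lt0r_neq0 x0) (is_derive_id x 1).
    by rewrite /GRing.scale/= mulr1.
  have dE : is_derive x (1:R) (fun z : R => expR (- z^-1)) (x^-1 ^+ 2 * expR (- x^-1)).
    have d2 : is_derive x (1:R) (fun z : R => - z^-1) (x ^- 2).
      by apply: is_derive_eq; rewrite opprK.
    have d3 := @is_derive1_comp R expR (fun z => - z^-1) x _ _ (is_derive_expR (- x^-1)) d2.
    by apply: (is_derive_eq d3); rewrite -exprVn mulrC.
  have dX n : is_derive x (1:R) (fun z : R => z^-1 ^+ n) (- (n%:R * x^-1 ^+ n.+1)).
    elim: n => [|n IH].
      under eq_fun do rewrite expr0.
      by rewrite mul0r oppr0; exact: is_derive_cst.
    under eq_fun do rewrite exprS.
    apply: (is_derive_eq (@is_deriveM R R _ _ x 1 _ _ dV IH)).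
    by rewrite /GRing.scale/= -!exprVn !exprS -(natr1 n); ring.
  apply: (is_derive_eq (@is_deriveM R R _ _ x 1 _ _ (dX k) dE)).
  by rewrite /GRing.scale/= !exprS; ring.
- have nx : \forall z \near x, 0 = expf k z.
    near=> z; rewrite /expf ifF//; apply/negbTE; rewrite -leNgt ltW//; near: z; exact: lt_nbhsl.
  rewrite /expf ltNge (ltW x0)/= mulr0 subr0.
  exact: (@near_eq_is_derive R R R (cst 0) (expf k) x 1 _ nx).
- rewrite {2 3}/expf ltxx mulr0 subr0.
  exact: (quadratic_derivable0 (expf_bound k)).
Unshelve. all: by end_near. Qed.

Let expfam (f : R -> R) : Prop :=
  exists (I : Type) (r : seq I) (a : I -> R) (k : I -> nat),
    f = fun x => \sum_(i <- r) a i * expf (k i) x.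

Lemma smooth_expf k : smooth (expf k).
Proof.
apply: (@smooth_from_family _ expfam); last first.
- exists unit, [:: tt], (fun=> 1), (fun=> k); apply/funext => x.
  by rewrite big_seq1 mul1r.
- move=> f c [I [r [a [m ->]]]]; exists I, r, (fun i => c * a i), m.
  by apply/funext => x; rewrite mulr_sumr; apply: eq_bigr => i _; rewrite mulrA.
- move=> f [I [r [a [m ->]]]].
  (* Each term of index m contributes two to the derivative, of index m+2 and m+1; the boolean tells
     them apart. *)
  exists (I * bool)%type, ([seq (i, true) | i <- r] ++ [seq (i, false) | i <- r]),
    (fun p => if p.2 then a p.1 else - (a p.1 * (m p.1)%:R)),
    (fun p => if p.2 then (m p.1).+2 else (m p.1).+1).
  apply/funext => x; rewrite derive1E big_cat/= !big_map/= -big_split/=.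
  elim: r => [|i r IH].
    rewrite big_nil; under eq_fun do rewrite big_nil.
    by rewrite derive_cst.
  rewrite big_cons -IH.
  under eq_fun do rewrite big_cons.
  have E : is_derive x (1:R) (fun z => a i * expf (m i) z) (a i * (expf (m i).+2 x - (m i)%:R * expf (m i).+1 x)).
    by have H := is_derive_expf (m i) x; apply: is_derive_eq.
  have D : derivable (fun z => \sum_(j <- r) a j * expf (m j) z) x 1.
    elim: {IH} r => [|j r IH].
      by under eq_fun do rewrite big_nil; exact: derivable_cst.
    under eq_fun do rewrite big_cons.
    apply: derivableD; last exact: IH.
    by apply: derivableZ; case: (is_derive_expf (m j) x).
  rewrite (deriveD (@ex_derive _ _ _ _ _ _ _ E) D); congr (_ + _).
  by rewrite (@derive_val _ _ _ _ _ _ _ E); ring.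
move=> f [I [r [a [m ->]]]] x.
elim: r => [|j r IH].
  by under eq_fun do rewrite big_nil; exact: derivable_cst.
under eq_fun do rewrite big_cons.
apply: derivableD; last exact: IH.
by apply: derivableZ; case: (is_derive_expf (m j) x).
Qed.

(** [Ck_comp] asks for an outer function smooth on all of R, which inversion is not; the induction
    on the order is redone with D(1/f) = - (1/f)^2 Df. *)
Lemma smooth_inv (V : normedModType R) (f : V -> R) :
  (forall x, f x != 0) -> smooth f -> smooth (fun x => (f x)^-1).
Proof.
move=> f0 /smoothP sf; apply/smoothP => n.
elim: n sf => [|n IH] sf.
  by move=> x; apply: continuousV => //; exact: (sf 0%N).
split; first by move=> x; apply: continuousV => //; exact: (sf 0%N).
have [_ df] := sf n.+1.
move=> v; have [df1 df2] := df v; split=> [x|]; first exact: derivableV.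
rewrite (_ : 'D_v _ = (fun x => (f x)^-1) \* ((fun x => (f x)^-1) \* (cst (-1) \* 'D_v f))).
  apply: CkM; first exact: IH.
  apply: CkM; first exact: IH.
  by apply: CkM => //; exact: Ck_cst.
apply/funext => x; rewrite deriveV//= /GRing.scale/=.
by rewrite -exprVn expr2; ring.
Qed.

Definition step (x : R) : R := expf 0 x / (expf 0 x + expf 0 (1 - x)).

Lemma expf0_ge0 x : 0 <= expf 0 x.
Proof. by rewrite /expf; case: ifP => // _; rewrite mulr_ge0 ?expR_ge0. Qed.

Lemma expf0_gt0 x : 0 < x -> 0 < expf 0 x.
Proof. by rewrite /expf => ->; rewrite mulr_gt0 ?expR_gt0. Qed.

Lemma expf0_eq0 x : x <= 0 -> expf 0 x = 0.
Proof. by move=> x0; rewrite /expf ltNge x0. Qed.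

Lemma step_den_gt0 x : 0 < expf 0 x + expf 0 (1 - x).
Proof.
have [x0|x0] := ltP 0 x; first by rewrite ltr_pwDl ?expf0_gt0 ?expf0_ge0.
by rewrite ltr_wpDl ?expf0_ge0// expf0_gt0//; lra.
Qed.

Lemma smooth_step : smooth step.
Proof.
apply: smoothM; first exact: smooth_expf.
apply: smooth_inv; first by move=> x; rewrite gt_eqF// step_den_gt0.
apply: smoothD; first exact: smooth_expf.
apply: (@smooth_affine R R R (expf 0) (fun x => 1 - x) (fun x => - x)).
- by move=> x; apply: continuousB; [exact: cst_continuous|exact: cvg_id].
- by move=> h v x; rewrite scalerN opprD addrCA.
- exact: smooth_expf.
Qed.

Lemma step_eq0 x : x <= 0 -> step x = 0.
Proof. by move=> x0; rewrite /step expf0_eq0// mul0r. Qed.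

Lemma step_eq1 x : 1 <= x -> step x = 1.
Proof.
move=> x1; rewrite /step (@expf0_eq0 (1 - x)) ?subr_le0// addr0 divff// gt_eqF//.
by rewrite expf0_gt0// (lt_le_trans ltr01).
Qed.

Lemma step_ge0 x : 0 <= step x.
Proof. by rewrite divr_ge0// ?expf0_ge0// ltW// step_den_gt0. Qed.

Lemma step_le1 x : step x <= 1.
Proof. by rewrite ler_pdivrMr ?step_den_gt0// mul1r lerDl expf0_ge0. Qed.

Lemma step_gt0 x : 0 < x -> 0 < step x.
Proof. by move=> x0; rewrite divr_gt0 ?step_den_gt0 ?expf0_gt0. Qed.

(** The derivative is continuous, hence bounded on [0, 1], and it vanishes outside. The bound
    controls the energy added by cutoffs. *)
Lemma step_derive_bound : exists2 C, 0 <= C & forall x, `|'D_1 step x| <= C.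
Proof.
have cD : continuous ('D_1 step) by apply: smooth_cont; exact/smooth_derive/smooth_step.
have [c1 _ c1max] := @EVT_max R (fun x => `|'D_1 step x|) 0 1 ler01
  (continuous_subspaceT (fun x => continuous_comp (cD x) (@norm_continuous _ _ _))).
exists `|'D_1 step c1|; first exact: normr_ge0.
move=> x.
have [x0|x0] := ltP x 0.
  rewrite (_ : 'D_1 step x = 0) ?normr0//.
  rewrite (@near_eq_derive R R R step (cst 0) x 1) ?derive_cst//.
  near=> z; rewrite step_eq0// ltW//; near: z; exact: lt_nbhsl.
have [x1|x1] := ltP 1 x.
  rewrite (_ : 'D_1 step x = 0) ?normr0//.
  rewrite (@near_eq_derive R R R step (cst 1) x 1) ?derive_cst//.
  near=> z; rewrite step_eq1// ltW//; near: z; exact: lt_nbhsr.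
by apply: c1max; rewrite in_itv/= x0 x1.
Unshelve. all: by end_near. Qed.

End smooth_step.

(** * Pre-Hilbert spaces *)

Section prehilbert.
Context {R : realType}.

(** [B] is only semidefinite, so that functions serve directly instead of classes modulo null sets.
    [E] marks the vectors for which the integrals behind [B] are finite, where bilinearity holds. *)
Record prehilbert (H : lmodType R) (E : H -> Prop) (B : H -> H -> R) : Prop := {
  ph_D : forall x y, E x -> E y -> E (x + y);
  ph_Z : forall a x, E x -> E (a *: x);
  ph_C : forall x y, B x y = B y x;
  ph_BD : forall x y z, E x -> E y -> E z -> B (x + y) z = B x z + B y z;
  ph_BZ : forall a x z, E x -> E z -> B (a *: x) z = a * B x z;
  ph_ge0 : forall x, E x -> 0 <= B x x }.

Section theory.
Context (H : lmodType R) (E : H -> Prop) (B : H -> H -> R).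
Hypothesis hB : prehilbert E B.

Definition nrm (x : H) : R := Num.sqrt (B x x).

Lemma ph_N x : E x -> E (- x).
Proof. by move=> Ex; rewrite -scaleN1r; exact: (ph_Z hB). Qed.

Lemma ph_B x y : E x -> E y -> E (x - y).
Proof. by move=> Ex Ey; apply: (ph_D hB) => //; exact: ph_N. Qed.

Lemma ph_BN x z : E x -> E z -> B (- x) z = - B x z.
Proof. by move=> Ex Ez; rewrite -scaleN1r (ph_BZ hB)// mulN1r. Qed.

Lemma ph_BB x y z : E x -> E y -> E z -> B (x - y) z = B x z - B y z.
Proof. by move=> Ex Ey Ez; rewrite (ph_BD hB)// ?ph_BN//; exact: ph_N. Qed.

Lemma nrm_ge0 x : 0 <= nrm x.
Proof. exact: sqrtr_ge0. Qed.

Lemma nrm_sqr x : E x -> nrm x ^+ 2 = B x x.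
Proof. by move=> Ex; rewrite sqr_sqrtr// (ph_ge0 hB). Qed.

Lemma ph_sqrD x y a : E x -> E y ->
  B (x + a *: y) (x + a *: y) = B x x + 2 * a * B x y + a ^+ 2 * B y y.
Proof.
move=> Ex Ey; have Eay := ph_Z hB a Ey; have Es := ph_D hB Ex Eay.
rewrite (ph_BD hB)// (ph_BZ hB)// ![B _ (x + _)](ph_C hB) !(ph_BD hB)//.
rewrite !(ph_BZ hB)// (ph_C hB y x); ring.
Qed.

Lemma ph_sqrB x y : E x -> E y -> B (x - y) (x - y) = B x x - 2 * B x y + B y y.
Proof. by move=> Ex Ey; rewrite -scaleN1r ph_sqrD//; ring. Qed.

Lemma ph_CS2 x y : E x -> E y -> B x y ^+ 2 <= B x x * B y y.
Proof.
move=> Ex Ey.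
have Q a : 0 <= B x x + 2 * a * B x y + a ^+ 2 * B y y.
  by rewrite -ph_sqrD//; apply: (ph_ge0 hB); apply: (ph_D hB) => //; exact: (ph_Z hB).
have [y0|y0] := eqVneq (B y y) 0.
  rewrite y0 mulr0.
  have [->|xy0] := eqVneq (B x y) 0; first by rewrite expr0n.
  (* When [B y y = 0] the quadratic is affine in [a]; at this point it would take the value -1. *)
  have := Q (- (B x x + 1) / (2 * B x y)).
  rewrite y0 mulr0 addr0 (_ : 2 * _ * _ = - (B x x + 1)); last by field.
  by rewrite opprD addrA subrr add0r ler0N1.
have yp : 0 < B y y by rewrite lt_neqAle eq_sym y0 (ph_ge0 hB).
have := Q (- B x y / B y y).
rewrite (_ : _ + _ + _ = (B x x * B y y - B x y ^+ 2) / B y y); last by field.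
by rewrite pmulr_lge0 ?invr_gt0// subr_ge0.
Qed.

Lemma ph_CS x y : E x -> E y -> `|B x y| <= nrm x * nrm y.
Proof.
move=> Ex Ey; rewrite -sqrtrM ?(ph_ge0 hB)// -sqrtr_sqr.
by rewrite ler_wsqrtr// ph_CS2.
Qed.

Lemma nrm_le x c : E x -> 0 <= c -> B x x <= c ^+ 2 -> nrm x <= c.
Proof. by move=> Ex c0 h; rewrite -(ger0_norm c0) -sqrtr_sqr ler_wsqrtr. Qed.

Lemma nrm_triangle x y : E x -> E y -> nrm (x + y) <= nrm x + nrm y.
Proof.
move=> Ex Ey; apply: nrm_le; first exact: (ph_D hB).
  by rewrite addr_ge0 ?nrm_ge0.
rewrite -[y]scale1r ph_sqrD// scale1r.
have -> : (nrm x + nrm y) ^+ 2 = B x x + 2 * (nrm x * nrm y) + B y y.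
  by rewrite -!nrm_sqr//; ring.
have h : B x y <= nrm x * nrm y by apply: le_trans (ph_CS Ex Ey); exact: ler_norm.
by rewrite expr1n; lra.
Qed.

Lemma nrmN x : E x -> nrm (- x) = nrm x.
Proof.
move=> Ex; have EN := ph_N Ex; rewrite /nrm ph_BN// (ph_C hB) ph_BN//.
by rewrite opprK.
Qed.

Lemma nrmBC x y : E x -> E y -> nrm (x - y) = nrm (y - x).
Proof. by move=> Ex Ey; rewrite -opprB nrmN//; exact: ph_B. Qed.

Lemma nrm_triangleB x y z : E x -> E y -> E z ->
  nrm (x - z) <= nrm (x - y) + nrm (y - z).
Proof.
move=> Ex Ey Ez; have -> : x - z = (x - y) + (y - z) by rewrite addrA subrK.
by apply: nrm_triangle; exact: ph_B.
Qed.

Lemma nrm_dist x y : E x -> E y -> `|nrm x - nrm y| <= nrm (x - y).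
Proof.
move=> Ex Ey; rewrite ler_norml; apply/andP; split.
  rewrite lerNl opprB lerBlDr addrC.
  by rewrite nrmBC// addrC -[leLHS]addr0 -{1}(subrK x y) addr0 nrm_triangle//; exact: ph_B.
by rewrite lerBlDr -{1}(subrK y x) nrm_triangle//; exact: ph_B.
Qed.

Lemma nrmZ a x : E x -> nrm (a *: x) = `|a| * nrm x.
Proof.
move=> Ex; have EZ := ph_Z hB a Ex; rewrite /nrm (ph_BZ hB)// (ph_C hB) (ph_BZ hB)//.
by rewrite mulrA -expr2 sqrtrM ?sqr_ge0// sqrtr_sqr.
Qed.

Definition ncvg (u : nat -> H) (x : H) := nrm (u n - x) @[n --> \oo] --> (0:R).

Lemma ncvg_nrm u x : (forall n, E (u n)) -> E x -> ncvg u x ->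
  nrm (u n) @[n --> \oo] --> nrm x.
Proof.
move=> Eu Ex ux; apply/cvgrPdist_le => e e0.
move/cvgr0Pnorm_le : ux => /(_ e e0); apply: filterS => n.
rewrite (ger0_norm (nrm_ge0 _)) => h; rewrite distrC.
exact: le_trans (nrm_dist (Eu n) Ex) h.
Qed.

Lemma ncvg_B u x y : (forall n, E (u n)) -> E x -> E y -> ncvg u x ->
  B (u n) y @[n --> \oo] --> B x y.
Proof.
move=> Eu Ex Ey ux; apply/cvgrPdist_le => e e0.
have e1 : 0 < e / (nrm y + 1) by rewrite divr_gt0// ltr_wpDl// nrm_ge0.
move/cvgr0Pnorm_le : ux => /(_ _ e1); apply: filterS => n.
rewrite (ger0_norm (nrm_ge0 _)) => h.
rewrite distrC -ph_BB// (le_trans (ph_CS (ph_B (Eu n) Ex) Ey))//.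
apply: (@le_trans _ _ (e / (nrm y + 1) * (nrm y + 1))); last first.
  by rewrite divfK// gt_eqF// ltr_wpDl// nrm_ge0.
by apply: ler_pM => //; rewrite ?nrm_ge0// lerDl.
Qed.

Lemma ncvg_BB u x : (forall n, E (u n)) -> E x -> ncvg u x ->
  B (u n) (u n) @[n --> \oo] --> B x x.
Proof.
move=> Eu Ex ux; under eq_fun do rewrite -nrm_sqr//.
rewrite -nrm_sqr//; have := ncvg_nrm Eu Ex ux => h.
by rewrite expr2; under eq_fun do rewrite expr2; exact: cvgM.
Qed.

Lemma ncvgD u v x y : (forall n, E (u n)) -> (forall n, E (v n)) -> E x -> E y ->
  ncvg u x -> ncvg v y -> ncvg (fun n => u n + v n) (x + y).
Proof.
move=> Eu Ev Ex Ey ux vy.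
apply: (@squeeze_cvgr _ _ _ _ (fun=> 0) (fun n => nrm (u n - x) + nrm (v n - y))).
- apply: nearW => n; rewrite nrm_ge0/= opprD addrACA.
  by apply: nrm_triangle; exact: ph_B.
- exact: cvg_cst.
- by rewrite -[X in _ --> X]addr0; exact: cvgD.
Qed.

Lemma ncvgZ u x a : (forall n, E (u n)) -> E x ->
  ncvg u x -> ncvg (fun n => a *: u n) (a *: x).
Proof.
move=> Eu Ex ux; rewrite /ncvg.
under eq_fun do rewrite -scalerBr (nrmZ _ (ph_B (Eu _) Ex)).
by rewrite -(mulr0 `|a|); exact: cvgMr.
Qed.

Definition ncauchy (u : nat -> H) := forall e : R, 0 < e ->
  exists N, forall n m, (N <= n)%N -> (N <= m)%N -> nrm (u n - u m) <= e.

Lemma ncvg_cauchy u x : (forall n, E (u n)) -> E x -> ncvg u x -> ncauchy u.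
Proof.
move=> Eu Ex ux e e0.
have e2 : 0 < e / 2 by rewrite divr_gt0.
move/cvgr0Pnorm_le : ux => /(_ _ e2)[N _ hN]; exists N => n m Nn Nm.
rewrite (le_trans (nrm_triangleB (Eu n) Ex (Eu m)))// (nrmBC Ex (Eu m)).
have := hN n Nn; have := hN m Nm; rewrite /= !(ger0_norm (nrm_ge0 _)).
by lra.
Qed.

Definition ncomplete := forall u : nat -> H, (forall n, E (u n)) -> ncauchy u ->
  exists2 x, E x & ncvg u x.

(** * Representation of bounded functionals *)

Section riesz.
Context (P : lmodType R) (A : P -> Prop) (L : P -> H) (l : P -> R) (C : R).
Hypotheses (A0 : exists p, A p)
  (AD : forall (a : R) p q, A p -> A q -> A (p + a *: q))
  (LE : forall p, A p -> E (L p))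
  (LD : forall (a : R) p q, A p -> A q -> L (p + a *: q) = L p + a *: L q)
  (lD : forall (a : R) p q, A p -> A q -> l (p + a *: q) = l p + a * l q)
  (C0 : 0 <= C) (lC : forall p, A p -> l p <= C * nrm (L p)).

(* A minimising sequence of B (L p) (L p) - 2 l p is Cauchy by the parallelogram
   identity; its limit represents l. *)
Lemma riesz_minimizer : ncomplete ->
  exists (phi : nat -> P) (F : H),
    [/\ forall n, A (phi n), E F, ncvg (L \o phi) F &
       forall p, A p -> B F (L p) = l p].
Proof.
move=> cplt.
pose J p := B (L p) (L p) - 2 * l p.
(* Completing the square: n^2 - 2 C n >= - C^2, with n the norm of [L p]. *)
have Jlb p : A p -> - C ^+ 2 <= J p.
  move=> Ap; rewrite /J -nrm_sqr; last exact: LE.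
  have := lC Ap; set n := nrm _ => h.
  have h2 := sqr_ge0 (n - C); have -> : n ^+ 2 = (n - C) ^+ 2 + 2 * (C * n) - C ^+ 2 by ring.
  by lra.
pose S := [set J p | p in A].
have Slb : has_inf S.
  split; first by have [p Ap] := A0; exists (J p), p.
  by exists (- C ^+ 2) => _ [p Ap <-]; exact: Jlb.
pose m := inf S.
have mJ p : A p -> m <= J p by move=> Ap; apply: ge_inf; [case: Slb|exists p].
have /choice[phi hphi] (n : nat) : exists p, A p /\ J p <= m + n.+1%:R^-1.
  have n0 : 0 < n.+1%:R^-1 :> R by rewrite invr_gt0.
  by have [_ [p Ap <-] /ltW h] := inf_adherent n0 Slb; exists p.
have Aphi n : A (phi n) by have [] := hphi n.
have Ephi n : E (L (phi n)) by exact: LE.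
(* The competitor is the midpoint of [p] and [q], written through the only closure at hand, p + a
   q. *)
have par p q : A p -> A q -> B (L p - L q) (L p - L q) <= 2 * (J p - m) + 2 * (J q - m).
  move=> Ap Aq.
  have Amid : A (p + 2^-1 *: (q + (-1) *: p)) by apply: AD => //; exact: AD.
  have := mJ _ Amid; rewrite /J LD//; last exact: AD.
  rewrite lD//; last exact: AD.
  rewrite LD// lD//.
  have Ep := LE Ap; have Eq := LE Aq.
  have Eq1 : E (L q + (-1) *: L p) by apply: (ph_D hB) => //; exact: (ph_Z hB).
  rewrite ph_sqrD// ph_sqrD// ph_sqrB//.
  rewrite [B (L p) (_ + _)](ph_C hB) (ph_BD hB)//; last exact: (ph_Z hB).
  rewrite (ph_BZ hB)// (ph_C hB (L q) (L p)) => h.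
  set a := B (L p) (L p) in h *; set b := B (L p) (L q) in h *.
  set c := B (L q) (L q) in h *.
  by lra.
have cau : ncauchy (L \o phi).
  move=> e e0.
  have e4 : 0 < e ^+ 2 / 4 by rewrite divr_gt0// exprn_gt0.
  have [N hN] : exists N, forall n, (N <= n)%N -> n.+1%:R^-1 <= e ^+ 2 / 4.
    exists (Num.truncn (e ^+ 2 / 4)^-1) => n Nn.
    rewrite -[leRHS]invrK lef_pV2 ?posrE ?invr_gt0//.
    by rewrite ltW// (lt_le_trans (truncnS_gt _))// ler_nat.
  exists N => n k Nn Nk; apply: nrm_le.
  - exact: (ph_B (Ephi n) (Ephi k)).
  - exact: ltW.
  rewrite /= (le_trans (par _ _ (Aphi n) (Aphi k)))//.
  have [_ hn] := hphi n; have [_ hk] := hphi k.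
  have := hN _ Nn; have := hN _ Nk; move: hn hk.
  by set a := n.+1%:R^-1; set b := k.+1%:R^-1; set q := e ^+ 2; lra.
have [F EF LF] := cplt _ Ephi cau.
exists phi, F; split => // p Ap.
have Ep := LE Ap.
(* First variation in the direction [p], in the limit: [phi n] minimises up to 1/(n+1), so
   perturbing it can lower [J] by no more than that. *)
have key a : 0 <= 2 * a * (B F (L p) - l p) + a ^+ 2 * B (L p) (L p).
  have cB : 2 * a * (B (L (phi n)) (L p) - l p) + a ^+ 2 * B (L p) (L p) + n.+1%:R^-1
      @[n --> \oo] --> 2 * a * (B F (L p) - l p) + a ^+ 2 * B (L p) (L p) + 0.
    apply: cvgD; last exact: cvg_harmonic.
    apply: cvgD; last exact: cvg_cst.
    apply: cvgMr; apply: cvgB; last exact: cvg_cst.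
    exact: (ncvg_B Ephi EF Ep LF).
  move: cB; rewrite addr0 => cB; apply: (cvgr_to_ge cB).
  apply: nearW => n.
  have := mJ _ (AD a (Aphi n) Ap); have [_] := hphi n.
  rewrite /J LD// lD// ph_sqrD// => h1 h2; move: h1 h2.
  by set i := n.+1%:R^-1; lra.
set t := B F (L p) - l p in key.
have [/eqP|t0] := eqVneq t 0; first by rewrite subr_eq0 => /eqP.
exfalso; have b0 := ph_ge0 hB Ep; set b := B (L p) (L p) in key b0.
(* Dividing by [b + 1] instead of [b] keeps the choice legitimate when [L p] has norm zero. *)
have := key (- t / (b + 1)).
have b1 : b + 1 != 0 by rewrite gt_eqF// ltr_wpDl.
rewrite (_ : _ + _ = - (t ^+ 2 * (b + 2) / (b + 1) ^+ 2)); last by field.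
rewrite oppr_ge0 leNgt divr_gt0// ?exprn_gt0 ?ltr_wpDl// mulr_gt0 ?ltr_wpDl//.
by rewrite lt_neqAle sqr_ge0 eq_sym sqrf_eq0 t0.
Qed.

End riesz.
End theory.
End prehilbert.

(** * Square integrable functions *)

Section coordspace.
Context {R : realType}.

(** One description for scalars, row vectors and pairs (x, t), so that square integrable functions
    are treated once; [cmk] rebuilds a vector from the limits of its coordinates in the proof of
    completeness. *)
Record coordspace (U : lmodType R) := Coordspace {
  cix : finType;
  co : cix -> U -> R;
  cmk : (cix -> R) -> U;
  co_lin : forall i a p q, co i (a *: p + q) = a * co i p + co i q;
  co_mk : forall i f, co i (cmk f) = f i }.

Context (U : lmodType R) (cs : coordspace U).

Definition dotc (p q : U) : R := \sum_(i : cix cs) co i p * co i q.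

Lemma coD (i : cix cs) p q : co i (p + q) = co i p + co i q.
Proof. by rewrite -[p]scale1r co_lin scale1r mul1r. Qed.

Lemma co0 (i : cix cs) : co i (0 : U) = 0.
Proof. by have := co_lin i 1 (0 : U) 0; rewrite scaler0 addr0 mul1r; lra. Qed.

Lemma co_scale (i : cix cs) a p : co i (a *: p) = a * co i p.
Proof. by rewrite -[a *: p]addr0 co_lin co0 addr0. Qed.

Lemma coB (i : cix cs) p q : co i (p - q) = co i p - co i q.
Proof. by rewrite coD -scaleN1r co_scale mulN1r. Qed.

Lemma dotcC p q : dotc p q = dotc q p.
Proof. by apply: eq_bigr => i _; rewrite mulrC. Qed.

Lemma dotcDl p q r : dotc (p + q) r = dotc p r + dotc q r.
Proof. by rewrite -big_split; apply: eq_bigr => i _; rewrite coD mulrDl. Qed.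

Lemma dotcZl a p r : dotc (a *: p) r = a * dotc p r.
Proof. by rewrite mulr_sumr; apply: eq_bigr => i _; rewrite co_scale mulrA. Qed.

Lemma dotc_ge0 p : 0 <= dotc p p.
Proof. by apply: sumr_ge0 => i _; rewrite -expr2 sqr_ge0. Qed.

Lemma dotc_le p q : `|dotc p q| <= dotc p p + dotc q q.
Proof.
rewrite (le_trans (ler_norm_sum _ _ _))// -big_split/=; apply: ler_sum => i _.
set a := co i p; set b := co i q; rewrite ler_norml; apply/andP; split.
  have := sqr_ge0 (a + b); have := sqr_ge0 a; have := sqr_ge0 b.
  by rewrite sqrrD !expr2; lra.
have := sqr_ge0 (a - b); have := sqr_ge0 a; have := sqr_ge0 b.
by rewrite sqrrB !expr2; lra.
Qed.

End coordspace.

Lemma cvg_sum0 {R : realType} (I : Type) (r : seq I) (f : I -> nat -> R) :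
  (forall i, f i n @[n --> \oo] --> (0 : R)) ->
  \sum_(i <- r) f i n @[n --> \oo] --> (0 : R).
Proof.
move=> h; elim: r => [|i r IH].
  by under eq_fun do rewrite big_nil; exact: cvg_cst.
under eq_fun do rewrite big_cons.
have H := cvgD (h i) IH; rewrite addr0 in H; exact: H.
Qed.

Section L2.
Context {R : realType} {dT : measure_display} {T : measurableType dT}.
Context (mu : {measure set T -> \bar R}) (D : set T).
Hypothesis mD : measurable D.

Section general.
Context (U : lmodType R) (cs : coordspace U) (W : T -> R).
Hypotheses (mW : measurable_fun D W) (W0 : forall x, D x -> 0 < W x).
Implicit Types F G : T -> U.
Local Notation dotc := (dotc cs).

Definition mfc F := forall i : cix cs, measurable_fun D (fun x => co i (F x)).

Definition sqint F : \bar R := (\int[mu]_(x in D) (W x * dotc (F x) (F x))%:E)%E.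

Definition EL2 F : Prop := mfc F /\ (sqint F < +oo)%E.

Definition ip F G : R := \int[mu]_(x in D) (W x * dotc (F x) (G x)).

Lemma measurable_dotc F G : mfc F -> mfc G ->
  measurable_fun D (fun x => dotc (F x) (G x)).
Proof.
by move=> mF mG; apply: measurable_sum => i; exact: measurable_funM.
Qed.

Lemma measurable_Wdotc F G : mfc F -> mfc G ->
  measurable_fun D (fun x => (W x * dotc (F x) (G x))%:E).
Proof.
by move=> mF mG; apply/measurable_EFinP/measurable_funM => //; exact: measurable_dotc.
Qed.

Lemma Wdotc_ge0 F x : D x -> (0 <= (W x * dotc (F x) (F x))%:E)%E.
Proof. by move=> Dx; rewrite lee_fin mulr_ge0 ?dotc_ge0// ltW// W0. Qed.

Lemma sqint_ge0 F : (0 <= sqint F)%E.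
Proof. by apply: integral_ge0 => x Dx; exact: Wdotc_ge0. Qed.

Lemma mfcD F G : mfc F -> mfc G -> mfc (F + G).
Proof.
move=> mF mG i; under eq_fun do rewrite fctE coD.
exact: measurable_funD.
Qed.

Lemma mfcZ a F : mfc F -> mfc (a *: F).
Proof.
move=> mF i; under eq_fun do rewrite fctE co_scale.
exact: measurable_funM.
Qed.

Lemma EL2_integrable F G : EL2 F -> EL2 G ->
  mu.-integrable D (EFin \o (fun x => W x * dotc (F x) (G x))).
Proof.
move=> [mF fF] [mG fG].
have iH H : mfc H -> (sqint H < +oo)%E ->
    mu.-integrable D (fun x => (W x * dotc (H x) (H x))%:E).
  move=> mH fH; apply/integrableP; split; first exact: measurable_Wdotc.
  under eq_integral => x /set_mem Dx do rewrite gee0_abs ?Wdotc_ge0//.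
  exact: fH.
apply: (le_integrable mD _ _ (integrableD mD (iH _ mF fF) (iH _ mG fG))).
  exact: measurable_Wdotc.
move=> x Dx; rewrite -EFinD/= lee_fin normrM -mulrDr.
have Wx := W0 Dx.
rewrite (gtr0_norm Wx) [leRHS]ger0_norm; last first.
  by rewrite mulr_ge0 ?addr_ge0 ?dotc_ge0// ltW.
by rewrite ler_pM2l// dotc_le.
Qed.

Lemma ip_EFin F : EL2 F -> sqint F = (ip F F)%:E.
Proof.
move=> EF; rewrite /ip /Rintegral fineK//.
exact: (integrable_fin_num mD (EL2_integrable EF EF)).
Qed.

Lemma EL2D F G : EL2 F -> EL2 G -> EL2 (F + G).
Proof.
move=> EF EG; have [mF fF] := EF; have [mG fG] := EG.
have mFG := mfcD mF mG; split => //.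
apply: (@le_lt_trans _ _ (\int[mu]_(x in D)
    ((2 * (W x * dotc (F x) (F x)))%:E + (2 * (W x * dotc (G x) (G x)))%:E))%E).
  apply: ge0_le_integral => //.
  - by move=> x Dx; exact: Wdotc_ge0.
  - exact: measurable_Wdotc.
  - by apply: emeasurable_funD; apply/measurable_EFinP; apply: measurable_funM => //;
      apply/measurable_EFinP; exact: measurable_Wdotc.
  - move=> x Dx; rewrite -EFinD lee_fin fctE.
    rewrite dotcDl ![dotc _ (_ + _)]dotcC !dotcDl.
    (* |F - G|^2 >= 0 bounds the mixed term, whence |F + G|^2 <= 2 |F|^2 + 2 |G|^2. *)
    have := dotc_ge0 cs (F x - G x).
    rewrite dotcDl -scaleN1r dotcZl ![dotc _ (_ + _)]dotcC !dotcDl !dotcZl.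
    rewrite (dotcC cs (G x) (F x)) => h.
    have := W0 Dx.
    move: h; set a := dotc (F x) (F x); set b := dotc (F x) (G x); set c := dotc (G x) (G x).
    by move=> h w0; nra.
have i2 H : EL2 H -> mu.-integrable D (fun x => (2 * (W x * dotc (H x) (H x)))%:E).
  move=> EH; under eq_fun do rewrite EFinM.
  by apply: integrableZl => //; exact: EL2_integrable.
have := integrable_fin_num mD (integrableD mD (i2 _ EF) (i2 _ EG)).
by rewrite /= => /fin_numPlt/andP[].
Qed.

Lemma EL2Z a F : EL2 F -> EL2 (a *: F).
Proof.
move=> EF; have [mF fF] := EF; split; first exact: mfcZ.
rewrite /sqint.
under eq_integral do rewrite fctE dotcZl dotcC dotcZl mulrCA (mulrCA (W _)) EFinM (EFinM a).
have := EL2_integrable EF EF => iF.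
rewrite integralZl//; last exact: integrableZl.
rewrite integralZl//.
have := integrable_fin_num mD iF.
by move=> /fineK <-; rewrite -!EFinM ltry.
Qed.

Lemma prehilbert_L2 : prehilbert EL2 ip.
Proof.
split; [exact: EL2D|exact: EL2Z| | | | ].
- by move=> F G; rewrite /ip; apply: eq_Rintegral => x _; rewrite dotcC.
- move=> F G H EF EG EH; rewrite /ip -RintegralD//; last 2 first.
    exact: EL2_integrable.
    exact: EL2_integrable.
  by apply: eq_Rintegral => x _; rewrite dotcDl mulrDr.
- move=> a F H EF EH; rewrite /ip -RintegralZl//; last exact: EL2_integrable.
  by apply: eq_Rintegral => x _; rewrite dotcZl mulrCA.
- by move=> F EF; apply: Rintegral_ge0 => x Dx; have := @Wdotc_ge0 F x Dx; rewrite lee_fin.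
Qed.

Lemma sqrte_sqint F : EL2 F -> Defs.sqrte (sqint F) = (nrm ip F)%:E.
Proof.
move=> EF; rewrite (ip_EFin EF) /Defs.sqrte poweR_EFin /nrm -powR12_sqrt//.
exact: (ph_ge0 prehilbert_L2).
Qed.

Lemma sqint_le F (e : R) : mfc F -> 0 <= e ->
  (sqint F <= (e ^+ 2)%:E)%E -> EL2 F /\ nrm ip F <= e.
Proof.
move=> mF e0 h; have EF : EL2 F by split => //; exact: (le_lt_trans h (ltry _)).
split => //; rewrite (ip_EFin EF) lee_fin in h.
exact: (nrm_le EF e0 h).
Qed.

Definition L2dist F G : \bar R := Defs.sqrte (sqint (F - G)).

(** The distance tends to 0, so it is finite for some index N, and F = u_N - (u_N - F) is a
    difference of square integrable functions. *)
Lemma L2dist_ncvg (u : nat -> T -> U) F : (forall n, EL2 (u n)) -> mfc F ->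
  L2dist (u n) F @[n --> \oo] --> 0%E -> EL2 F /\ ncvg ip u F.
Proof.
move=> Eu mF uF.
have h n : (L2dist (u n) F < +oo)%E -> EL2 (u n - F).
  move=> h; split; first by rewrite -scaleN1r; apply: mfcD; [by case: (Eu n)|exact: mfcZ].
  case E : (sqint (u n - F)) => [r| |]; rewrite ?ltry//.
    by move: h; rewrite /L2dist E /Defs.sqrte poweRyr ?ltxx// gt_eqF// invr_gt0.
have fin : \forall n \near \oo, (L2dist (u n) F < +oo)%E.
  by apply: (uF [set x | (x < +oo)%E]); exists 1 => //= r _; exact: ltry.
have EF : EL2 F.
  have [N _ /(_ N (leqnn N)) /= hN] := fin.
  rewrite (_ : F = u N - (u N - F)); last by rewrite subKr.
  by apply: (ph_B prehilbert_L2) => //; exact: h.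
split => //.
have e n : L2dist (u n) F = (nrm ip (u n - F))%:E.
  by apply: sqrte_sqint; exact: (ph_B prehilbert_L2).
rewrite /ncvg (_ : (fun n => _) = fine \o (fun n => L2dist (u n) F)); first exact: fine_cvg.
by apply/funext => n /=; rewrite e.
Qed.

Lemma ncvg_L2dist (u : nat -> T -> U) F : (forall n, EL2 (u n)) -> EL2 F ->
  ncvg ip u F -> L2dist (u n) F @[n --> \oo] --> 0%E.
Proof.
move=> Eu EF uF; have e n : L2dist (u n) F = (nrm ip (u n - F))%:E.
  by apply: sqrte_sqint; exact: (ph_B prehilbert_L2).
by rewrite (eq_cvg _ _ e); apply: cvg_EFin => //; apply: nearW.
Qed.

Lemma nrm0_ae F : EL2 F -> nrm ip F = 0 -> {ae mu, forall x, D x -> forall i : cix cs, co i (F x) = 0}.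
Proof.
move=> EF F0.
have E0 : sqint F = 0%E.
  by rewrite (ip_EFin EF) -(nrm_sqr prehilbert_L2 EF) F0 expr0n.
have m : measurable_fun D (fun x => (W x * dotc (F x) (F x))%:E) by exact: measurable_Wdotc (proj1 EF) (proj1 EF).
have := (ae_eq_integral_abs mu mD m).1.
have -> : (\int[mu]_(x in D) `|(W x * dotc (F x) (F x))%:E| = 0)%E.
  by rewrite -E0; apply: eq_integral => x /set_mem Dx; rewrite gee0_abs// Wdotc_ge0.
move=> /(_ erefl); apply: filterS => x + Dx i.
move=> /(_ Dx)[] /eqP; rewrite mulf_eq0 (gt_eqF (W0 Dx))/= => /eqP s0.
have := @psumr_eq0P _ _ predT (fun i : cix cs => co i (F x) * co i (F x)).
move=> /(_ (fun j _ => _))/(_ s0 i isT) => H.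
by apply/eqP; rewrite -sqrf_eq0 expr2; apply/eqP/H => j; rewrite -expr2 sqr_ge0.
Qed.

(** Replacing a representative by one equal almost everywhere changes no pairing; this is how the
    chosen gradients are handled. *)
Lemma nrm_eq_ae F G : EL2 F -> EL2 G ->
  {ae mu, forall x, D x -> forall i : cix cs, co i (F x) = co i (G x)} ->
  forall H, EL2 H -> ip F H = ip G H.
Proof.
move=> EF EG FG H EH; rewrite /ip /Rintegral; congr fine; apply: ae_eq_integral => //.
- exact: measurable_Wdotc (proj1 EF) (proj1 EH).
- exact: measurable_Wdotc (proj1 EG) (proj1 EH).
apply: filterS FG => x h Dx; congr (_ * _)%:E.
by apply: eq_bigr => i _; rewrite h.
Qed.

End general.

Section complete.
Definition coordR : coordspace R := @Coordspace R R unit (fun _ x => x) (fun f => f tt)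
  (fun _ _ _ _ => erefl) (fun i f => ltac:(by case: i)).
Context (W : T -> R).
Hypotheses (mW : measurable_fun D W) (W0 : forall x, D x -> 0 < W x).
Local Notation EL2s := (EL2 coordR W).
Local Notation ips := (ip coordR W).
Local Notation N := (nrm ips).

Lemma dotcR (a b : R) : dotc coordR a b = a * b.
Proof. by rewrite /dotc (big_pred1 tt)//; case. Qed.

Let hB := prehilbert_L2 coordR mW W0.

Lemma measurable_EL2s (f : T -> R) : EL2s f -> measurable_fun D f.
Proof. by move=> [/(_ tt)]. Qed.

Lemma EL2s_norm (f : T -> R) : EL2s f -> EL2s (fun x => `|f x|) /\ N (fun x => `|f x|) = N f.
Proof.
move=> Ef; have e x : dotc coordR `|f x| `|f x| = dotc coordR (f x) (f x).
  by rewrite !dotcR -!expr2 real_normK ?num_real.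
split; last by rewrite /nrm /ip; congr Num.sqrt; apply: eq_Rintegral => x _; rewrite e.
split; first by case=> /=; apply: measurableT_comp => //; exact: measurable_EL2s.
by rewrite /sqint; under eq_integral do rewrite e; case: Ef.
Qed.

(** The partial sums [S] of |f_(n+1) - f_n| have norm at most 1. By monotone convergence the limit
    of W S_n^2 has a finite integral, hence is finite almost everywhere; there the series of
    increments converges absolutely. *)
Lemma riesz_fischer_subseq (f : nat -> T -> R) : (forall n, EL2s (f n)) ->
  (forall n, N (f n.+1 - f n) <= 2^-1 ^+ n.+1) ->
  {ae mu, forall x, D x -> cvgn (f ^~ x)}.
Proof.
move=> Ef Hf.
pose dl n (x : T) : R := `|f n.+1 x - f n x|.
have Ed n : EL2s (dl n) /\ N (dl n) <= 2^-1 ^+ n.+1.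
  have [h1 h2] := EL2s_norm (ph_B hB (Ef n.+1) (Ef n)).
  by split; [exact: h1|rewrite /dl h2].
pose S n : T -> R := \sum_(k < n) dl k.
have ES n : EL2s (S n) /\ N (S n) <= 1 - 2^-1 ^+ n.
  elim: n => [|n [IH1 IH2]].
    rewrite /S big_ord0 expr0 subrr; split.
      by rewrite -(scale0r (dl 0)); apply: (ph_Z hB); case: (Ed 0%N).
    by rewrite -(scale0r (dl 0)) (nrmZ hB) ?normr0 ?mul0r//; case: (Ed 0%N).
  have [h1 h2] := Ed n.
  have -> : S n.+1 = S n + dl n by rewrite /S big_ord_recr.
  split; first exact: (ph_D hB).
  rewrite (le_trans (nrm_triangle hB IH1 h1))//.
  by rewrite (le_trans (lerD IH2 h2))// exprS; lra.
pose u n x := (W x * dotc coordR (S n x) (S n x))%:E.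
have mu_ n : measurable_fun D (u n) by apply: measurable_Wdotc => //; case: (ES n) => -[].
have u0 n x : D x -> (0 <= u n x)%E by exact: Wdotc_ge0.
have SE n x : S n x = \sum_(k < n) dl k x by rewrite /S fct_sumE.
have S0 n x : 0 <= S n x by rewrite SE; apply: sumr_ge0 => k _; exact: normr_ge0.
have Snd x : {homo (S ^~ x) : n m / (n <= m)%N >-> n <= m}.
  by apply/nondecreasing_seqP => n; rewrite !SE big_ord_recr lerDl; exact: normr_ge0.
have und x : D x -> {homo u ^~ x : n m / (n <= m)%N >-> (n <= m)%E}.
  move=> Dx n m nm; rewrite lee_fin ler_pM2l ?W0// !dotcR.
  by apply: ler_pM => //; exact: Snd.
have cu : (\int[mu]_(x in D) u n x)%E @[n --> \oo] --> (\int[mu]_(x in D) limn (u ^~ x))%E.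
  exact: cvg_monotone_convergence.
have ub n : (\int[mu]_(x in D) u n x <= 1)%E.
  have [h1 h2] := ES n; rewrite -[leLHS]/(sqint coordR W (S n)) (ip_EFin mW W0 h1) lee_fin.
  rewrite -(nrm_sqr hB h1) -(expr1n _ 2) lerXn2r ?nnegrE ?nrm_ge0//.
  by rewrite (le_trans h2)// gerBl exprn_ge0.
pose ul x : \bar R := limn (u ^~ x).
have iul : mu.-integrable D ul.
  apply/integrableP; split.
    apply: (@emeasurable_fun_cvg _ _ _ _ u ul mu_) => x Dx.
    by apply: ereal_nondecreasing_is_cvgn; exact: und.
  have -> : (\int[mu]_(x in D) `|ul x| = \int[mu]_(x in D) ul x)%E.
    apply: eq_integral => x /set_mem Dx; rewrite gee0_abs//.
    apply: lime_ge; first by apply: ereal_nondecreasing_is_cvgn; exact: und.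
    by apply: nearW => n; exact: u0.
  apply: (@le_lt_trans _ _ 1%E); last exact: ltry.
  rewrite -(cvg_lim _ cu)//; apply: lime_le; first by apply/cvg_ex; eexists; exact: cu.
  by apply: nearW => n; exact: ub.
have := integrable_ae mD iul; apply: filterS => x + Dx => /(_ Dx) fx.
have Wx := W0 Dx.
have Sb n : W x * (S n x * S n x) <= fine (ul x).
  rewrite -lee_fin fineK// -(dotcR (S n x)); apply: lime_ge.
    by apply: ereal_nondecreasing_is_cvgn; exact: und.
  by exists n => // k /= nk; exact: und.
have cS : cvgn (S ^~ x).
  apply: nondecreasing_is_cvgn; first exact: Snd.
  exists (1 + fine (ul x) / W x) => _ [n _ <-].
  have h : S n x * S n x <= fine (ul x) / W x by rewrite ler_pdivlMr// mulrC.
  have [s1|s1] := leP (S n x) 1.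
    by rewrite (le_trans s1)// lerDl (le_trans _ h)// mulr_ge0.
  rewrite (@le_trans _ _ (S n x * S n x))//; last by rewrite (le_trans h)// lerDr.
  by rewrite ler_peMl// ltW.
have c1 : cvgn [series f k.+1 x - f k x]_k.
  apply: normed_cvg.
  suff <- : S ^~ x = [normed series (fun k => f k.+1 x - f k x)] by [].
  by apply/funext => n; rewrite SE -(big_mkord xpredT (fun k => dl k x)).
have -> : f ^~ x = (fun n => [series f k.+1 x - f k x]_k n + f 0%N x).
  by apply/funext => n; rewrite /series/= telescope_sumr// subrK.
by apply: is_cvgD => //; exact: is_cvg_cst.
Qed.

(** The pointwise limit of a fast subsequence is the candidate, and Fatou's lemma along that
    subsequence turns the Cauchy bound into a bound for the distance to it. *)
Theorem complete_L2R : ncomplete EL2s ips.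
Proof.
move=> u Eu cu.
have /choice[g hg] (k : nat) : exists n0, forall n m, (n0 <= n)%N -> (n0 <= m)%N ->
    N (u n - u m) <= 2^-1 ^+ k.+1 by apply: cu; rewrite exprn_gt0// invr_gt0.
(* A running maximum: [G k] is past both [k] and the threshold [g k], and [G k.+1] is past [g k]
   too, so consecutive terms of [f] are within 2^(-k-1). *)
pose G k := (\max_(i < k.+1) maxn i (g i))%N.
have gGm k : (maxn k (g k) <= G k)%N.
  exact: (@leq_bigmax _ (fun i : 'I_k.+1 => maxn i (g i)) ord_max).
have gG k : (g k <= G k)%N by rewrite (leq_trans _ (gGm k))// leq_maxr.
have gGS k : (g k <= G k.+1)%N.
  by rewrite /G big_ord_recr/= leq_max gG.
pose f k := u (G k).
have Ef k : EL2s (f k) by exact: Eu.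
have fcvg := riesz_fischer_subseq Ef (fun k => hg k _ _ (gGS k) (gG k)).
(* The upper limit is measurable without reference to the set of convergence; on the null set of
   divergence its value is arbitrary. *)
pose F x := fine (limn_esup (EFin \o f ^~ x)).
have mF : measurable_fun D F.
  apply: (measurable_comp (F := setT)) => //.
  apply: measurable_fun_limn_esup => k; apply/measurable_EFinP; exact: measurable_EL2s.
have FE x : cvgn (f ^~ x) -> f ^~ x @ \oo --> F x.
  move=> c; rewrite /F is_cvg_limn_esupE; last first.
    by apply/cvg_ex; exists (limn (f ^~ x))%:E; apply/cvg_EFin; [exact: nearW|exact: c].
  have /cvg_lim -> // : EFin \o f ^~ x @ \oo --> (limn (f ^~ x))%:E.
  by apply/cvg_EFin; [exact: nearW|exact: c].
have mfF : mfc coordR F by case.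
have key e : 0 < e -> exists n0, forall n, (n0 <= n)%N -> EL2s (u n - F) /\ N (u n - F) <= e.
  move=> e0; have [n0 hn0] := cu e e0; exists n0 => n n0n.
  have mun : mfc coordR (u n - F).
    by rewrite -scaleN1r; apply: mfcD; [case: (Eu n)|exact: mfcZ].
  have cn := measurable_EL2s (Eu n).
  apply: (sqint_le mW W0 mun (ltW e0)).
  pose v k x := (W x * dotc coordR ((u n - f k) x) ((u n - f k) x))%:E.
  have muf k : EL2s (u n - f k) by exact: (ph_B hB).
  have mv k : measurable_fun D (v k) by apply: measurable_Wdotc => //; case: (muf k).
  have v0 k x : D x -> (0 <= v k x)%E by exact: Wdotc_ge0.
  have -> : sqint coordR W (u n - F) = (\int[mu]_(x in D) limn_einf (v ^~ x))%E.
    apply: ge0_ae_eq_integral => //.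
    - exact: measurable_Wdotc.
    - rewrite (_ : (fun x => _) = (fun x => - limn_esup ((-%E \o v ^~ x)))%E).
        apply: measurableT_comp => //; apply: measurable_fun_limn_esup => k.
        by apply: measurableT_comp => //; exact: mv.
      by apply/funext => x; rewrite limn_esupN oppeK.
    - by move=> x; exact: Wdotc_ge0.
    - move=> x Dx; rewrite limn_einf_lim; apply: lime_ge; first exact: is_cvg_einfs.
      apply: nearW => k; apply: le_ereal_inf_tmp => _ [i /= ki <-]; exact: v0.
    - apply: filterS fcvg => x /[apply] /FE c.
      have cv : v ^~ x @ \oo --> (W x * dotc coordR ((u n - F) x) ((u n - F) x))%:E.
        apply/cvg_EFin; first exact: nearW.
        apply: cvgMr; under eq_fun do rewrite /= dotcR; rewrite dotcR.
        by apply: cvgM; apply: cvgB => //; exact: cvg_cst.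
      by rewrite is_cvg_limn_einfE; [rewrite (cvg_lim _ cv)|apply/cvg_ex; eexists; exact: cv].
  apply: (le_trans (fatou mu mD mv v0)).
  rewrite limn_einf_lim; apply: lime_le; first exact: is_cvg_einfs.
  apply: nearW => k.
  apply: (@le_trans _ _ (\int[mu]_(x in D) v (maxn k n0) x)%E).
    by apply: ereal_inf_lbound; exists (maxn k n0) => //=; rewrite leq_maxl.
  rewrite -[leLHS]/(sqint coordR W (u n - f (maxn k n0))) (ip_EFin mW W0 (muf _)) lee_fin.
  rewrite -(nrm_sqr hB (muf _)) lerXn2r ?nnegrE ?nrm_ge0 ?(ltW e0)//.
  apply: hn0 => //.
  by rewrite (leq_trans _ (gGm _))// leq_max leq_maxr.
have [n0 /(_ n0 (leqnn _))[EuF _]] := key 1 ltr01.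
have EF : EL2s F by have := ph_B hB (Eu n0) EuF; rewrite subKr.
exists F => //; apply/cvgr0Pnorm_le => e e0; have [n1 hn1] := key e e0.
exists n1 => // n /= n1n; rewrite (ger0_norm (nrm_ge0 _ _)).
by have [] := hn1 n n1n.
Qed.

Section vector.
Context (U : lmodType R) (cs : coordspace U).

Lemma mfc_co (F : T -> U) (i : cix cs) : mfc cs F -> mfc coordR (fun x => co i (F x)).
Proof. by move=> mF []; exact: mF. Qed.

Lemma sqint_co (F : T -> U) : mfc cs F ->
  sqint cs W F = (\sum_(i : cix cs) sqint coordR W (fun x => co i (F x)))%E.
Proof.
move=> mF; rewrite /sqint -ge0_integral_sum//; last 2 first.
- by move=> i; apply: measurable_Wdotc => //; exact: mfc_co.
- by move=> i x Dx; rewrite lee_fin mulr_ge0 ?dotc_ge0// ltW// W0.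
apply: eq_integral => x _; rewrite sumEFin; congr EFin.
by rewrite mulr_sumr; apply: eq_bigr => i _; rewrite dotcR.
Qed.

Lemma EL2_co (F : T -> U) (i : cix cs) : EL2 cs W F -> EL2s (fun x => co i (F x)).
Proof.
move=> [mF]; rewrite sqint_co// => h; split; first exact: mfc_co.
apply: le_lt_trans h; rewrite (bigD1 i)//= leeDl// sume_ge0// => j _.
exact: sqint_ge0.
Qed.

Lemma EL2_ofco (F : T -> U) : (forall i : cix cs, EL2s (fun x => co i (F x))) -> EL2 cs W F.
Proof.
move=> h; have mF : mfc cs F by move=> i; have [/(_ tt)] := h i.
split => //; rewrite sqint_co//; apply: lte_sum_pinfty => i _.
by case: (h i).
Qed.

Lemma nrm_co (F : T -> U) : EL2 cs W F ->
  nrm (ip cs W) F ^+ 2 = \sum_(i : cix cs) N (fun x => co i (F x)) ^+ 2.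
Proof.
move=> EF; apply: EFin_inj; rewrite (nrm_sqr (prehilbert_L2 cs mW W0) EF).
rewrite -(ip_EFin mW W0 EF) (sqint_co (proj1 EF)) -sumEFin.
apply: eq_bigr => i _; have Ei := EL2_co i EF.
by rewrite (nrm_sqr hB Ei) -(ip_EFin mW W0 Ei).
Qed.

Lemma nrm_co_le (F : T -> U) (i : cix cs) : EL2 cs W F ->
  N (fun x => co i (F x)) <= nrm (ip cs W) F.
Proof.
move=> EF; rewrite -(@ler_pXn2r _ 2)// ?nnegrE ?nrm_ge0//.
rewrite (nrm_co EF) (bigD1 i)//= lerDl; apply: sumr_ge0 => j _; exact: sqr_ge0.
Qed.

(** Each coordinate is Cauchy because its norm is at most that of the vector; the squared distances
    to the coordinatewise limits add up over finitely many coordinates. *)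
Theorem complete_L2 : ncomplete (EL2 cs W) (ip cs W).
Proof.
move=> u Eu cu; have hV := prehilbert_L2 cs mW W0.
have /choice[F hF] (i : cix cs) : exists F, EL2s F /\ ncvg ips (fun n x => co i (u n x)) F.
  have ci : ncauchy ips (fun n x => co i (u n x)).
    move=> e e0; have [n0 h] := cu e e0; exists n0 => n m hn hm.
    apply: le_trans (h n m hn hm).
    have := nrm_co_le i (ph_B hV (Eu n) (Eu m)).
    by under eq_fun do rewrite coB.
  have [F EF uF] := @complete_L2R (fun n x => co i (u n x)) (fun n => EL2_co i (Eu n)) ci.
  by exists F.
pose G x := cmk (fun i : cix cs => F i x).
have GE i x : co i (G x) = F i x by rewrite co_mk.
have EG : EL2 cs W G.
  apply: EL2_ofco => i; rewrite (_ : (fun x => _) = F i); first by case: (hF i).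
  by apply/funext => x; exact: GE.
exists G => //.
have sq : nrm (ip cs W) (u n - G) ^+ 2 @[n --> \oo] --> (0 : R).
  have -> : (fun n => nrm (ip cs W) (u n - G) ^+ 2) =
            (fun n => \sum_(i : cix cs) N ((fun x => co i (u n x)) - F i) ^+ 2).
    apply/funext => n; rewrite (nrm_co (ph_B hV (Eu n) EG)).
    apply: eq_bigr => i _; congr (N _ ^+ 2); apply/funext => x.
    by rewrite coB GE.
  apply: cvg_sum0 => i; rewrite -[X in _ --> X](mulr0 0).
  under eq_fun do rewrite expr2.
  by apply: cvgM; case: (hF i).
apply/cvgr0Pnorm_le => e e0; have e2 : 0 < e ^+ 2 by rewrite exprn_gt0.
move/cvgr0Pnorm_le : sq => /(_ _ e2); apply: filterS => n.
rewrite ger0_norm ?sqr_ge0// ger0_norm ?nrm_ge0// => h.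
by rewrite -(@ler_pXn2r _ 2)// ?nnegrE ?nrm_ge0// ltW.
Qed.

End vector.
End complete.
End L2.

Section coordspaces.
Context {R : realType} (d : nat).

Definition coV (i : 'I_d) (x : 'rV[R]_d) : R := x ord0 i.

Lemma coV_lin i (a : R) p q : coV i (a *: p + q) = a * coV i p + coV i q.
Proof. by rewrite /coV !mxE. Qed.

Lemma coV_mk i (f : 'I_d -> R) : coV i (\row_j f j) = f i.
Proof. by rewrite /coV mxE. Qed.

Definition coordV : coordspace 'rV[R]_d := Coordspace coV_lin coV_mk.

Definition coZ (i : option 'I_d) (z : 'rV[R]_d * R) : R :=
  if i is Some j then z.1 ord0 j else z.2.

Lemma coZ_lin i (a : R) p q : coZ i (a *: p + q) = a * coZ i p + coZ i q.
Proof. by case: i => [i|] /=; rewrite ?mxE. Qed.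

Definition coordZ : coordspace ('rV[R]_d * R)%type :=
  @Coordspace R ('rV[R]_d * R)%type (option 'I_d) coZ
   (fun f => (\row_i f (Some i), f None))
   coZ_lin (fun i f => ltac:(by case: i => [i|] //=; rewrite mxE)).

Lemma dotE a b : dot a b = dotc coordV a b. Proof. by []. Qed.

Lemma sum_option (V : nmodType) (f : option 'I_d -> V) :
  \sum_i f i = \sum_i f (Some i) + f None.
Proof.
rewrite (bigD1 None)//= addrC; congr (_ + _).
rewrite (reindex_omap (Some : 'I_d -> option 'I_d) id)//=; last by case.
by apply: eq_bigl => i; rewrite eqxx.
Qed.

Lemma dotzE a b : dotz a b = dotc coordZ a b.
Proof. by rewrite /dotc sum_option. Qed.

End coordspaces.

(** * Borel sets and Lebesgue measure on row vectors *)

Section borel.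
Context {R : realType}.

Lemma measurable_fun_rVP d (T : measurableType d) (D : set T) n (F : T -> 'rV[R]_n) :
  measurable D ->
  measurable_fun D F <-> forall i, measurable_fun D (fun x => F x ord0 i).
Proof.
move=> mD; split=> [mF i|mF].
  by apply: (measurableT_comp (measurable_coor i)).
apply: (@measurability _ _ _ _ _ F _ (erefl : @measurable _ 'rV[R]_n = _)).
move=> _ [B + <-]; rewrite -bigcup_seq => -[i /= _ [C mC <-]].
by have := mF i mD C mC; rewrite setTI.
Qed.

Definition bbox d (q : 'rV[R]_d * R) (r : R) : set ('rV[R]_d * R) :=
  [set z | forall i, `|coZ i z - coZ i q| < r].

Lemma measurable_coZ d (i : option 'I_d) :
  measurable_fun [set: ('rV[R]_d * measurableTypeR R)%type] (coZ i).
Proof.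
case: i => [i|]; last exact: measurable_snd.
exact: (measurableT_comp (measurable_coor i) measurable_fst).
Qed.

Lemma measurable_bbox d (q : 'rV[R]_d * R) r :
  measurable (bbox q r : set ('rV[R]_d * measurableTypeR R)%type).
Proof.
rewrite (_ : bbox q r = \bigcap_(i in [set: option 'I_d]) [set z | `|coZ i z - coZ i q| < r]); last first.
  by apply/seteqP; split => [z h i _|z h i]; [exact: h|exact: h].
apply: fin_bigcap_measurable => // i _.
rewrite -[X in measurable X]setTI.
apply: (measurable_fun_ltr (f := fun z : 'rV[R]_d * measurableTypeR R => `|coZ i z - coZ i q|) (g := cst r)) => //.
apply: measurableT_comp => //; apply: measurable_funB => //; exact: measurable_coZ.
Qed.

Lemma bbox_ball d (q : 'rV[R]_d * R) r : 0 < r -> bbox q r = ball q r.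
Proof.
move=> r0; apply/seteqP; split => [z h|z h].
  have h2 := h None; rewrite /= distrC in h2.
  split => //=; split => // i j; rewrite (ord1 i).
  by have /= := h (Some j); rewrite distrC.
case=> [i|]; rewrite distrC; first by case: h => -[_ /(_ ord0 i)].
by case: h.
Qed.

(** The sigma-algebra is generated by coordinates, so open sets are reached through boxes; rational
    centres and radii 1/(n+1) leave countably many of them. *)
Lemma open_bboxes d (U : set ('rV[R]_d * R)) : open U ->
  U = \bigcup_(p in [set p : 'rV[rat]_d * rat * nat |
     bbox (map_mx ratr p.1.1, ratr p.1.2) (p.2.+1%:R^-1 : R) `<=` U])
     bbox (map_mx ratr p.1.1, ratr p.1.2) (p.2.+1%:R^-1).
Proof.
move=> oU; apply/seteqP; split; last by move=> z [p /= h]; exact: h.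
move=> z Uz; have [e /= e0 he] := (nbhs_ballP z U).1 (open_nbhs_nbhs (conj oU Uz)).
(* A box of radius 1/(n+1) around a rational point that close to [z] lies within 2/(n+1) of [z]. *)
have [n hn] : exists n : nat, 2 * n.+1%:R^-1 < e.
  exists (Num.truncn (2 / e)).
  rewrite -ltr_pdivlMl// mulrC -[ltRHS]invrK ltf_pV2 ?posrE ?invr_gt0 ?divr_gt0//.
  rewrite (_ : (2^-1 * e)^-1 = e^-1 * 2); last by rewrite invfM invrK mulrC.
  exact: truncnS_gt.
  by rewrite mulr_gt0// invr_gt0.
have n0 : 0 < n.+1%:R^-1 :> R by rewrite invr_gt0.
have /choice[f hf] (i : option 'I_d) : exists q : rat, `|coZ i z - ratr q| < n.+1%:R^-1.
  have lt : coZ i z - n.+1%:R^-1 < coZ i z + n.+1%:R^-1 by rewrite ltrD2l gtrN.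
  have [q] := rat_in_itvoo lt; rewrite in_itv/= => /andP[h1 h2]; exists q.
  by rewrite distrC ltr_norml ltrBrDl h1 ltrBlDl h2.
have zin : bbox (map_mx ratr (\row_i f (Some i)), ratr (f None)) (n.+1%:R^-1) z.
  by case=> [i|] /=; [rewrite !mxE; exact: (hf (Some i))|exact: (hf None)].
exists ((\row_i f (Some i), f None), n) => //=.
rewrite bbox_ball// in zin *; move=> y yb; apply: he.
by apply: (le_ball (ltW hn)); rewrite mulr_natl mulr2n; apply: ball_triangle yb; exact: ball_sym.
Qed.

Lemma open_measurableZ d (U : set ('rV[R]_d * R)) : open U ->
  measurable (U : set ('rV[R]_d * measurableTypeR R)%type).
Proof.
move=> /open_bboxes ->; rewrite bigcup_mkcond; apply: countable_bigcupT_measurable => [|p].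
  exact: countableP.
by case: ifP => _; [exact: measurable_bbox|exact: measurable0].
Qed.

Lemma continuous_measurableZ d (f : 'rV[R]_d * R -> R) : continuous f ->
  measurable_fun [set: 'rV[R]_d * measurableTypeR R] f.
Proof.
move=> cf; apply: (measurability _ (RGenOpens.measurableE R)).
move=> _ [_ [a [b ->] <-]]; rewrite setTI.
apply: open_measurableZ; apply: open_comp; last exact: interval_open.
by move=> z _; exact: cf.
Qed.

Lemma measurable_pair0 d : measurable_fun [set: 'rV[R]_d] (fun x => (x, 0) : 'rV[R]_d * measurableTypeR R).
Proof. exact: measurable_fun_pair. Qed.

(** Transferred from R^d x R by composing with x -> (x, 0). *)
Lemma continuous_measurableV d (f : 'rV[R]_d -> R) : continuous f ->
  measurable_fun [set: 'rV[R]_d] f.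
Proof.
move=> cf.
have h : measurable_fun [set: 'rV[R]_d * measurableTypeR R] (f \o fst).
  by apply: continuous_measurableZ => z; apply: continuous_comp; [exact: cvg_fst|exact: cf].
exact: (measurableT_comp h (@measurable_pair0 d)).
Qed.

Lemma open_measurableV d (U : set 'rV[R]_d) : open U -> measurable U.
Proof.
move=> oU.
have h : measurable (fst @^-1` U : set ('rV[R]_d * measurableTypeR R)).
  by apply: open_measurableZ; apply: open_comp => // z _; exact: cvg_fst.
have := @measurable_pair0 d measurableT _ h.
by rewrite setTI (_ : _ @^-1` _ = U).
Qed.

Lemma coord_le_norm d (x : 'rV[R]_d) i : `|x ord0 i| <= `|x|.
Proof.
rewrite [leRHS]/Num.norm/= mx_normrE.
exact: (le_bigmax _ (fun ij : 'I_1 * 'I_d => `|x ij.1 ij.2|) (ord0, i)).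
Qed.

Definition vbox d (M : R) : set 'rV[R]_d := [set x | forall i, `|x ord0 i| <= M].

Lemma measurable_vbox d M : measurable (vbox M : set 'rV[R]_d).
Proof.
rewrite (_ : vbox M = \bigcap_(i in [set: 'I_d]) [set x | `|x ord0 i| <= M]); last first.
  by apply/seteqP; split => [z h i _|z h i]; [exact: h|exact: h].
apply: fin_bigcap_measurable => // i _; rewrite -[X in measurable X]setTI.
apply: (measurable_fun_ler (f := fun z : 'rV[R]_d => `|z ord0 i|) (g := cst M)) => //.
by apply: measurableT_comp => //; exact: measurable_coor.
Qed.

End borel.

Section leb_facts.
Context {R : realType}.
Local Open Scope ereal_scope.

Lemma leb_box_lty d (M : R) : leb d (vbox M) < +oo.
Proof.
elim: d => [|d IH]; first by rewrite /leb/= diracE ltry.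
rewrite /= /pushforward.
rewrite (_ : _ @^-1` _ = `[(- M)%R, M]%classic `*` vbox M); last first.
  apply/seteqP; split=> [[t x] h|[t x] [/= ht hx] i].
    split => /=; first by have := h ord0; rewrite consrV0/= in_itv/= ler_norml.
    by move=> i; have := h (lift ord0 i); rewrite consrVS.
  have [j ->|->] := unliftP ord0 i; first by rewrite consrVS/=; exact: hx.
  by rewrite consrV0/= ler_norml; move: ht; rewrite in_itv/=.
have mB := @measurable_vbox R d M.
rewrite product_measure1E//= lte_mul_pinfty//.
by rewrite lebesgue_measure_itv/=; case: ifP.
Qed.

Lemma bounded_vbox d (A : set 'rV[R]_d) : bounded_set A -> exists2 M : R, (0 < M)%R & A `<=` vbox M.
Proof.
move=> [M [_ hM]]; exists (`|M| + 1)%R; first by rewrite ltr_wpDl.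
move=> x Ax i; apply: le_trans (coord_le_norm x i) _; apply: hM => //.
by rewrite (le_lt_trans (ler_norm M))// ltrDl.
Qed.

Lemma leb_bounded_lty d (A : set 'rV[R]_d) : measurable A -> bounded_set A -> leb d A < +oo.
Proof.
move=> mA /bounded_vbox[M _ hM].
by apply: le_lt_trans (leb_box_lty d M); apply: le_measure; rewrite ?inE//; exact: measurable_vbox.
Qed.

Lemma integral_lebS m (f : 'rV[R]_m.+1 -> \bar R) :
  measurable_fun setT f -> (forall x, 0 <= f x) ->
  \int[leb m.+1]_x f x = \int[lebesgue_measure]_s \int[leb m]_x f (consrV (s, x)).
Proof.
move=> mf f0.
transitivity (\int[pushforward (@lebesgue_measure R \x @leb R m) (@consrV R m)]_x f x).
  by [].
have E := @ge0_integral_pushforward _ _ (measurableTypeR R * 'rV[R]_m)%type 'rV[R]_m.+1 R (@consrV R m) (@measurable_consrV R m)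
  (@lebesgue_measure R \x @leb R m) setT f measurableT mf (fun x _ => f0 x).
apply: (etrans E); rewrite preimage_setT.
have mg : measurable_fun [set: (measurableTypeR R * 'rV[R]_m)%type] (f \o @consrV R m).
  by apply: measurableT_comp => //; exact: measurable_consrV.
exact: (@fubini_tonelli1 _ _ (measurableTypeR R) 'rV[R]_m R (@lebesgue_measure R) (@leb R m) (f \o @consrV R m) mg (fun x => f0 _)).
Qed.

(** * Tonelli's theorem on rectangles *)

Section prod.
Context d1 d2 (T1 : measurableType d1) (T2 : measurableType d2).
Context (m1 : {sigma_finite_measure set T1 -> \bar R}) (m2 : {sigma_finite_measure set T2 -> \bar R}).
Context (A : set T1) (B : set T2).
Hypotheses (mA : measurable A) (mB : measurable B).
Context (f : T1 * T2 -> \bar R).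
Hypotheses (mf : measurable_fun (A `*` B) f) (f0 : forall z, (A `*` B) z -> 0 <= f z).

Let g := f \_ (A `*` B).
Let mg : measurable_fun setT g.
Proof. exact/(measurable_restrictT _ (measurableX mA mB)). Qed.
Let g0 z : 0 <= g z. Proof. by apply: erestrict_ge0 => ? ?; exact: f0. Qed.

Let gE1 x : \int[m2]_y g (x, y) = ((fun x => \int[m2]_(y in B) f (x, y)) \_ A) x.
Proof.
rewrite patchE; case: ifPn => xA.
  rewrite [RHS]integral_mkcond; apply: eq_integral => y _.
  by rewrite /g !patchE/= in_setX/= xA.
by apply: integral0_eq => y _; rewrite /g patchE in_setX/= (negbTE xA).
Qed.

Let gE2 y : \int[m1]_x g (x, y) = ((fun y => \int[m1]_(x in A) f (x, y)) \_ B) y.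
Proof.
rewrite patchE; case: ifPn => yB.
  rewrite [RHS]integral_mkcond; apply: eq_integral => x _.
  by rewrite /g !patchE/= in_setX/= yB andbT.
by apply: integral0_eq => x _; rewrite /g patchE in_setX/= (negbTE yB) andbF.
Qed.

Lemma tonelli1 : \int[m1 \x m2]_(z in A `*` B) f z = \int[m1]_(x in A) \int[m2]_(y in B) f (x, y).
Proof.
rewrite integral_mkcond (fubini_tonelli1 g mg g0) [RHS]integral_mkcond.
by apply: eq_integral => x _; rewrite -gE1.
Qed.

Lemma tonelli2 : \int[m1 \x m2]_(z in A `*` B) f z = \int[m2]_(y in B) \int[m1]_(x in A) f (x, y).
Proof.
rewrite integral_mkcond (fubini_tonelli1 g mg g0) (fubini_tonelli g mg g0) [RHS]integral_mkcond.
by apply: eq_integral => y _; rewrite -gE2.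
Qed.

Lemma measurable_tonelli1 : measurable_fun A (fun x => \int[m2]_(y in B) f (x, y)).
Proof.
apply/(measurable_restrictT _ mA); rewrite (_ : _ \_ _ = fun x => \int[m2]_y g (x, y)).
  exact: (measurable_fun_fubini_tonelli_F g mg g0).
by apply/funext => x; rewrite -gE1.
Qed.

Lemma measurable_tonelli2 : measurable_fun B (fun y => \int[m1]_(x in A) f (x, y)).
Proof.
apply/(measurable_restrictT _ mB); rewrite (_ : _ \_ _ = fun y => \int[m1]_x g (x, y)).
  exact: (measurable_fun_fubini_tonelli_G g mg g0).
by apply/funext => y; rewrite -gE2.
Qed.

End prod.
End leb_facts.

(** * Slices of smooth functions *)

Section slices.
Context {R : realType}.

Lemma continuous_consrV d : continuous (@consrV R d).
Proof.
move=> p; apply/cvg_ballP => e e0.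
exists (ball p.1 e, ball p.2 e) => /=; first by split; exact: nbhsx_ballx.
move=> q [h1 [_ h2]]; split => // i j; rewrite (ord1 i).
have [k ->|->] := unliftP ord0 j; first by rewrite !consrVS; exact: h2.
by rewrite !consrV0.
Qed.

Lemma consrV_lin d (h : R) (p q : R * 'rV[R]_d) :
  consrV (h *: p + q) = h *: consrV p + consrV q.
Proof.
apply/rowP => j; rewrite [RHS]mxE [(h *: consrV p) _ _]mxE.
have [k ->|->] := unliftP ord0 j; first by rewrite !consrVS !mxE.
by rewrite !consrV0.
Qed.

Lemma consrV_delta0 d : consrV (1, 0) = delta_mx ord0 ord0 :> 'rV[R]_d.+1.
Proof.
apply/rowP => j.
have [k ->|->] := unliftP ord0 j; first by rewrite consrVS !mxE.
by rewrite consrV0 mxE.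
Qed.

Lemma consrV_deltaS d (i : 'I_d) :
  consrV (0, delta_mx ord0 i) = delta_mx ord0 (lift ord0 i) :> 'rV[R]_d.+1.
Proof.
apply/rowP => j.
have [k ->|->] := unliftP ord0 j; last by rewrite consrV0 mxE.
by rewrite consrVS !mxE /= (inj_eq lift_inj).
Qed.

Lemma smooth_slice_tail d (f : 'rV[R]_d.+1 -> R) (s : R) :
  smooth f -> smooth (fun x => f (consrV (s, x))).
Proof.
apply: (@smooth_affine R 'rV[R]_d 'rV[R]_d.+1 f (fun x => consrV (s, x)) (fun v => consrV (0, v))).
  move=> x; apply: (@continuous_comp _ _ _ (fun x => (s, x)) (@consrV R d)).
    exact: (cvg_pair (@cst_continuous _ _ s x) cvg_id).
  exact: continuous_consrV.
by move=> h v x; rewrite -consrV_lin; congr consrV; congr pair; rewrite /= scaler0 add0r.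
Qed.

Lemma smooth_slice_head d (f : 'rV[R]_d.+1 -> R) (x : 'rV[R]_d) :
  smooth f -> smooth (fun s => f (consrV (s, x))).
Proof.
apply: (@smooth_affine R R 'rV[R]_d.+1 f (fun s => consrV (s, x)) (fun v => consrV (v, 0))).
  move=> s; apply: (@continuous_comp _ _ _ (fun s => (s, x)) (@consrV R d)).
    exact: (cvg_pair cvg_id (cvg_cst x)).
  exact: continuous_consrV.
by move=> h v s; rewrite -consrV_lin; congr consrV; congr pair; rewrite /= scaler0 add0r.
Qed.

Lemma derive_slice_tail d (f : 'rV[R]_d.+1 -> R) (s : R) x (i : 'I_d) :
  'D_(delta_mx ord0 i) (fun x => f (consrV (s, x))) x =
  'D_(delta_mx ord0 (lift ord0 i)) f (consrV (s, x)).
Proof.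
have H (h : R) : consrV (s, h *: delta_mx ord0 i + x) =
    h *: delta_mx ord0 (lift ord0 i) + consrV (s, x).
  rewrite -consrV_deltaS -consrV_lin; congr consrV; congr pair.
  by rewrite /= scaler0 add0r.
by have [_] := @derive_affine R 'rV[R]_d 'rV[R]_d.+1 f (fun x => consrV (s, x)) _ _ x H.
Qed.

Lemma derive_slice_head d (f : 'rV[R]_d.+1 -> R) (s : R) x :
  'D_1 (fun s => f (consrV (s, x))) s = 'D_(delta_mx ord0 ord0) f (consrV (s, x)).
Proof.
have H (h : R) : consrV (h *: (1 : R) + s, x) = h *: delta_mx ord0 ord0 + consrV (s, x).
  rewrite -consrV_delta0 -consrV_lin; congr consrV; congr pair.
  by rewrite /= scaler0 add0r.
by have [_] := @derive_affine R R 'rV[R]_d.+1 f (fun s => consrV (s, x)) _ _ s H.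
Qed.

Lemma gradx_cont d (f : 'rV[R]_d -> R) : smooth f ->
  continuous (fun x => dot (gradx f x) (gradx f x)).
Proof.
move=> sf; apply: (@smooth_cont R).
rewrite (_ : (fun x => _) = fun x => \sum_(i < d) 'D_(delta_mx ord0 i) f x * 'D_(delta_mx ord0 i) f x).
  rewrite unlock /=; elim: (index_enum _) => [|i r IH] /=; first exact: smooth_cst.
  apply: (smoothD _ IH); apply: smoothM; exact: smooth_derive.
by apply/funext => x; apply: eq_bigr => i _; rewrite !mxE.
Qed.

Lemma continuous_measurable1 (g : R -> R) (D : set (measurableTypeR R)) : measurable D -> continuous g -> measurable_fun D g.
Proof. by move=> mD cg; apply: measurable_funTS; exact: continuous_measurable_fun. Qed.

Lemma CS_segment (g : R -> R) (r s : R) : r <= s -> continuous g ->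
  (\int[lebesgue_measure]_(u in `[r, s]) g u) ^+ 2 <=
  (s - r) * \int[lebesgue_measure]_(u in `[r, s]) (g u ^+ 2).
Proof.
move=> rs cg.
have ig (k : R -> R) : continuous k -> lebesgue_measure.-integrable `[r, s] (EFin \o k).
  move=> ck; apply: continuous_compact_integrable; first exact: segment_compact.
  exact: continuous_subspaceT.
have E2 (k : R -> R) : continuous k -> EL2 (@lebesgue_measure R) `[r, s]%classic coordR (cst 1) k.
  move=> ck; split; first by case; exact: continuous_measurable1.
  rewrite /sqint; under eq_integral do rewrite mul1r dotcR.
  have ikk := ig (fun u => k u * k u) (fun u => continuousM (ck u) (ck u)).
  have : (\int[lebesgue_measure]_(u in `[r, s]) (k u * k u)%:E)%E \is a fin_num.
    by apply: integrable_fin_num => //; exact: ikk.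
  by move=> /fin_numPlt/andP[].
have hB := prehilbert_L2 (@lebesgue_measure R) (measurable_itv `[r, s]) coordR
  (measurable_cst (1:R)) (fun _ _ => ltr01).
have c1 : continuous (cst 1 : R -> R) by exact: cst_continuous.
have := ph_CS2 hB (E2 _ cg) (E2 _ c1).
rewrite /ip.
under eq_Rintegral do rewrite mul1r dotcR mulr1.
under [X in _ <= X * _ -> _]eq_Rintegral do rewrite mul1r dotcR -expr2.
under [X in _ <= _ * X -> _]eq_Rintegral do rewrite mul1r dotcR mulr1.
rewrite [X in _ <= _ * X -> _]Rintegral_cst//= mul1r lebesgue_measure_itv/= lte_fin.
case: ltP => [_|sr] /=; first by rewrite mulrC.
by move=> h; rewrite (le_trans h)// mulr0 mulr_ge0 ?subr_ge0// Rintegral_ge0// => x _; rewrite sqr_ge0.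
Qed.

Lemma FTC_smooth (f : R -> R) (r s : R) : r <= s -> smooth f ->
  \int[lebesgue_measure]_(u in `[r, s]) 'D_1 f u = f s - f r.
Proof.
rewrite le_eqVlt => /orP[/eqP -> _|rs sf].
  by rewrite set_itv1 Rintegral_set1 subrr.
have E : (\int[lebesgue_measure]_(u in `[r, s]) ('D_1 f u)%:E = (f s)%:E - (f r)%:E)%E.
  apply: continuous_FTC2 => //.
  - by apply: continuous_subspaceT; apply: smooth_cont; exact: smooth_derive.
  - split.
    + by move=> x _; exact: smooth_derivable.
    + by apply: cvg_at_right_filter; exact: smooth_cont.
    + by apply: cvg_at_left_filter; exact: smooth_cont.
  - by move=> x _; rewrite derive1E.
by rewrite /Rintegral E.
Qed.

(** Fundamental theorem of calculus and Cauchy-Schwarz on [r, s], a segment of length at most h. The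
    bound is in extended reals to fit Tonelli's theorem. *)
Lemma sqr_dist_le (f : R -> R) (a h s r : R) : smooth f ->
  a <= s < a + h -> a <= r < a + h ->
  (((f s - f r) ^+ 2)%:E <= h%:E * \int[lebesgue_measure]_(u in `[a, (a + h)%R[) (('D_1 f u) ^+ 2)%:E)%E.
Proof.
move=> sf; wlog : s r / r <= s.
  move=> H hs hr; have [rs|sr] := leP r s; first exact: H.
  by rewrite -sqrrN opprB; apply: H => //; exact: ltW.
move=> rs /andP[as_ sa] /andP[ar ra].
have cD : continuous ('D_1 f) by apply: smooth_cont; exact: smooth_derive.
have h0 : 0 <= h by rewrite -(lerD2l a) addr0 ltW// (le_lt_trans as_).
have ig : lebesgue_measure.-integrable `[r, s] (EFin \o (fun u => 'D_1 f u ^+ 2)).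
  apply: continuous_compact_integrable; first exact: segment_compact.
  exact: (continuous_subspaceT (fun u => continuousM (cD u) (cD u))).
have := CS_segment rs cD; rewrite FTC_smooth// => H.
apply: (@le_trans _ _ (((s - r) * \int[lebesgue_measure]_(u in `[r, s]) ('D_1 f u ^+ 2))%:E)).
  by rewrite lee_fin.
rewrite EFinM /Rintegral fineK; last exact: integrable_fin_num.
apply: lee_pmul => //.
- by rewrite lee_fin subr_ge0.
- by apply: integral_ge0 => u _; rewrite lee_fin sqr_ge0.
- by rewrite lee_fin lerBlDr; lra.
apply: ge0_subset_integral => //.
- apply/measurable_EFinP; apply: continuous_measurable1 => //.
  exact: (fun u => continuousM (cD u) (cD u)).
- by move=> u _; rewrite lee_fin sqr_ge0.
- by move=> u /=; rewrite !in_itv/= => /andP[h1 h2]; lra.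
Qed.

End slices.

(** * Rellich's theorem *)

Section poincare.
Context {R : realType}.
Local Open Scope ereal_scope.

Lemma integral_cst_itv (a b : R) (c : \bar R) :
  \int[lebesgue_measure]_(s in `[a, b[) c = c * lebesgue_measure `[a, b[%classic.
Proof. exact: (integral_cst (@lebesgue_measure R) (measurable_itv `[a, b[) c). Qed.

Definition cell d (a : 'rV[R]_d) (h : R) : set 'rV[R]_d :=
  [set x | forall i, (a ord0 i <= x ord0 i < a ord0 i + h)%R].

Definition tailV d (a : 'rV[R]_d.+1) : 'rV[R]_d := (unconsrV a).2.

Lemma cell_consrV d (a : 'rV[R]_d.+1) h s x :
  cell a h (consrV (s, x)) <->
  (a ord0 ord0 <= s < a ord0 ord0 + h)%R /\ cell (tailV a) h x.
Proof.
split=> [H|[H1 H2] i].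
  split; first by have := H ord0; rewrite consrV0.
  by move=> i; have := H (lift ord0 i); rewrite consrVS mxE.
have [k ->|->] := unliftP ord0 i; last by rewrite consrV0.
by rewrite consrVS; have := H2 k; rewrite mxE.
Qed.

Lemma measurable_cell d (a : 'rV[R]_d) h : measurable (cell a h).
Proof.
rewrite (_ : cell a h = \bigcap_(i in [set: 'I_d])
    ((fun x : 'rV[R]_d => x ord0 i) @^-1` `[a ord0 i, (a ord0 i + h)%R[)); last first.
  apply/seteqP; split=> [x H i _|x H i]; first by rewrite /= in_itv/=; exact: H.
  by have := H i I; rewrite /= in_itv/=.
apply: fin_bigcap_measurable => // i _.
by rewrite -[X in measurable X]setTI; exact: measurable_coor.
Qed.

Section slice_int.
Context (d : nat) (a : 'rV[R]_d.+1) (h : R) (g : 'rV[R]_d.+1 -> \bar R).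
Hypotheses (mg : measurable_fun setT g) (g0 : forall x, 0 <= g x).

Let mgc : measurable_fun [set: (measurableTypeR R * 'rV[R]_d)%type] (g \o @consrV R d).
Proof. by apply: measurableT_comp => //; exact: measurable_consrV. Qed.

Lemma cell_intS :
  \int[leb d.+1]_(x in cell a h) g x =
  \int[lebesgue_measure]_(s in `[a ord0 ord0, (a ord0 ord0 + h)%R[)
    \int[leb d]_(x in cell (tailV a) h) g (consrV (s, x)).
Proof.
rewrite integral_mkcond integral_lebS; last 2 first.
- by apply/(measurable_restrictT _ (measurable_cell a h)); exact: measurable_funTS.
- by apply: erestrict_ge0 => x _.
rewrite [RHS]integral_mkcond; apply: eq_integral => s _; rewrite patchE.
have [sI|sI] := boolP (s \in `[a ord0 ord0, (a ord0 ord0 + h)%R[%classic).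
  rewrite [RHS]integral_mkcond; apply: eq_integral => x _; rewrite !patchE.
  move: sI; rewrite inE/= in_itv/= => sI.
  congr (if _ then _ else _); apply/idP/idP => /set_mem H; apply/mem_set.
    by have [] := (cell_consrV a h s x).1 H.
  by apply/cell_consrV.
apply: integral0_eq => x _; rewrite patchE ifF//; apply/negbTE.
apply: contra sI => /set_mem H; apply/mem_set; rewrite /= in_itv/=.
by have [] := (cell_consrV a h s x).1 H.
Qed.

Lemma cell_intS_swap :
  \int[leb d.+1]_(x in cell a h) g x =
  \int[leb d]_(x in cell (tailV a) h)
  \int[lebesgue_measure]_(s in `[a ord0 ord0, (a ord0 ord0 + h)%R[) g (consrV (s, x)).
Proof.
rewrite cell_intS.
have mX := measurable_funTS (D := `[a ord0 ord0, (a ord0 ord0 + h)%R[%classic `*` cell (tailV a) h) mgc.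
rewrite -(@tonelli1 _ _ _ (measurableTypeR R) 'rV[R]_d (@lebesgue_measure R) (@leb R d)
  _ _ (measurable_itv _) (measurable_cell _ _) _ mX (fun z _ => g0 _)).
by rewrite (@tonelli2 _ _ _ (measurableTypeR R) 'rV[R]_d (@lebesgue_measure R) (@leb R d)
  _ _ (measurable_itv _) (measurable_cell _ _) _ mX (fun z _ => g0 _)).
Qed.

Lemma measurable_slice_int (D : set 'rV[R]_d) : measurable D ->
  measurable_fun [set: measurableTypeR R] (fun s => \int[leb d]_(x in D) g (consrV (s, x))).
Proof.
move=> mD.
have mX := measurable_funTS (D := [set: measurableTypeR R] `*` D) mgc.
exact: (@measurable_tonelli1 _ _ _ (measurableTypeR R) 'rV[R]_d (@leb R d)
  _ _ measurableT mD _ mX (fun z _ => g0 _)).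
Qed.

Lemma measurable_slice_int2 (D : set (measurableTypeR R)) : measurable D ->
  measurable_fun setT (fun x => \int[lebesgue_measure]_(s in D) g (consrV (s, x))).
Proof.
move=> mD.
have mX := measurable_funTS (D := D `*` [set: 'rV[R]_d]) mgc.
exact: (@measurable_tonelli2 _ _ _ (measurableTypeR R) 'rV[R]_d (@lebesgue_measure R)
  _ _ mD measurableT _ mX (fun z _ => g0 _)).
Qed.

Lemma measurable_slice_tail s : measurable_fun setT (fun x => g (consrV (s, x))).
Proof. by apply: (measurableT_comp mgc (measurable_fun_pair (measurable_cst s) (@measurable_id _ _ _))). Qed.

End slice_int.

Lemma leb_cell d (a : 'rV[R]_d) h : (0 < h)%R -> leb d (cell a h) = (h ^+ d)%:E.
Proof.
move=> h0; elim: d a => [|d IH] a.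
  by rewrite /leb/= diracE mem_set// => -[].
transitivity (\int[leb d.+1]_(x in cell a h) 1).
  by rewrite integral_cst ?mul1e//; exact: measurable_cell.
rewrite cell_intS//.
transitivity (\int[lebesgue_measure]_(s in `[a ord0 ord0, (a ord0 ord0 + h)%R[) (h ^+ d)%:E).
  apply: eq_integral => s _; etransitivity; first exact: (integral_cst (leb d) (measurable_cell (tailV a) h) 1).
  by rewrite mul1e; exact: IH.
rewrite integral_cst_itv lebesgue_measure_itv/= lte_fin ltrDl h0 -EFinB addrAC subrr add0r.
by rewrite -EFinM -exprSr.
Qed.

Lemma measurable_sqr_dist d (f : 'rV[R]_d -> R) : continuous f ->
  measurable_fun [set: 'rV[R]_d * 'rV[R]_d] (fun z => ((f z.1 - f z.2) ^+ 2)%:E).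
Proof.
move=> cf; apply/measurable_EFinP; apply: measurable_funX; apply: measurable_funB.
  by apply: measurableT_comp measurable_fst; exact: continuous_measurableV.
by apply: measurableT_comp measurable_snd; exact: continuous_measurableV.
Qed.

Lemma measurable_int_sqr_dist d (f : 'rV[R]_d -> R) (D : set 'rV[R]_d) : measurable D ->
  continuous f -> measurable_fun setT (fun x => \int[leb d]_(y in D) ((f x - f y) ^+ 2)%:E).
Proof.
move=> mD cf.
exact: (@measurable_tonelli1 _ _ _ 'rV[R]_d 'rV[R]_d (@leb R d) setT D measurableT mD
  (fun z => ((f z.1 - f z.2) ^+ 2)%:E) (measurable_funTS (measurable_sqr_dist cf))
  (fun z _ => ltac:(by rewrite lee_fin sqr_ge0))).
Qed.

(** Induction on the dimension: pass from (s, x') to (s, y') by the induction hypothesis, and from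
    (s, y') to (r, y') by a one-dimensional estimate. Double differences, unlike means, split
    coordinate by coordinate. Splitting the square costs a factor 2 per coordinate; the free
    variable of the double integral gives h^d, and the derivative gives h^2. *)
Lemma poincare_cell d (a : 'rV[R]_d) h (f : 'rV[R]_d -> R) : (0 < h)%R -> smooth f ->
  \int[leb d]_(x in cell a h) \int[leb d]_(y in cell a h) ((f x - f y) ^+ 2)%:E <=
  (2 ^+ d * h ^+ d.+2)%:E * \int[leb d]_(x in cell a h) (dot (gradx f x) (gradx f x))%:E.
Proof.
move=> h0; elim: d a f => [|d IH] a f sf.
  rewrite integral0_eq; last first.
    move=> x _; rewrite integral0_eq// => y _.
    by rewrite (_ : x = y) ?subrr ?expr0n//; apply/rowP => -[].
  apply: mule_ge0; first by rewrite lee_fin mulr_ge0 ?exprn_ge0// ltW.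
  by apply: integral_ge0 => x _; rewrite lee_fin dotE dotc_ge0.
set C := cell (tailV a) h; set I := `[a ord0 ord0, (a ord0 ord0 + h)%R[%classic.
have mC : measurable C by exact: measurable_cell.
have mI : measurable I by exact: measurable_itv.
have lC : leb d C = (h ^+ d)%:E by exact: leb_cell.
have cC c : \int[leb d]_(x in C) c = c * (h ^+ d)%:E.
  by rewrite -lC; exact: (integral_cst (leb d) mC c).
have lI : lebesgue_measure I = h%:E.
  by rewrite /I lebesgue_measure_itv/= lte_fin ltrDl h0 -EFinB addrAC subrr add0r.
pose F s x := f (consrV (s, x)).
have sF s : smooth (F s) by exact: smooth_slice_tail.
have cf : continuous f by exact: smooth_cont.
pose p v := (('D_(delta_mx ord0 ord0) f v) ^+ 2)%:E.
pose q v := (\sum_(i < d) ('D_(delta_mx ord0 (lift ord0 i)) f v) ^+ 2)%:E.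
have mp : measurable_fun setT p.
  apply/measurable_EFinP/measurable_funX; apply: continuous_measurableV.
  by apply: smooth_cont; exact: smooth_derive.
have mq : measurable_fun setT q.
  apply/measurable_EFinP; apply: measurable_sum => i; apply: measurable_funX.
  by apply: continuous_measurableV; apply: smooth_cont; exact: smooth_derive.
have p0 v : 0 <= p v by rewrite lee_fin sqr_ge0.
have q0 v : 0 <= q v by rewrite lee_fin sumr_ge0// => i _; rewrite sqr_ge0.
have gE v : (dot (gradx f v) (gradx f v))%:E = p v + q v.
  rewrite -EFinD /dot big_ord_recl !mxE expr2; congr (_ + _)%:E.
  by apply: eq_bigr => i _; rewrite !mxE expr2.
have gF s x : (dot (gradx (F s) x) (gradx (F s) x))%:E = q (consrV (s, x)).
  congr EFin; apply: eq_bigr => i _; rewrite !mxE expr2.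
  by rewrite -derive_slice_tail.
pose K y := \int[lebesgue_measure]_(u in I) p (consrV (u, y)).
have K0 y : 0 <= K y by apply: integral_ge0 => u _.
have mK : measurable_fun setT K by exact: measurable_slice_int2.
pose B := \int[leb d]_(y in C) K y.
have B0 : 0 <= B by apply: integral_ge0.
pose Q := \int[lebesgue_measure]_(s in I) \int[leb d]_(x in C) q (consrV (s, x)).
have Q0 : 0 <= Q by apply: integral_ge0 => s _; apply: integral_ge0.
pose E1 s x := \int[leb d]_(y in C) ((F s x - F s y) ^+ 2)%:E.
have E10 s x : 0 <= E1 s x by apply: integral_ge0 => y _; rewrite lee_fin sqr_ge0.
have mE1 s : measurable_fun setT (E1 s) by apply: measurable_int_sqr_dist => //; exact: smooth_cont.
pose c2 : R := (2 * h)%R.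
have c20 : (0 <= c2)%R by rewrite /c2 mulr_ge0// ltW.
have mdist c : measurable_fun setT (fun v => ((c - f v) ^+ 2)%:E).
  by apply/measurable_EFinP/measurable_funX/measurable_funB => //; exact: continuous_measurableV.
(* The intermediate point is (s, y): the first coordinate of one point with the tail of the
   other. *)
have step1 s x r : I s -> I r ->
    \int[leb d]_(y in C) ((F s x - F r y) ^+ 2)%:E <= 2%:E * E1 s x + c2%:E * B.
  move=> Is Ir.
  have me1 : measurable_fun setT (fun y => ((F s x - F s y) ^+ 2)%:E).
    exact: (measurable_slice_tail (mdist (F s x)) s).
  have -> : 2%:E * E1 s x + c2%:E * B =
      \int[leb d]_(y in C) (2%:E * ((F s x - F s y) ^+ 2)%:E + c2%:E * K y).
    rewrite ge0_integralD//; last 4 first.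
    - by move=> y _; rewrite -EFinM lee_fin mulr_ge0// sqr_ge0.
    - by apply: measurable_funeM; exact: measurable_funTS me1.
    - by move=> y _; rewrite mule_ge0.
    - by apply: measurable_funeM; exact: measurable_funTS mK.
    rewrite ge0_integralZl_EFin//; last 2 first.
    - by move=> y _; rewrite lee_fin sqr_ge0.
    - exact: measurable_funTS me1.
    by rewrite ge0_integralZl_EFin//; exact: measurable_funTS mK.
  apply: ge0_le_integral => //.
  - by move=> y _; rewrite lee_fin sqr_ge0.
  - exact: measurable_funTS (measurable_slice_tail (mdist (F s x)) r).
  - apply: emeasurable_funD; apply: measurable_funeM; first exact: measurable_funTS me1.
    exact: measurable_funTS mK.
  - move=> y _.
    have H : ((F s y - F r y) ^+ 2)%:E <= h%:E * K y.
      rewrite /K; under eq_integral do rewrite /p -derive_slice_head.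
      apply: (@sqr_dist_le R (fun s => F s y) (a ord0 ord0) h s r).
      - exact: smooth_slice_head.
      - by move: Is; rewrite /I/= in_itv.
      - by move: Ir; rewrite /I/= in_itv.
    apply: (@le_trans _ _ (2%:E * ((F s x - F s y) ^+ 2)%:E + 2%:E * ((F s y - F r y) ^+ 2)%:E)).
      rewrite -!EFinM -EFinD lee_fin.
      set u := F s x; set v := F s y; set w := F r y.
      have := sqr_ge0 ((u - v) - (v - w))%R => h1.
      have -> : (2 * (u - v) ^+ 2 + 2 * (v - w) ^+ 2 = (u - w) ^+ 2 + (u - v - (v - w)) ^+ 2)%R by ring.
      by rewrite lerDl.
    apply: leeD => //; rewrite (_ : c2%:E = 2%:E * h%:E)//.
    by rewrite -muleA lee_pmul2l// lte_fin.
have step2 s x : I s ->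
    \int[leb d.+1]_(y in cell a h) ((F s x - f y) ^+ 2)%:E <= c2%:E * E1 s x + (c2 * h)%:E * B.
  move=> Is; rewrite cell_intS//; last by move=> v; rewrite lee_fin sqr_ge0.
  apply: (@le_trans _ _ (\int[lebesgue_measure]_(r in I) (2%:E * E1 s x + c2%:E * B))).
    apply: ge0_le_integral => //.
    - by move=> r _; apply: integral_ge0 => y _; rewrite lee_fin sqr_ge0.
    - apply: measurable_funTS; apply: (measurable_slice_int (g := fun v => ((F s x - f v) ^+ 2)%:E)) => //.
      by move=> v; rewrite lee_fin sqr_ge0.
    - by move=> r Ir; exact: step1.
  rewrite integral_cst_itv lI muleC ge0_muleDr ?mule_ge0//.
  have e1 : (h * 2)%R = c2 by rewrite /c2 mulrC.
  have e2 : (h * c2)%R = (c2 * h)%R by rewrite mulrC.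
  by rewrite !muleA -!EFinM e1 e2.
have step3 s : I s ->
    \int[leb d]_(x in C) \int[leb d.+1]_(y in cell a h) ((F s x - f y) ^+ 2)%:E <=
    (c2 * (2 ^+ d * h ^+ d.+2))%:E * \int[leb d]_(x in C) q (consrV (s, x)) + (c2 * h ^+ d.+1)%:E * B.
  move=> Is.
  apply: (@le_trans _ _ (\int[leb d]_(x in C) (c2%:E * E1 s x + (c2 * h)%:E * B))).
    apply: ge0_le_integral => //.
    - by move=> r _; apply: integral_ge0 => y _; rewrite lee_fin sqr_ge0.
    - have m2 := measurable_int_sqr_dist (measurable_cell a h) cf.
      exact: measurable_funTS (measurable_slice_tail m2 s).
    - apply: emeasurable_funD; last exact: measurable_cst.
      by apply: measurable_funeM; exact: measurable_funTS (mE1 s).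
    - by move=> x _; exact: step2.
  rewrite ge0_integralD//; last 3 first.
  - by move=> x _; rewrite mule_ge0.
  - by apply: measurable_funeM; exact: measurable_funTS (mE1 s).
  - by move=> x _; rewrite mule_ge0// lee_fin mulr_ge0// ltW.
  rewrite cC ge0_integralZl_EFin//; last exact: measurable_funTS (mE1 s).
  apply: leeD; last first.
    by rewrite muleAC -EFinM -mulrA -exprS.
  have -> : (c2 * (2 ^+ d * h ^+ d.+2))%:E = c2%:E * (2 ^+ d * h ^+ d.+2)%:E by rewrite EFinM.
  rewrite -muleA lee_pmul2l//; last by rewrite lte_fin mulr_gt0.
  have := IH (tailV a) (F s) (sF s).
  by under [X in _ <= _ * X -> _]eq_integral do rewrite gF.
rewrite cell_intS//; last 2 first.
- exact: measurable_int_sqr_dist (measurable_cell a h) cf.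
- by move=> v; apply: integral_ge0 => y _; rewrite lee_fin sqr_ge0.
have mqs : measurable_fun setT (fun s => \int[leb d]_(x in C) q (consrV (s, x))).
  exact: measurable_slice_int.
apply: (@le_trans _ _ (\int[lebesgue_measure]_(s in I)
   ((c2 * (2 ^+ d * h ^+ d.+2))%:E * \int[leb d]_(x in C) q (consrV (s, x)) + (c2 * h ^+ d.+1)%:E * B))).
  apply: ge0_le_integral => //.
  - by move=> s _; apply: integral_ge0 => x _; apply: integral_ge0 => y _; rewrite lee_fin sqr_ge0.
  - have m2 := measurable_int_sqr_dist (measurable_cell a h) cf.
    apply: measurable_funTS; apply: (measurable_slice_int m2) => //.
    by move=> v; apply: integral_ge0 => y _; rewrite lee_fin sqr_ge0.
  - apply: emeasurable_funD; last exact: measurable_cst.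
    by apply: measurable_funeM; exact: measurable_funTS.
have k1 : (0 <= c2 * (2 ^+ d * h ^+ d.+2))%R by apply: mulr_ge0 => //; apply: mulr_ge0; apply: exprn_ge0; rewrite ?ltW.
have k2 : (0 <= c2 * h ^+ d.+1)%R by apply: mulr_ge0 => //; apply: exprn_ge0; rewrite ltW.
rewrite ge0_integralD//; last 3 first.
- by move=> s _; rewrite mule_ge0 ?lee_fin//; apply: integral_ge0.
- by apply: measurable_funeM; exact: measurable_funTS.
- by move=> s _; rewrite mule_ge0 ?lee_fin.
rewrite integral_cst_itv lI ge0_integralZl_EFin//; last 2 first.
- by move=> s _; apply: integral_ge0.
- exact: measurable_funTS.
under [X in _ <= _ * X]eq_integral do rewrite gE.
rewrite [X in _ <= _ * X]ge0_integralD//; last 3 first.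
- exact: measurable_cell.
- exact: measurable_funTS.
- exact: measurable_funTS.
rewrite (cell_intS_swap _ _ mp)// (cell_intS _ _ mq)// -/C -/I -/Q -/K -/B.
have -> : (2 ^+ d.+1 * h ^+ d.+3)%:E * (B + Q) =
    (2 ^+ d.+1 * h ^+ d.+3)%:E * Q + (2 ^+ d.+1 * h ^+ d.+3)%:E * B.
  have -> : B + Q = Q + B by exact: addeC.
  exact: ge0_muleDr.
have k3 : (c2 * h ^+ d.+1 * h <= 2 ^+ d.+1 * h ^+ d.+3)%R.
  rewrite /c2 (_ : 2 * h * h ^+ d.+1 * h = 2 * h ^+ d.+3)%R; last by rewrite !exprS; ring.
  rewrite ler_wpM2r ?exprn_ge0 ?(ltW h0)// exprS ler_peMr// exprn_ege1//.
  by rewrite ler1n.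
apply: leeD.
  rewrite lee_wpmul2r// lee_fin /c2.
  by rewrite (_ : 2 * h * (2 ^+ d * h ^+ d.+2) = 2 ^+ d.+1 * h ^+ d.+3)%R// !exprS; ring.
by rewrite muleAC -EFinM lee_wpmul2r// lee_fin.
Qed.

End poincare.

(** * Test functions *)

Section test_functions.
Context {R : realType} (V : normedModType R).
Implicit Types (U : set V) (f : V -> R).

Lemma test_fun_compact_closed (K : set V) : compact K -> closed K.
Proof. by apply: compact_closed; exact: norm_hausdorff. Qed.

Lemma derive_eq0_out (K : set V) f v : closed K -> (forall x, ~ K x -> f x = 0) ->
  forall x, ~ K x -> 'D_v f x = 0.
Proof.
move=> cK f0 x Kx.
have oK : open (~` K) by exact: closed_openC.
rewrite (@near_eq_derive R V R f (cst 0) x v) ?derive_cst//.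
have : nbhs x (~` K) by exact: open_nbhs_nbhs.
by apply: filterS => y Ky; rewrite f0.
Qed.

Lemma test_fun_derive U f v : test_fun U f -> test_fun U ('D_v f).
Proof.
move=> [sf [K [cK KU f0]]]; split; first exact: smooth_derive.
exists K; split => // x Kx; apply: (derive_eq0_out v _ f0) => //.
exact: test_fun_compact_closed.
Qed.

Lemma test_fun_out U f x : test_fun U f -> ~ U x -> f x = 0.
Proof. by move=> [_ [K [_ KU f0]]] Ux; apply: f0 => /KU. Qed.

Lemma test_funD U (a : R) f g : test_fun U f -> test_fun U g ->
  test_fun U (f + a *: g).
Proof.
move=> [sf [K [cK KU f0]]] [sg [L [cL LU g0]]]; split.
  exact: (smoothD sf (smoothZ a sg)).
exists (K `|` L); split; first exact: compactU.
  by move=> x [/KU|/LU].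
move=> x /not_orP[Kx Lx]; rewrite !fctE f0// g0//.
by rewrite scaler0 addr0.
Qed.

Lemma test_funM U f g : test_fun U f -> smooth g -> test_fun U (f \* g).
Proof.
move=> [sf [K [cK KU f0]]] sg; split; first exact: smoothM.
by exists K; split => // x Kx; rewrite /= f0// mul0r.
Qed.

Lemma compact_support_bounded (K : set V) f : compact K -> continuous f ->
  (forall x, ~ K x -> f x = 0) -> exists2 C, 0 <= C & forall x, `|f x| <= C.
Proof.
move=> cK cf f0.
have : compact (f @` K) by apply: continuous_compact => //; exact: continuous_subspaceT.
move=> /compact_bounded[M [_ hM]]; exists (`|M| + 1); first by rewrite addr_ge0.
move=> x; have [Kx|Kx] := pselect (K x).
  apply: (hM (`|M| + 1)); last by exists x.
  by rewrite (le_lt_trans (ler_norm M))// ltrDl.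
by rewrite f0// normr0 addr_ge0.
Qed.

Lemma test_fun_bounded U f : test_fun U f -> exists2 C, 0 <= C & forall x, `|f x| <= C.
Proof.
by move=> [sf [K [cK _ f0]]]; apply: (compact_support_bounded cK) => //; exact: smooth_cont.
Qed.

Lemma derive_lin (f g : V -> R) a x v : derivable f x v -> derivable g x v ->
  'D_v (f + a *: g) x = 'D_v f x + a * 'D_v g x.
Proof.
move=> df dg.
by have [_ ->] := is_deriveD (DeriveDef df erefl) (is_deriveZ a (DeriveDef dg erefl)).
Qed.

End test_functions.

Section EL2_bounded.
Context {R : realType} d (T : measurableType d) (mu : {measure set T -> \bar R}).
Context (D : set T) (mD : measurable D) (W : T -> R).
Hypotheses (mW : measurable_fun D W) (W0 : forall x, D x -> 0 < W x).
Hypothesis fW : (\int[mu]_(x in D) (W x)%:E < +oo)%E.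

Lemma EL2_bounded (f : T -> R) C : measurable_fun D f ->
  (forall x, D x -> `|f x| <= C) -> EL2 mu D coordR W f.
Proof.
move=> mf fC; split; first by case.
have W0' x : D x -> (0 <= (W x)%:E)%E by move=> Dx; rewrite lee_fin ltW// W0.
apply: (@le_lt_trans _ _ ((C ^+ 2)%:E * \int[mu]_(x in D) (W x)%:E)%E); last first.
  by rewrite lte_mul_pinfty// lee_fin sqr_ge0.
rewrite -ge0_integralZl_EFin ?sqr_ge0//; last exact/measurable_EFinP.
apply: ge0_le_integral => //.
- by move=> x Dx; apply: (Wdotc_ge0 coordR W0).
- by apply: measurable_Wdotc => //; case.
- by apply/measurable_EFinP/measurable_funM.
move=> x Dx; rewrite -EFinM lee_fin dotcR mulrC ler_pM2r ?W0//.
rewrite -expr2 -[f x ^+ 2]real_normK ?num_real//.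
by rewrite lerXn2r ?nnegrE// ?fC// (le_trans _ (fC x Dx)).
Qed.

End EL2_bounded.

(** * A grid of cells *)

Section cells.
Context {R : realType} (d : nat) (M : R) (N : nat).
Hypotheses (M0 : 0 < M) (N0 : (0 < N)%N).
Local Open Scope ereal_scope.

(** The grid tiles the half-open cube of half-width M + 1, which contains the closed box [vbox M]
    although the cells are open on one side. *)
Let h : R := (2 * (M + 1) / N%:R)%R.
Let h0 : (0 < h)%R. Proof. by rewrite divr_gt0 ?ltr0n// mulr_gt0// addr_gt0. Qed.

Definition gcell (k : {ffun 'I_d -> 'I_N}) : set 'rV[R]_d :=
  cell (\row_i (- (M + 1) + (k i)%:R * h)%R) h.

Lemma gcell_inj k k' x : gcell k x -> gcell k' x -> k = k'.
Proof.
move=> H H'; apply/ffunP => i; apply/val_inj => /=.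
have := H i; have := H' i; rewrite !mxE => /andP[a1 a2] /andP[b1 b2].
have e1 : (((k i)%:R : R) * h < (k' i).+1%:R * h)%R by rewrite -natr1 mulrDl mul1r; lra.
have e2 : (((k' i)%:R : R) * h < (k i).+1%:R * h)%R by rewrite -natr1 mulrDl mul1r; lra.
move: e1 e2; rewrite !ltr_pM2r// !ltr_nat !ltnS => e1 e2.
by apply/eqP; rewrite eqn_leq e1 e2.
Qed.

Lemma gcell_cover x : vbox M x -> exists k, gcell k x.
Proof.
move=> xM.
have b i : (0 <= (x ord0 i + (M + 1)) / h < N%:R)%R.
  have := xM i; rewrite ler_norml => /andP[x1 x2].
  apply/andP; split; first by rewrite divr_ge0 ?ltW//; lra.
  rewrite ltr_pdivrMr// /h mulrCA divff ?mulr1; last by rewrite pnatr_eq0 -lt0n.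
  by lra.
have tN i : (Num.truncn ((x ord0 i + (M + 1)) / h)%R < N)%N.
  have /andP[b1 b2] := b i.
  by rewrite -(@ltr_nat R) (le_lt_trans _ b2)// truncn_le.
exists [ffun i => Ordinal (tN i)] => i; rewrite !mxE ffunE /=.
have /andP[b1 b2] := b i.
have t1 := truncn_le ((x ord0 i + (M + 1)) / h)%R; rewrite b1 in t1.
have t2 := truncnS_gt ((x ord0 i + (M + 1)) / h)%R.
move: t1 t2; set t := Num.truncn _; rewrite ler_pdivlMr// ltr_pdivrMr// -natr1 mulrDl mul1r.
by move=> t1 t2; apply/andP; split; lra.
Qed.

Context (g : 'rV[R]_d -> \bar R).
Hypotheses (mg : measurable_fun setT g) (g0 : forall x, 0 <= g x).

Let sumE : \sum_k \int[leb d]_(x in gcell k) g x = \int[leb d]_x \sum_k (g \_ (gcell k)) x.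
Proof.
under eq_bigr do rewrite integral_mkcond.
rewrite -ge0_integral_sum//.
  move=> k; apply/(measurable_restrictT _ (measurable_cell _ _)).
  exact: measurable_funTS.
by move=> k x _; apply: erestrict_ge0.
Qed.

Let msum : measurable_fun setT (fun x => \sum_k (g \_ (gcell k)) x).
Proof.
apply: emeasurable_sum => k; apply/(measurable_restrictT _ (measurable_cell _ _)).
exact: measurable_funTS.
Qed.

Let sum_in x k : gcell k x -> \sum_k (g \_ (gcell k)) x = g x.
Proof.
move=> kx; rewrite (bigD1 k)//= patchE mem_set// big1 ?adde0// => j jk.
rewrite patchE memNset// => jx; move/eqP : jk; apply.
exact: gcell_inj jx kx.
Qed.

Lemma gcells_le : \sum_k \int[leb d]_(x in gcell k) g x <= \int[leb d]_x g x.
Proof.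
rewrite sumE; apply: ge0_le_integral => //.
  by move=> x _; apply: sume_ge0 => k _; apply: erestrict_ge0.
move=> x _; have [[k kx]|H] := pselect (exists k, gcell k x); first by rewrite (sum_in kx).
rewrite big1// => k _; rewrite patchE memNset// => kx; apply: H; by exists k.
Qed.

Lemma gcells_ge : (forall x, g x != 0 -> vbox M x) ->
  \int[leb d]_x g x <= \sum_k \int[leb d]_(x in gcell k) g x.
Proof.
move=> gM; rewrite sumE; apply: ge0_le_integral => //.
move=> x _; have [->|gx] := eqVneq (g x) 0.
  by apply: sume_ge0 => k _; apply: erestrict_ge0.
by have [k kx] := gcell_cover (gM x gx); rewrite (sum_in kx).
Qed.

End cells.

Section cell_estimate.
Context {R : realType} (d : nat) (a : 'rV[R]_d) (h : R).
Hypothesis h0 : 0 < h.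
Local Notation C := (cell a h).
Local Notation m f := (\int[leb d]_(x in C) f x).
Local Notation ipC := (ip (leb d) C coordR (cst 1)).
Local Notation E2 := (EL2 (leb d) C coordR (cst 1)).

Let mC : measurable C. Proof. exact: measurable_cell. Qed.
Let m1 : measurable_fun C (cst 1 : _ -> R). Proof. exact: measurable_cst. Qed.
Let p1 : forall x, C x -> 0 < (cst 1 x : R). Proof. by move=> x _; exact: ltr01. Qed.
Let hB := prehilbert_L2 (leb d) mC coordR m1 p1.

Let int1 : (\int[leb d]_(x in C) ((cst 1 x : R))%:E = (h ^+ d)%:E)%E.
Proof.
rewrite -(leb_cell a h0); apply: etrans (mul1e _).
exact: (integral_cst (leb d) mC 1%E).
Qed.

Lemma EL2_cell (f : 'rV[R]_d -> R) K : continuous f -> (forall x, `|f x| <= K) -> E2 f.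
Proof.
move=> cf fK; apply: (EL2_bounded mC m1 p1 _ _ (C := K)) => //.
  by rewrite int1 ltry.
by apply: measurable_funTS; exact: continuous_measurableV.
Qed.

Lemma ip_cell (f g : 'rV[R]_d -> R) : ipC f g = \int[leb d]_(x in C) (f x * g x).
Proof. by apply: eq_Rintegral => x _; rewrite dotcR mul1r. Qed.

(** Expanding the square turns the double integral of (f x - f y)^2 into 2 h^d S - 2 m^2, with S the
    integral of f^2 and m that of f. Its Poincaré bound gives the first part, its mere nonnegativity
    the second. *)
Lemma cell_estimate (f : 'rV[R]_d -> R) K : smooth f -> (forall x, `|f x| <= K) ->
  (\int[leb d]_(x in C) ((f x) ^+ 2)%:E <=
   (h ^- d * (m f) ^+ 2)%:E +
   (2 ^+ d * h ^+ 2)%:E * \int[leb d]_(x in C) (dot (gradx f x) (gradx f x))%:E)%E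
  /\ (m f) ^+ 2 <= h ^+ d * fine (\int[leb d]_(x in C) ((f x) ^+ 2)%:E)%E.
Proof.
move=> sf fK; have cf := smooth_cont sf.
have Ef := EL2_cell cf fK.
have E1 : E2 (cst 1 : _ -> R).
  by apply: (@EL2_cell _ 1); [exact: cst_continuous|move=> x; rewrite normr1].
have i11 : ipC (cst 1 : _ -> R) (cst 1 : _ -> R) = h ^+ d.
  rewrite ip_cell /Rintegral; under eq_integral do rewrite mulr1.
  by rewrite int1.
have if1 : ipC f (cst 1 : _ -> R) = m f.
  by rewrite ip_cell; apply: eq_Rintegral => x _; rewrite mulr1.
pose S := ipC f f.
have SE : (\int[leb d]_(x in C) ((f x) ^+ 2)%:E)%E = S%:E.
  rewrite -(ip_EFin mC m1 p1 Ef) /sqint.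
  by apply: eq_integral => x _; rewrite dotcR mul1r expr2.
have inner x : (\int[leb d]_(y in C) ((f x - f y) ^+ 2)%:E)%E =
    (h ^+ d * f x ^+ 2 - 2 * m f * f x + S)%:E.
  have Ecf : E2 (f x *: (cst 1 : _ -> R)) by exact: (ph_Z hB).
  transitivity (sqint (leb d) C coordR (cst 1) (f x *: (cst 1 : _ -> R) - f)).
    apply: eq_integral => y _; rewrite dotcR !fctE mul1r expr2.
    by rewrite /GRing.scale/= mulr1.
  rewrite (ip_EFin mC m1 p1 (ph_B hB Ecf Ef)); congr EFin.
  rewrite (ph_sqrB hB Ecf Ef) (ph_BZ hB) // (ph_BZ hB) // [ipC (cst 1) (_ *: _)](ph_C hB) (ph_BZ hB)//.
  by rewrite [ipC (cst 1) f](ph_C hB) i11 if1 -/S; ring.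
have outer : (\int[leb d]_(x in C) \int[leb d]_(y in C) ((f x - f y) ^+ 2)%:E)%E =
    (2 * h ^+ d * S - 2 * (m f) ^+ 2)%:E.
  under eq_integral do rewrite inner.
  have i1 := EL2_integrable mC m1 p1 Ef Ef.
  have i2 := EL2_integrable mC m1 p1 Ef E1.
  have i3 := EL2_integrable mC m1 p1 E1 E1.
  transitivity (\int[leb d]_(x in C) (((h ^+ d)%:E * (cst 1 x * dotc coordR (f x) (f x))%:E
     + (- (2 * m f))%:E * (cst 1 x * dotc coordR (f x) (cst 1 x))%:E)
     + S%:E * (cst 1 x * dotc coordR (cst 1 x : R) (cst 1 x))%:E))%E.
    apply: eq_integral => x _; rewrite -!EFinM -!EFinD; congr EFin.
    by rewrite !dotcR /=; ring.
  rewrite integralD//=; last 2 first.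
    by apply: integrableD => //; exact: integrableZl.
    exact: integrableZl.
  rewrite integralD//=; last 2 first.
    exact: integrableZl.
    exact: integrableZl.
  rewrite !integralZl//.
  have e1 : (\int[leb d]_(x in C) (1 * dotc coordR (f x) (f x))%:E)%E = S%:E.
    exact: (ip_EFin mC m1 p1 Ef).
  have e3 : (\int[leb d]_(x in C) (1 * dotc coordR (1 : R) 1)%:E)%E = (h ^+ d)%:E.
    by rewrite -i11; exact: (ip_EFin mC m1 p1 E1).
  have e2 : (\int[leb d]_(x in C) (1 * dotc coordR (f x) 1)%:E)%E = (m f)%:E.
    rewrite -if1 /ip /Rintegral fineK//.
    by apply: integrable_fin_num => //; exact: i2.
  rewrite e1 e2 e3 -!EFinM -!EFinD; congr EFin; ring.
have P := poincare_cell a h0 sf; rewrite outer in P.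
have hd : 0 < h ^+ d by rewrite exprn_gt0.
rewrite SE /=; split; last first.
  have : (0 <= (2 * h ^+ d * S - 2 * (m f) ^+ 2)%:E)%E.
    by rewrite -outer; apply: integral_ge0 => x _; apply: integral_ge0 => y _; rewrite lee_fin sqr_ge0.
  by rewrite lee_fin; set u := h ^+ d * S; rewrite -mulrA -/u; lra.
set G := (\int[leb d]_(x in C) (dot (gradx f x) (gradx f x))%:E)%E in P *.
have G0 : (0 <= G)%E by apply: integral_ge0 => x _; rewrite lee_fin dotE dotc_ge0.
case: (G) G0 P => [r|_ _|//]; last first.
  by rewrite gt0_muley ?lte_fin ?mulr_gt0 ?exprn_gt0// addey// leey.
rewrite lee_fin => r0; rewrite -!EFinM -EFinD !lee_fin => P.
have hd2 : h ^+ d.+2 = h ^+ d * h ^+ 2 by rewrite -exprD addn2.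
have e0 : h ^+ d * (h ^- d * (m f) ^+ 2) = (m f) ^+ 2 by rewrite mulrA mulfV ?gt_eqF// mul1r.
have e1 : h ^+ d * (2 ^+ d * h ^+ 2 * r) = 2 ^+ d * h ^+ d.+2 * r by rewrite hd2; ring.
rewrite -(ler_pM2l hd) mulrDr e0 e1.
have : 0 <= 2 ^+ d * h ^+ d.+2 * r.
  by apply: mulr_ge0 => //; apply: mulr_ge0; apply: exprn_ge0 => //; exact: ltW.
move: P; set u := _ * r; rewrite -mulrA; set v := h ^+ d * S; lra.
Qed.

End cell_estimate.

(** With N cells per side the gradient term is c/N^2; such a mesh keeps it below half of e^2 and
    leaves the other half to the cell means, for which [rellich_tol] fixes the tolerance. *)
Lemma rellich_mesh {R : realFieldType} (c e N : R) : 0 < e -> 1 <= N -> 2 * c / e ^+ 2 <= N ->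
  c / N ^+ 2 <= e ^+ 2 / 2.
Proof.
move=> e0 N1; have N0 : 0 < N by exact: lt_le_trans N1.
rewrite !ler_pdivrMr ?exprn_gt0// => h.
have : N * e ^+ 2 <= N ^+ 2 * e ^+ 2 by rewrite ler_wpM2r ?sqr_ge0// expr2 ler_peMr// ltW.
have -> : e ^+ 2 / 2 * N ^+ 2 = (N ^+ 2 * e ^+ 2) / 2 by ring.
by move: h; set u := N ^+ 2 * _; set v := N * _; lra.
Qed.

Lemma rellich_tol {R : realFieldType} (T e : R) : 0 <= T -> 0 < e ->
  T * (2 * (e / (4 * (T + 1)))) ^+ 2 <= e ^+ 2 / 2.
Proof.
move=> T0 e0; have T1 : T + 1 != 0 by rewrite gt_eqF// ltr_wpDl.
rewrite (_ : T * _ = e ^+ 2 / 4 * (T / (T + 1) ^+ 2)); last by field.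
have t1 : T / (T + 1) ^+ 2 <= 1.
  rewrite ler_pdivrMr ?exprn_gt0 ?ltr_wpDl// mul1r.
  have -> : (T + 1) ^+ 2 = T ^+ 2 + 2 * T + 1 by ring.
  by have := sqr_ge0 T; set u := T ^+ 2; lra.
have e2 : 0 <= e ^+ 2 / 4 by rewrite divr_ge0 ?sqr_ge0.
have := ler_wpM2l e2 t1; have := sqr_ge0 e.
by set u := e ^+ 2; set v := T / _; lra.
Qed.

Section rellich.
Context {R : realType} (d : nat) (Omega : set 'rV[R]_d).
Hypotheses (mO : measurable Omega) (bO : bounded_set Omega).
Local Notation ipO := (ip (leb d) Omega coordR (cst 1)).
Local Notation ipG := (ip (leb d) Omega (coordV d) (cst 1)).

Let m1 : measurable_fun Omega (cst 1 : _ -> R). Proof. exact: measurable_cst. Qed.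
Let p1 : forall x, Omega x -> 0 < (cst 1 x : R). Proof. by move=> x _; exact: ltr01. Qed.

Lemma int1_Omega : (\int[leb d]_(x in Omega) ((cst 1 x : R))%:E < +oo)%E.
Proof.
apply: le_lt_trans (leb_bounded_lty mO bO).
by rewrite -[leRHS]mul1e; rewrite -(integral_cst (leb d) mO 1%E).
Qed.

Lemma test_EL2 f : test_fun Omega f -> EL2 (leb d) Omega coordR (cst 1) f.
Proof.
move=> tf; have [K _ fK] := test_fun_bounded tf.
apply: (EL2_bounded mO m1 p1 int1_Omega (C := K)) => //.
by apply: measurable_funTS; apply: continuous_measurableV; apply: smooth_cont; case: tf.
Qed.

Lemma test_grad_EL2 f : test_fun Omega f -> EL2 (leb d) Omega (coordV d) (cst 1) (gradx f).
Proof.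
move=> tf; apply: (EL2_ofco mO m1 p1) => i.
rewrite (_ : (fun x => _) = 'D_(delta_mx ord0 i) f).
  by apply: test_EL2; exact: test_fun_derive.
by apply/funext => x; rewrite /co /= /coV mxE.
Qed.

Lemma gradx_lin (f g : 'rV[R]_d -> R) (a : R) : smooth f -> smooth g ->
  gradx (f + a *: g) = gradx f + a *: gradx g.
Proof.
move=> sf sg; apply/funext => x; apply/rowP => i; rewrite !mxE derive_lin//; exact: smooth_derivable.
Qed.

Let hO := prehilbert_L2 (leb d) mO coordR m1 p1.
Let hG := prehilbert_L2 (leb d) mO (coordV d) m1 p1.

(** Sum of the cell estimates for a function that is zero outside Omega. On a fine mesh finitely
    many cell means control the L^2 norm up to a small multiple of the gradient, which is the source
    of compactness; with a single cell it leads to Poincaré's inequality. *)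
Lemma friedrichs_cells (M : R) (N : nat) f : 0 < M -> (0 < N)%N -> Omega `<=` vbox M ->
  test_fun Omega f ->
  let h := 2 * (M + 1) / N%:R in
  (nrm ipO f ^+ 2 <= 2 ^+ d * h ^+ 2 * nrm ipG (gradx f) ^+ 2 +
    \sum_(k : {ffun 'I_d -> 'I_N}) h ^- d * (\int[leb d]_(x in gcell M k) f x) ^+ 2) /\
  (forall k : {ffun 'I_d -> 'I_N}, (\int[leb d]_(x in gcell M k) f x) ^+ 2 <= h ^+ d * nrm ipO f ^+ 2).
Proof.
move=> M0 N0 OM tf h.
have h0 : 0 < h by rewrite divr_gt0 ?ltr0n// mulr_gt0// addr_gt0.
have [sf _] := tf; have cf := smooth_cont sf.
have [K _ fK] := test_fun_bounded tf.
have Ef := test_EL2 tf; have Eg := test_grad_EL2 tf.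
have f0 x : ~ Omega x -> f x = 0 by exact: test_fun_out.
have g0 x : ~ Omega x -> dot (gradx f x) (gradx f x) = 0.
  move=> Ox; rewrite /dot big1// => i _; rewrite mxE.
  by rewrite (test_fun_out (test_fun_derive (delta_mx ord0 i) tf) Ox) mul0r.
have mf2 : measurable_fun setT (fun x => ((f x) ^+ 2)%:E).
  by apply/measurable_EFinP/measurable_funX; exact: continuous_measurableV.
have mg2 : measurable_fun setT (fun x => (dot (gradx f x) (gradx f x))%:E).
  by apply/measurable_EFinP; apply: continuous_measurableV; exact: gradx_cont.
have nf : (\int[leb d]_x ((f x) ^+ 2)%:E)%E = (nrm ipO f ^+ 2)%:E.
  rewrite (nrm_sqr hO Ef) -(ip_EFin mO m1 p1 Ef) /sqint [RHS]integral_mkcond.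
  apply: eq_integral => x _; rewrite patchE; case: ifPn => [_|/negP xO].
    by rewrite dotcR mul1r expr2.
  by rewrite f0 ?expr0n// => /mem_set.
have ng : (\int[leb d]_x (dot (gradx f x) (gradx f x))%:E)%E = (nrm ipG (gradx f) ^+ 2)%:E.
  rewrite (nrm_sqr hG Eg) -(ip_EFin mO m1 p1 Eg) /sqint [RHS]integral_mkcond.
  apply: eq_integral => x _; rewrite patchE; case: ifPn => [_|/negP xO].
    by rewrite mul1r.
  by rewrite g0// => /mem_set.
have sq0 x : (0 <= ((f x) ^+ 2)%:E)%E by rewrite lee_fin sqr_ge0.
have gr0 x : (0 <= (dot (gradx f x) (gradx f x))%:E)%E by rewrite lee_fin dotE dotc_ge0.
have CE (k : {ffun 'I_d -> 'I_N}) := cell_estimate (\row_i (- (M + 1) + (k i)%:R * h)) h0 sf fK.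
split; last first.
  move=> k; have [_] := CE k => /le_trans; apply.
  rewrite ler_pM2l ?exprn_gt0//.
  have le1 : (\int[leb d]_(x in gcell M k) ((f x) ^+ 2)%:E <= (nrm ipO f ^+ 2)%:E)%E.
    rewrite -nf; apply: ge0_subset_integral => //; exact: measurable_cell.
  rewrite -[leRHS]/(fine (nrm ipO f ^+ 2)%:E) fine_le//.
  rewrite ge0_fin_numE; first by apply: le_lt_trans le1 _; rewrite ltry.
  by apply: integral_ge0.
have H1 := gcells_ge M0 N0 mf2 sq0.
rewrite -lee_fin -nf.
apply: (le_trans (H1 _)).
  move=> x; have [/OM//|Ox] := pselect (Omega x).
  by rewrite f0// expr0n/= eqxx.
apply: (@le_trans _ _ (\sum_(k : {ffun 'I_d -> 'I_N}) ((h ^- d * (\int[leb d]_(x in gcell M k) f x) ^+ 2)%:E +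
   (2 ^+ d * h ^+ 2)%:E * \int[leb d]_(x in gcell M k) (dot (gradx f x) (gradx f x))%:E))%E).
  by apply: lee_sum => k _; have [] := CE k.
rewrite big_split/= -ge0_sume_distrr; last by move=> k _; apply: integral_ge0.
rewrite sumEFin.
set X := \sum_(k : {ffun 'I_d -> 'I_N}) h ^- d * _.
have -> : (2 ^+ d * h ^+ 2 * nrm ipG (gradx f) ^+ 2 + X)%:E =
   (X%:E + (2 ^+ d * h ^+ 2)%:E * (nrm ipG (gradx f) ^+ 2)%:E)%E by rewrite -EFinM -EFinD addrC.
apply: leeD => //.
rewrite lee_wpmul2l//.
  by rewrite lee_fin; apply: mulr_ge0; apply: exprn_ge0 => //; exact: ltW.
by rewrite -ng; exact: gcells_le.
Qed.

(** An ultrafilter finer than the tails replaces successive extraction of subsequences: along it the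
    cell means converge for all meshes at once. A fine mesh and close means give, for each e, a set
    of the ultrafilter on which the sequence oscillates by at most e. *)
Lemma rellich (f : nat -> 'rV[R]_d -> R) (C1 C2 : R) : (forall n, test_fun Omega (f n)) ->
  (forall n, nrm ipO (f n) <= C1) -> (forall n, nrm ipG (gradx (f n)) <= C2) ->
  exists2 sigma : nat -> nat, (forall k, (k <= sigma k)%N) & ncauchy ipO (f \o sigma).
Proof.
move=> tf fC1 gC2.
have [M M0 OM] := bounded_vbox bO.
have [U [UU subU]] := ultraFilterLemma eventually_filter.
have C10 : 0 <= C1 by rewrite (le_trans _ (fC1 0%N))// nrm_ge0.
have C20 : 0 <= C2 by rewrite (le_trans _ (gC2 0%N))// nrm_ge0.
have claim (e : R) : 0 < e -> exists A, U A /\ forall n m, A n -> A m -> nrm ipO (f n - f m) <= e.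
  move=> e0.
  pose c := 2 ^+ d * (2 * (M + 1)) ^+ 2 * (2 * C2) ^+ 2.
  have c0 : 0 <= c by apply: mulr_ge0; [apply: mulr_ge0; [exact: exprn_ge0|exact: sqr_ge0]|exact: sqr_ge0].
  pose N := (Num.truncn (2 * c / e ^+ 2)).+1.
  have N0 : (0 < N)%N by [].
  have Nr0 : 0 < N%:R :> R by rewrite ltr0n.
  pose h := 2 * (M + 1) / N%:R.
  have h0 : 0 < h by rewrite divr_gt0// mulr_gt0// addr_gt0.
  have cN : 2 ^+ d * h ^+ 2 * (2 * C2) ^+ 2 <= e ^+ 2 / 2.
    have -> : 2 ^+ d * h ^+ 2 * (2 * C2) ^+ 2 = c / N%:R ^+ 2.
      by rewrite /c /h expr_div_n; ring.
    by apply: rellich_mesh => //; [rewrite ler1n|rewrite ltW// truncnS_gt].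
  pose a (k : {ffun 'I_d -> 'I_N}) n := \int[leb d]_(x in gcell M k) f n x.
  have ab k n : a k n \in `[(- (Num.sqrt (h ^+ d) * C1)), Num.sqrt (h ^+ d) * C1].
    have [_ /(_ k)] := friedrichs_cells M0 N0 OM (tf n).
    rewrite -/h -/(a k n) => H; rewrite in_itv/= -ler_norml -sqrtr_sqr.
    rewrite (le_trans (ler_wsqrtr H))// sqrtrM ?exprn_ge0 ?(ltW h0)//.
    by rewrite sqrtr_sqr ger0_norm ?nrm_ge0// ler_wpM2l ?sqrtr_ge0.
  (* The cell means stay in a segment; by compactness they cluster along [U], and for an ultrafilter
     a cluster point is a limit. *)
  have /choice[L hL] (k : {ffun 'I_d -> 'I_N}) : exists l : R, a k n @[n --> U] --> l.
    have := @segment_compact R (- (Num.sqrt (h ^+ d) * C1)) (Num.sqrt (h ^+ d) * C1).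
    move=> /(_ (a k @ U) _)[].
      by apply: (@filterE _ U) => n; exact: ab.
    move=> l [_ cl]; exists l => B Bl.
    have [//|nB] := in_ultra_setVsetC (a k @^-1` B) UU.
    by have [x []] := cl (~` B) B nB Bl.
  pose T := \sum_(k : {ffun 'I_d -> 'I_N}) h ^- d.
  have T0 : 0 <= T by rewrite sumr_ge0// => k _; rewrite invr_ge0 exprn_ge0// ltW.
  pose de := e / (4 * (T + 1)).
  have de0 : 0 < de by rewrite divr_gt0// mulr_gt0// ltr_wpDl.
  exists [set n | forall k, `|L k - a k n| <= de]; split.
    apply: filter_forall => k; have := hL k; move/cvgrPdist_le => /(_ de de0).
    exact.
  move=> n m An Am.
  have tD : test_fun Omega (f n - f m).
    by rewrite -scaleN1r; exact: test_funD.
  have [F _] := friedrichs_cells M0 N0 OM tD.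
  have aD k : \int[leb d]_(x in gcell M k) (f n - f m) x = a k n - a k m.
    pose K := (\row_i (- (M + 1) + (k i)%:R * h)).
    have [Cn _ hCn] := test_fun_bounded (tf n); have [Cm _ hCm] := test_fun_bounded (tf m).
    have En := EL2_cell K h0 (smooth_cont (proj1 (tf n))) hCn.
    have Em := EL2_cell K h0 (smooth_cont (proj1 (tf m))) hCm.
    have E1 : EL2 (leb d) (cell K h) coordR (cst 1) (cst 1 : _ -> R).
      by apply: (@EL2_cell _ _ K h h0 _ 1); [exact: cst_continuous|move=> x; rewrite normr1].
    have hC := prehilbert_L2 (leb d) (measurable_cell K h) coordR
      (measurable_cst (1 : R)) (fun _ _ => ltr01).
    have ip1 (u : 'rV[R]_d -> R) : ip (leb d) (cell K h) coordR (cst 1) u (cst 1 : _ -> R) =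
        \int[leb d]_(x in cell K h) u x.
      by rewrite ip_cell; apply: eq_Rintegral => x _; exact: mulr1.
    by have := ph_BB hC En Em E1; rewrite !ip1.
  rewrite -(@ler_pXn2r _ 2)// ?nnegrE ?nrm_ge0 ?(ltW e0)//.
  apply: (le_trans F).
  have -> : e ^+ 2 = e ^+ 2 / 2 + e ^+ 2 / 2 by field.
  apply: lerD.
    have k0 : 0 <= 2 ^+ d * h ^+ 2.
      by apply: mulr_ge0; apply: exprn_ge0 => //; exact: ltW.
    apply: le_trans cN; apply: (ler_wpM2l k0).
    have c20 : 0 <= 2 * C2 by apply: mulr_ge0.
    rewrite lerXn2r ?nnegrE ?nrm_ge0//.
    rewrite -scaleN1r (gradx_lin _ (proj1 (tf n)) (proj1 (tf m))) scaleN1r.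
    have Eg k := test_grad_EL2 (tf k).
    rewrite (le_trans (nrm_triangle hG (Eg n) (ph_N hG (Eg m))))// (nrmN hG (Eg m)).
    by rewrite mulr_natl mulr2n lerD.
  apply: (@le_trans _ _ (\sum_(k : {ffun 'I_d -> 'I_N}) h ^- d * (2 * de) ^+ 2)).
    apply: ler_sum => k _.
    have k0 : 0 <= h ^- d by rewrite invr_ge0; apply: exprn_ge0; exact: ltW.
    apply: (ler_wpM2l k0); rewrite aD -[leLHS]real_normK ?num_real// lerXn2r ?nnegrE//; first exact: mulr_ge0 (ltW de0).
    rewrite (_ : a k n - a k m = (L k - a k m) - (L k - a k n)); last by ring.
    by rewrite (le_trans (ler_normB _ _))// mulr_natl mulr2n lerD.
  by rewrite -mulr_suml -/T; exact: rellich_tol.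
have /choice[A hA] (k : nat) : exists A, U A /\ forall n m, A n -> A m ->
    nrm ipO (f n - f m) <= k.+1%:R^-1 by apply: claim; rewrite invr_gt0.
(* Finitely many of the sets [A i] and the tail beyond [k] all belong to [U], so they have a common
   point. *)
have /choice[sg hsg] (k : nat) : exists n, (k <= n)%N /\ forall i : 'I_k.+1, A i n.
  have UA : U [set n | (k <= n)%N /\ forall i : 'I_k.+1, A i n].
    apply: filterI; first by apply: subU; exists k.
    by apply: filter_forall => i; case: (hA i).
  by have [n hn] := filter_ex UA; exists n.
exists sg; first by move=> k; case: (hsg k).
move=> e e0; exists (Num.truncn e^-1) => n m hn hm.
set k := Num.truncn e^-1 in hn hm.
have AK j : (k <= j)%N -> A k (sg j).
  move=> kj; have kj' : (k < j.+1)%N by rewrite ltnS.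
  by have [_ /(_ (Ordinal kj'))] := hsg j.
have [_ /(_ _ _ (AK n hn) (AK m hm)) H] := hA k.
apply: (le_trans H); rewrite -[leRHS]invrK lef_pV2 ?posrE ?invr_gt0//.
by rewrite ltW// truncnS_gt.
Qed.

End rellich.

(** * The first Dirichlet eigenvalue *)

Section bumps.
Context {R : realType}.

Definition bump1 (n : nat) (a b : R) (u : R) : R :=
  step (n%:R * (u - a)) * step (n%:R * (b - u)).

Lemma smooth_bump1 n a b : smooth (bump1 n a b).
Proof.
apply: smoothM.
  apply: (@smooth_affine R R R step (fun u => n%:R * (u - a)) (fun u => n%:R * u)).
  - by move=> u; apply: cvgMr; apply: cvgB; [exact: cvg_id|exact: cvg_cst].
  - by move=> h v u; rewrite /GRing.scale/=; ring.
  - exact: smooth_step.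
apply: (@smooth_affine R R R step (fun u => n%:R * (b - u)) (fun u => - (n%:R * u))).
- by move=> u; apply: cvgMr; apply: cvgB; [exact: cvg_cst|exact: cvg_id].
- by move=> h v u; rewrite /GRing.scale/=; ring.
- exact: smooth_step.
Qed.

Lemma bump1_out n a b u : ~ (a < u < b) -> bump1 n a b u = 0.
Proof.
move=> H; rewrite /bump1; have [ua|au] := leP u a.
  by rewrite step_eq0 ?mul0r// mulr_ge0_le0// subr_le0.
have [bu|ub] := leP b u; last by exfalso; apply: H; rewrite au ub.
by rewrite [X in _ * X]step_eq0 ?mulr0// mulr_ge0_le0// subr_le0.
Qed.

Lemma bump1_ge0 n a b u : 0 <= bump1 n a b u.
Proof. by rewrite mulr_ge0 ?step_ge0. Qed.

Lemma bump1_le1 n a b u : bump1 n a b u <= 1.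
Proof. by rewrite mulr_ile1 ?step_ge0 ?step_le1. Qed.

Lemma bump1_gt0 n a b u : (0 < n)%N -> a < u < b -> 0 < bump1 n a b u.
Proof.
move=> n0 /andP[au ub].
by rewrite mulr_gt0// step_gt0// mulr_gt0 ?ltr0n// subr_gt0.
Qed.

Lemma bump1_cvg a b u : bump1 n a b u @[n --> \oo] --> (((a < u < b)%R : bool)%:R : R).
Proof.
have [/andP[au ub]|/negP H] := boolP (a < u < b); last first.
  by under eq_fun do rewrite (bump1_out _ H); exact: cvg_cst.
have ua' : 0 < u - a by rewrite subr_gt0.
have ub' : 0 < b - u by rewrite subr_gt0.
have s1 (c : R) : 0 < c -> \forall n \near \oo, step (n%:R * c) = 1.
  move=> c0; exists (Num.truncn c^-1).+1 => // n /= hn; apply: step_eq1.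
  rewrite -ler_pdivrMr// mul1r ltW// (lt_le_trans (truncnS_gt _))// ler_nat.
  exact: hn.
apply: (cvg_trans (G := (1 : R) @[n --> \oo])); last exact: cvg_cst.
apply: near_eq_cvg; near=> n; rewrite /bump1.
by rewrite (near (s1 _ ua') n)// (near (s1 _ ub') n)// mulr1.
Unshelve. all: by end_near. Qed.

Lemma continuous_coZ d i : continuous (@coZ R d i).
Proof.
move=> z; case: i => [i|]; last exact: cvg_snd.
apply: (@continuous_comp _ _ _ fst (fun x : 'rV[R]_d => x ord0 i)); first exact: cvg_fst.
exact: coord_continuous.
Qed.

Definition bumpZ d (n : nat) (a b : 'rV[R]_d * R) (z : 'rV[R]_d * R) : R :=
  \prod_(i <- index_enum (option 'I_d)) bump1 n (coZ i a) (coZ i b) (coZ i z).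

Lemma smooth_bumpZ d n (a b : 'rV[R]_d * R) : smooth (bumpZ n a b).
Proof.
apply: smooth_prod => i.
apply: (@smooth_affine R ('rV[R]_d * R)%type R (bump1 n (coZ i a) (coZ i b)) (coZ i) (coZ i)).
- exact: continuous_coZ.
- by move=> h v x; rewrite coZ_lin.
- exact: smooth_bump1.
Qed.

Definition obox d (a b : 'rV[R]_d * R) : set ('rV[R]_d * R) :=
  [set z | forall i, coZ i a < coZ i z < coZ i b].
Definition cbox d (a b : 'rV[R]_d * R) : set ('rV[R]_d * R) :=
  [set z | forall i, coZ i a <= coZ i z <= coZ i b].

Lemma bumpZ_out d n (a b : 'rV[R]_d * R) z : ~ obox a b z -> bumpZ n a b z = 0.
Proof.
move=> /existsNP[i hi]; rewrite /bumpZ (bigD1_seq i) ?mem_index_enum ?index_enum_uniq//=.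
by rewrite bump1_out ?mul0r.
Qed.

Lemma bumpZ_ge0 d n (a b : 'rV[R]_d * R) z : 0 <= bumpZ n a b z.
Proof. by apply: prodr_ge0 => i _; exact: bump1_ge0. Qed.

Lemma bumpZ_le1 d n (a b : 'rV[R]_d * R) z : bumpZ n a b z <= 1.
Proof. by apply: prodr_ile1 => i _; rewrite bump1_ge0 bump1_le1. Qed.

Lemma bumpZ_gt0 d n (a b : 'rV[R]_d * R) z : (0 < n)%N -> obox a b z -> 0 < bumpZ n a b z.
Proof. by move=> n0 H; apply: prodr_gt0 => i _; exact: bump1_gt0. Qed.

Lemma bumpZ_cvg d (a b : 'rV[R]_d * R) z :
  bumpZ n a b z @[n --> \oo] --> (\1_(obox a b) z : R).
Proof.
have -> : (\1_(obox a b) z : R) = \prod_(i <- index_enum (option 'I_d)) ((coZ i a < coZ i z < coZ i b)%R : bool)%:R.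
  rewrite indicE; have [H|H] := pselect (obox a b z).
    by rewrite mem_set// big1// => i _; rewrite H.
  rewrite memNset//; move/existsNP : H => [i /negP/negbTE hi].
  by rewrite (bigD1_seq i) ?mem_index_enum ?index_enum_uniq//= hi mul0r.
rewrite /bumpZ; elim: (index_enum _) => [|i r IH].
  by under eq_fun do rewrite big_nil; rewrite big_nil; exact: cvg_cst.
under eq_fun do rewrite big_cons; rewrite big_cons.
by apply: cvgM => //; exact: bump1_cvg.
Qed.

Lemma vec_closed d (a b : 'rV[R]_d) : closed [set x : 'rV[R]_d | forall i, a ord0 i <= x ord0 i <= b ord0 i].
Proof.
rewrite (_ : [set x | _] = \bigcap_(i in [set: 'I_d]) ((fun x : 'rV[R]_d => x ord0 i) @^-1` `[a ord0 i, b ord0 i])); last first.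
  apply/seteqP; split=> [x H i _|x H i]; first by rewrite /= in_itv/=; exact: H.
  by have := H i I; rewrite /= in_itv/=.
apply: closed_bigI => i _; apply: closed_comp; last exact: interval_closed.
by move=> x _; exact: coord_continuous.
Qed.

Lemma vec_compact d (a b : 'rV[R]_d) : compact [set x : 'rV[R]_d | forall i, a ord0 i <= x ord0 i <= b ord0 i].
Proof.
apply: bounded_closed_compact; last exact: vec_closed.
exists (`|a| + `|b|); split; first by rewrite num_real.
move=> y hy x /= Hx; rewrite [leLHS]/Num.norm/= mx_normrE.
apply: bigmax_le; first by rewrite (le_trans _ (ltW hy)).
move=> [i j] _ /=; rewrite (ord1 i) (le_trans _ (ltW hy))//.
have /andP[h1 h2] := Hx j; have := coord_le_norm a j; have := coord_le_norm b j.
rewrite !ler_norml => /andP[b1 b2] /andP[a1 a2].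
apply/andP; split; first by rewrite opprD; apply: le_trans h1; apply: le_trans a1; rewrite gerDl oppr_le0.
by apply: (le_trans h2); apply: (le_trans b2); rewrite lerDr.
Qed.

Lemma cbox_compact d (a b : 'rV[R]_d * R) : compact (cbox a b).
Proof.
rewrite (_ : cbox a b = [set x : 'rV[R]_d | forall i, a.1 ord0 i <= x ord0 i <= b.1 ord0 i] `*` `[a.2, b.2]%classic).
  by apply: compact_setX; [exact: vec_compact|exact: segment_compact].
apply/seteqP; split=> [z H|z [H1 H2] [i|]].
- by split; [move=> i; exact: (H (Some i))|rewrite /= in_itv/=; exact: (H None)].
- exact: H1.
- by move: H2; rewrite /= in_itv.
Qed.

Lemma test_bumpZ d n (a b : 'rV[R]_d * R) U : cbox a b `<=` U -> test_fun U (bumpZ n a b).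
Proof.
move=> abU; split; first exact: smooth_bumpZ.
exists (cbox a b); split => //; first exact: cbox_compact.
move=> z H; apply: bumpZ_out => Hz; apply: H => i.
by have /andP[/ltW -> /ltW ->] := Hz i.
Qed.

Lemma smooth_sliceZ d (f : 'rV[R]_d * R -> R) t : smooth f -> smooth (fun x => f (x, t)).
Proof.
apply: (@smooth_affine R 'rV[R]_d ('rV[R]_d * R)%type f (fun x => (x, t)) (fun x => (x, 0))).
  by move=> x; exact: (cvg_pair cvg_id (@cst_continuous _ _ t x)).
by move=> h v x; congr pair; rewrite /= scaler0 add0r.
Qed.

(** The section t = 0 of a bump in d + 1 variables is a bump in d variables. The cell, of half the
    width, lies strictly inside its box, so the function is positive on a set of positive
    measure. *)
Lemma exists_test d (Omega : set 'rV[R]_d) : open Omega -> Omega !=set0 ->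
  exists f (q : 'rV[R]_d) (r : R), [/\ test_fun Omega f, 0 < r, cell q r `<=` Omega &
    forall x, cell q r x -> 0 < f x].
Proof.
move=> oO [x0 Ox0].
have [e /= e0 he] := (nbhs_ballP x0 Omega).1 (open_nbhs_nbhs (conj oO Ox0)).
pose a : 'rV[R]_d := \row_i (x0 ord0 i - e / 2).
pose b : 'rV[R]_d := \row_i (x0 ord0 i + e / 2).
pose q : 'rV[R]_d := \row_i (x0 ord0 i - e / 4).
have abO (x : 'rV[R]_d) : (forall i, a ord0 i <= x ord0 i <= b ord0 i) -> Omega x.
  move=> H; apply: he; split => // i j; rewrite (ord1 i) /ball/= ltr_norml.
  by have := H j; rewrite !mxE => /andP[h1 h2]; apply/andP; split; lra.
exists (fun x => bumpZ 1 (a, -1) (b, 1) (x, 0)), q, (e / 2).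
have qab (x : 'rV[R]_d) : cell q (e / 2) x -> forall i, a ord0 i < x ord0 i < b ord0 i.
  by move=> H i; have := H i; rewrite !mxE => /andP[h1 h2]; apply/andP; split; lra.
split.
- split; first exact: smooth_sliceZ (smooth_bumpZ _ _ _).
  exists [set x : 'rV[R]_d | forall i, a ord0 i <= x ord0 i <= b ord0 i]; split => //.
    exact: vec_compact.
  move=> x H; apply: bumpZ_out => Hz; apply: H => i.
  by have /andP[/ltW /= -> /ltW /= ->] := Hz (Some i).
- by rewrite divr_gt0.
- by move=> x /qab H; apply: abO => i; have /andP[/ltW -> /ltW ->] := H i.
- move=> x /qab H; apply: bumpZ_gt0 => // -[i|] /=; first exact: H.
  by rewrite ltrN10 ltr01.
Qed.

End bumps.

(** * Existence of the first eigenfunction *)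

Section eigen.
Context {R : realType} (d : nat) (Omega : set 'rV[R]_d).
Hypotheses (d0 : (0 < d)%N) (oO : open Omega) (bO : bounded_set Omega) (nO : Omega !=set0).
Local Notation ipO := (ip (leb d) Omega coordR (cst 1)).
Local Notation ipG := (ip (leb d) Omega (coordV d) (cst 1)).
Local Notation EO := (EL2 (leb d) Omega coordR (cst 1)).
Local Notation EG := (EL2 (leb d) Omega (coordV d) (cst 1)).
Local Notation test := (test_fun Omega).

Let mO : measurable Omega := open_measurableV oO.
Let m1 : measurable_fun Omega (cst 1 : _ -> R). Proof. exact: measurable_cst. Qed.
Let p1 : forall x, Omega x -> 0 < (cst 1 x : R). Proof. by move=> x _; exact: ltr01. Qed.
Let hO := prehilbert_L2 (leb d) mO coordR m1 p1.
Let hG := prehilbert_L2 (leb d) mO (coordV d) m1 p1.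
Let tE := @test_EL2 _ _ _ mO bO.
Let tG := @test_grad_EL2 _ _ _ mO bO.

Lemma mean_cell (M : R) (k : {ffun 'I_d -> 'I_1}) f : 0 < M -> Omega `<=` vbox M -> test f ->
  \int[leb d]_(x in gcell M k) f x = \int[leb d]_(x in Omega) f x.
Proof.
move=> M0 OM tf; rewrite Rintegral_mkcond [RHS]Rintegral_mkcond; apply: eq_Rintegral => x _.
rewrite !patchE; have [xO|xO] := pselect (Omega x).
  rewrite !mem_set//; have [k' kx] := gcell_cover M0 (ltn0Sn 0) (OM _ xO).
  rewrite (_ : k = k')//; apply/ffunP => i; by rewrite !ord1.
by rewrite (test_fun_out tf xO) !if_same.
Qed.

(** Two one-cell grids, of sides h1 and h2 = 2 h1; the choice M' = 2 M + 1 doubles the side. The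
    integral m of f is the same over both cells. The small one gives m^2 <= h1^d |f|^2, so in the
    estimate on the large one the mean term is at most (h1/h2)^d |f|^2 <= |f|^2 / 2 and is
    absorbed. *)
Lemma poincare_test : exists2 C : R, 0 < C & forall f, test f ->
  nrm ipO f ^+ 2 <= C * nrm ipG (gradx f) ^+ 2.
Proof.
have [M M0 OM] := bounded_vbox bO.
pose M' := 2 * M + 1.
have M'0 : 0 < M' by rewrite addr_gt0// mulr_gt0.
have OM' : Omega `<=` vbox M'.
  by move=> x /OM H i; apply: (le_trans (H i)); rewrite /M'; lra.
pose h1 := 2 * (M + 1); pose h2 := 2 * (M' + 1).
have h12 : h2 = 2 * h1 by rewrite /h2 /h1 /M'; ring.
have h10 : 0 < h1 by rewrite mulr_gt0// addr_gt0.
have h20 : 0 < h2 by rewrite mulr_gt0// addr_gt0.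
have c0 : 0 < 2 ^+ d * h2 ^+ 2 by rewrite mulr_gt0// exprn_gt0.
exists (2 * (2 ^+ d * h2 ^+ 2)); first by rewrite mulr_gt0.
move=> f tf.
have [_ /(_ [ffun=> ord0])] := friedrichs_cells mO bO M0 (ltn0Sn 0) OM tf.
rewrite (mean_cell _ M0 OM tf) divr1 -/h1; set m := (\int[_]_(_ in _) _) => H1.
have [+ _] := friedrichs_cells mO bO M'0 (ltn0Sn 0) OM' tf.
under eq_bigr => k _ do rewrite (mean_cell _ M'0 OM' tf) -/m.
rewrite divr1 -/h2 sumr_const card_ffun !card_ord exp1n mulr1n.
set A := nrm ipO f ^+ 2 in H1 *; set B := nrm ipG _ ^+ 2 => H2.
have A0 : 0 <= A by exact: sqr_ge0.
have H3 : h2 ^- d * m ^+ 2 <= 2^-1 * A.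
  apply: (@le_trans _ _ (h2 ^- d * (h1 ^+ d * A))).
    by rewrite ler_pM2l// invr_gt0 exprn_gt0.
  rewrite h12 exprMn invfM mulrA -(mulrA (2 ^- d)) mulVf ?gt_eqF ?exprn_gt0// mulr1.
  rewrite ler_wpM2r// lef_pV2 ?posrE ?exprn_gt0//.
  by rewrite -[leLHS]expr1 ler_weXn2l// ler1n.
move: H2 H3; rewrite -(mulrA 2) ; set X := _ * B; set Y := h2 ^- d * _; lra.
Qed.

Lemma test_nrm_pos : exists2 f, test f & 0 < nrm ipO f.
Proof.
have [f [q [r [tf r0 qO f0]]]] := exists_test oO nO.
exists f => //; rewrite lt_neqAle nrm_ge0 andbT; apply/negP => /eqP nf.
have [N [mN N0 hN]] := nrm0_ae mO m1 p1 (tE tf) (esym nf).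
have : (leb d (cell q r) <= leb d N)%E.
  apply: le_measure; rewrite ?inE//; first exact: measurable_cell.
  move=> x qx; apply: hN => /= /(_ (qO _ qx) tt) fx.
  by have := f0 _ qx; rewrite [X in 0 < X](fx : f x = 0) ltxx.
by rewrite N0 (leb_cell _ r0) lee_fin leNgt exprn_gt0.
Qed.

Lemma test_nrmZ a f : test f -> test (a *: f) /\ gradx (a *: f) = a *: gradx f.
Proof.
move=> tf; have t0 : test (0 : _ -> R).
  split; first exact: (smooth_cst 0).
  by exists set0; split => //; exact: compact0.
have E : a *: f = 0 + a *: f by rewrite add0r.
split; first by rewrite E; exact: test_funD.
rewrite E (gradx_lin a (proj1 t0) (proj1 tf)).
rewrite (_ : gradx _ = 0) ?add0r//; apply/funext => x; apply/rowP => i.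
by rewrite !mxE derive_cst.
Qed.

Definition rayleigh : R := inf [set nrm ipG (gradx f) ^+ 2 | f in [set f | test f /\ nrm ipO f = 1]].

Let ray_has : has_inf [set nrm ipG (gradx f) ^+ 2 | f in [set f | test f /\ nrm ipO f = 1]].
Proof.
split; last by exists 0 => _ [f _ <-]; exact: sqr_ge0.
have [f tf f0] := test_nrm_pos.
have [tg _] := test_nrmZ (nrm ipO f)^-1 tf.
exists (nrm ipG (gradx ((nrm ipO f)^-1 *: f)) ^+ 2); exists ((nrm ipO f)^-1 *: f) => //; split => //.
by rewrite (nrmZ hO _ (tE tf)) ger0_norm ?invr_ge0 ?nrm_ge0// mulVf// gt_eqF.
Qed.

Lemma rayleigh_le f : test f -> rayleigh * ipO f f <= ipG (gradx f) (gradx f).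
Proof.
move=> tf; rewrite -(nrm_sqr hO (tE tf)) -(nrm_sqr hG (tG tf)).
have [f0|f0] := eqVneq (nrm ipO f) 0; first by rewrite f0 expr0n mulr0 sqr_ge0.
have fp : 0 < nrm ipO f by rewrite lt_neqAle eq_sym f0 nrm_ge0.
have [tg gg] := test_nrmZ (nrm ipO f)^-1 tf.
have : rayleigh <= nrm ipG (gradx ((nrm ipO f)^-1 *: f)) ^+ 2.
  apply: ge_inf; first exact: (proj2 ray_has).
  exists ((nrm ipO f)^-1 *: f) => //; split => //.
  by rewrite (nrmZ hO _ (tE tf)) ger0_norm ?invr_ge0 ?nrm_ge0// mulVf.
rewrite gg (nrmZ hG _ (tG tf)) ger0_norm ?invr_ge0 ?nrm_ge0// exprMn exprVn mulrC.
by rewrite ler_pdivlMr// exprn_gt0.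
Qed.

Lemma rayleigh_gt0 : 0 < rayleigh.
Proof.
have [C C0 hC] := poincare_test.
apply: (@lt_le_trans _ _ C^-1); first by rewrite invr_gt0.
apply: lb_le_inf; first exact: (proj1 ray_has).
move=> _ [f [tf f1] <-]; have := hC f tf; rewrite f1 expr1n.
by rewrite -ler_pdivrMl// mulr1.
Qed.

(** Nonnegative by the definition of [rayleigh], and null in the limit along a minimising sequence.
    Cauchy-Schwarz for this semidefinite form then yields the eigenvalue equation. *)
Let q (f g : 'rV[R]_d -> R) := ipG (gradx f) (gradx g) - rayleigh * ipO f g.

Let hq : prehilbert test q.
Proof.
split.
- by move=> x y tx ty; rewrite -[y]scale1r; exact: test_funD.
- by move=> a x tx; case: (test_nrmZ a tx).
- by move=> x y; rewrite /q (ph_C hG) (ph_C hO).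
- move=> x y z tx ty tz; rewrite /q (ph_BD hO (tE tx) (tE ty) (tE tz)).
  have -> : gradx (x + y) = gradx x + gradx y.
    by have := gradx_lin 1 (proj1 tx) (proj1 ty); rewrite !scale1r.
  by rewrite (ph_BD hG (tG tx) (tG ty) (tG tz)) mulrDr opprD addrACA.
- move=> a x z tx tz; rewrite /q (ph_BZ hO a (tE tx) (tE tz)).
  by rewrite (proj2 (test_nrmZ a tx)) (ph_BZ hG a (tG tx) (tG tz)) mulrBr mulrCA.
- by move=> x tx; rewrite /q subr_ge0; exact: rayleigh_le.
Qed.

Lemma minimizing : exists f : nat -> 'rV[R]_d -> R,
  [/\ forall n, test (f n), forall n, nrm ipO (f n) = 1,
     forall n, nrm ipG (gradx (f n)) ^+ 2 <= rayleigh + n.+1%:R^-1 & ncauchy ipO f].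
Proof.
have /choice[f hf] (n : nat) : exists f, [/\ test f, nrm ipO f = 1 &
   nrm ipG (gradx f) ^+ 2 <= rayleigh + n.+1%:R^-1].
  have e0 : 0 < (n.+1%:R^-1 : R) by rewrite invr_gt0.
  have [_ [f [tf f1] <-] hl] := inf_adherent e0 ray_has.
  by exists f; split => //; exact: ltW.
have gb n : nrm ipG (gradx (f n)) <= rayleigh + 2.
  have [tf _ hl] := hf n.
  have r0 := rayleigh_gt0.
  apply: (nrm_le (tG tf)); first lra.
  rewrite -(nrm_sqr hG (tG tf)) (le_trans hl)//.
  have n1 : n.+1%:R^-1 <= 1 :> R by rewrite invf_le1 ?ltr0n// ler1n.
  move: n1; set u := _^-1 => n1.
  have -> : (rayleigh + 2) ^+ 2 = rayleigh ^+ 2 + 4 * rayleigh + 4 by ring.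
  by have := sqr_ge0 rayleigh; set v := _ ^+ 2; lra.
have fb n : nrm ipO (f n) <= 1 by case: (hf n) => _ ->.
have tf n : test (f n) by case: (hf n).
have [sg sgk sgc] := rellich mO bO tf fb gb.
exists (f \o sg); split => //= n; have [h1 h2 h3] := hf (sg n) => //.
(* [sg n >= n], so the rate 1/(n+1) survives the extraction. *)
by rewrite (le_trans h3)// lerD2l lef_pV2 ?posrE// ler_nat ltnS.
Qed.

Lemma normOE f : normO Omega f = Defs.sqrte (sqint (leb d) Omega coordR (cst 1) f).
Proof. by congr Defs.sqrte; apply: eq_integral => x _; rewrite dotcR mul1r expr2. Qed.

Lemma normOvE F : normOv Omega F = Defs.sqrte (sqint (leb d) Omega (coordV d) (cst 1) F).
Proof. by congr Defs.sqrte; apply: eq_integral => x _; rewrite mul1r dotE. Qed.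

(** Rellich's theorem makes the minimising sequence Cauchy in L^2. Its gradients are Cauchy because
    |grad u|^2 = q(u, u) + rayleigh |u|^2 and q(f_n - f_m, f_n - f_m) <= 2 q(f_n, f_n) + 2 q(f_m,
    f_m). *)
Lemma eigen_pair : exists u Gu, [/\ H10 Omega u Gu, EO u, EG Gu, nrm ipO u = 1 &
  forall v, test v -> ipG Gu (gradx v) = rayleigh * ipO u v].
Proof.
have [f [tf f1 gf cf]] := minimizing.
have r0 := rayleigh_gt0.
have Ef n := tE (tf n); have Egf n := tG (tf n).
have qf n : q (f n) (f n) <= n.+1%:R^-1.
  by rewrite /q -(nrm_sqr hO (Ef n)) -(nrm_sqr hG (Egf n)) f1 expr1n mulr1 lerBlDl.
have cg : ncauchy ipG (gradx \o f).
  move=> e e0.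
  (* The tolerance for which rayleigh e'^2 <= e^2 / 2, by [rellich_tol]. *)
  pose e' := 2 * (e / (4 * (rayleigh + 1))).
  have e'0 : 0 < e' by rewrite mulr_gt0// divr_gt0// mulr_gt0// addr_gt0.
  have [N1 hN1] := cf e' e'0.
  pose N2 := Num.truncn (e ^+ 2 / 8)^-1.
  exists (maxn N1 N2) => n m; rewrite !geq_max => /andP[n1 n2] /andP[m1' m2].
  have tD : test (f n - f m) by exact: (ph_B hq).
  have gD : gradx (f n) - gradx (f m) = gradx (f n - f m).
    by have := gradx_lin (-1) (proj1 (tf n)) (proj1 (tf m)); rewrite !scaleN1r.
  have small k : (N2 <= k)%N -> q (f k) (f k) <= e ^+ 2 / 8.
    move=> kk; apply: (le_trans (qf k)); rewrite -[leRHS]invrK lef_pV2 ?posrE ?invr_gt0 ?divr_gt0 ?exprn_gt0//.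
    by rewrite ltW// (lt_le_trans (truncnS_gt _))// ler_nat ltnS.
  have q2 : q (f n - f m) (f n - f m) <= e ^+ 2 / 2.
    have H1 := ph_sqrB hq (tf n) (tf m).
    have H2 := ph_sqrD hq 1 (tf n) (tf m).
    have H3 := ph_ge0 hq (ph_D hq (tf n) (ph_Z hq 1 (tf m))).
    have H4 := small n n2; have H5 := small m m2.
    rewrite H2 in H3; rewrite H1.
    move: H3 H4 H5; move: (q (f n) (f n)) (q (f n) (f m)) (q (f m) (f m)) => x y z.
    by set e2 := e ^+ 2; rewrite expr1n; lra.
  have E : q (f n - f m) (f n - f m) + rayleigh * ipO (f n - f m) (f n - f m) = ipG (gradx (f n - f m)) (gradx (f n - f m)).
    by rewrite /q subrK.
  rewrite /= gD; apply: (nrm_le (tG tD) (ltW e0)); rewrite -E.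
  have H6 : rayleigh * ipO (f n - f m) (f n - f m) <= e ^+ 2 / 2.
    apply: le_trans (rellich_tol (ltW r0) e0).
    apply: ler_wpM2l; first exact: ltW.
    rewrite -(nrm_sqr hO (tE tD)) lerXn2r ?nnegrE ?nrm_ge0 ?(ltW e'0)//.
    exact: hN1.
  rewrite (_ : e ^+ 2 = e ^+ 2 / 2 + e ^+ 2 / 2); first exact: lerD.
  by rewrite -splitr.
have [u Eu fu] := complete_L2R mO m1 p1 Ef cf.
have [Gu EGu fGu] := complete_L2 mO m1 p1 (cs := coordV d) Egf cg.
exists u, Gu; split => //.
- split.
  + by have [/(_ tt)] := Eu.
  + apply: (measurable_fun_rVP Gu mO).2 => i; by have [/(_ i)] := EGu.
  + exists f; split => //.
      under eq_fun do rewrite normOE.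
      exact: (ncvg_L2dist mO m1 p1 Ef Eu fu).
    under eq_fun do rewrite normOvE.
    exact: (ncvg_L2dist mO m1 p1 Egf EGu fGu).
- have := ncvg_nrm hO Ef Eu fu; under eq_fun do rewrite f1.
  by move/(cvg_lim (@Rhausdorff R)) => <-; rewrite lim_cst//; exact: Rhausdorff.
- move=> v tv; apply/eqP; rewrite -subr_eq0; apply/eqP.
  have c1 := ncvg_B hG Egf EGu (tG tv) fGu.
  have c2 := ncvg_B hO Ef Eu (tE tv) fu.
  have c3 : q (f n) v @[n --> \oo] --> ipG Gu (gradx v) - rayleigh * ipO u v.
    by apply: cvgB; [exact: c1|apply: cvgMr; exact: c2].
  (* The limit is also 0, since q(f_n, v)^2 <= q(f_n, f_n) q(v, v) <= q(v, v) / (n+1). *)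
  apply: (cvg_unique (@Rhausdorff R) c3).
  apply/cvgr0Pnorm_le => e e0.
  have Q0 := ph_ge0 hq tv.
  pose N := Num.truncn ((q v v + 1) / e ^+ 2).
  exists N => // n /= Nn.
  rewrite -(@ler_pXn2r _ 2)// ?nnegrE ?(ltW e0)// real_normK ?num_real//.
  apply: (le_trans (ph_CS2 hq (tf n) tv)).
  have : (q v v + 1) / e ^+ 2 <= n.+1%:R.
    by rewrite ltW// (lt_le_trans (truncnS_gt _))// ler_nat ltnS.
  rewrite ler_pdivrMr ?exprn_gt0// => H.
  apply: (@le_trans _ _ (n.+1%:R^-1 * q v v)); first exact: ler_wpM2r.
  by rewrite ler_pdivrMl// (le_trans _ H)// lerDl.
Qed.

Lemma H10_EL2 v Gv : H10 Omega v Gv -> [/\ EO v, EG Gv & exists phi, [/\ forall n, test (phi n),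
  ncvg ipO phi v & ncvg ipG (gradx \o phi) Gv]].
Proof.
move=> [mv mGv [phi [tphi c1 c2]]].
have Ep n := tE (tphi n); have Eg n := tG (tphi n).
have [Ev cv] : EO v /\ ncvg ipO phi v.
  apply: (L2dist_ncvg mO m1 p1 Ep); first by case.
  by move: c1; under eq_fun do rewrite normOE.
have [Egv cgv] : EG Gv /\ ncvg ipG (gradx \o phi) Gv.
  apply: (L2dist_ncvg mO m1 p1 Eg); first exact: (measurable_fun_rVP Gv mO).1.
  by move: c2; under eq_fun do rewrite normOvE.
by split => //; exists phi.
Qed.

Lemma ipO_int f g : ipO f g = \int[leb d]_(x in Omega) (f x * g x).
Proof. by apply: eq_Rintegral => x _; rewrite dotcR mul1r. Qed.

Lemma ipG_int F G : ipG F G = \int[leb d]_(x in Omega) dot (F x) (G x).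
Proof. by apply: eq_Rintegral => x _; rewrite mul1r dotE. Qed.

(** Tested with its own eigenfunction, each eigenvalue is the Rayleigh quotient of a limit of test
    functions, hence at least [rayleigh]. Conversely the equation of [eigen_pair], extended from
    test functions by density, makes [rayleigh] an eigenvalue. *)
Lemma lambda1E : lambda1 Omega = rayleigh.
Proof.
have [u [Gu [Hu Eu EGu u1 uv]]] := eigen_pair.
have lb : lbound [set l | dirichlet_eigenvalue Omega l] rayleigh.
  move=> l [v [Gv [Hv v0 hv]]]; have [Ev EGv [phi [tp c1 c2]]] := H10_EL2 Hv.
  have := hv _ _ Hv; rewrite -ipO_int -ipG_int => e.
  have le : rayleigh * ipO v v <= l * ipO v v.
    rewrite -e.
    have h1 := ncvg_BB hO (fun n => tE (tp n)) Ev c1.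
    have h2 := ncvg_BB hG (fun n => tG (tp n)) EGv c2.
    have h3 : rayleigh * ipO (phi n) (phi n) @[n --> \oo] --> rayleigh * ipO v v.
      by apply: cvgMr; exact: h1.
    apply: (ler_cvg_to h3 h2); apply: nearW => n; exact: rayleigh_le.
  move: le; rewrite ler_pM2r// lt_neqAle (ph_ge0 hO Ev) andbT.
  apply/negP => /eqP n0; move/eqP : v0; apply.
  by rewrite normOE (sqrte_sqint mO m1 p1 Ev) /nrm -n0 sqrtr0.
suff ev : dirichlet_eigenvalue Omega rayleigh.
  apply/eqP; rewrite eq_le; apply/andP; split.
    by apply: ge_inf; first by exists rayleigh.
  by apply: lb_le_inf => //; exists rayleigh.
exists u, Gu; split => //.
  by rewrite normOE (sqrte_sqint mO m1 p1 Eu) u1 eqe oner_neq0.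
move=> v Gv Hv; have [Ev EGv [phi [tp c1 c2]]] := H10_EL2 Hv.
rewrite -ipO_int -ipG_int.
have h1 := ncvg_B hO (fun n => tE (tp n)) Ev Eu c1.
have h2 := ncvg_B hG (fun n => tG (tp n)) EGv EGu c2.
rewrite (ph_C hG) (ph_C hO).
apply: (cvg_unique (@Rhausdorff R) h2).
have h3 : rayleigh * ipO (phi n) u @[n --> \oo] --> rayleigh * ipO v u by apply: cvgMr; exact: h1.
apply: cvg_trans h3; apply: near_eq_cvg; apply: nearW => n.
by rewrite /= (ph_C hO) -uv// (ph_C hG).
Qed.

Lemma lambda1_gt0 : 0 < lambda1 Omega.
Proof. by rewrite lambda1E rayleigh_gt0. Qed.

Lemma friedrichs_test f : test f -> lambda1 Omega * ipO f f <= ipG (gradx f) (gradx f).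
Proof. by rewrite lambda1E; exact: rayleigh_le. Qed.

End eigen.

(** * Friedrichs' inequality *)

(** Iterated derivatives at a point depend only on nearby values. This serves to extend functions by
    zero. *)
Lemma smooth_local {R : realType} (V : normedModType R) (f : V -> R) :
  (forall x : V, exists2 g, smooth g & \forall y \near x, f y = g y) -> smooth f.
Proof.
move=> H vs.
have E (x : V) g : (\forall y \near x, f y = g y) ->
    \forall y \near x, iter_derive f vs y = iter_derive g vs y.
  elim: vs => [//|v vs IH] /= /IH /nbhs_interior.
  by apply: filterS => y hy; exact: near_eq_derive.
split=> [x|v x]; have [g sg /E fg] := H x.
  rewrite /continuous_at (nbhs_singleton fg).
  apply: cvg_trans ((sg vs).1 x); apply: near_eq_cvg.
  by apply: filterS fg => y ->.
apply: near_eq_derivable ((sg vs).2 v x).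
by apply: filterS fg => y ->.
Qed.

(** * Truncation of small values *)

Section truncation.
Context {R : realType}.

(* Vanishes near 0, so that truncating a function which is zero on the boundary
   makes it compactly supported. *)
Definition trunc_fun (y : R) : R := y * (step (y - 1) + step (- y - 1)).

Lemma smooth_trunc : smooth trunc_fun.
Proof.
apply: smoothM; first exact: smooth_id.
apply: smoothD.
  apply: (@smooth_affine R R R step (fun u => u - 1) (fun u => u)).
  - by move=> u; apply: cvgB; [exact: cvg_id|exact: cvg_cst].
  - by move=> h v u; rewrite addrA.
  - exact: smooth_step.
apply: (@smooth_affine R R R step (fun u => - u - 1) (fun u => - u)).
- by move=> u; apply: cvgB; [apply: cvgN; exact: cvg_id|exact: cvg_cst].
- by move=> h v u; rewrite /GRing.scale/=; ring.
- exact: smooth_step.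
Qed.

Lemma trunc_eq0 y : `|y| <= 1 -> trunc_fun y = 0.
Proof.
rewrite ler_norml => /andP[h1 h2].
by rewrite /trunc_fun !step_eq0 ?addr0 ?mulr0//; lra.
Qed.

Lemma trunc_id y : 2 <= `|y| -> trunc_fun y = y.
Proof.
rewrite /trunc_fun; have [y0|y0] := leP 0 y.
  rewrite (ger0_norm y0) => h.
  by rewrite step_eq1 ?step_eq0 ?addr0 ?mulr1//; lra.
rewrite (ltr0_norm y0) => h.
by rewrite step_eq0 ?step_eq1 ?add0r ?mulr1//; lra.
Qed.

Lemma trunc_le y : `|trunc_fun y| <= 2 * `|y|.
Proof.
rewrite normrM mulrC ler_wpM2r// ger0_norm ?addr_ge0 ?step_ge0//.
by have := step_le1 (y - 1); have := step_le1 (- y - 1); lra.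
Qed.

Lemma trunc_derive_id y : 2 < `|y| -> derive1 trunc_fun y = 1.
Proof.
move=> hy; rewrite derive1E (@near_eq_derive R R R trunc_fun id y 1); first by rewrite derive_id.
have : \forall z \near y, 2 < `|z|.
  apply: open_nbhs_nbhs; split => //.
  have : open ((fun z : R => `|z|) @^-1` [set t | 2 < t]); last exact.
  by apply: open_comp; [move=> z _; exact: norm_continuous|exact: open_gt].
by apply: filterS => z hz; rewrite trunc_id// ltW.
Qed.

Lemma trunc_derive0 : derive1 trunc_fun 0 = 0.
Proof.
rewrite derive1E (@near_eq_derive R R R trunc_fun (cst 0) 0 1) ?derive_cst//.
have : \forall z \near (0 : R), `|z| < 1.
  apply: open_nbhs_nbhs; split; last by rewrite normr0.
  have : open ((fun z : R => `|z|) @^-1` [set t | t < 1]); last exact.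
  by apply: open_comp; [move=> z _; exact: norm_continuous|exact: open_lt].
by apply: filterS => z hz; rewrite trunc_eq0// ltW.
Qed.

Lemma trunc_derive_bound : exists2 C : R, 0 <= C & forall y, `|derive1 trunc_fun y| <= C.
Proof.
have cT : continuous (derive1 trunc_fun).
  rewrite (_ : derive1 trunc_fun = 'D_1 trunc_fun); last by apply/funext => y; rewrite derive1E.
  by apply: smooth_cont; apply: smooth_derive; exact: smooth_trunc.
have : compact (derive1 trunc_fun @` `[-2, 2]).
  by apply: continuous_compact; [exact: continuous_subspaceT|exact: segment_compact].
move=> /compact_bounded[M [_ hM]]; exists (`|M| + 1); first by rewrite addr_ge0.
move=> y; have [h|h] := leP `|y| 2.
  apply: (hM (`|M| + 1)); first by rewrite (le_lt_trans (ler_norm M))// ltrDl.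
  by exists y => //; rewrite /= in_itv/= -ler_norml.
by rewrite trunc_derive_id// normr1 lerDr.
Qed.

End truncation.

Section friedrichs.
Context {R : realType} (d : nat) (Omega : set 'rV[R]_d).
Hypotheses (d0 : (0 < d)%N) (oO : open Omega) (bO : bounded_set Omega) (nO : Omega !=set0).
Local Notation EO := (EL2 (leb d) Omega coordR (cst 1)).
Local Notation EG := (EL2 (leb d) Omega (coordV d) (cst 1)).

Let mO : measurable Omega := open_measurableV oO.
Let m1 : measurable_fun Omega (cst 1 : _ -> R). Proof. exact: measurable_cst. Qed.
Let p1 : forall x, Omega x -> 0 < (cst 1 x : R). Proof. by move=> x _; exact: ltr01. Qed.

Lemma Omega_in_compact : exists2 K, compact K & Omega `<=` K.
Proof.
have [M M0 OM] := bounded_vbox bO.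
exists [set x : 'rV[R]_d | forall i, (\row__ - M) ord0 i <= x ord0 i <= (\row__ M) ord0 i].
  exact: vec_compact.
by move=> x /OM H i /=; rewrite !mxE -ler_norml.
Qed.

Lemma continuous_bounded_Omega (f : 'rV[R]_d -> R) : continuous f ->
  exists C, forall x, Omega x -> `|f x| <= C.
Proof.
move=> cf; have [K cK OK] := Omega_in_compact.
have : compact (f @` K) by apply: continuous_compact => //; exact: continuous_subspaceT.
move=> /compact_bounded[M [_ hM]]; exists (`|M| + 1) => x Ox.
apply: (hM (`|M| + 1)); first by rewrite (le_lt_trans (ler_norm M))// ltrDl.
by exists x => //; exact: OK.
Qed.

Lemma smooth_EL2 f : smooth f -> EO f /\ EG (gradx f).
Proof.
have H (h : 'rV[R]_d -> R) : smooth h -> EO h.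
  move=> /smooth_cont ch; have [C hC] := continuous_bounded_Omega ch.
  apply: (EL2_bounded mO m1 p1 (int1_Omega mO bO) _ hC).
  by apply: measurable_funTS; exact: continuous_measurableV.
move=> sf; split; first exact: H.
apply: (EL2_ofco mO m1 p1) => i.
rewrite (_ : (fun x => _) = 'D_(delta_mx ord0 i) f).
  by apply: H; exact: smooth_derive.
by apply/funext => x; rewrite /co /= /coV mxE.
Qed.

Section cut.
Context (f : 'rV[R]_d -> R) (n : nat).
Hypotheses (sf : smooth f) (f0 : forall x, boundary Omega x -> f x = 0).

Let N : R := n.+1%:R.
Let N0 : 0 < N. Proof. by rewrite ltr0n. Qed.

Definition cut_smooth x := N^-1 * trunc_fun (N * f x).
Definition cut x := if `[< Omega x >] then cut_smooth x else 0.

Let sNf : smooth (fun x => N * f x). Proof. exact: smoothZ. Qed.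
Lemma smooth_cut_smooth : smooth cut_smooth.
Proof. by apply: smoothZ; apply: (smooth_comp smooth_trunc). Qed.

Lemma derive_cut_smooth v x : 'D_v cut_smooth x = derive1 trunc_fun (N * f x) * 'D_v f x.
Proof.
have dc : derivable (trunc_fun \o (fun x => N * f x)) x v.
  by apply: smooth_derivable; exact: smooth_comp smooth_trunc sNf.
have -> : cut_smooth = N^-1 *: (trunc_fun \o (fun x => N * f x)) by [].
rewrite deriveZ//.
have H := is_derive_comp_line (smooth_derivable (x := x) (v := v) sNf) (smooth_derivable (x := N * f x) (v := 1) smooth_trunc).
rewrite (derive_val (is_derive := H)).
have -> : (fun x => N * f x) = N *: f by [].
rewrite deriveZ; last exact: smooth_derivable.
by rewrite /GRing.scale/= [LHS]mulrCA mulKf ?gt_eqF.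
Qed.

Let K := closure Omega `&` [set x | 1 <= `|N * f x|].

Let cK : closed K.
Proof.
apply: closedI; first exact: closed_closure.
have : closed ((fun x => `|N * f x|) @^-1` [set y : R | 1 <= y]).
  apply: closed_comp; last exact: closed_ge.
  move=> x _; apply: (@continuous_comp _ _ _ (fun x => N * f x) (fun y : R => `|y|)).
    by move: x; exact: smooth_cont.
  exact: norm_continuous.
exact.
Qed.

Let KO : K `<=` Omega.
Proof.
move=> x [cx hx]; apply: contrapT => Ox.
have := f0 (x := x); rewrite /boundary => fx.
have : f x = 0.
  apply: fx; split => //; by move/interior_subset.
by move=> e; move: hx; rewrite /= e mulr0 normr0 ler10.
Qed.

Let cut0 x : ~ K x -> cut x = 0.
Proof.
rewrite /cut; case: asboolP => // Ox Kx; rewrite /cut_smooth trunc_eq0 ?mulr0//.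
rewrite leNgt; apply/negP => /ltW h; apply: Kx; split => //.
exact: subset_closure.
Qed.

Let near_cut x : Omega x -> \forall y \near x, cut y = cut_smooth y.
Proof.
move=> Ox; have : nbhs x Omega by exact: open_nbhs_nbhs.
by apply: filterS => y Oy; rewrite /cut asboolT.
Qed.

(** The cut vanishes where |N f| <= 1, so it is supported in the closed set [K], which avoids the
    boundary because f = 0 there. Near points outside Omega the extension is therefore identically
    zero. *)
Lemma test_cut : test_fun Omega cut.
Proof.
split.
  apply: smooth_local => x; have [Ox|Ox] := pselect (Omega x).
    by exists cut_smooth; [exact: smooth_cut_smooth|exact: near_cut].
  exists (cst 0); first exact: smooth_cst.
  have : nbhs x (~` K) by apply: open_nbhs_nbhs; split; [exact: closed_openC|move/KO].
  by apply: filterS => y /cut0.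
exists K; split => //.
have [C cC OC] := Omega_in_compact.
apply: (subclosed_compact cK cC) => x [cx _].
have clC : closed C by exact: test_fun_compact_closed.
by apply: clC; move: x cx; exact: closure_subset.
Qed.

Lemma gradx_cut x : Omega x -> gradx cut x = derive1 trunc_fun (N * f x) *: gradx f x.
Proof.
move=> Ox; apply/rowP => i; rewrite !mxE -derive_cut_smooth.
by apply: near_eq_derive; exact: near_cut.
Qed.

Lemma friedrichs_cut : ((lambda1 Omega)%:E * \int[leb d]_(x in Omega) ((cut_smooth x) ^+ 2)%:E <=
  \int[leb d]_(x in Omega) ((derive1 trunc_fun (N * f x)) ^+ 2 * dot (gradx f x) (gradx f x))%:E)%E.
Proof.
have tc := test_cut.
have := friedrichs_test d0 oO bO nO tc.
rewrite -lee_fin EFinM -(ip_EFin mO m1 p1 (test_EL2 mO bO tc)) -(ip_EFin mO m1 p1 (test_grad_EL2 mO bO tc)).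
have -> : sqint (leb d) Omega coordR (cst 1) cut = (\int[leb d]_(x in Omega) ((cut_smooth x) ^+ 2)%:E)%E.
  by apply: eq_integral => x /set_mem Ox; rewrite dotcR mul1r /cut asboolT.
have -> // : sqint (leb d) Omega (coordV d) (cst 1) (gradx cut) =
  (\int[leb d]_(x in Omega) ((derive1 trunc_fun (N * f x)) ^+ 2 * dot (gradx f x) (gradx f x))%:E)%E.
apply: eq_integral => x /set_mem Ox.
by rewrite mul1r (gradx_cut Ox) dotcZl dotcC dotcZl mulrA -expr2 dotE.
Qed.

End cut.

(** The cuts converge to f. The derivatives of the truncation converge to 1 where f is nonzero and
    to 0 where f = 0, so the energies converge to the gradient integral over the set of nonzero
    values, which is at most the full one. *)
Theorem friedrichs f : smooth f -> (forall x, boundary Omega x -> f x = 0) ->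
  ((lambda1 Omega)%:E * \int[leb d]_(x in Omega) ((f x) ^+ 2)%:E <=
  \int[leb d]_(x in Omega) (dot (gradx f x) (gradx f x))%:E)%E.
Proof.
move=> sf f0; have [Ef Eg] := smooth_EL2 sf.
have l0 := lambda1_gt0 d0 oO bO nO.
have cf := smooth_cont sf.
have mf : measurable_fun setT f by exact: continuous_measurableV.
have mT : measurable_fun setT (@trunc_fun R).
  by apply: continuous_measurable_fun; exact: smooth_cont smooth_trunc.
have cT' : continuous (derive1 (@trunc_fun R)).
  rewrite (_ : derive1 trunc_fun = 'D_1 trunc_fun); last by apply/funext => y; rewrite derive1E.
  by apply: smooth_cont; apply: smooth_derive; exact: smooth_trunc.
have mg : measurable_fun setT (fun x => dot (gradx f x) (gradx f x)).
  by apply: continuous_measurableV; exact: gradx_cont.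
have [C C0 hC] := @trunc_derive_bound R.
have big (y : R) : y != 0 -> \forall n \near \oo, 2 < `|n.+1%:R * y|.
  move=> y0; exists (Num.truncn (2 / `|y|)).+1 => // n /= hn.
  rewrite normrM normr_nat -ltr_pdivrMr ?normr_gt0// (lt_le_trans (truncnS_gt _))//.
  by rewrite ler_nat (leq_trans hn).
have c1 : (\int[leb d]_(x in Omega) ((cut_smooth f n x) ^+ 2)%:E @[n --> \oo] -->
    \int[leb d]_(x in Omega) ((f x) ^+ 2)%:E)%E.
  apply: (@dominated_cvg _ _ _ _ _ mO _ _ (fun x => (4 * f x ^+ 2)%:E)) => //.
  - move=> n; apply/measurable_EFinP/measurable_funX/measurable_funM => //.
    apply: measurable_funTS; apply: (measurableT_comp mT).
    exact: measurable_funM.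
  - move=> x Ox; apply: cvg_EFin; first by apply: nearW.
    have [y0|y0] := eqVneq (f x) 0.
      rewrite (_ : _ \o _ = cst ((f x) ^+ 2)); first exact: cvg_cst.
      apply/funext => n /=; rewrite /cut_smooth y0 mulr0 trunc_eq0 ?normr0// mulr0//.
    apply: (@cvg_trans _ ((f x ^+ 2) @[n --> \oo])); last exact: cvg_cst.
    apply: near_eq_cvg; apply: filterS (big _ y0) => n h /=.
    by rewrite /cut_smooth trunc_id ?(ltW h)// mulKf// pnatr_eq0.
  - have i1 := EL2_integrable mO m1 p1 Ef Ef.
    have := integrableZl mO 4 i1; apply: eq_integrable => // x _ /=.
    by rewrite dotcR mul1r expr2 EFinM.
  - move=> n x Ox; rewrite lee_fin ger0_norm ?sqr_ge0// -[leLHS]real_normK ?num_real//.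
    have -> : 4 * f x ^+ 2 = (2 * `|f x|) ^+ 2 by rewrite exprMn real_normK ?num_real//; ring.
    rewrite lerXn2r ?nnegrE ?mulr_ge0// /cut_smooth normrM normfV normr_nat.
    rewrite ler_pdivrMl ?ltr0n// (le_trans (trunc_le _))// normrM normr_nat.
    by rewrite mulrCA.
have c2 : (\int[leb d]_(x in Omega) ((derive1 trunc_fun (n.+1%:R * f x)) ^+ 2 * dot (gradx f x) (gradx f x))%:E @[n --> \oo] -->
    \int[leb d]_(x in Omega) ((f x != 0)%:R * dot (gradx f x) (gradx f x))%:E)%E.
  apply: (@dominated_cvg _ _ _ _ _ mO _ _ (fun x => (C ^+ 2 * dot (gradx f x) (gradx f x))%:E)) => //.
  - move=> n; apply/measurable_EFinP/measurable_funM; last exact: measurable_funTS.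
    apply: measurable_funX; apply: measurable_funTS; apply: measurableT_comp.
      exact: continuous_measurable_fun.
    exact: measurable_funM.
  - move=> x Ox; apply: cvg_EFin; first by apply: nearW.
    apply: cvgMl.
    have [y0|y0] := eqVneq (f x) 0.
      rewrite (_ : (fun n => _) = cst 0); first exact: cvg_cst.
      by apply/funext => n /=; rewrite y0 mulr0 trunc_derive0 expr0n.
    apply: (@cvg_trans _ ((1 : R) @[n --> \oo])); last exact: cvg_cst.
    apply: near_eq_cvg; apply: filterS (big _ y0) => n h /=.
    by rewrite trunc_derive_id// expr1n.
  - have i1 := EL2_integrable mO m1 p1 Eg Eg.
    have := integrableZl mO (C ^+ 2) i1; apply: eq_integrable => // x _ /=.
    by rewrite mul1r EFinM dotE.
  - move=> n x Ox; rewrite lee_fin ger0_norm; last by apply: mulr_ge0; [exact: sqr_ge0|rewrite dotE dotc_ge0].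
    rewrite dotE; apply: ler_wpM2r; first exact: dotc_ge0.
    by rewrite -[leLHS]real_normK ?num_real// lerXn2r ?nnegrE.
apply: (@le_trans _ _ (\int[leb d]_(x in Omega) ((f x != 0)%:R * dot (gradx f x) (gradx f x))%:E)%E).
  have c3 : ((lambda1 Omega)%:E * \int[leb d]_(x in Omega) ((cut_smooth f n x) ^+ 2)%:E @[n --> \oo] -->
    (lambda1 Omega)%:E * \int[leb d]_(x in Omega) ((f x) ^+ 2)%:E)%E by exact: cvgeZl.
  rewrite -(cvg_lim _ c3)// -(cvg_lim _ c2)//; apply: lee_lim.
  - by apply/cvg_ex; eexists; exact: c3.
  - by apply/cvg_ex; eexists; exact: c2.
  - by apply: nearW => n; exact: friedrichs_cut.
apply: ge0_le_integral => //.
- by move=> x _; rewrite lee_fin mulr_ge0// dotE dotc_ge0.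
- apply/measurable_EFinP/measurable_funM; last exact: measurable_funTS.
  apply: measurable_funTS.
  rewrite (_ : (fun x => _) = (fun x => if f x == 0 then 0 else 1)); last first.
    by apply/funext => x; case: eqP.
  by apply: measurable_fun_ifT => //; apply: measurable_fun_eqr.
- by apply/measurable_EFinP; exact: measurable_funTS.
- move=> x _; rewrite lee_fin ler_piMl ?dotE ?dotc_ge0//.
  by case: (f x != 0).
Qed.

End friedrichs.

(** * The one-dimensional trace inequality *)

Section pos_line.
Context {R : realType}.
Implicit Types (a c t r : R).

Lemma powR_continuous (p x : R) : 0 < x -> {for x, continuous (fun t : R => t `^ p)}.
Proof.
move=> x0; apply/differentiable_continuous/derivable1_diffP.
by apply: derivable_powR; rewrite in_itv/= andbT.
Qed.

(** Besides exhausting the half-line, these intervals are invariant under r -> c^2/r, the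
    substitution behind [bessel_neg]. *)
Definition posE (c : R) (n : nat) : set R := `[c / n.+1%:R, c * n.+1%:R]%classic.

Lemma posE_cover c : 0 < c -> \bigcup_n posE c n = `]0, +oo[%classic.
Proof.
move=> c0; apply/seteqP; split=> [r [n _]|r].
  rewrite /posE/= !in_itv/= andbT => /andP[h _]; apply: lt_le_trans h.
  by rewrite divr_gt0.
rewrite /= in_itv/= andbT => r0.
exists (maxn (Num.truncn (c / r)) (Num.truncn (r / c))) => //.
set n := maxn _ _; rewrite /posE/= in_itv/=; apply/andP; split.
  rewrite ler_pdivrMr ?ltr0n// mulrC -ler_pdivrMr//.
  by rewrite ltW// (lt_le_trans (truncnS_gt _))// ler_nat ltnS leq_maxl.
rewrite mulrC -ler_pdivrMr//.
by rewrite ltW// (lt_le_trans (truncnS_gt _))// ler_nat ltnS leq_maxr.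
Qed.

Lemma posE_nd c : 0 < c -> nondecreasing_seq (posE c).
Proof.
move=> c0 n m nm; apply/subsetPset => r; rewrite /posE/= !in_itv/= => /andP[h1 h2].
have nm' : n.+1%:R <= m.+1%:R :> R by rewrite ler_nat ltnS.
apply/andP; split.
  by apply: le_trans h1; rewrite ler_pM2l// lef_pV2// posrE ltr0n.
by apply: (le_trans h2); rewrite ler_pM2l.
Qed.

Lemma posE_sub c n : 0 < c -> posE c n `<=` `]0, +oo[%classic.
Proof. by move=> c0; rewrite -(posE_cover c0); exact: bigcup_sup. Qed.

Lemma posE_cvg c (f : R -> \bar R) : 0 < c -> measurable_fun (`]0%R, +oo[%classic : set R) f ->
  (forall r, 0 < r -> (0 <= f r)%E) ->
  (\int[@lebesgue_measure R]_(r in posE c n) f r @[n --> \oo] -->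
   \int[@lebesgue_measure R]_(r in `]0%R, +oo[) f r)%E.
Proof.
move=> c0 mf f0; rewrite -(posE_cover c0); apply: ge0_nondecreasing_set_cvg_integral.
- exact: posE_nd.
- by move=> n; exact: measurable_itv.
- by move=> n; apply: measurable_funS mf => //; exact: posE_sub.
- by move=> n r /(posE_sub c0) /=; rewrite in_itv/= andbT; exact: f0.
Qed.

Lemma continuous_measurable_pos (f : R -> R) :
  (forall x, 0 < x -> {for x, continuous f}) -> measurable_fun (`]0%R, +oo[%classic : set R) f.
Proof.
move=> cf; apply: open_continuous_measurable_fun => // x.
by rewrite inE/= in_itv/= andbT; exact: cf.
Qed.

Lemma measurable_powR_pos p : measurable_fun (`]0%R, +oo[%classic : set R) (fun t : R => t `^ p).
Proof. by apply: continuous_measurable_pos => x; exact: powR_continuous. Qed.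

(** The integrand may be singular at 0, so the antiderivative is evaluated on compact subintervals
    that exhaust ]0, K]. *)
Lemma int_powR_le (p K : R) : -1 < p -> 0 < K ->
  (\int[@lebesgue_measure R]_(t in `]0%R, K]) (t `^ p)%:E <= (K `^ (p + 1) / (p + 1))%:E)%E.
Proof.
move=> p1 K0; have pp : 0 < p + 1 by rewrite -ltrBlDr sub0r.
(* [n.+2] keeps the left end strictly below [K] from n = 0 on, as the fundamental theorem of
   calculus asks. *)
pose F n : set R := `[K / n.+2%:R, K]%classic.
have EF : `]0, K]%classic = \bigcup_n F n.
  apply/seteqP; split=> [r|r [n _]]; rewrite /F/= !in_itv/=.
    move=> /andP[r0 rK]; exists (Num.truncn (K / r)) => //; rewrite /= in_itv/= rK andbT.
    rewrite ler_pdivrMr ?ltr0n// mulrC -ler_pdivrMr//.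
    by rewrite ltW// (lt_trans (truncnS_gt _))// ltr_nat.
  by move=> /andP[h ->]; rewrite andbT; apply: lt_le_trans h; rewrite divr_gt0.
rewrite EF.
have ndF : nondecreasing_seq F.
  move=> n m nm; apply/subsetPset => r; rewrite /F/= !in_itv/= => /andP[h1 ->].
  rewrite andbT; apply: le_trans h1; rewrite ler_pM2l// lef_pV2 ?posrE ?ltr0n// ler_nat.
  by rewrite !ltnS.
have sub n : F n `<=` `]0, +oo[%classic.
  move=> r; rewrite /F/= !in_itv/= andbT => /andP[h _].
  by apply: lt_le_trans h; rewrite divr_gt0.
have cv : (\int[@lebesgue_measure R]_(t in F n) (t `^ p)%:E @[n --> \oo] -->
    \int[@lebesgue_measure R]_(t in \bigcup_n F n) (t `^ p)%:E)%E.
  apply: ge0_nondecreasing_set_cvg_integral => //.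
  - by move=> n; exact: measurable_itv.
  - move=> n; apply: measurable_funS; [|exact: (@sub n)|]; first exact: measurable_itv.
    by apply/measurable_EFinP; exact: measurable_powR_pos.
  - by move=> n x _; rewrite lee_fin powR_ge0.
rewrite -(cvg_lim _ cv)//; apply: lime_le; first by apply/cvg_ex; eexists; exact: cv.
apply: nearW => n.
have a0 : 0 < K / n.+2%:R by rewrite divr_gt0.
have aK : K / n.+2%:R < K by rewrite ltr_pdivrMr// ltr_pMr// ltr1n.
have -> : (\int[@lebesgue_measure R]_(t in F n) (t `^ p)%:E =
   (K `^ (p + 1) / (p + 1))%:E - ((K / n.+2%:R) `^ (p + 1) / (p + 1))%:E)%E.
  have dF (x : R) : 0 < x -> is_derive x 1 (fun t => t `^ (p + 1) / (p + 1)) (x `^ p).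
    move=> x0; have H := is_derive1_powR (p + 1) x0.
    rewrite (_ : (fun t => _) = (p + 1)^-1 *: (fun t : R => t `^ (p + 1))); last first.
      by apply/funext => t; rewrite /GRing.scale/= mulrC.
    apply: is_derive_eq; rewrite /GRing.scale/= mulKf ?gt_eqF// addrK//.
  have cF (x : R) : 0 < x -> {for x, continuous (fun t => t `^ (p + 1) / (p + 1))}.
    by move=> x0; apply/differentiable_continuous/derivable1_diffP; have [] := dF x x0.
  apply: (@continuous_FTC2 R (fun t => t `^ p) (fun t => t `^ (p + 1) / (p + 1))) => //.
  - apply: continuous_in_subspaceT => x; rewrite inE/= in_itv/= => /andP[h _].
    by apply: powR_continuous; exact: lt_le_trans h.
  - split.
    + move=> x; rewrite in_itv/= => /andP[h _].
      by have [] := dF x (lt_trans a0 h).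
    + by apply: cvg_at_right_filter; exact: cF.
    + by apply: cvg_at_left_filter; exact: cF.
  - move=> x; rewrite in_itv/= => /andP[h _]; rewrite derive1E.
    by have [_ ->] := dF x (lt_trans a0 h).
rewrite -EFinB lee_fin gerBl divr_ge0 ?powR_ge0// ltW//.
Qed.

Lemma int_expRN : (\int[@lebesgue_measure R]_(r in `]0%R, +oo[) (expR (- r))%:E <= 1)%E.
Proof.
have H : (\int[@lebesgue_measure R]_(r in `[0%R, +oo[) (expR (- r))%:E = 0%:E - (- expR (- 0%R))%:E)%E.
  apply: (@ge0_continuous_FTC2y R (fun r => expR (- r)) (fun r => - expR (- r))).
  - by move=> x _; exact: expR_ge0.
  - apply: continuous_subspaceT => x; apply: (@continuous_comp _ _ _ -%R expR).
      exact: opp_continuous.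
    exact: continuous_expR.
  - rewrite -oppr0; apply: cvgN; exact: cvgr_expR.
  - by move=> x _; exact: ex_derive.
  - apply: cvg_at_right_filter; apply: cvgN.
    apply: (@continuous_comp _ _ _ -%R expR); [exact: opp_continuous|exact: continuous_expR].
  - by move=> x _; rewrite derive1E derive_val /GRing.scale/=; ring.
apply: (@le_trans _ _ (\int[@lebesgue_measure R]_(r in `[0%R, +oo[) (expR (- r))%:E)%E).
  apply: ge0_subset_integral => //.
  - apply/measurable_EFinP; apply: measurable_funTS; apply: continuous_measurable_fun => x.
    apply: (@continuous_comp _ _ _ -%R expR); [exact: opp_continuous|exact: continuous_expR].
  - by move=> x; rewrite /= !in_itv/= !andbT => /ltW.
by rewrite H oppr0 expR0 -EFinB opprK add0r.
Qed.

(** This is ln u <= u - 1 at u = m/(b r), multiplied by b; the left-hand side is largest at r =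
    m/b. *)
Lemma powR_expR_bound (b m r : R) : 0 < b -> 0 < m -> 0 < r ->
  r `^ (- b) * expR (- (m / r)) <= (b / m) `^ b.
Proof.
move=> b0 m0 r0; rewrite /powR !gt_eqF ?divr_gt0// -expRD ler_expR.
rewrite ln_div ?posrE// mulNr.
have y0 : 0 < m / (b * r) by rewrite divr_gt0// mulr_gt0.
have h1 : -1 < m / (b * r) - 1 by rewrite ltrBDl subrr.
have h := le_ln1Dx h1; rewrite addrC subrK ln_div ?posrE ?mulr_gt0// lnM ?posrE// in h.
have := ler_wpM2l (ltW b0) h.
have -> : b * (m / (b * r) - 1) = m / r - b by field; rewrite !gt_eqF.
rewrite !mulrBr mulrDr; set x := b * ln m; set y := b * ln b; set z := b * ln r; set w := m / r.
lra.
Qed.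

End pos_line.

(** * Bessel type integrals *)

Section bessel.
Context {R : realType}.
Local Notation leb1 := (@lebesgue_measure R).
Local Notation P := (`]0%R, +oo[%classic : set R).
Implicit Types (a t r : R).

Let mP : @measurable _ (measurableTypeR R) P. Proof. exact: measurable_itv. Qed.

Definition kern a t r : R := r `^ (a - 1) * expR (- r - t ^+ 2 / 4 / r).
(* 2 (t/2)^a K_a(t) for the modified Bessel function K_a, also finite at t = 0 when a > 0. *)
Definition bessel a t : R := \int[leb1]_(r in P) kern a t r.

Lemma kern_ge0 a t r : 0 <= kern a t r.
Proof. by rewrite mulr_ge0 ?powR_ge0 ?expR_ge0. Qed.

Lemma kern_continuous a t r : 0 < r -> {for r, continuous (kern a t)}.
Proof.
move=> r0; apply: continuousM; first exact: powR_continuous.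
apply: (@continuous_comp _ _ _ (fun r => - r - t ^+ 2 / 4 / r) expR); last exact: continuous_expR.
apply: continuousB; first exact: opp_continuous.
apply: continuousM; first exact: cst_continuous.
by apply: continuousV; rewrite ?gt_eqF//; exact: cvg_id.
Qed.

Lemma measurable_kern a t : measurable_fun P (kern a t).
Proof. by apply: continuous_measurable_pos => r; exact: kern_continuous. Qed.

(** A majorant uniform in t >= u, also for negative [a], where the factor exp(-t^2/(4r)) tames the
    singularity at r = 0. It serves differentiation in t. *)
Lemma kern_le_neg a t u r : a < 1 -> 0 < u -> u <= t -> 0 < r ->
  kern a t r <= ((1 - a) / (u ^+ 2 / 4)) `^ (1 - a) * expR (- r).
Proof.
move=> a1 u0 ut r0; rewrite /kern expRD mulrCA mulrC ler_wpM2r ?expR_ge0//.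
have b0 : 0 < 1 - a by rewrite subr_gt0.
have m0 : 0 < u ^+ 2 / 4 by rewrite divr_gt0// exprn_gt0.
apply: le_trans (powR_expR_bound b0 m0 r0); rewrite opprB.
rewrite ler_wpM2l ?powR_ge0// ler_expR lerN2 ler_wpM2r ?invr_ge0 ?(ltW r0)//.
by rewrite ler_wpM2r// lerXn2r ?nnegrE// ltW// (lt_le_trans u0).
Qed.

Lemma integrable_expRN : leb1.-integrable P (EFin \o (fun r => expR (- r))).
Proof.
apply/integrableP; split.
  apply/measurable_EFinP; apply: measurable_funTS; apply: continuous_measurable_fun => x.
  apply: (@continuous_comp _ _ _ -%R expR); [exact: opp_continuous|exact: continuous_expR].
apply: (@le_lt_trans _ _ 1%E); last exact: ltry.
apply: le_trans int_expRN; apply: ge0_le_integral => //.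
- apply/measurable_EFinP; apply: measurableT_comp => //; apply: measurable_funTS; apply: continuous_measurable_fun => x.
  apply: (@continuous_comp _ _ _ -%R expR); [exact: opp_continuous|exact: continuous_expR].
- apply/measurable_EFinP; apply: measurable_funTS; apply: continuous_measurable_fun => x.
  apply: (@continuous_comp _ _ _ -%R expR); [exact: opp_continuous|exact: continuous_expR].
- by move=> x _ /=; rewrite lee_fin ger0_norm// expR_ge0.
Qed.

Lemma integrable_kern_neg a t : a < 1 -> 0 < t -> leb1.-integrable P (EFin \o kern a t).
Proof.
move=> a1 t0; pose C := ((1 - a) / (t ^+ 2 / 4)) `^ (1 - a).
apply: (@le_integrable _ _ _ leb1 P _ _ (fun r => C%:E * (expR (- r))%:E)%E).
- exact: measurable_itv.
- by apply/measurable_EFinP; exact: measurable_kern.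
- move=> r; rewrite /= in_itv/= andbT => r0.
  rewrite lee_fin ger0_norm ?kern_ge0// ger0_norm ?mulr_ge0 ?powR_ge0 ?expR_ge0//.
  exact: kern_le_neg.
- by apply: integrableZl => //; exact: integrable_expRN.
Qed.

(** A majorant of [kern a t] for all t, including 0, when a < 1: the exponential is at most 1 below
    r = 1, the power is at most 1 above. It serves the limit t -> 0. *)
Definition gamma_dom a r : R := r `^ (a - 1) * (r <= 1)%R%:R + expR (- r).

Lemma kern_le_dom a t r : a < 1 -> 0 < r -> kern a t r <= gamma_dom a r.
Proof.
move=> a1 r0; have e1 : expR (- r - t ^+ 2 / 4 / r) <= expR (- r).
  by rewrite ler_expR gerDl oppr_le0 divr_ge0 ?(ltW r0)// divr_ge0// sqr_ge0.
have e2 : expR (- r) <= 1 by rewrite -expR0 ler_expR oppr_le0 ltW.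
rewrite /kern /gamma_dom; have [r1|r1] := leP r 1.
  rewrite mulr1; apply: (@le_trans _ _ (r `^ (a - 1) * 1)).
    by rewrite ler_wpM2l ?powR_ge0// (le_trans e1).
  by rewrite mulr1 lerDl expR_ge0.
rewrite mulr0 add0r; apply: (@le_trans _ _ (1 * expR (- r - t ^+ 2 / 4 / r))).
  rewrite ler_wpM2r ?expR_ge0// /powR gt_eqF// -[leRHS]expR0 ler_expR.
  by rewrite mulr_le0_ge0 ?subr_le0 ?(ltW a1)// ln_ge0// ltW.
by rewrite mul1r.
Qed.

Lemma integrable_dom a : 0 < a -> a < 1 -> leb1.-integrable P (EFin \o gamma_dom a).
Proof.
move=> a0 a1; have mle : measurable_fun P (fun r : R => (r <= 1)%R%:R : R).
  rewrite (_ : (fun r => _) = (fun r : R => if r <= 1 then 1 else 0)); last first.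
    by apply/funext => r; case: (r <= 1).
  apply: measurable_funTS; apply: measurable_fun_ifT => //.
  exact: measurable_fun_ler.
rewrite (_ : _ \o _ = (fun r => (r `^ (a - 1) * (r <= 1)%R%:R)%:E + (expR (- r))%:E)%E)//.
apply: integrableD => //; last exact: integrable_expRN.
apply/integrableP; split.
  apply/measurable_EFinP; apply: measurable_funM => //; exact: measurable_powR_pos.
apply: (@le_lt_trans _ _ (\int[leb1]_(r in `]0%R, 1%R]) (r `^ (a - 1))%:E)%E).
  rewrite integral_mkcond [leRHS]integral_mkcond; apply: ge0_le_integral => //.
  - by move=> r _; apply: erestrict_ge0.
  - apply/(measurable_restrictT _ (measurable_itv _)); apply/measurable_EFinP.
    apply: measurableT_comp => //; apply: measurable_funM => //; exact: measurable_powR_pos.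
  - apply/(measurable_restrictT _ (measurable_itv _)); apply/measurable_EFinP.
    apply: measurable_funS (measurable_powR_pos (a - 1)) => //.
    by move=> r; rewrite /= !in_itv/= andbT => /andP[].
  move=> r _; rewrite !patchE; case: ifPn => [/set_mem|].
    rewrite /= in_itv/= andbT => r0; have [r1|r1] := leP r 1.
      by rewrite mem_set/= ?in_itv/= ?r0// mulr1 lee_fin ger0_norm ?powR_ge0.
    by rewrite mulr0 normr0; case: ifP => // _; rewrite lee_fin powR_ge0.
  by move=> _; case: ifP => // _; rewrite lee_fin powR_ge0.
by apply: le_lt_trans (int_powR_le _ ltr01) (ltry _); rewrite ltrBDl addrN.
Qed.

Lemma integrable_kern a t : 0 < a -> a < 1 -> leb1.-integrable P (EFin \o kern a t).
Proof.
move=> a0 a1; apply: (@le_integrable _ _ _ leb1 P _ _ (EFin \o gamma_dom a)).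
- exact: measurable_itv.
- by apply/measurable_EFinP; exact: measurable_kern.
- move=> r; rewrite /= in_itv/= andbT => r0; rewrite lee_fin ger0_norm ?kern_ge0//.
  by rewrite (le_trans (kern_le_dom t a1 r0))// ler_norm.
- exact: integrable_dom.
Qed.

Lemma bessel0 a : bessel a 0 = Gamma_fun a.
Proof.
by apply: eq_Rintegral => r _; rewrite /kern expr0n !mul0r subr0.
Qed.

Lemma bessel_cvg0 a : 0 < a -> a < 1 -> bessel a t @[t --> 0^'+] --> Gamma_fun a.
Proof.
move=> a0 a1; rewrite -bessel0.
apply/cvg_at_rightP => u [u0 cu].
have ik t := integrable_kern t a0 a1.
have H : (\int[leb1]_(r in P) (kern a (u n) r)%:E @[n --> \oo] --> \int[leb1]_(r in P) (kern a 0 r)%:E)%E.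
  apply: (@dominated_cvg _ _ _ leb1 P _ _ _ (EFin \o gamma_dom a)) => //.
  - by move=> n; apply/measurable_EFinP; exact: measurable_kern.
  - move=> r _; apply: cvg_EFin; first exact: nearW.
    apply: cvgMr; apply: (@cvg_comp _ _ _ (fun n => - r - u n ^+ 2 / 4 / r) expR _ (nbhs (- r - 0 ^+ 2 / 4 / r))); last exact: continuous_expR.
    by apply: cvgB; [exact: cvg_cst|do 2 apply: cvgMl; apply: cvgM].
  - exact: integrable_dom.
  - move=> n r; rewrite /= in_itv/= andbT => r0; rewrite lee_fin ger0_norm ?kern_ge0//.
    exact: kern_le_dom.
have E t : (\int[leb1]_(r in P) (kern a t r)%:E = (bessel a t)%:E)%E.
  by rewrite /bessel /Rintegral fineK//; have := integrable_fin_num mP (ik t); exact.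
move: H; rewrite E; under eq_fun do rewrite E.
by move/fine_cvgP => [].
Qed.

(** On [1, 2] the kernel is bounded below: the power and exp(-r) are least at r = 2, the remaining
    exponential at r = 1. *)
Lemma bessel_gt0 a t : 0 < a -> a < 1 -> 0 < bessel a t.
Proof.
move=> a0 a1; have ik := integrable_kern t a0 a1.
have E : (\int[leb1]_(r in P) (kern a t r)%:E = (bessel a t)%:E)%E.
  by rewrite /bessel /Rintegral fineK//; have := integrable_fin_num mP ik; exact.
pose c : R := 2 `^ (a - 1) * expR (- 2 - t ^+ 2 / 4).
have c0 : 0 < c by rewrite mulr_gt0 ?powR_gt0 ?expR_gt0.
rewrite -lte_fin -E; apply: (@lt_le_trans _ _ (\int[leb1]_(r in `[1%R, 2%R]) c%:E)%E).
  have -> : (\int[leb1]_(r in `[1%R, 2%R]) c%:E = c%:E * leb1 `[1%R, 2%R]%classic)%E.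
    exact: (integral_cst leb1 (measurable_itv `[1%R, 2%R]) c%:E).
  rewrite lebesgue_measure_itv/= lte_fin ltr1n/=.
  by rewrite -EFinD -EFinM lte_fin mulr_gt0// subr_gt0 ltr1n.
apply: (@le_trans _ _ (\int[leb1]_(r in `[1%R, 2%R]) (kern a t r)%:E)%E).
  have sub : `[1%R, 2%R]%classic `<=` P.
    by move=> r; rewrite /= !in_itv/= andbT => /andP[r1 _]; exact: lt_le_trans r1.
  apply: ge0_le_integral => //.
  - by move=> r _; rewrite lee_fin ltW.
  - apply/measurable_EFinP; apply: measurable_funS; [|exact: sub|exact: measurable_kern]; exact: measurable_itv.
  move=> r; rewrite /= in_itv/= => /andP[r1 r2]; rewrite lee_fin.
  have r0 : 0 < r by exact: lt_le_trans r1.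
  apply: ler_pM; rewrite ?powR_ge0 ?expR_ge0//.
    rewrite /powR !gt_eqF// ler_expR ler_wnM2l// ?subr_le0 ?(ltW a1)//.
    by rewrite ler_ln ?posrE.
  rewrite ler_expR lerB// ?lerN2// ler_pdivrMr// ler_peMr//.
  by rewrite divr_ge0// sqr_ge0.
apply: ge0_subset_integral => //.
- by apply/measurable_EFinP; exact: measurable_kern.
- by move=> r _; rewrite lee_fin kern_ge0.
- by move=> r; rewrite /= !in_itv/= andbT => /andP[r1 _]; exact: lt_le_trans r1.
Qed.

Lemma is_derive_kern a t r : 0 < r -> is_derive t 1 (fun t => kern a t r) (- (t / 2) * kern (a - 1) t r).
Proof.
move=> r0.
have H : is_derive t 1 (fun t : R => - r - t ^+ 2 / 4 / r) (- (t / 2 / r)).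
  have -> : (fun t : R => - r - t ^+ 2 / 4 / r) = cst (- r) + (- (4^-1 / r)) *: ((id : R -> R) * (id : R -> R)).
    by apply/funext => u; rewrite !fctE /GRing.scale /=; ring.
  have D := is_deriveD (is_derive_cst (- r) t 1) (is_deriveZ (- (4^-1 / r))
    (is_deriveM (is_derive_id t (1 : R)) (is_derive_id t (1 : R)))).
  apply: (is_derive_eq D); rewrite /GRing.scale/=; field; by rewrite gt_eqF.
have K : is_derive t 1 (expR \o (fun t : R => - r - t ^+ 2 / 4 / r)) (- (t / 2 / r) * expR (- r - t ^+ 2 / 4 / r)).
  have := @is_derive1_comp R expR (fun t : R => - r - t ^+ 2 / 4 / r) t _ _ (is_derive_expR _) H.
  by rewrite /GRing.scale/= mulrC.
have -> : (fun t => kern a t r) = r `^ (a - 1) *: (expR \o (fun t : R => - r - t ^+ 2 / 4 / r)) by [].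
have e : r `^ (a - 1 - 1) = r `^ (a - 1) / r.
  by rewrite powRB; [rewrite powRr1// ltW|apply/implyP => _; rewrite gt_eqF].
apply: (is_derive_eq (is_deriveZ (r `^ (a - 1)) K)); rewrite /GRing.scale/= /kern e.
by field; rewrite gt_eqF.
Qed.

(** Differentiation in t brings down -t/(2r), which lowers the index by one. For parameters in ]t/2,
    2t[ the derivative is dominated by a multiple of exp(-r), by [kern_le_neg] with u = t/2. *)
Lemma is_derive_bessel a t : 0 < a -> a < 1 -> 0 < t ->
  is_derive t 1 (bessel a) (- (t / 2) * bessel (a - 1) t).
Proof.
move=> a0 a1 t0.
have t2 : 0 < t / 2 by rewrite divr_gt0.
pose C := ((1 - (a - 1)) / ((t / 2) ^+ 2 / 4)) `^ (1 - (a - 1)).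
pose G (r : R) := t * C * expR (- r).
have a11 : a - 1 < 1 by rewrite ltrBlDr (lt_trans a1)// ltrDl.
have tI : `]t / 2, 2 * t[%classic t by rewrite /= in_itv/=; apply/andP; split; lra.
have h1 (x : R) : `]t / 2, 2 * t[%classic x -> leb1.-integrable P (EFin \o kern a x).
  by move=> _; exact: integrable_kern.
have h2 (x y : R) : `]t / 2, 2 * t[%classic x -> P y -> derivable (fun u => kern a u y) x 1.
  by move=> _; rewrite /= in_itv/= andbT => y0; have [] := is_derive_kern a x y0.
have G0 y : 0 <= G y by rewrite !mulr_ge0 ?powR_ge0 ?expR_ge0// ltW.
have iG : leb1.-integrable P (EFin \o G).
  rewrite (_ : _ \o _ = (fun r => (t * C)%:E * (expR (- r))%:E)%E)//.
  by apply: integrableZl => //; exact: integrable_expRN.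
have h3 (x y : R) : `]t / 2, 2 * t[%classic x -> P y -> `|partial1of2 (kern a) x y| <= G y.
  rewrite /= !in_itv/= andbT => /andP[x1 x2] y0.
  have x0 : 0 < x by exact: lt_trans x1.
  rewrite /partial1of2 derive1E; have [_ ->] := is_derive_kern a x y0.
  rewrite normrM normrN !ger0_norm ?kern_ge0 ?divr_ge0 ?(ltW x0)// /G -[leRHS]mulrA ler_pM ?kern_ge0 ?divr_ge0 ?(ltW x0)//.
    by rewrite ler_pdivrMr// mulrC ltW.
  by apply: kern_le_neg => //; exact: ltW.
have D := derivable_under_integral mP tI h1 h2 G0 iG h3.
have E := differentiation_under_integral mP tI h1 h2 G0 iG h3.
apply: DeriveDef; first exact: D.
rewrite -derive1E [LHS]E.
transitivity (\int[leb1]_(r in P) (- (t / 2) * kern (a - 1) t r)).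
  apply: eq_Rintegral => r /set_mem; rewrite /= in_itv/= andbT => r0.
  by rewrite /partial1of2 derive1E; have [_ ->] := is_derive_kern a t r0.
by rewrite RintegralZl//; exact: integrable_kern_neg.
Qed.

(** The substitution r -> c^2/r with c = t/2 exchanges the two terms of the exponent and the signs
    of the index: the symmetry K_(-a) = K_a of Bessel functions. It is carried out on the intervals
    [posE c n], each mapped onto itself. *)
Lemma bessel_neg a t : 0 < a -> a < 1 -> 0 < t ->
  bessel (- a) t = (t / 2) `^ (- (2 * a)) * bessel a t.
Proof.
move=> a0 a1 t0; pose c := t / 2.
have c0 : 0 < c by rewrite divr_gt0.
have a1' : - a < 1 by rewrite (lt_trans _ ltr01)// oppr_lt0.
have c2 : t ^+ 2 / 4 = c ^+ 2 by rewrite /c; field.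
pose F (r : R) := c ^+ 2 / r.
have dF (x : R) : 0 < x -> is_derive x 1 F (- (c ^+ 2 / x ^+ 2)).
  move=> x0; have -> : F = c ^+ 2 *: (fun r : R => r^-1) by [].
  have Dx := @is_deriveV R id x 1 1 (lt0r_neq0 x0) (is_derive_id _ _).
  apply: is_derive_eq; rewrite /GRing.scale/= mulr1; field; by rewrite gt_eqF.
have S n : (\int[leb1]_(r in posE c n) (kern (- a) t r)%:E =
    ((c `^ (- (2 * a))))%:E * \int[leb1]_(r in posE c n) (kern a t r)%:E)%E.
  rewrite -ge0_integralZl_EFin ?powR_ge0//; last 3 first.
  - exact: measurable_itv.
  - by move=> r _; rewrite lee_fin kern_ge0.
  - by apply/measurable_EFinP; apply: measurable_funS; [|exact: (@posE_sub _ c n c0)|exact: measurable_kern]; exact: measurable_itv.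
  pose u := c / n.+1%:R; pose v := c * n.+1%:R.
  have n1 : 1 <= n.+1%:R :> R by rewrite ler1n.
  have u0 : 0 < u by rewrite divr_gt0.
  have v0 : 0 < v by rewrite mulr_gt0.
  have uv : u <= v by rewrite /u /v ler_pM2l// (le_trans _ n1)// invf_le1.
  have Fu : F u = v by rewrite /F /u /v; field; rewrite ?gt_eqF ?pnatr_eq0//= gt_eqF.
  have Fv : F v = u by rewrite /F /u /v; field; rewrite ?gt_eqF ?pnatr_eq0//= gt_eqF.
  have cF (x : R) : 0 < x -> {for x, continuous F}.
    by move=> x0; apply/differentiable_continuous/derivable1_diffP; have [] := dF x x0.
  have cF' (x : R) : 0 < x -> {for x, continuous (derive1 F)}.
    move=> x0; have h : {for x, continuous (fun x : R => - (c ^+ 2 / x ^+ 2))}.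
      apply: continuousN; apply: continuousM; first exact: cst_continuous.
      apply: continuousV; first by rewrite gt_eqF// exprn_gt0.
      exact: exprn_continuous.
    have Hx : derive1 F x = - (c ^+ 2 / x ^+ 2) by rewrite derive1E; have [_ ->] := dF x x0.
    change (derive1 F z @[z --> x] --> derive1 F x); rewrite Hx.
    apply: cvg_trans h; apply: near_eq_cvg.
    have : \forall y \near x, 0 < y by exact: lt_nbhsr.
    by apply: filterS => y y0; rewrite derive1E; have [_ ->] := dF y y0.
  have := @integration_by_substitution_decreasing R F (kern (- a) t) u v uv.
  rewrite Fu Fv => ->.
  - apply: eq_integral => r /set_mem; rewrite /= in_itv/= => /andP[r1 r2].
    have r0 : 0 < r by exact: lt_le_trans r1.
    rewrite -EFinM /= !fctE/= derive1E; have [_ ->] := dF r r0; congr EFin.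
    have e1 : c ^+ 2 / (c ^+ 2 / r) = r by field; rewrite !gt_eqF.
    rewrite /kern opprK c2 /F e1.
    have -> : - (c ^+ 2 / r) - r = - r - c ^+ 2 / r by rewrite addrC.
    rewrite mulrAC [RHS]mulrA; congr (_ * _).
    rewrite -powR_mulrn ?ltW// -(powR_mulrn 2 (ltW r0)) /powR !gt_eqF ?divr_gt0 ?expR_gt0//.
    rewrite lnM ?posrE ?expR_gt0 ?invr_gt0// lnV ?posrE// expRK -!expRN -!expRD.
    by congr expR; ring.
  - move=> x y; rewrite !in_itv/= => /andP[x1 _] /andP[y1 _] xy.
    have x0 : 0 < x by exact: lt_le_trans x1.
    by rewrite /F ltr_pM2l ?exprn_gt0// ltf_pV2 ?posrE// (lt_le_trans u0).
  - by move=> x; rewrite in_itv/= => /andP[h _]; apply: cF'; exact: lt_trans h.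
  - by apply/cvg_ex; eexists; apply: cvg_at_right_filter; exact: cF'.
  - by apply/cvg_ex; eexists; apply: cvg_at_left_filter; exact: cF'.
  - split.
    + by move=> x; rewrite in_itv/= => /andP[h _]; have [] := dF x (lt_trans u0 h).
    + by apply: cvg_at_right_filter; exact: cF.
    + by apply: cvg_at_left_filter; exact: cF.
  - apply: continuous_in_subspaceT => x; rewrite inE/= in_itv/= => /andP[h _].
    by apply: kern_continuous; exact: lt_le_trans h.
have m b : measurable_fun P (EFin \o kern b t) by apply/measurable_EFinP; exact: measurable_kern.
have p b (r : R) : 0 < r -> (0 <= (EFin \o kern b t) r)%E by rewrite lee_fin kern_ge0.
have c1 := posE_cvg c0 (m (- a)) (p (- a)).
have c3 := posE_cvg c0 (m a) (p a).
have c4 : (\int[leb1]_(r in posE c n) (kern (- a) t r)%:E @[n --> \oo] -->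
   (c `^ (- (2 * a)))%:E * \int[leb1]_(r in P) (kern a t r)%:E)%E.
  by under eq_fun do rewrite S; apply: cvgeZl => //; exact: c3.
have E : (\int[leb1]_(r in P) (kern (- a) t r)%:E = (c `^ (- (2 * a)))%:E * \int[leb1]_(r in P) (kern a t r)%:E)%E.
  exact: (cvg_unique (@ereal_hausdorff R) c1 c4).
rewrite /bessel /Rintegral E fineM//.
by have := integrable_fin_num mP (integrable_kern t a0 a1); exact.
Qed.

End bessel.

(** * The Riccati equation and the trace inequality on a half-line *)

Section riccati.
Context {R : realType} (s : R).
Hypotheses (s0 : 0 < s) (s1 : s < 1).
Local Notation leb1 := (@lebesgue_measure R).
Local Notation P := (`]0%R, +oo[%classic : set R).

Let s1' : 0 < 1 - s. Proof. by rewrite subr_gt0. Qed.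
Let s0' : 1 - s < 1. Proof. by rewrite gtrBl. Qed.

Lemma powRDp (x a b : R) : 0 < x -> x `^ (a + b) = x `^ a * x `^ b.
Proof. by move=> x0; rewrite powRD//; apply/implyP => _; rewrite gt_eqF. Qed.

Lemma powR_half (b t : R) : 0 < t -> t / 2 * (t / 2) `^ b = t `^ (1 + b) * 2 `^ (- (1 + b)).
Proof.
move=> t0; have t2 : 0 < t / 2 by rewrite divr_gt0.
rewrite -{1}(powRr1 (ltW t2)) -powRDp//.
by rewrite powRM ?invr_ge0 ?(ltW t0)// -powR_inv1// -powRrM mulN1r.
Qed.

(** For t > 0 this is -t^(1-2s) times the derivative of [bessel s], rewritten through [bessel_neg]
    as a Bessel integral of positive index, which is finite at 0. *)
Definition profile_flux t : R := 2 `^ (1 - 2 * s) * bessel (1 - s) t.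

Lemma is_derive_profile (t : R) : 0 < t ->
  is_derive t 1 (bessel s) (- (t `^ (2 * s - 1) * profile_flux t)).
Proof.
move=> t0; apply: (is_derive_eq (is_derive_bessel s0 s1 t0)).
rewrite (_ : s - 1 = - (1 - s)); last by rewrite opprB.
rewrite bessel_neg// mulrA mulNr powR_half// /profile_flux mulNr; congr (- _).
by rewrite mulrA; congr (_ `^ _ * _ `^ _ * _); ring.
Qed.

(** Together with [is_derive_profile] this is the equation (t^(1-2s) b')' = t^(1-2s) b for b =
    [bessel s]: the extension problem on a single mode of eigenvalue 1. *)
Lemma is_derive_profile_flux (t : R) : 0 < t ->
  is_derive t 1 profile_flux (- (t `^ (1 - 2 * s) * bessel s t)).
Proof.
move=> t0; apply: (is_derive_eq (is_deriveZ (2 `^ (1 - 2 * s)) (is_derive_bessel s1' s0' t0))).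
rewrite (_ : 1 - s - 1 = - s); last by ring.
rewrite bessel_neg// mulrA mulNr powR_half// /GRing.scale/= mulNr mulrN; congr (- _).
rewrite mulrA [_ * (_ * _)]mulrCA; congr (_ * _).
by rewrite -[1 + _]/(1 - 2 * s) -powRDp// subrr powRr0 mulr1.
Qed.

(* The conormal derivative of the profile [bessel s] divided by the profile. *)
Definition riccati t : R := profile_flux t / bessel s t.

Lemma is_derive_riccati (t : R) : 0 < t ->
  is_derive t 1 riccati (t `^ (2 * s - 1) * riccati t ^+ 2 - t `^ (1 - 2 * s)).
Proof.
move=> t0; have b0 := bessel_gt0 t s0 s1; have bn : bessel s t != 0 by rewrite gt_eqF.
have D := is_deriveM (is_derive_profile_flux t0) (is_deriveV bn (is_derive_profile t0)).
apply: (is_derive_eq D); rewrite /GRing.scale/= /riccati.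
set A := t `^ (1 - 2 * s); set B := t `^ (2 * s - 1); set q := profile_flux t.
by field.
Qed.

Lemma Gamma_gt0 a : 0 < a -> a < 1 -> 0 < Gamma_fun a :> R.
Proof. by move=> a0 a1; rewrite -bessel0; exact: bessel_gt0. Qed.

Lemma C_s_gt0 : 0 < C_s s.
Proof. by rewrite mulr_gt0 ?powR_gt0// divr_gt0 ?Gamma_gt0. Qed.

Lemma riccati_cvg0 : riccati t @[t --> 0^'+] --> C_s s.
Proof.
rewrite /C_s mulrA; apply: cvgM; first by apply: cvgMr; exact: bessel_cvg0.
by apply: cvgV; [rewrite gt_eqF// Gamma_gt0|exact: bessel_cvg0].
Qed.

Context (c : R) (c0 : 0 < c).
(** Dilation by c turns the eigenvalue 1 into c^2; the factor c^(2s) restores the coefficient of the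
    square in the Riccati equation and ends up in the trace constant. *)
Definition riccati_scaled t : R := c `^ (2 * s) * riccati (c * t).

Lemma powR_inv_weight (t : R) : 0 < t -> t `^ (1 - 2 * s) * t `^ (2 * s - 1) = 1.
Proof.
move=> t0; rewrite -powRDp//.
by rewrite (_ : _ + _ = 0) ?powRr0//; ring.
Qed.

Lemma is_derive_riccati_scaled (t : R) : 0 < t ->
  is_derive t 1 riccati_scaled (t `^ (2 * s - 1) * riccati_scaled t ^+ 2 - c ^+ 2 * t `^ (1 - 2 * s)).
Proof.
move=> t0; have ct0 : 0 < c * t by rewrite mulr_gt0.
have D1 := is_deriveZ c (is_derive_id t (1 : R)).
have D := is_deriveZ (c `^ (2 * s)) (@is_derive1_comp R riccati (c \*: id) t _ _ (is_derive_riccati ct0) D1).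
apply: (is_derive_eq D); rewrite /GRing.scale/= mulr1 /riccati_scaled.
rewrite !powRM ?(ltW c0) ?(ltW t0)//.
set r := riccati _; set A := t `^ (1 - 2 * s); set B := t `^ (2 * s - 1).
have e1 : c `^ (2 * s) * c * c `^ (2 * s - 1) = (c `^ (2 * s)) ^+ 2.
  rewrite -mulrA -[X in _ * (X * _)](powRr1 (ltW c0)) -!powRDp// expr2 -powRDp//.
  by congr (_ `^ _); ring.
have e2 : c `^ (2 * s) * c * c `^ (1 - 2 * s) = c ^+ 2.
  rewrite -mulrA -[X in _ * (X * _)](powRr1 (ltW c0)) -!powRDp// -powR_mulrn ?ltW//.
  by congr (_ `^ _); ring.
rewrite -e2 [(_ * r) ^+ 2]exprMn -e1; ring.
Qed.

Lemma trace_1d (v : R -> R) (T : R) : smooth v -> (forall t, T <= t -> v t = 0) ->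
  ((C_s s * c `^ (2 * s) * v 0 ^+ 2)%:E <=
   \int[leb1]_(t in P) (t `^ (1 - 2 * s) * (('D_1 v t) ^+ 2 + c ^+ 2 * v t ^+ 2))%:E)%E.
Proof.
wlog T0 : T / 0 < T.
  move=> H sv vT; apply: (H (Num.max T 1)) => //; first by rewrite lt_max ltr01 orbT.
  by move=> t; rewrite ge_max => /andP[/vT].
move=> sv vT; have cv := smooth_cont sv; have cdv : continuous ('D_(1 : R) v) by apply: smooth_cont; exact: smooth_derive.
pose W (t : R) := t `^ (1 - 2 * s) * (('D_1 v t) ^+ 2 + c ^+ 2 * v t ^+ 2).
have cW (t : R) : 0 < t -> {for t, continuous W}.
  move=> t0; apply: continuousM; first exact: powR_continuous.
  apply: continuousD; first exact: (continuousM (cdv t) (cdv t)).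
  apply: continuousM; [exact: cst_continuous|exact: (continuousM (cv t) (cv t))].
have mW : measurable_fun P W by exact: continuous_measurable_pos.
have W0 t : 0 <= W t.
  apply: mulr_ge0; [exact: powR_ge0|apply: addr_ge0; [exact: sqr_ge0|apply: mulr_ge0; exact: sqr_ge0]].
rewrite -/(\int[leb1]_(t in P) (W t)%:E)%E.
pose g t := riccati_scaled t * v t ^+ 2.
pose dg (t : R) := (t `^ (2 * s - 1) * riccati_scaled t ^+ 2 - c ^+ 2 * t `^ (1 - 2 * s)) * v t ^+ 2 + riccati_scaled t * (2 * v t * 'D_1 v t).
have Dg (t : R) : 0 < t -> is_derive t 1 g (dg t).
  move=> t0; have Dv : is_derive t 1 v ('D_1 v t) by apply: DeriveDef => //; exact: smooth_derivable.
  have D := is_deriveM (is_derive_riccati_scaled t0) (is_deriveM Dv Dv).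
  by apply: (is_derive_eq D); rewrite /GRing.scale/= !fctE /dg; ring.
have crs (t : R) : 0 < t -> {for t, continuous riccati_scaled}.
  by move=> t0; apply/differentiable_continuous/derivable1_diffP; have [] := is_derive_riccati_scaled t0.
have cg (t : R) : 0 < t -> {for t, continuous g}.
  by move=> t0; apply/differentiable_continuous/derivable1_diffP; have [] := Dg t t0.
have cdg (t : R) : 0 < t -> {for t, continuous dg}.
  move=> t0; have ccr := crs t t0.
  apply: continuousD.
    apply: continuousM; last exact: (continuousM (cv t) (cv t)).
    apply: continuousB.
      apply: continuousM; [exact: powR_continuous|exact: (continuousM ccr ccr)].
    by apply: continuousM; [exact: cst_continuous|exact: powR_continuous].
  apply: continuousM => //; apply: continuousM; last exact: cdv.
  by apply: continuousM; [exact: cst_continuous|exact: cv].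
have dgW (t : R) : 0 < t -> - dg t <= W t.
  move=> t0; rewrite -subr_ge0.
  have -> : W t - - dg t = t `^ (1 - 2 * s) * ('D_1 v t + t `^ (2 * s - 1) * riccati_scaled t * v t) ^+ 2.
    have e := powR_inv_weight t0; rewrite /W /dg; move: e.
    set A := t `^ (1 - 2 * s); set B := t `^ (2 * s - 1); set r := riccati_scaled t; set x := v t; set y := 'D_1 v t => e.
    have -> : A * (y + B * r * x) ^+ 2 = A * y ^+ 2 + 2 * (A * B) * r * x * y + (A * B) * B * r ^+ 2 * x ^+ 2 by ring.
    by rewrite e; ring.
  by rewrite mulr_ge0 ?powR_ge0 ?sqr_ge0.
(* The derivative of [g] is available for t > 0 only, so the integration starts at e. Since g
   vanishes at T, what remains is g(e), and e -> 0 brings in the limit [C_s] of the Riccati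
   solution. *)
have key (e : R) : 0 < e -> e < T -> ((g e)%:E <= \int[leb1]_(t in P) (W t)%:E)%E.
  move=> e0 eT.
  have sub : `[e, T]%classic `<=` P.
    by move=> r; rewrite /= !in_itv/= andbT => /andP[h _]; exact: lt_le_trans h.
  have wit (f : R -> R) : (forall t, 0 < t -> {for t, continuous f}) -> {within `[e, T], continuous f}.
    move=> cf; apply: continuous_in_subspaceT => x; rewrite inE/= in_itv/= => /andP[h _].
    by apply: cf; exact: lt_le_trans h.
  have cndg (t : R) : 0 < t -> {for t, continuous (fun t => - dg t)}.
    by move=> t0; apply: continuousN; exact: cdg.
  have E : (\int[leb1]_(t in `[e, T]) (- dg t)%:E = (- g T)%:E - (- g e)%:E)%E.
    apply: (@continuous_FTC2 R (fun t => - dg t) (fun t => - g t)) => //.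
    - exact: wit.
    - split.
      + by move=> x; rewrite in_itv/= => /andP[h _]; apply: derivableN; have [] := Dg x (lt_trans e0 h).
      + by apply: cvg_at_right_filter; apply: cvgN; exact: cg.
      + by apply: cvg_at_left_filter; apply: cvgN; exact: cg.
    - move=> x; rewrite in_itv/= => /andP[h _]; rewrite derive1E.
      by have [_ ->] := is_deriveN (Dg x (lt_trans e0 h)).
  have -> : ((g e)%:E = (- g T)%:E - (- g e)%:E)%E.
    by rewrite (_ : g T = 0) ?oppr0 -?EFinB ?opprK ?add0r// /g (vT T)// expr0n mulr0.
  rewrite -E; apply: (@le_trans _ _ (\int[leb1]_(t in `[e, T]) (W t)%:E)%E).
    apply: le_integral => //.
    - by apply: continuous_compact_integrable; [exact: segment_compact|exact: wit].
    - by apply: continuous_compact_integrable; [exact: segment_compact|exact: wit].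
    - move=> x /set_mem; rewrite /= in_itv/= => /andP[h _].
      by rewrite lee_fin dgW//; exact: lt_le_trans h.
  apply: ge0_subset_integral => //; first by apply/measurable_EFinP.
  by move=> t _; rewrite lee_fin.
move: key; set X := (\int[leb1]_(t in P) (W t)%:E)%E.
have X0 : (0 <= X)%E by apply: integral_ge0 => t _; rewrite lee_fin.
case: X X0 => [x _ key|_ _|//]; last by rewrite leey.
rewrite lee_fin.
have C : g t @[t --> 0^'+] --> C_s s * c `^ (2 * s) * v 0 ^+ 2.
  apply: cvgM; last first.
    apply: cvg_at_right_filter; exact: (continuousM (cv 0) (cv 0)).
  rewrite mulrC; apply: cvgMr.
  apply/cvg_at_rightP => u [u0 cu].
  have /cvg_at_rightP := riccati_cvg0; apply; split; first by move=> n; rewrite mulr_gt0.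
  by rewrite -(mulr0 c); apply: cvgMr.
apply: (ler_cvg_to C (cvg_cst x)); near=> t; rewrite -lee_fin; apply: key.
  by near: t; exact: nbhs_right_gt.
by near: t; exact: nbhs_right_lt.
Unshelve. all: by end_near. Qed.

End riccati.

(** * Weights on the half-line *)

Section weights.
Context {R : realType}.
Local Notation leb1 := (@lebesgue_measure R).
Local Notation P := (`]0%R, +oo[%classic : set R).

(** Integrability near 0 gives smooth functions of bounded support finite energy. The class contains
    [om0], its reciprocal, the regularised weights and, for e <= 1, their reciprocals. *)
Definition weight (om : R -> R) := [/\ measurable_fun P om, forall t, 0 < t -> 0 < om t &
  forall K, 0 < K -> (\int[leb1]_(t in `]0%R, K]) (om t)%:E < +oo)%E].

Lemma weight_powR (p : R) : -1 < p -> weight (fun t => t `^ p).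
Proof.
move=> p1; split; first exact: measurable_powR_pos.
  by move=> t t0; exact: powR_gt0.
by move=> K K0; exact: le_lt_trans (int_powR_le p1 K0) (ltry _).
Qed.

Lemma itvoc_sub_pos (K : R) : `]0%R, K]%classic `<=` P.
Proof. by move=> r; rewrite /= !in_itv/= andbT => /andP[]. Qed.

Lemma weight_le (om1 om2 : R -> R) : measurable_fun P om1 -> (forall t, 0 < t -> 0 < om1 t) ->
  (forall t, 0 < t -> om1 t <= om2 t) -> weight om2 -> weight om1.
Proof.
move=> m1 p1 le [m2 p2 i2]; split => // K K0; apply: le_lt_trans (i2 K K0).
have m (om : R -> R) : measurable_fun P om -> measurable_fun (`]0%R, K]%classic : set R) (EFin \o om).
  move=> mo; apply/measurable_EFinP; apply: measurable_funS; [|exact: (@itvoc_sub_pos K)|exact: mo].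
  exact: measurable_itv.
apply: ge0_le_integral => //.
- by move=> t /itvoc_sub_pos; rewrite /= in_itv/= andbT => t0; rewrite lee_fin ltW// p1.
- exact: m.
- exact: m.
- by move=> t /itvoc_sub_pos; rewrite /= in_itv/= andbT => t0; rewrite lee_fin le.
Qed.

End weights.

(** * Weighted integrals over the cylinder *)

Section support.
Context {R : realType} (d : nat).
Local Notation Z := ('rV[R]_d * R)%type.

Definition sbox (M : R) : set Z := cbox (const_mx (- M), - M) (const_mx M, M).

Lemma sboxP M (z : Z) : sbox M z <-> forall i, `|coZ i z| <= M.
Proof.
split=> H i; have := H i; case: i => [i|] /=; rewrite ?mxE ?ler_norml//;
by rewrite ler_norml.
Qed.

Lemma compact_sbox M : compact (sbox M). Proof. exact: cbox_compact. Qed.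
Lemma closed_sbox M : closed (sbox M). Proof. apply: test_fun_compact_closed; exact: compact_sbox. Qed.

Definition bsupp (f : Z -> R) := exists2 M, 0 < M & forall z, ~ sbox M z -> f z = 0.

Lemma bsupp_bounded_set f : bsupp f <-> bounded_set [set z | f z != 0].
Proof.
split=> [[M M0 hM]|[M [_ hM]]].
  exists M; split; first by rewrite num_real.
  move=> N MN z /= fz; have zM : sbox M z by apply: contrapT => /hM fz0; rewrite fz0 eqxx in fz.
  move/sboxP : zM => H; rewrite (le_trans _ (ltW MN))// /Num.norm/= ge_max.
  apply/andP; split; last exact: (H None).
  rewrite [leLHS]/Num.norm/= mx_normrE; apply: bigmax_le; first exact: ltW.
  by move=> [i j] _ /=; rewrite (ord1 i); exact: (H (Some j)).
exists (`|M| + 1); first by rewrite ltr_wpDl.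
move=> z /sboxP nz; apply: contrapT => /eqP fz; apply: nz.
have := hM (`|M| + 1); rewrite (le_lt_trans (ler_norm M)) ?ltrDl// => /(_ isT z fz).
rewrite /Num.norm/= ge_max => /andP[h1 h2] [i|] //=.
exact: le_trans (coord_le_norm _ _) h1.
Qed.

Lemma bsupp_bounded f : continuous f -> bsupp f -> exists2 C, 0 <= C & forall z, `|f z| <= C.
Proof. by move=> cf [M _ hM]; apply: (compact_support_bounded (@compact_sbox M)). Qed.

Lemma bsupp_derive f v : bsupp f -> bsupp ('D_v f).
Proof.
move=> [M M0 hM]; exists M => // z; apply: derive_eq0_out => //; exact: closed_sbox.
Qed.

Lemma bsuppD (a : R) f g : bsupp f -> bsupp g -> bsupp (f + a *: g).
Proof.
move=> [M M0 hM] [N N0 hN]; exists (Num.max M N); first by rewrite lt_max M0.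
move=> z nz; rewrite !fctE hM ?hN ?scaler0 ?addr0// => /sboxP H; apply: nz; apply/sboxP => i;
by rewrite le_max H ?orbT.
Qed.

Lemma bsuppM f g : bsupp f -> bsupp (f \* g).
Proof. by move=> [M M0 hM]; exists M => // z /hM /= ->; rewrite mul0r. Qed.

Lemma bsupp_tail f : bsupp f -> exists2 M, 0 < M & forall x t, M < t -> f (x, t) = 0.
Proof.
move=> [M M0 hM]; exists M => // x t Mt; apply: hM => /sboxP /(_ None) /=.
by rewrite leNgt (lt_le_trans Mt)// ler_norm.
Qed.

Lemma gradz_slices (f : Z -> R) x t : smooth f ->
  gradz f (x, t) = (gradx (fun x => f (x, t)) x, 'D_1 (fun t => f (x, t)) t).
Proof.
move=> sf; congr pair.
  apply/rowP => i; rewrite !mxE.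
  have H (h : R) : (h *: delta_mx ord0 i + x, t) = h *: ((delta_mx ord0 i, 0) : Z) + (x, t).
    by congr pair; rewrite /= scaler0 add0r.
  by have [_ ->] := @derive_affine R 'rV[R]_d Z f (fun x => (x, t)) _ _ x H.
have H (h : R) : (x, h *: (1 : R) + t) = h *: ((0, 1) : Z) + (x, t).
  by congr pair; rewrite /= scaler0 add0r.
by have [_ ->] := @derive_affine R R Z f (fun t => (x, t)) _ _ t H.
Qed.

Lemma smooth_slice_t (f : Z -> R) x : smooth f -> smooth (fun t => f (x, t)).
Proof.
apply: (@smooth_affine R R Z f (fun t => (x, t)) (fun t => (0, t))).
  by move=> t; exact: (cvg_pair (@cst_continuous _ _ x t) cvg_id).
by move=> h v t; congr pair; rewrite /= scaler0 add0r.
Qed.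

Lemma coZ_gradz (f : Z -> R) i z : coZ i (gradz f z) =
  'D_(if i is Some j then ((delta_mx ord0 j, 0) : Z) else (0, 1)) f z.
Proof. by case: i => [i|] //=; rewrite mxE. Qed.

Lemma gradz_lin (f g : Z -> R) (a : R) : smooth f -> smooth g ->
  gradz (f + a *: g) = gradz f + a *: gradz g.
Proof.
move=> sf sg; apply/funext => z; rewrite /gradz !fctE /GRing.scale/= /GRing.add/=.
have D v := derive_lin a (smooth_derivable (x := z) (v := v) sf) (smooth_derivable (x := z) (v := v) sg).
congr pair; last by rewrite D.
by apply/rowP => i; rewrite !mxE D.
Qed.

End support.

Section cylinder_integrals.
Context {R : realType} (d : nat) (Omega : set 'rV[R]_d).
Hypotheses (oO : open Omega) (bO : bounded_set Omega).
Local Notation Z := ('rV[R]_d * R)%type.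
Local Notation ZM := ('rV[R]_d * measurableTypeR R)%type.
Local Notation leb1 := (@lebesgue_measure R).
Local Notation P := (`]0%R, +oo[%classic : set R).
Local Notation mu := (@leb R d \x leb1)%E.
Local Notation Q := (cyl Omega).

Let mO : measurable Omega := open_measurableV oO.
Let mP : @measurable _ (measurableTypeR R) P. Proof. exact: measurable_itv. Qed.

Lemma measurable_cyl : measurable (Q : set ZM).
Proof. exact: measurableX. Qed.

Lemma open_cyl : open (Q : set Z).
Proof.
rewrite (_ : Q = fst @^-1` Omega `&` snd @^-1` `]0%R, +oo[%classic)//.
apply: openI; apply: open_comp => //.
- by move=> z _; exact: cvg_fst.
- by move=> z _; exact: cvg_snd.
Qed.

Lemma cylP x t : Q (x, t) <-> Omega x /\ 0 < t.
Proof. by rewrite /cyl; split=> [[/= Ox]|[Ox t0]]; [rewrite in_itv/= andbT|split => //=; rewrite in_itv/= andbT]. Qed.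

Lemma cyl_pos z : Q z -> 0 < z.2.
Proof. by case: z => x t /cylP[]. Qed.

Definition wt (om : R -> R) (z : Z) : R := om z.2.

Lemma measurable_wt om : measurable_fun P om -> measurable_fun (Q : set ZM) (wt om).
Proof.
move=> mom; apply: (@measurable_comp _ _ _ _ _ _ P om Q snd) => //.
  by move=> _ [[x t] /cylP[_ t0] <-]; rewrite /= in_itv/= andbT.
by apply: measurable_funTS; exact: measurable_snd.
Qed.

Definition iQ (om : R -> R) (f : Z -> R) : \bar R := (\int[mu]_(z in Q) (om z.2 * f z)%:E)%E.

Section fixed_weight.
Context (om : R -> R) (wom : weight om).
Let mom : measurable_fun P om. Proof. by case: wom. Qed.
Let om0 t : 0 < t -> 0 < om t. Proof. by case: wom => _ + _; exact. Qed.

Section nonneg.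
Context (f : Z -> R) (mf : measurable_fun [set: ZM] f) (f0 : forall z, 0 <= f z).

Lemma measurable_iQ : measurable_fun (Q : set ZM) (fun z => (om z.2 * f z)%:E).
Proof.
apply/measurable_EFinP; apply: measurable_funM; first exact: (measurable_wt mom).
exact: measurable_funTS.
Qed.

Lemma iQ_integrand_ge0 z : Q z -> (0 <= (om z.2 * f z)%:E)%E.
Proof. by move=> /cyl_pos z0; rewrite lee_fin mulr_ge0// ltW// om0. Qed.

Lemma iQ_ge0 : (0 <= iQ om f)%E.
Proof. by apply: integral_ge0 => z; exact: iQ_integrand_ge0. Qed.

Lemma iQ_tonelli1 : iQ om f = (\int[leb d]_(x in Omega) \int[leb1]_(t in P) (om t * f (x, t))%:E)%E.
Proof.
exact: (@tonelli1 _ _ _ 'rV[R]_d (measurableTypeR R) (leb d) leb1 Omega P mO mP _ measurable_iQ iQ_integrand_ge0).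
Qed.

Lemma measurable_iQ_tonelli1 : measurable_fun Omega (fun x => \int[leb1]_(t in P) (om t * f (x, t))%:E)%E.
Proof.
exact: (@measurable_tonelli1 _ _ _ 'rV[R]_d (measurableTypeR R) leb1 Omega P mO mP _ measurable_iQ iQ_integrand_ge0).
Qed.

Lemma measurable_slice_x t : measurable_fun Omega (fun x => (f (x, t))%:E).
Proof.
apply/measurable_EFinP; apply: measurable_funTS.
exact: (measurableT_comp mf (measurable_fun_pair (@measurable_id _ _ _) (measurable_cst t))).
Qed.

Lemma measurable_slice_tt x (D : set (measurableTypeR R)) : measurable_fun D (fun t => f (x, t)).
Proof.
apply: measurable_funTS.
exact: (measurableT_comp mf (measurable_fun_pair (measurable_cst x) (@measurable_id _ _ _))).
Qed.

Lemma iQ_tonelli2 : iQ om f = (\int[leb1]_(t in P) ((om t)%:E * \int[leb d]_(x in Omega) (f (x, t))%:E))%E.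
Proof.
rewrite /iQ (@tonelli2 _ _ _ 'rV[R]_d (measurableTypeR R) (leb d) leb1 Omega P mO mP _ measurable_iQ iQ_integrand_ge0).
apply: eq_integral => t /set_mem; rewrite /= in_itv/= andbT => t0.
by rewrite -ge0_integralZl_EFin//; first [exact: measurable_slice_x|by rewrite ltW// om0|by move=> x _; rewrite lee_fin].
Qed.

Lemma measurable_int_x : measurable_fun P (fun t => \int[leb d]_(x in Omega) (f (x, t))%:E)%E.
Proof.
have m : measurable_fun (Q : set ZM) (EFin \o f) by apply/measurable_EFinP; exact: measurable_funTS.
by apply: (@measurable_tonelli2 _ _ _ 'rV[R]_d (measurableTypeR R) (leb d) Omega P mO mP _ m) => z _; rewrite lee_fin.
Qed.

End nonneg.

Lemma iQ_le (f g : Z -> R) : measurable_fun [set: ZM] f -> measurable_fun [set: ZM] g -> (forall z, 0 <= f z) ->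
  (forall z, Q z -> f z <= g z) -> (iQ om f <= iQ om g)%E.
Proof.
move=> mf mg f0 fg; apply: ge0_le_integral.
- exact: measurable_cyl.
- by move=> z; exact: iQ_integrand_ge0.
- exact: measurable_iQ.
- exact: measurable_iQ.
- by move=> z Qz; rewrite lee_fin ler_wpM2l ?fg// ltW// om0// cyl_pos.
Qed.

Lemma iQD (f g : Z -> R) : measurable_fun [set: ZM] f -> measurable_fun [set: ZM] g ->
  (forall z, 0 <= f z) -> (forall z, 0 <= g z) -> (iQ om (fun z => f z + g z)%R = iQ om f + iQ om g)%E.
Proof.
move=> mf mg f0 g0; rewrite /iQ -ge0_integralD//.
- by apply: eq_integral => z _; rewrite mulrDr EFinD.
- exact: measurable_cyl.
- exact: iQ_integrand_ge0.
- exact: measurable_iQ.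
- exact: iQ_integrand_ge0.
- exact: measurable_iQ.
Qed.

Lemma iQZ (c : R) (f : Z -> R) : measurable_fun [set: ZM] f -> (forall z, 0 <= f z) -> 0 <= c ->
  (iQ om (fun z => c * f z)%R = c%:E * iQ om f)%E.
Proof.
move=> mf f0 c0; rewrite /iQ -ge0_integralZl_EFin//.
- by apply: eq_integral => z _; rewrite mulrCA EFinM.
- exact: measurable_cyl.
- exact: iQ_integrand_ge0.
- exact: measurable_iQ.
Qed.

Lemma iQ_bounded_lty (f : Z -> R) (C M : R) : measurable_fun [set: ZM] f -> (forall z, 0 <= f z <= C) -> 0 < M ->
  (forall x t, M < t -> f (x, t) = 0) -> (iQ om f < +oo)%E.
Proof.
move=> mf fC M0 fM; have f0 z : 0 <= f z by have /andP[] := fC z.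
have C0 : 0 <= C by have /andP[] := fC (0, 0); exact: le_trans.
have [_ _ /(_ M M0) iom] := wom.
have mcm : measurable_fun P (fun t => (C * om t)%:E) by apply/measurable_EFinP; exact: measurable_funM.
rewrite iQ_tonelli1//.
pose B := (\int[leb1]_(t in `]0%R, M]) (C * om t)%:E)%E.
have BE : B = (C%:E * \int[leb1]_(t in `]0%R, M]) (om t)%:E)%E.
  rewrite /B -ge0_integralZl_EFin//; last 2 first.
  - by move=> t /itvoc_sub_pos; rewrite /= in_itv/= andbT => t0; rewrite lee_fin ltW// om0.
  - apply/measurable_EFinP; apply: measurable_funS; [|exact: (@itvoc_sub_pos R M)|exact: mom]; exact: measurable_itv.
apply: (@le_lt_trans _ _ (\int[leb d]_(x in Omega) B)%E); last first.
  have -> : (\int[leb d]_(x in Omega) B = B * leb d Omega)%E by exact: (integral_cst (leb d) mO B).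
  rewrite BE; apply: lte_mul_pinfty.
  - by rewrite mule_ge0// ?lee_fin// integral_ge0// => t /itvoc_sub_pos; rewrite /= in_itv/= andbT => t0; rewrite lee_fin ltW// om0.
  - rewrite fin_numM// ge0_fin_numE// integral_ge0// => t /itvoc_sub_pos; rewrite /= in_itv/= andbT => t0.
    by rewrite lee_fin ltW// om0.
  - exact: leb_bounded_lty.
apply: ge0_le_integral => //.
- move=> x _; apply: integral_ge0 => t; rewrite /= in_itv/= andbT => t0; rewrite lee_fin mulr_ge0// ltW// om0//.
- exact: measurable_iQ_tonelli1.
move=> x _; rewrite /B integral_mkcond [leRHS]integral_mkcond; apply: ge0_le_integral => //.
- move=> t _; rewrite patchE; case: ifP => // /set_mem; rewrite /= in_itv/= andbT => t0.
  by rewrite lee_fin mulr_ge0// ltW// om0.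
- apply/(measurable_restrictT _ mP); apply/measurable_EFinP; apply: measurable_funM => //.
  exact: measurable_slice_tt.
- apply/(measurable_restrictT _ (measurable_itv _)).
  apply: measurable_funS; [|exact: (@itvoc_sub_pos R M)|exact: mcm]; exact: measurable_itv.
move=> t _; rewrite !patchE; case: ifPn => [/set_mem|].
  rewrite /= in_itv/= andbT => t0; have [tM|Mt] := leP t M.
    rewrite mem_set/= ?in_itv/= ?t0// lee_fin mulrC ler_wpM2r ?(ltW (om0 t0))//.
    by have /andP[] := fC (x, t).
  rewrite fM// mulr0; case: ifP => // _; rewrite lee_fin mulr_ge0// ltW// om0//.
move=> nt; case: ifP => // /set_mem /itvoc_sub_pos /mem_set tP.
by rewrite tP in nt.
Qed.

Local Notation EQ cs := (EL2 mu Q cs (wt om)).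

Lemma bsupp_EQ f : continuous f -> bsupp f -> EQ coordR f.
Proof.
move=> cf sf; have mf := continuous_measurableZ cf.
split; first by move=> i; exact: measurable_funTS.
have [C C0 hC] := bsupp_bounded cf sf; have [M M0 hM] := bsupp_tail sf.
have := @iQ_bounded_lty (fun z => f z ^+ 2) (C ^+ 2) M.
rewrite /iQ /sqint => H; under eq_integral do rewrite dotcR -expr2 /wt; apply: H => //.
- exact: measurable_funX.
- move=> z; rewrite sqr_ge0/= -[leLHS]real_normK ?num_real// lerXn2r ?nnegrE//.
- by move=> x t /hM ->; rewrite expr0n.
Qed.

Lemma bsupp_grad_EQ f : smooth f -> bsupp f -> EQ (coordZ d) (gradz f).
Proof.
move=> sf bf; apply: EL2_ofco.
- exact: measurable_cyl.
- exact: measurable_wt.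
- by move=> z /cyl_pos; exact: om0.
move=> i; rewrite (_ : (fun x => _) = 'D_(if i is Some j then ((delta_mx ord0 j, 0) : Z) else (0, 1)) f); last first.
  by apply/funext => z; exact: coZ_gradz.
apply: bsupp_EQ; last exact: bsupp_derive.
by apply: smooth_cont; exact: smooth_derive.
Qed.

End fixed_weight.

Lemma admissibleP (phi : Z -> R) : admissible Omega phi <->
  [/\ smooth phi, bsupp phi & forall x t, boundary Omega x -> 0 < t -> phi (x, t) = 0].
Proof. by split=> -[? /bsupp_bounded_set ? ?]; split. Qed.

Lemma admissible_lin (a : R) phi psi : admissible Omega phi -> admissible Omega psi ->
  admissible Omega (phi + a *: psi).
Proof.
move=> /admissibleP[s1 b1 z1] /admissibleP[s2 b2 z2]; apply/admissibleP; split.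
- exact: (smoothD s1 (smoothZ a s2)).
- exact: bsuppD.
- by move=> x t bx t0; rewrite !fctE z1// z2// scaler0 addr0.
Qed.

End cylinder_integrals.

(** * Friedrichs' and trace inequalities on the cylinder *)

Section slice_inequalities.
Context {R : realType} (d : nat) (Omega : set 'rV[R]_d).
Hypotheses (d0 : (0 < d)%N) (oO : open Omega) (bO : bounded_set Omega) (nO : Omega !=set0).
Local Notation Z := ('rV[R]_d * R)%type.
Local Notation ZM := ('rV[R]_d * measurableTypeR R)%type.
Local Notation leb1 := (@lebesgue_measure R).
Local Notation P := (`]0%R, +oo[%classic : set R).
Local Notation lam := (lambda1 Omega).

Let mO : measurable Omega := open_measurableV oO.
Let mP : @measurable _ (measurableTypeR R) P. Proof. exact: measurable_itv. Qed.
Let lam0 : 0 < lam. Proof. exact: lambda1_gt0. Qed.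

Definition dxsq (f : Z -> R) (z : Z) : R := dot (gradz f z).1 (gradz f z).1.
Definition dtsq (f : Z -> R) (z : Z) : R := (gradz f z).2 ^+ 2.
Definition gsq (f : Z -> R) (z : Z) : R := dotz (gradz f z) (gradz f z).

Lemma dxsq_ge0 f z : 0 <= dxsq f z. Proof. by rewrite /dxsq dotE dotc_ge0. Qed.
Lemma dtsq_ge0 f z : 0 <= dtsq f z. Proof. exact: sqr_ge0. Qed.
Lemma gsqE f z : gsq f z = dxsq f z + dtsq f z. Proof. by rewrite /gsq /dotz -expr2. Qed.
Lemma gsq_ge0 f z : 0 <= gsq f z.
Proof. by rewrite gsqE addr_ge0 ?dxsq_ge0 ?dtsq_ge0. Qed.

Lemma continuous_dxsq f : smooth f -> continuous (dxsq f).
Proof.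
move=> sf; rewrite (_ : dxsq f = fun x => \sum_(i < d) 'D_((delta_mx ord0 i, 0) : Z) f x * 'D_((delta_mx ord0 i, 0) : Z) f x).
  apply: (@smooth_cont R); rewrite unlock /=; elim: (index_enum _) => [|i r IH] /=; first exact: smooth_cst.
  apply: (smoothD _ IH); apply: smoothM; exact: smooth_derive.
by apply/funext => x; apply: eq_bigr => i _; rewrite !mxE.
Qed.

Lemma continuous_dtsq f : smooth f -> continuous (dtsq f).
Proof.
move=> sf; apply: (@smooth_cont R).
rewrite (_ : dtsq f = 'D_((0, 1) : Z) f \* 'D_((0, 1) : Z) f); last by apply/funext => z; rewrite /dtsq expr2.
by apply: smoothM; exact: smooth_derive.
Qed.

Lemma measurable_dxsq f : smooth f -> measurable_fun [set: ZM] (dxsq f).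
Proof. by move=> /continuous_dxsq; exact: continuous_measurableZ. Qed.
Lemma measurable_dtsq f : smooth f -> measurable_fun [set: ZM] (dtsq f).
Proof. by move=> /continuous_dtsq; exact: continuous_measurableZ. Qed.
Lemma measurable_gsq f : smooth f -> measurable_fun [set: ZM] (gsq f).
Proof.
move=> sf; rewrite (_ : gsq f = dxsq f \+ dtsq f); last by apply/funext => z; rewrite gsqE.
by apply: measurable_funD; [exact: measurable_dxsq|exact: measurable_dtsq].
Qed.
Lemma measurable_sq f : smooth f -> measurable_fun [set: ZM] (fun z => f z ^+ 2).
Proof. by move=> /smooth_cont /continuous_measurableZ h; exact: measurable_funX. Qed.

Lemma iQ_gsq om f : weight om -> smooth f -> iQ Omega om (gsq f) = (iQ Omega om (dxsq f) + iQ Omega om (dtsq f))%E.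
Proof.
move=> wom sf; have -> : gsq f = (fun z => dxsq f z + dtsq f z)%R by apply/funext => z; rewrite gsqE.
apply: iQD => //.
- exact: measurable_dxsq.
- exact: measurable_dtsq.
- exact: dxsq_ge0.
- exact: dtsq_ge0.
Qed.

(** Friedrichs' inequality on each slice, integrated in t: a weight depending on t alone passes
    through. *)
Lemma friedrichs_cyl om phi : weight om -> admissible Omega phi ->
  (lam%:E * iQ Omega om (fun z => (phi z) ^+ 2)%R <= iQ Omega om (dxsq phi))%E.
Proof.
move=> wom /admissibleP[sf bf zf].
have [mom om0 _] := wom.
rewrite (iQ_tonelli2 oO wom (measurable_sq sf)); last by move=> z; exact: sqr_ge0.
rewrite (iQ_tonelli2 oO wom (measurable_dxsq sf)); last exact: dxsq_ge0.
have q0 (t : R) : (0 <= \int[leb d]_(x in Omega) ((phi (x, t)) ^+ 2)%:E)%E.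
  by apply: integral_ge0 => x _; rewrite lee_fin sqr_ge0.
have g0 (t : R) : (0 <= \int[leb d]_(x in Omega) (dxsq phi (x, t))%:E)%E.
  by apply: integral_ge0 => x _; rewrite lee_fin dxsq_ge0.
have m1 : measurable_fun P (fun t => (om t)%:E * \int[leb d]_(x in Omega) ((phi (x, t)) ^+ 2)%:E)%E.
  apply: emeasurable_funM; first exact/measurable_EFinP.
  by apply: (measurable_int_x oO (measurable_sq sf)) => z; exact: sqr_ge0.
have m2 : measurable_fun P (fun t => (om t)%:E * \int[leb d]_(x in Omega) (dxsq phi (x, t))%:E)%E.
  apply: emeasurable_funM; first exact/measurable_EFinP.
  by apply: (measurable_int_x oO (measurable_dxsq sf)); exact: dxsq_ge0.
rewrite -ge0_integralZl_EFin ?(ltW lam0)//; last first.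
  by move=> t; rewrite /= in_itv/= andbT => t0; rewrite mule_ge0// lee_fin ltW// om0.
apply: ge0_le_integral => //.
- by move=> t; rewrite /= in_itv/= andbT => t0; rewrite !mule_ge0// lee_fin ltW// om0.
- by apply: emeasurable_funM => //; exact: measurable_cst.
move=> t; rewrite /= in_itv/= andbT => t0; rewrite muleCA lee_wpmul2l ?lee_fin ?(ltW (om0 _ t0))//.
apply: (le_trans (friedrichs d0 oO bO nO (smooth_sliceZ t sf) _)).
  by move=> x bx; exact: zf.
rewrite le_eqVlt; apply/orP; left; apply/eqP; apply: eq_integral => x _.
by rewrite /dxsq gradz_slices.
Qed.

Lemma friedrichs_cyl_gsq om phi : weight om -> admissible Omega phi ->
  (lam%:E * iQ Omega om (fun z => (phi z) ^+ 2)%R <= iQ Omega om (gsq phi))%E.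
Proof.
move=> wom aphi; have [sf _ _] := aphi.
apply: (le_trans (friedrichs_cyl wom aphi)); rewrite iQ_gsq// leeDl//.
by apply: iQ_ge0 => //; exact: dtsq_ge0.
Qed.

Definition trsq (phi : Z -> R) (t : R) : \bar R := (\int[leb d]_(x in Omega) ((phi (x, t)) ^+ 2)%:E)%E.

Lemma trace_cyl (s : R) phi : 0 < s -> s < 1 -> admissible Omega phi ->
  ((C_s s * lam `^ s)%:E * trsq phi 0 <= iQ Omega (fun t : R => t `^ (1 - 2 * s))%R (gsq phi))%E.
Proof.
move=> s0 s1 aphi; have [sf bf zf] := aphi.
have wom : weight (fun t : R => t `^ (1 - 2 * s)) by apply: weight_powR; lra.
have [M M0 hM] := bsupp_tail (let: And3 _ b _ := (admissibleP _ _).1 aphi in b).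
have [mom om0 _] := wom.
have mq := measurable_sq sf; have mt := measurable_dtsq sf.
have lq0 z : 0 <= lam * phi z ^+ 2 by rewrite mulr_ge0 ?sqr_ge0// ltW.
have mlq : measurable_fun [set: ZM] (fun z => lam * phi z ^+ 2) by exact: measurable_funM.
(* Friedrichs' inequality trades the x-gradient for lambda1 phi^2, which leaves a one-dimensional
   integrand on each line x = const. *)
apply: (@le_trans _ _ (iQ Omega (fun t : R => t `^ (1 - 2 * s))%R (fun z => dtsq phi z + lam * phi z ^+ 2)%R)); last first.
  rewrite iQD//; last exact: dtsq_ge0.
  rewrite iQ_gsq// addeC leeD2r// iQZ ?(ltW lam0)//; last by move=> z; exact: sqr_ge0.
  exact: friedrichs_cyl.
have m12 : measurable_fun [set: ZM] (fun z => dtsq phi z + lam * phi z ^+ 2) by exact: measurable_funD.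
have p12 z : 0 <= dtsq phi z + lam * phi z ^+ 2 by rewrite addr_ge0 ?dtsq_ge0.
rewrite (iQ_tonelli1 oO wom m12 p12).
have Cl : 0 <= C_s s * lam `^ s by rewrite mulr_ge0 ?powR_ge0// ltW// C_s_gt0.
rewrite /trsq -ge0_integralZl_EFin//; last 2 first.
- by move=> x _; rewrite lee_fin sqr_ge0.
- exact: (measurable_slice_x mq).
apply: ge0_le_integral => //.
- by move=> x _; rewrite mule_ge0// lee_fin sqr_ge0.
- apply: emeasurable_funM; first exact: measurable_cst.
  exact: (measurable_slice_x mq).
- exact: (measurable_iQ_tonelli1 oO wom m12 p12).
move=> x _.
pose c := Num.sqrt lam.
have c0 : 0 < c by rewrite sqrtr_gt0.
have c2 : c ^+ 2 = lam by rewrite sqr_sqrtr// ltW.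
have cs : c `^ (2 * s) = lam `^ s by rewrite powRrM powR_mulrn ?(ltW c0)// c2.
have := trace_1d s0 s1 c0 (T := M + 1) (smooth_slice_t x sf).
rewrite cs c2 -EFinM => H; apply: (le_trans (H _)).
  by move=> t Mt; apply: hM; rewrite (lt_le_trans _ Mt)// ltrDl.
rewrite le_eqVlt; apply/orP; left; apply/eqP; apply: eq_integral => t _.
by rewrite /dtsq gradz_slices.
Qed.

(** Weighted Cauchy-Schwarz on ]0, c] for v' against 1/om: their pairing is the plain integral of
    v', and the square norm of 1/om is I. *)
Lemma cs_weight_segment (om v : R -> R) (c I : R) : weight om -> weight (fun t => (om t)^-1) ->
  0 < c -> smooth v ->
  (\int[leb1]_(t in `]0%R, c]) ((om t)^-1)%:E = I%:E)%E ->
  (((v c - v 0) ^+ 2)%:E <= I%:E * \int[leb1]_(t in P) (om t * ('D_1 v t) ^+ 2)%:E)%E.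
Proof.
move=> wom [mi _ _] c0 sv EI; have [mom om0 iom] := wom.
have cdv : continuous ('D_(1 : R) v) by apply: smooth_cont; exact: smooth_derive.
pose D : set R := `]0%R, c]%classic.
have mD : @measurable _ (measurableTypeR R) D by exact: measurable_itv.
have DP : D `<=` P by exact: itvoc_sub_pos.
have D0 (t : R) : D t -> 0 < t by move=> /DP; rewrite /= in_itv/= andbT.
have mW : measurable_fun D om by apply: measurable_funS DP mom.
have W0 t : D t -> 0 < om t by move=> /D0; exact: om0.
have miv : measurable_fun D (fun t => (om t)^-1) by apply: measurable_funS DP mi.
pose iom1 (t : R) := (om t)^-1.
have Ei : EL2 leb1 D coordR om iom1.
  split; first by case.
  apply: (@le_lt_trans _ _ I%:E); last exact: ltry.
  rewrite -EI le_eqVlt; apply/orP; left; apply/eqP; apply: eq_integral => t /set_mem Dt.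
  by rewrite dotcR mulrA divff ?mul1r// gt_eqF// W0.
have [K hK] : exists K, forall t, D t -> `|'D_1 v t| <= K.
  have : compact ('D_(1 : R) v @` `[0%R, c]).
    by apply: continuous_compact; [exact: continuous_subspaceT|exact: segment_compact].
  move=> /compact_bounded[M [_ hM]]; exists (`|M| + 1) => t; rewrite /D/= in_itv/= => /andP[t0 tc].
  apply: (hM (`|M| + 1)); first by rewrite (le_lt_trans (ler_norm M))// ltrDl.
  by exists t => //; rewrite /= in_itv/= (ltW t0).
have Ev : EL2 leb1 D coordR om ('D_(1 : R) v).
  apply: (EL2_bounded mD mW W0 (iom c c0) _ hK).
  exact: continuous_measurable1.
have := ph_CS2 (prehilbert_L2 leb1 mD coordR mW W0) Ei Ev.
have -> : ip leb1 D coordR om iom1 ('D_(1 : R) v) = v c - v 0.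
  rewrite -(FTC_smooth (ltW c0) sv) /Rintegral; congr fine.
  rewrite -integral_itv_obnd_cbnd; last first.
    by apply/measurable_EFinP; exact: continuous_measurable1.
  apply: eq_integral => t /set_mem Dt.
  by rewrite dotcR mulrA divff ?mul1r// gt_eqF// W0.
have -> : ip leb1 D coordR om iom1 iom1 = I.
  rewrite /ip /Rintegral -[RHS]/(fine I%:E) -EI; congr fine; apply: eq_integral => t /set_mem Dt.
  by rewrite dotcR mulrA divff ?mul1r// gt_eqF// W0.
move=> H; apply: (@le_trans _ _ (I%:E * (ip leb1 D coordR om ('D_(1 : R) v) ('D_(1 : R) v))%:E)%E).
  by rewrite -EFinM lee_fin.
rewrite -(ip_EFin mD mW W0 Ev).
have I0 : (0 <= I%:E)%E by rewrite -EI integral_ge0// => t Dt; rewrite lee_fin invr_ge0 ltW// W0.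
rewrite lee_wpmul2l//.
apply: (@le_trans _ _ (\int[leb1]_(t in D) (om t * ('D_1 v t) ^+ 2)%:E)%E).
  rewrite le_eqVlt; apply/orP; left; apply/eqP; apply: eq_integral => t _.
  by rewrite dotcR expr2.
apply: ge0_subset_integral => //.
- apply/measurable_EFinP; apply: measurable_funM => //.
  apply: measurable_funX; exact: continuous_measurable1.
- by move=> t; rewrite /= in_itv/= andbT => t0; rewrite lee_fin mulr_ge0 ?sqr_ge0// ltW// om0.
Qed.

(** Bounds how far the trace moves when a function is shifted by [c]; the factor is small with [c]
    because 1/om is integrable near 0. *)
Lemma trace_shift (om : R -> R) phi (c : R) : weight om -> weight (fun t => (om t)^-1) ->
  0 < c -> admissible Omega phi ->
  (\int[leb d]_(x in Omega) ((phi (x, c) - phi (x, 0)) ^+ 2)%:E <=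
   (\int[leb1]_(t in `]0%R, c]) ((om t)^-1)%:E) * iQ Omega om (gsq phi))%E.
Proof.
move=> wom wi c0 [sf _ _]; have [mom om0 _] := wom; have [mi i0 /(_ c c0) ic] := wi.
have I0 : (0 <= \int[leb1]_(t in `]0%R, c]) ((om t)^-1)%:E)%E.
  by apply: integral_ge0 => t /itvoc_sub_pos; rewrite /= in_itv/= andbT => t0; rewrite lee_fin ltW// i0.
have [I EI] : exists I : R, (\int[leb1]_(t in `]0%R, c]) ((om t)^-1)%:E = I%:E)%E.
  by exists (fine (\int[leb1]_(t in `]0%R, c]) ((om t)^-1)%:E)); rewrite fineK// ge0_fin_numE.
rewrite EI in I0 *.
apply: (@le_trans _ _ (I%:E * iQ Omega om (dtsq phi))%E); last first.
  rewrite lee_wpmul2l// iQ_gsq// leeDr//; apply: iQ_ge0 => //; exact: dxsq_ge0.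
have mt := measurable_dtsq sf.
rewrite (iQ_tonelli1 oO wom mt (dtsq_ge0 phi)).
have p0 x : (0 <= \int[leb1]_(t in P) (om t * dtsq phi (x, t))%:E)%E.
  by apply: integral_ge0 => t; rewrite /= in_itv/= andbT => t0; rewrite lee_fin mulr_ge0 ?dtsq_ge0// ltW// om0.
have mm : measurable_fun Omega (fun x => \int[leb1]_(t in P) (om t * dtsq phi (x, t))%:E)%E.
  exact: (measurable_iQ_tonelli1 oO wom mt (dtsq_ge0 phi)).
rewrite -ge0_integralZl_EFin//.
have mphi := continuous_measurableZ (smooth_cont sf).
have ms t : measurable_fun Omega (fun x => phi (x, t)).
  by apply/measurable_EFinP; exact: measurable_slice_x.
apply: ge0_le_integral => //.
- by move=> x _; rewrite lee_fin sqr_ge0.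
- apply/measurable_EFinP; apply: measurable_funX; exact: measurable_funB.
- by apply: emeasurable_funM => //; exact: measurable_cst.
move=> x _; apply: (le_trans (cs_weight_segment wom wi c0 (smooth_slice_t x sf) EI)).
have -> // : (\int[leb1]_(t in P) (om t * ('D_1 (fun t0 : R => phi (x, t0)) t) ^+ 2)%:E =
    \int[leb1]_(t in P) (om t * dtsq phi (x, t))%:E)%E.
by apply: eq_integral => t _; rewrite /dtsq gradz_slices.
Qed.

End slice_inequalities.

Lemma integrable_supp {R : realType} d (T : measurableType d) (mu : {measure set T -> \bar R})
  (A : set T) (f : T -> R) (C : R) : measurable A -> (mu A < +oo)%E -> measurable_fun setT f ->
  (forall x, `|f x| <= C) -> (forall x, ~ A x -> f x = 0) -> mu.-integrable setT (EFin \o f).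
Proof.
move=> mA Aoo mf fC f0; apply/integrableP; split; first exact/measurable_EFinP.
apply: (@le_lt_trans _ _ (\int[mu]_(x in A) C%:E)%E).
  rewrite [leRHS]integral_mkcond; apply: ge0_le_integral => //.
  - by apply/measurable_EFinP; apply: measurableT_comp.
  - by apply/(measurable_restrictT _ mA); exact: measurable_cst.
  move=> x _; rewrite patchE; case: ifPn => [_|/negP h].
    by rewrite lee_fin.
  by rewrite /= f0 ?normr0// => /mem_set.
have -> : (\int[mu]_(x in A) C%:E = C%:E * mu A)%E by exact: (integral_cst mu mA C%:E).
by rewrite lte_mul_pinfty// lee_fin (le_trans _ (fC point)).
Qed.

Lemma ae_mono {R : realType} d (T : measurableType d) (mu : {measure set T -> \bar R}) (A B : T -> Prop) :
  (forall x, A x -> B x) -> {ae mu, forall x, A x} -> {ae mu, forall x, B x}.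
Proof.
by move=> AB [N [mN N0 hN]]; exists N; split => // z hz; apply: hN => /= /AB.
Qed.

Lemma ae_all {R : realType} d (T : measurableType d) (mu : {measure set T -> \bar R}) (A : T -> Prop) :
  (forall x, A x) -> {ae mu, forall x, A x}.
Proof. by move=> A0; exists set0; split => // z /(_ (A0 z)). Qed.

(** * The fundamental lemma of the calculus of variations *)

Section int_derive.
Context {R : realType}.
Local Notation leb1 := (@lebesgue_measure R).

Lemma int_line0 (h : R -> R) (M : R) : 0 < M -> smooth h -> (forall t, M <= `|t| -> h t = 0) ->
  (\int[leb1]_t ('D_1 h t)%:E = 0)%E.
Proof.
move=> M0 sh h0.
have cd : continuous ('D_(1 : R) h) by apply: smooth_cont; exact: smooth_derive.
transitivity (\int[leb1]_(t in `[(- M)%R, M]) ('D_1 h t)%:E)%E.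
  rewrite [RHS]integral_mkcond; apply: eq_integral => t _; rewrite patchE; case: ifPn => // /negP nt.
  rewrite (@derive_eq0_out R R `[- M, M] h 1)//; first exact: interval_closed.
    move=> x nx; apply: h0; rewrite leNgt; apply/negP => hx; apply: nx.
    by rewrite /= in_itv/= -ler_norml ltW.
  by move=> /mem_set.
have MM : - M <= M by lra.
have i : leb1.-integrable `[- M, M]%classic (EFin \o 'D_(1 : R) h).
  by apply: continuous_compact_integrable; [exact: segment_compact|exact: continuous_subspaceT].
have E := FTC_smooth MM sh.
rewrite /Rintegral in E; rewrite -[LHS]fineK; last exact: integrable_fin_num.
by rewrite E !h0 ?subrr// ?normrN ler_norm.
Qed.

(** Fubini's theorem in the order that integrates the differentiated coordinate inside: [int_line0]
    if it is the first one, the induction hypothesis on the tail otherwise. *)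
Lemma int_derive_rV d (f : 'rV[R]_d -> R) (M : R) i : 0 < M -> smooth f ->
  (forall x, ~ vbox M x -> f x = 0) -> (\int[leb d]_x ('D_(delta_mx ord0 i) f x)%:E = 0)%E.
Proof.
move=> M0; elim: d f i => [|d IH] f i sf f0; first by case: i.
pose g := 'D_(delta_mx ord0 i) f.
have cg : continuous g by apply: smooth_cont; exact: smooth_derive.
have closed_vbox n (N : R) : closed (vbox N : set 'rV[R]_n).
  have := @vec_closed R n (const_mx (- N)) (const_mx N); congr closed.
  by apply/seteqP; split=> x H j; have := H j; rewrite !mxE ler_norml.
have compact_vbox n (N : R) : compact (vbox N : set 'rV[R]_n).
  have := @vec_compact R n (const_mx (- N)) (const_mx N); congr compact.
  by apply/seteqP; split=> x H j; have := H j; rewrite !mxE ler_norml.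
have g0 x : ~ vbox M x -> g x = 0 by exact: (derive_eq0_out _ (closed_vbox _ _) f0).
have [C C0 hC] := compact_support_bounded (compact_vbox _ M) cg g0.
have mg : measurable_fun setT g by exact: continuous_measurableV.
have ig : (leb d.+1).-integrable setT (EFin \o g).
  exact: (integrable_supp (measurable_vbox M) (leb_box_lty _ M) mg hC g0).
have mgc : measurable_fun [set: (measurableTypeR R * 'rV[R]_d)%type] (g \o @consrV R d).
  by apply: measurableT_comp => //; exact: measurable_consrV.
have igc : (leb1 \x leb d)%E.-integrable [set: (measurableTypeR R * 'rV[R]_d)%type] (EFin \o (g \o @consrV R d)).
  apply: (@integrable_supp R _ (measurableTypeR R * 'rV[R]_d)%type (leb1 \x leb d)%E ((`[- M, M]%classic : set (measurableTypeR R)) `*` (vbox M : set 'rV[R]_d)) (g \o @consrV R d) C) => //.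
  - by apply: measurableX; [exact: measurable_itv|exact: measurable_vbox].
  - pose J : set (measurableTypeR R) := `[- M, M]%classic.
    have E : ((leb1 \x leb d)%E (J `*` (vbox M : set 'rV[R]_d)) = leb1 J * leb d (vbox M))%E.
      by apply: product_measure1E; [exact: measurable_itv|exact: measurable_vbox].
    have : (leb1 J * leb d (vbox M) < +oo)%E.
      rewrite lte_mul_pinfty ?leb_box_lty//.
      by rewrite /J lebesgue_measure_itv/=; case: ifP.
    by rewrite -E; exact.
  - by move=> [t x] /=; exact: hC.
  - move=> [t x] /= nx; apply: g0 => H; apply: nx; split => [|j] /=;
    [by have := H ord0; rewrite consrV0/= in_itv/= ler_norml|by have := H (lift ord0 j); rewrite consrVS].
have E : (\int[leb d.+1]_x (g x)%:E = \int[leb1 \x leb d]_z (g (consrV z))%:E)%E.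
  have := @integral_pushforward _ _ (measurableTypeR R * 'rV[R]_d)%type 'rV[R]_d.+1 R (@consrV R d) (@measurable_consrV R d)
    (leb1 \x leb d)%E setT (EFin \o g) ((measurable_EFinP _ _).2 mg).
  rewrite preimage_setT => /(_ igc measurableT); exact.
rewrite E {E}.
have sM t : M < `|t| -> forall x : 'rV[R]_d, f (consrV (t, x)) = 0.
  move=> tM x; apply: f0 => /(_ ord0); rewrite consrV0/= leNgt tM//.
have [j ij|ij] := unliftP ord0 i.
  rewrite -(@integral12_prod_meas1 _ _ (measurableTypeR R) 'rV[R]_d R leb1 (leb d) (EFin \o (g \o @consrV R d)) igc).
  apply: integral0_eq => t _ /=.
  rewrite -[RHS](IH (fun x => f (consrV (t, x))) j (smooth_slice_tail t sf)).
    by apply: eq_integral => x _; rewrite derive_slice_tail /g ij.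
  move=> x nx; apply: f0 => H; apply: nx => k; by have := H (lift ord0 k); rewrite consrVS.
rewrite -(@integral21_prod_meas1 _ _ (measurableTypeR R) 'rV[R]_d R leb1 (leb d) (EFin \o (g \o @consrV R d)) igc).
apply: integral0_eq => x _ /=.
rewrite -[RHS](@int_line0 (fun t => f (consrV (t, x))) (M + 1)).
- by apply: eq_integral => t _; rewrite derive_slice_head /g ij.
- by rewrite addr_gt0.
- exact: smooth_slice_head.
- by move=> t tM; apply: sM; rewrite (lt_le_trans _ tM)// ltrDl.
Qed.

Context (d : nat).
Local Notation Z := ('rV[R]_d * R)%type.
Local Notation ZM := ('rV[R]_d * measurableTypeR R)%type.
Local Notation mu := (@leb R d \x leb1)%E.

Definition ebasis (i : option 'I_d) : Z := if i is Some j then (delta_mx ord0 j, 0) else (0, 1).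

Lemma measurable_sbox M : measurable (sbox M : set ZM).
Proof.
rewrite (_ : sbox M = \bigcap_(i in [set: option 'I_d]) [set z | `|coZ i z| <= M]); last first.
  by apply/seteqP; split => [z /sboxP h i _|z h]; [exact: h|apply/sboxP => i; exact: h].
apply: fin_bigcap_measurable => // i _; rewrite -[X in measurable X]setTI.
apply: (measurable_fun_ler (f := fun z : ZM => `|coZ i z|) (g := cst M)) => //.
by apply: measurableT_comp => //; exact: measurable_coZ.
Qed.

Lemma mu_sbox_lty M : (mu (sbox M : set ZM) < +oo)%E.
Proof.
apply: (@le_lt_trans _ _ (mu ((vbox M : set 'rV[R]_d) `*` (`[- M, M]%classic : set (measurableTypeR R))))).
  apply: le_measure; rewrite ?inE; first exact: measurable_sbox.
    by apply: measurableX; [exact: measurable_vbox|exact: measurable_itv].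
  move=> z /sboxP H; split; first by move=> i; exact: (H (Some i)).
  by rewrite /= in_itv/= -ler_norml; exact: (H None).
rewrite product_measure1E//=; [|exact: measurable_vbox].
rewrite muleC lte_mul_pinfty ?leb_box_lty//.
by rewrite lebesgue_measure_itv/=; case: ifP.
Qed.

Lemma integrable_bsupp (f : Z -> R) : continuous f -> bsupp f ->
  mu.-integrable [set: ZM] (EFin \o f).
Proof.
move=> cf bf; have [C C0 hC] := bsupp_bounded cf bf; have [M M0 hM] := bf.
exact: (integrable_supp (measurable_sbox M) (mu_sbox_lty M) (continuous_measurableZ cf) hC hM).
Qed.

Lemma int_derive_Z (f : Z -> R) i : smooth f -> bsupp f ->
  (\int[mu]_z ('D_(ebasis i) f z)%:E = 0)%E.
Proof.
move=> sf bf; have [M M0 hM] := bf.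
have sg := smooth_derive (ebasis i) sf.
have ig := integrable_bsupp (smooth_cont sg) (bsupp_derive (ebasis i) bf).
case: i sg ig => [i|] sg ig.
  rewrite -(@integral21_prod_meas1 _ _ 'rV[R]_d (measurableTypeR R) R (leb d) leb1 _ ig).
  apply: integral0_eq => t _ /=.
  rewrite -[RHS](@int_derive_rV d (fun x => f (x, t)) M i M0 (smooth_sliceZ t sf)).
    apply: eq_integral => x _; congr EFin.
    have /(congr1 (fun p : Z => p.1 ord0 i)) := gradz_slices x t sf; rewrite !mxE; exact.
  by move=> x nx; apply: hM => /sboxP H; apply: nx => k; exact: (H (Some k)).
rewrite -(@integral12_prod_meas1 _ _ 'rV[R]_d (measurableTypeR R) R (leb d) leb1 _ ig).
apply: integral0_eq => x _ /=.
rewrite -[RHS](@int_line0 (fun t => f (x, t)) (M + 1)).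
- by apply: eq_integral => t _; congr EFin; have /(congr1 (fun p : Z => p.2)) := gradz_slices x t sf.
- by rewrite addr_gt0.
- exact: smooth_slice_t.
- move=> t tM; apply: hM => /sboxP /(_ None) /=; rewrite leNgt (lt_le_trans _ tM)//.
  by rewrite ltrDl.
Qed.

End int_derive.

Section fundamental.
Context {R : realType} (d : nat).
Local Notation Z := ('rV[R]_d * R)%type.
Local Notation ZM := ('rV[R]_d * measurableTypeR R)%type.
Local Notation leb1 := (@lebesgue_measure R).
Local Notation mu := (@leb R d \x leb1)%E.

Definition oboxes : set (set Z) := [set obox p.1 p.2 | p in [set: Z * Z]].

Lemma oboxes_setI : setI_closed oboxes.
Proof.
move=> _ _ [[a b] _ <-] [[a' b'] _ <-] /=.
exists ((\row_i Num.max (a.1 ord0 i) (a'.1 ord0 i), Num.max a.2 a'.2),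
        (\row_i Num.min (b.1 ord0 i) (b'.1 ord0 i), Num.min b.2 b'.2)) => //=.
apply/seteqP; split=> [z H|z [H1 H2] i].
  by split=> i; have := H i; case: i => [i|] /=; rewrite ?mxE gt_max lt_min => /andP[/andP[h1 h2] /andP[h3 h4]]; apply/andP.
by have := H1 i; have := H2 i; case: i => [i|] /=; rewrite ?mxE gt_max lt_min => /andP[-> ->] /andP[-> ->].
Qed.

Lemma measurable_obox (a b : Z) : measurable (obox a b : set ZM).
Proof.
rewrite (_ : obox a b = \bigcap_(i in [set: option 'I_d]) ((coZ i) @^-1` `]coZ i a, coZ i b[)); last first.
  by apply/seteqP; split => [z h i _|z h i]; have := h i; rewrite /= in_itv/= //; exact.
apply: fin_bigcap_measurable => // i _; rewrite -[X in measurable X]setTI.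
by apply: (measurable_coZ i) => //; exact: measurable_itv.
Qed.

(** A half-space z_i > r is a countable union of boxes whose other sides grow, so the coordinates,
    and with them the identity, are measurable for the sigma-algebra of boxes. *)
Lemma gen_oboxes : @measurable _ ZM = <<s oboxes >>.
Proof.
apply/seteqP; split; last first.
  by apply: smallest_sub; [exact: sigma_algebra_measurable|move=> _ [[a b] _ <-]; exact: measurable_obox].
pose T := g_sigma_algebraType oboxes.
have mc i : @measurable_fun _ _ T (measurableTypeR R) setT (fun z => coZ i (z : Z)).
  apply: (measurability _ (RGenOInfty.measurableE R)).
  move=> _ [_ [r ->] <-]; rewrite setTI.
  pose a (n : nat) : Z := (\row_j (if i == Some j then r else - n%:R), if i == None then r else - n%:R).
  pose b (n : nat) : Z := (const_mx n%:R, n%:R).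
  rewrite (_ : _ @^-1` _ = \bigcup_n obox (a n) (b n)).
    apply: bigcup_measurable => n _; apply: sub_sigma_algebra.
    by exists (a n, b n).
  have ca n j : coZ j (a n) = if i == j then r else - n%:R by case: j => [j|] //=; rewrite mxE.
  have cb n j : coZ j (b n) = n%:R by case: j => [j|] //=; rewrite mxE.
  apply/seteqP; split=> [z|z [n _ H]]; rewrite /= in_itv/= andbT; last first.
    by have := H i; rewrite ca eqxx => /andP[].
  move=> rz; pose n := (Num.truncn (\sum_j `|coZ j z|)).+1.
  exists n => // j; rewrite ca cb.
  have : `|coZ j z| < n%:R.
    rewrite (le_lt_trans _ (truncnS_gt _))// (bigD1 j)//= lerDl.
    by apply: sumr_ge0.
  rewrite ltr_norml => /andP[h1 h2]; rewrite h2 andbT.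
  by case: eqVneq => // <-.
have mid : @measurable_fun _ _ T ZM setT (fun z : Z => z).
  rewrite (_ : (fun z => z) = fun z : Z => (z.1, z.2)); last by apply/funext => -[].
  apply: measurable_fun_pair; last exact: (mc None).
  apply: (@measurable_fun_rV R d _ T (fun z : Z => z.1)) => i; exact: (mc (Some i)).
by move=> A mA; have := mid measurableT A mA; rewrite setTI.
Qed.

(** Open boxes are stable under intersection and generate the sigma-algebra, so a Dynkin argument
    extends the zero integrals to all measurable sets. *)
Lemma ae_zero_of_boxes (h : Z -> \bar R) : mu.-integrable [set: ZM] h ->
  (\int[mu]_z h z = 0)%E -> (forall a b, \int[mu]_(z in obox a b) h z = 0)%E ->
  {ae mu, forall z, h z = 0%E}.
Proof.
move=> ih hT hb.
have H A : measurable (A : set ZM) -> (\int[mu]_(z in A) h z = 0)%E.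
  rewrite gen_oboxes; apply: (@dynkin_induction _ ZM oboxes (fun A => (\int[mu]_(z in A) h z = 0)%E)).
  - exact: gen_oboxes.
  - exact: oboxes_setI.
  - exact: hT.
  - by move=> _ [[a b] _ <-]; exact: hb.
  - move=> S mS S0.
    have := @integral_setU _ _ _ mu S (~` S) h mS (measurableC mS).
    rewrite setUv => /(_ (measurable_int _ ih)); rewrite S0 hT add0e => <-//.
    exact/disj_setPCl.
  - move=> F mF tF F0; rewrite integral_bigcup//; last by apply: (integrableS measurableT _ _ ih) => //; exact: bigcupT_measurable.
    by rewrite eseries0// => i _ _; exact: F0.
have [|N [mN N0 hN]] := @integral_ae_eq _ _ _ mu setT measurableT (cst 0%E) h ih (measurable_cst _).
  by move=> E _ mE; rewrite H// integral0.
by exists N; split => // z hz; apply: hN => /= /(_ I).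
Qed.

Context (Q : set Z) (oQ : open Q).

Definition locint (delta : Z -> R) := measurable_fun (Q : set ZM) delta /\
  forall K : set Z, compact K -> K `<=` Q -> mu.-integrable (K : set ZM) (EFin \o delta).

Let mQ : measurable (Q : set ZM). Proof. exact: open_measurableZ. Qed.

Lemma locint_test (delta xi : Z -> R) : locint delta -> test_fun Q xi ->
  mu.-integrable [set: ZM] ((fun z => (delta z * xi z)%:E) \_ Q).
Proof.
move=> [md id] [sx [K [cK KQ x0]]].
have mx := continuous_measurableZ (smooth_cont sx).
have [C C0 hC] := compact_support_bounded cK (smooth_cont sx) x0.
have mK : measurable (K : set ZM).
  rewrite -[K]setCK; apply: measurableC; apply: open_measurableZ; apply: closed_openC.
  exact: test_fun_compact_closed.
have E : ((fun z => (delta z * xi z)%:E) \_ Q)%E = ((fun z => (delta z * xi z)%:E) \_ K)%E.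
  apply/funext => z; rewrite !patchE; have [zK|zK] := pselect (K z).
    by rewrite !mem_set//; exact: KQ.
  by rewrite x0// mulr0 !if_same.
rewrite E; apply/(integrable_mkcond _ mK).
apply: (@le_integrable _ _ _ mu K mK _ (fun z => (C%:E * (delta z)%:E)%E)).
- apply/measurable_EFinP; apply: measurable_funM; last exact: measurable_funTS.
  exact: measurable_funS KQ md.
- move=> z _; rewrite -EFinM !abse_EFin lee_fin !normrM mulrC ler_wpM2r//.
  by rewrite (le_trans (hC z))// ler_norm.
- by apply: integrableZl => //; exact: id.
Qed.

(** Multiplication by a test function xi makes [delta] integrable on the whole space. Testing with
    xi times bumps that increase to the indicator of a box gives zero integral over boxes, so delta
    xi = 0 almost everywhere. Countably many xi suffice to be positive at every point of [Q]. *)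
Theorem fundamental_lemma (delta : Z -> R) : locint delta ->
  (forall xi, test_fun Q xi -> \int[mu]_(z in Q) (delta z * xi z) = 0) ->
  {ae mu, forall z, Q z -> delta z = 0}.
Proof.
move=> ld H0.
have H xi : test_fun Q xi -> (\int[mu]_z ((fun z => (delta z * xi z)%:E) \_ Q) z = 0)%E.
  move=> tx; have i := locint_test ld tx.
  rewrite -[LHS]fineK; last exact: integrable_fin_num.
  by rewrite -integral_mkcond; congr EFin; exact: H0.
have ae1 xi : test_fun Q xi -> {ae mu, forall z, ((fun z => (delta z * xi z)%:E) \_ Q) z = 0%E}.
  move=> tx; have i := locint_test ld tx.
  apply: ae_zero_of_boxes => //; first exact: H.
  move=> a b; rewrite integral_mkcond.
  pose h z := ((fun z => (delta z * xi z)%:E) \_ Q) z.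
  have c : (\int[mu]_z (h z * (bumpZ n a b z)%:E) @[n --> \oo] --> \int[mu]_z ((h \_ (obox a b)) z))%E.
    apply: (@dominated_cvg _ ZM R mu setT measurableT _ _ (fun z => `|h z|)%E) => //.
    - move=> n; apply: emeasurable_funM; first exact: (measurable_int _ i).
      by apply/measurable_EFinP; apply: continuous_measurableZ; apply: smooth_cont; exact: smooth_bumpZ.
    - move=> z _; rewrite patchE.
      have -> : (if z \in obox a b then h z else 0%E) = (h z * (\1_(obox a b) z)%:E)%E.
        by rewrite indicE; case: (z \in obox a b); rewrite ?mule1 ?mule0.
      apply: cvgeZl; first by rewrite /h patchE; case: ifP.
      by apply: cvg_EFin; [exact: nearW|exact: bumpZ_cvg].
    - by move=> z _; rewrite /h patchE; case: ifP.
    - exact: integrable_abse.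
    - move=> n z _; rewrite abseM -[leRHS]mule1 lee_wpmul2l// lee_fin ger0_norm ?bumpZ_ge0//.
      exact: bumpZ_le1.
  apply: (cvg_unique (@ereal_hausdorff R) c).
  rewrite (_ : (fun n => _) = cst 0%E); first exact: cvg_cst.
  apply/funext => n; rewrite -[RHS](H (xi \* bumpZ n a b)); last first.
    by apply: test_funM => //; exact: smooth_bumpZ.
  apply: eq_integral => z _; rewrite /h !patchE; case: ifP => _; last by rewrite mul0e.
  by rewrite /= -EFinM mulrA.
(* Boxes with rational centre and half-width 1/(n+1) that stay in [Q]; every point of [Q] is
   interior to one of them. *)
pose good (p : 'rV[rat]_d * rat * nat) :=
  cbox (map_mx ratr p.1.1 - const_mx p.2.+1%:R^-1, ratr p.1.2 - p.2.+1%:R^-1)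
       (map_mx ratr p.1.1 + const_mx p.2.+1%:R^-1, ratr p.1.2 + p.2.+1%:R^-1) `<=` Q.
pose bump (p : 'rV[rat]_d * rat * nat) : Z -> R :=
  bumpZ 1 (map_mx ratr p.1.1 - const_mx p.2.+1%:R^-1, ratr p.1.2 - p.2.+1%:R^-1)
       (map_mx ratr p.1.1 + const_mx p.2.+1%:R^-1, ratr p.1.2 + p.2.+1%:R^-1).
have ae2 : {ae mu, forall z, forall n p, unpickle n = Some p -> good p -> Q z -> delta z * bump p z = 0}.
  apply: ae_foralln => n.
  case: (unpickle n) => [p|]; last by apply: ae_all.
  have [gp|gp] := pselect (good p); last by apply: ae_all => z q [<-].
  have tb : test_fun Q (bump p) by exact: test_bumpZ.
  apply: ae_mono (ae1 _ tb) => z hz q [<-] _ Qz.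
  by move: hz; rewrite patchE mem_set// => -[].
apply: ae_mono ae2 => z hz Qz.
have [e /= e0 he] := (nbhs_ballP z Q).1 (open_nbhs_nbhs (conj oQ Qz)).
have [n hn] : exists n : nat, 2 * n.+1%:R^-1 < e.
  exists (Num.truncn (2 / e)).
  rewrite -ltr_pdivlMl// mulrC -[ltRHS]invrK ltf_pV2 ?posrE ?invr_gt0 ?divr_gt0//.
  rewrite (_ : (2^-1 * e)^-1 = e^-1 * 2); last by rewrite invfM invrK mulrC.
  exact: truncnS_gt.
  by rewrite mulr_gt0// invr_gt0.
have n0 : 0 < n.+1%:R^-1 :> R by rewrite invr_gt0.
have /choice[f hf] (i : option 'I_d) : exists q : rat, `|coZ i z - ratr q| < n.+1%:R^-1.
  have lt : coZ i z - n.+1%:R^-1 < coZ i z + n.+1%:R^-1 by rewrite ltrD2l gtrN.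
  have [q] := rat_in_itvoo lt; rewrite in_itv/= => /andP[h1 h2]; exists q.
  by rewrite distrC ltr_norml ltrBrDl h1 ltrBlDl h2.
pose p := ((\row_i f (Some i), f None), n).
have gp : good p.
  rewrite /good /p /= => y Hy; apply: he; rewrite -bbox_ball// => i.
  have H1 : `|coZ i y - ratr (f i)| <= n.+1%:R^-1.
    move: n0 (Hy i); set u := n.+1%:R^-1 => n0.
    by rewrite ler_norml; case: i => [i|] /=; rewrite ?mxE => /andP[h1 h2]; apply/andP; split; lra.
  rewrite (_ : _ - _ = (coZ i y - ratr (f i)) - (coZ i z - ratr (f i))); last by ring.
  rewrite (le_lt_trans (ler_normB _ _))// (lt_trans _ hn)// mulr_natl mulr2n.
  by rewrite ler_ltD.
have bp : 0 < bump p z.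
  rewrite /bump /p /=; apply: bumpZ_gt0 => // i; move: n0 (hf i); set u := n.+1%:R^-1 => n0; rewrite ltr_norml.
  by case: i => [i|] /=; rewrite ?mxE => /andP[h1 h2]; apply/andP; split; lra.
have := hz (pickle p) p (pickleK p) gp Qz => /eqP.
by rewrite mulf_eq0 (gt_eqF bp) orbF => /eqP.
Qed.

End fundamental.

Lemma sqrte_lty {R : realType} (x : \bar R) : (Defs.sqrte x < +oo)%E -> (x < +oo)%E.
Proof. by apply: lty_poweRy; rewrite invr_eq0. Qed.

Lemma cvg_comb3 {R : realType} (u v w : nat -> R) (a : R) : u n @[n --> \oo] --> (0 : R) ->
  v n @[n --> \oo] --> (0 : R) -> w n @[n --> \oo] --> (0 : R) ->
  a * (u n + v n) + w n @[n --> \oo] --> (0 : R).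
Proof.
move=> cu cv cw; rewrite -[X in _ --> X](addr0 0) -[X in _ --> X + _](mulr0 a) -[X in _ * X](addr0 0).
by apply: cvgD => //; apply: cvgM; [exact: cvg_cst|exact: cvgD].
Qed.

(** * The energy space and its traces *)

Section energy_space.
Context {R : realType} (d : nat) (Omega : set 'rV[R]_d) (s : R).
Hypotheses (d0 : (0 < d)%N) (oO : open Omega) (bO : bounded_set Omega) (nO : Omega !=set0).
Hypotheses (s0 : 0 < s) (s1 : s < 1).
Local Notation Z := ('rV[R]_d * R)%type.
Local Notation ZM := ('rV[R]_d * measurableTypeR R)%type.
Local Notation leb1 := (@lebesgue_measure R).
Local Notation mu := (@leb R d \x leb1)%E.
Local Notation Q := (cyl Omega).
Local Notation adm := (admissible Omega).

Definition om0 (t : R) : R := t `^ (1 - 2 * s).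
Definition om1 (t : R) : R := t `^ (2 * s - 1).

Lemma weight_om0 : weight om0.
Proof. by apply: (@weight_powR R (1 - 2 * s)); move: s0 s1; lra. Qed.
Lemma weight_om1 : weight om1.
Proof. by apply: (@weight_powR R (2 * s - 1)); move: s0 s1; lra. Qed.

Local Notation ips := (ip mu Q coordR (wt om0)).
Local Notation ipv := (ip mu Q (coordZ d) (wt om0)).
Local Notation Es := (EL2 mu Q coordR (wt om0)).
Local Notation Ev := (EL2 mu Q (coordZ d) (wt om0)).
Local Notation ipO := (ip (leb d) Omega coordR (cst 1)).
Local Notation EO := (EL2 (leb d) Omega coordR (cst 1)).

Let mO : measurable Omega := open_measurableV oO.
Let mQ : measurable (Q : set ZM) := measurable_cyl oO.
Let mW : measurable_fun (Q : set ZM) (wt om0).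
Proof. by apply: measurable_wt; case: weight_om0. Qed.
Let W0 z : Q z -> 0 < wt om0 z.
Proof. by move=> /cyl_pos z0; rewrite /wt /om0 powR_gt0. Qed.
Let m1 : measurable_fun Omega (cst 1 : _ -> R). Proof. exact: measurable_cst. Qed.
Let p1 : forall x, Omega x -> 0 < (cst 1 x : R). Proof. by move=> x _; exact: ltr01. Qed.

Let hs := prehilbert_L2 mu mQ coordR mW W0.
Let hv := prehilbert_L2 mu mQ (coordZ d) mW W0.
Let hO := prehilbert_L2 (leb d) mO coordR m1 p1.

(** Continuation by 0 outside [D] reduces the claim to functions on the whole space. *)
Lemma measurable_fun_ZP dT (T : measurableType dT) (D : set T) (F : T -> Z) : measurable D ->
  measurable_fun D (F : T -> ZM) <-> forall i, measurable_fun D (fun x => coZ i (F x)).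
Proof.
move=> mD; split=> [mF i|mF].
  by apply: (measurableT_comp (@measurable_coZ R d i)).
pose F' x : Z := if x \in D then F x else 0.
have mF' : measurable_fun setT (F' : T -> ZM).
  rewrite (_ : F' = fun x => ((F' x).1, (F' x).2)); last by apply/funext => x; case: (F' x).
  have H i : measurable_fun setT (fun x => coZ i (F' x)).
    rewrite (_ : (fun x => _) = (fun x => coZ i (F x)) \_ D).
      exact/(measurable_restrictT _ mD).
    apply/funext => x; rewrite patchE /F'; case: ifP => // _.
    by case: i => [i|] //=; rewrite mxE.
  apply: measurable_fun_pair; last exact: (H None).
  by apply: (@measurable_fun_rV R d _ T (fun x => (F' x).1)) => i; exact: (H (Some i)).
apply: (@eq_measurable_fun _ _ _ ZM D F') => [x xD|]; first by rewrite /F' xD.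
exact: measurable_funTS.
Qed.

Lemma normQE f : normQ Omega s f = Defs.sqrte (sqint mu Q coordR (wt om0) f).
Proof. by congr Defs.sqrte; apply: eq_integral => x _; rewrite dotcR expr2. Qed.

Lemma normQvE F : normQv Omega s F = Defs.sqrte (sqint mu Q (coordZ d) (wt om0) F).
Proof. by congr Defs.sqrte; apply: eq_integral => x _; rewrite dotzE. Qed.

Lemma ipvE F G : \int[lebQ]_(z in Q) (z.2 `^ (1 - 2 * s) * dotz (F z) (G z)) = ipv F G.
Proof. by apply: eq_Rintegral => z _; rewrite dotzE. Qed.

Lemma adm_Es phi : adm phi -> Es phi.
Proof. by move=> /admissibleP[/smooth_cont cf bf _]; exact: (bsupp_EQ oO bO weight_om0). Qed.

Lemma adm_Ev phi : adm phi -> Ev (gradz phi).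
Proof. by move=> /admissibleP[sf bf _]; exact: (bsupp_grad_EQ oO bO weight_om0). Qed.

Lemma Ev_co i F : Ev F -> Es (fun z => coZ i (F z)).
Proof. exact: (EL2_co (cs := coordZ d) mQ mW W0 i). Qed.

Lemma nrm_coZ i F : Ev F -> nrm ips (fun z => coZ i (F z)) <= nrm ipv F.
Proof. exact: (nrm_co_le (cs := coordZ d) mQ mW W0 i). Qed.

Definition approx (w : Z -> R) (G : Z -> Z) (phi : nat -> Z -> R) :=
  [/\ forall n, adm (phi n), ncvg ips phi w & ncvg ipv (fun n => gradz (phi n)) G].

Lemma V_gradP w G : V_grad Omega s w G <-> [/\ Es w, Ev G & exists phi, approx w G phi].
Proof.
split=> [[mw mG [phi [aphi c1 c2]]]|[Ew EG [phi [aphi c1 c2]]]].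
  have [Ew cw] : Es w /\ ncvg ips phi w.
    apply: (L2dist_ncvg mQ mW W0 (fun n => adm_Es (aphi n))); first by case.
    by move: c1; under eq_fun do rewrite normQE.
  have [EG cG] : Ev G /\ ncvg ipv (fun n => gradz (phi n)) G.
    apply: (L2dist_ncvg mQ mW W0 (fun n => adm_Ev (aphi n))).
      exact: (measurable_fun_ZP G mQ).1.
    by move: c2; under eq_fun do rewrite normQvE.
  by split => //; exists phi.
split; first by have [/(_ tt)] := Ew.
  by apply: (measurable_fun_ZP G mQ).2; case: EG.
exists phi; split => //.
  under eq_fun do rewrite normQE.
  exact: (ncvg_L2dist mQ mW W0 (fun n => adm_Es (aphi n)) Ew c1).
under eq_fun do rewrite normQvE.
exact: (ncvg_L2dist mQ mW W0 (fun n => adm_Ev (aphi n)) EG c2).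
Qed.

Lemma V_approxP w G phi : Es w -> Ev G -> V_approx Omega s w G phi <-> approx w G phi.
Proof.
move=> Ew EG; split=> [[aphi c1 c2]|[aphi c1 c2]]; split => //.
- have [] // : Es w /\ ncvg ips phi w.
  apply: (L2dist_ncvg mQ mW W0 (fun n => adm_Es (aphi n))); first by case: Ew.
  by move: c1; under eq_fun do rewrite normQE.
- have [] // : Ev G /\ ncvg ipv (fun n => gradz (phi n)) G.
  apply: (L2dist_ncvg mQ mW W0 (fun n => adm_Ev (aphi n))); first by case: EG.
  by move: c2; under eq_fun do rewrite normQvE.
- under eq_fun do rewrite normQE.
  exact: (ncvg_L2dist mQ mW W0 (fun n => adm_Es (aphi n)) Ew c1).
- under eq_fun do rewrite normQvE.
  exact: (ncvg_L2dist mQ mW W0 (fun n => adm_Ev (aphi n)) EG c2).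
Qed.

Lemma gradQP w : inV Omega s w -> V_grad Omega s w (gradQ Omega s w).
Proof. by move=> wV; apply: (@xgetPex _ (fun=> 0) [set G | V_grad Omega s w G]). Qed.

Lemma V_grad_lin (a : R) w G w' G' : V_grad Omega s w G -> V_grad Omega s w' G' ->
  V_grad Omega s (w + a *: w') (G + a *: G').
Proof.
move=> /V_gradP[Ew EG [phi [aphi c1 c2]]] /V_gradP[Ew' EG' [psi [apsi e1 e2]]].
have aw' := ph_Z hs a Ew'; have aG' := ph_Z hv a EG'.
apply/V_gradP; split; [exact: (ph_D hs)|exact: (ph_D hv)|].
exists (fun n => phi n + a *: psi n); split.
- by move=> n; exact: admissible_lin.
- have h1 n : Es (phi n) := adm_Es (aphi n).
  have h2 n : Es (psi n) := adm_Es (apsi n).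
  have e3 := ncvgZ hs a h2 Ew' e1.
  exact: (ncvgD hs h1 (fun n => ph_Z hs a (h2 n)) Ew aw' c1 e3).
- rewrite (_ : (fun n => _) = fun n => gradz (phi n) + a *: gradz (psi n)); last first.
    by apply/funext => n; rewrite gradz_lin//; [case: (aphi n)|case: (apsi n)].
  have h1 n : Ev (gradz (phi n)) := adm_Ev (aphi n).
  have h2 n : Ev (gradz (psi n)) := adm_Ev (apsi n).
  have c3 := ncvgZ hv a h2 EG' e2.
  have c4 := ncvgD hv h1 (fun n => ph_Z hv a (h2 n)) EG aG' c2 c3.
  exact: c4.
Qed.

Lemma test_bsupp (f : Z -> R) U : test_fun U f -> bsupp f.
Proof.
move=> [_ [K [cK _ f0]]]; apply/bsupp_bounded_set.
have [M [_ hM]] := compact_bounded cK; exists M; split; first by rewrite num_real.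
by move=> N MN z /= fz; apply: hM => //; apply: contrapT => /f0 e; rewrite e eqxx in fz.
Qed.

Lemma test_adm (f : Z -> R) : test_fun Q f -> adm f.
Proof.
move=> tf; apply/admissibleP; split; [by case: tf|exact: test_bsupp tf|].
move=> x t [_ nx] t0; apply: (test_fun_out tf) => /cylP[Ox _]; apply: nx.
exact: (open_nbhs_nbhs (conj oO Ox)).
Qed.

(** The product psi xi is smooth, of bounded support and zero outside [Q], so its derivative has
    integral zero. *)
Lemma ibp_test (psi xi : Z -> R) i : smooth psi -> test_fun Q xi ->
  \int[mu]_(z in Q) ('D_(ebasis i) psi z * xi z) = - \int[mu]_(z in Q) (psi z * 'D_(ebasis i) xi z).
Proof.
move=> sp tx; have [sx _] := tx; have bx := test_bsupp tx.
have td := test_fun_derive (ebasis i) tx; have bd := test_bsupp td.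
have sdp := smooth_derive (ebasis i) sp; have sdx := smooth_derive (ebasis i) sx.
have i1 : mu.-integrable (Q : set ZM) (EFin \o (fun z => 'D_(ebasis i) psi z * xi z)).
  apply: (integrableS measurableT mQ (@subsetT _ _)); apply: integrable_bsupp.
    by apply: smooth_cont; exact: smoothM.
  rewrite (_ : (fun z => _) = xi \* 'D_(ebasis i) psi); first exact: bsuppM.
  by apply/funext => z; rewrite /= mulrC.
have i2 : mu.-integrable (Q : set ZM) (EFin \o (fun z => psi z * 'D_(ebasis i) xi z)).
  apply: (integrableS measurableT mQ (@subsetT _ _)); apply: integrable_bsupp.
    by apply: smooth_cont; exact: smoothM.
  rewrite (_ : (fun z => _) = 'D_(ebasis i) xi \* psi); first exact: bsuppM.
  by apply/funext => z; rewrite /= mulrC.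
apply/eqP; rewrite -addr_eq0 -RintegralD//; apply/eqP.
have E z : 'D_(ebasis i) (psi \* xi) z = 'D_(ebasis i) psi z * xi z + psi z * 'D_(ebasis i) xi z.
  have := is_deriveM (DeriveDef (smooth_derivable (x := z) (v := ebasis i) sp) erefl) (DeriveDef (smooth_derivable (x := z) (v := ebasis i) sx) erefl).
  by case=> _ ->; rewrite /GRing.scale/= addrC mulrC.
have bpx : bsupp (psi \* xi).
  rewrite (_ : psi \* xi = xi \* psi); first exact: bsuppM.
  by apply/funext => z; rewrite /= mulrC.
have := int_derive_Z i (smoothM sp sx) bpx.
rewrite /Rintegral => H; rewrite (_ : (\int[mu]_(z in Q) _)%E = 0%E)// -[RHS]H integral_mkcond.
apply: eq_integral => z _; rewrite patchE; case: ifPn => [_|/negP nz]; first by rewrite E.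
have nQ : ~ Q z by move=> Qz; apply: nz; exact: mem_set.
by rewrite E (test_fun_out tx nQ) (test_fun_out td nQ) !mulr0 addr0.
Qed.

Lemma om01 z : Q z -> wt om0 z * om1 z.2 = 1.
Proof. by move=> /cyl_pos z0; rewrite /wt /om0 /om1 powR_inv_weight. Qed.

Lemma om1_bounded_Es (f : Z -> R) (C M : R) : measurable_fun [set: ZM] f -> (forall z, `|f z| <= C) ->
  0 < M -> (forall x t, M < t -> f (x, t) = 0) -> Es (fun z => om1 z.2 * f z).
Proof.
move=> mf fC M0 fM; have [m1' _ _] := weight_om1; split.
  case=> /=; apply: measurable_funM; first exact: (measurable_wt m1').
  exact: measurable_funTS.
apply: (@le_lt_trans _ _ (iQ Omega om1 (fun z => f z ^+ 2))).
  rewrite le_eqVlt; apply/orP; left; apply/eqP; apply: eq_integral => z /set_mem Qz.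
  rewrite dotcR; congr EFin.
  have -> : wt om0 z * (om1 z.2 * f z * (om1 z.2 * f z)) = (wt om0 z * om1 z.2) * (om1 z.2 * f z ^+ 2) by ring.
  by rewrite om01// mul1r.
apply: (iQ_bounded_lty oO bO weight_om1 (C := C ^+ 2) (M := M)) => //.
- exact: measurable_funX.
- move=> z; rewrite sqr_ge0/= -[leLHS]real_normK ?num_real// lerXn2r ?nnegrE//.
  by rewrite (le_trans _ (fC z)).
- by move=> x t /fM ->; rewrite expr0n.
Qed.

(** Pairing with om1 1_K in the weighted space: the weights cancel, and om1 1_K is square integrable
    because om1 is integrable near t = 0. *)
Lemma Es_locint f : Es f -> locint Q f.
Proof.
move=> Ef; split; first by have [/(_ tt)] := Ef.
move=> K cK KQ.
have mK : measurable (K : set ZM).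
  rewrite -[K]setCK; apply: measurableC; apply: open_measurableZ; apply: closed_openC.
  exact: test_fun_compact_closed.
have [M [_ hM]] := compact_bounded cK.
have E1 : Es (fun z => om1 z.2 * \1_K z).
  apply: (om1_bounded_Es (C := 1) (M := `|M| + 1)).
  - exact: measurable_indic.
  - by move=> z; rewrite indicE; case: (z \in K); rewrite ?normr1 ?normr0.
  - by rewrite ltr_wpDl.
  - move=> x t Mt; rewrite indicE memNset// => Kz.
    have := hM (`|M| + 1); rewrite (le_lt_trans (ler_norm M)) ?ltrDl// => /(_ isT _ Kz).
    rewrite /Num.norm/= ge_max => /andP[_]; rewrite leNgt => /negP; apply.
    by rewrite (lt_le_trans Mt)// ler_norm.
have := integrableS mQ mK KQ (EL2_integrable mQ mW W0 Ef E1).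
apply: eq_integrable => // z /set_mem Kz /=.
rewrite dotcR indicE mem_set// mulr1.
by rewrite mulrCA om01 ?mulr1//; exact: KQ.
Qed.

Lemma test_om1_Es xi : test_fun Q xi -> Es (fun z => om1 z.2 * xi z).
Proof.
move=> tx; have [C C0 hC] := test_fun_bounded tx; have [M M0 hM] := bsupp_tail (test_bsupp tx).
apply: (om1_bounded_Es (C := C) (M := M)) => //.
by apply: continuous_measurableZ; apply: smooth_cont; case: tx.
Qed.

(** Since om0 om1 = 1, a plain pairing with a test function becomes a weighted inner product, so
    convergence in the weighted norm implies convergence of distributions. *)
Lemma ips_om1 f (xi : Z -> R) : ips f (fun z => om1 z.2 * xi z) = \int[mu]_(z in Q) (f z * xi z).
Proof.
apply: eq_Rintegral => z /set_mem Qz; rewrite dotcR.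
transitivity ((wt om0 z * om1 z.2) * (f z * xi z)); first by ring.
by rewrite om01// mul1r.
Qed.

Lemma ncvg_co (u : nat -> Z -> Z) F i : (forall n, Ev (u n)) -> Ev F -> ncvg ipv u F ->
  ncvg ips (fun n z => coZ i (u n z)) (fun z => coZ i (F z)).
Proof.
move=> Eu EF c; apply: (@squeeze_cvgr _ _ _ _ (fun=> 0) (fun n => nrm ipv (u n - F))).
- apply: nearW => n; rewrite nrm_ge0/=.
  apply: le_trans (nrm_coZ i (ph_B hv (Eu n) EF)).
  rewrite le_eqVlt; apply/orP; left; apply/eqP; congr (nrm _ _); apply/funext => z.
  exact: (esym (coB (cs := coordZ d) i (u n z) (F z))).
- exact: cvg_cst.
- exact: c.
Qed.

(** The difference is a gradient of 0 in the closure. Integration by parts against a test function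
    moves the derivative off the approximants, which tend to 0 in the weighted norm; the fundamental
    lemma concludes. *)
Lemma V_grad_uniq w G G' : V_grad Omega s w G -> V_grad Omega s w G' ->
  {ae mu, forall z, Q z -> forall i : option 'I_d, coZ i (G z) = coZ i (G' z)}.
Proof.
move=> H1 H2; have := V_grad_lin (-1) H1 H2.
rewrite !scaleN1r subrr => /V_gradP[E0 EH [psi [apsi c1 c2]]].
have H i : {ae mu, forall z, Q z -> coZ i ((G - G') z) = 0}.
  apply: (fundamental_lemma (open_cyl oO)).
    apply: Es_locint; exact: (Ev_co i EH).
  move=> xi tx; rewrite -ips_om1.
  have Ex := test_om1_Es tx.
  have a1 := ncvg_B hs (fun n => Ev_co i (adm_Ev (apsi n))) (Ev_co i EH) Ex
    (ncvg_co i (fun n => adm_Ev (apsi n)) EH c2).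
  apply: (cvg_unique (@Rhausdorff R) a1).
  have Edx := test_om1_Es (test_fun_derive (ebasis i) tx).
  have a2 := ncvg_B hs (fun n => adm_Es (apsi n)) E0 Edx c1.
  have z0 : ips 0 (fun z => om1 z.2 * 'D_(ebasis i) xi z) = 0.
    rewrite (ph_C hs) -[0]/(0 : Z -> R) -(scale0r (0 : Z -> R)) (ph_C hs) (ph_BZ hs)// mul0r//.
  rewrite z0 in a2.
  have a3 : - ips (psi n) (fun z => om1 z.2 * 'D_(ebasis i) xi z) @[n --> \oo] --> (0 : R).
    by rewrite -oppr0; exact: cvgN a2.
  apply: cvg_trans a3; apply: near_eq_cvg; apply: nearW => n /=.
  rewrite !ips_om1 -ibp_test//; last by case: (apsi n).
  by apply: eq_Rintegral => z _; rewrite /co/= coZ_gradz.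
(* The null sets of the finitely many coordinates are united through an enumeration of the index
   type. *)
have H2' : {ae mu, forall z, forall n i, unpickle n = Some i -> Q z -> coZ i ((G - G') z) = 0}.
  apply: ae_foralln => n; case: (unpickle n) => [i|]; last exact: ae_all.
  by apply: ae_mono (H i) => z hz j [<-].
apply: ae_mono H2' => z hz Qz i; apply/eqP; rewrite -subr_eq0; apply/eqP.
rewrite -[RHS](hz (pickle i) i (pickleK i) Qz); exact: (esym (coB (cs := coordZ d) i (G z) (G' z))).
Qed.

(** [gradQ] chooses a representative, so linearity is stated inside inner products, where it is
    insensitive to the choice. *)
Lemma gradQ_lin (a : R) w w' : inV Omega s w -> inV Omega s w' ->
  inV Omega s (w + a *: w') /\ forall H, Ev H ->
  ipv (gradQ Omega s (w + a *: w')) H = ipv (gradQ Omega s w) H + a * ipv (gradQ Omega s w') H.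
Proof.
move=> vw vw'; have g1 := gradQP vw; have g2 := gradQP vw'.
have gl := V_grad_lin a g1 g2.
have vl : inV Omega s (w + a *: w') by exists (gradQ Omega s w + a *: gradQ Omega s w').
split => // H EH; have g3 := gradQP vl.
have [_ E1 _] := (V_gradP _ _).1 g1; have [_ E2 _] := (V_gradP _ _).1 g2.
have [_ E3 _] := (V_gradP _ _).1 g3; have [_ El _] := (V_gradP _ _).1 gl.
rewrite -(ph_BZ hv a E2 EH) -(ph_BD hv E1 (ph_Z hv a E2) EH).
exact: (nrm_eq_ae mQ mW E3 El (V_grad_uniq g3 gl) EH).
Qed.

Lemma inV_approx w : inV Omega s w -> [/\ Es w, Ev (gradQ Omega s w) & exists phi, approx w (gradQ Omega s w) phi].
Proof. by move=> /gradQP /V_gradP. Qed.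

Lemma trsqE phi t : trsq Omega phi t = sqint (leb d) Omega coordR (cst 1) (fun x => phi (x, t)).
Proof. by apply: eq_integral => x _; rewrite dotcR mul1r expr2. Qed.

Lemma slice_EO (phi : Z -> R) (t : R) : smooth phi -> EO (fun x => phi (x, t)).
Proof. by move=> /(smooth_sliceZ t) /(smooth_EL2 oO bO)[]. Qed.

Lemma iQ_om0 phi : iQ Omega om0 (gsq phi) = sqint mu Q (coordZ d) (wt om0) (gradz phi).
Proof. by apply: eq_integral => z _; rewrite /gsq dotzE. Qed.

Definition trc : R := C_F Omega `^ s * kappa s.

(** The factor in front of the flux residual is the reciprocal square root of the constant in
    [trace_cyl]. *)
Lemma trcE : trc ^+ 2 * (C_s s * lambda1 Omega `^ s) = 1.
Proof.
have l0 := lambda1_gt0 d0 oO bO nO; have c0 := C_s_gt0 s0 s1.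
have -> : trc ^+ 2 = (lambda1 Omega `^ s)^-1 * (C_s s)^-1.
  rewrite /trc /C_F /kappa exprMn -!powR_mulrn ?powR_ge0// -!powRrM.
  rewrite -powRN -[(C_s s)^-1]powR_inv1 ?(ltW c0)//.
  by congr (_ `^ _ * _ `^ _); field.
have := powR_gt0 s l0; move: c0; set a := _ `^ s; set c := C_s s => c0 a0.
by rewrite mulrACA [a^-1 * c]mulrC mulrACA mulrC mulfV ?mulVf ?mulr1 ?gt_eqF.
Qed.

Lemma trc_gt0 : 0 < trc.
Proof.
by rewrite /trc mulr_gt0// powR_gt0 ?powR_gt0 ?C_s_gt0// lambda1_gt0.
Qed.

Lemma trace_le phi : adm phi -> nrm ipO (fun x => phi (x, 0)) <= trc * nrm ipv (gradz phi).
Proof.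
move=> aphi; have [sf _ _] := aphi; have EO0 := slice_EO 0 sf.
have Eg := adm_Ev aphi.
have l0 := lambda1_gt0 d0 oO bO nO; have c0 := C_s_gt0 s0 s1.
have H := trace_cyl d0 oO bO nO s0 s1 aphi.
rewrite -[X in iQ Omega X]/om0 iQ_om0 trsqE (ip_EFin mO m1 p1 EO0) (ip_EFin mQ mW W0 Eg) -EFinM lee_fin in H.
apply: (nrm_le EO0); first by rewrite mulr_ge0 ?nrm_ge0// ltW// trc_gt0.
have := ler_wpM2l (sqr_ge0 trc) H; rewrite mulrA trcE mul1r => {}H.
by rewrite exprMn (nrm_sqr hv Eg).
Qed.

Lemma trace_cauchy (phi : nat -> Z -> R) : (forall n, adm (phi n)) -> ncauchy ipv (fun n => gradz (phi n)) ->
  ncauchy ipO (fun n x => phi n (x, 0)).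
Proof.
move=> aphi c e e0; have t0 := trc_gt0.
have [N hN] := c (e / trc) (divr_gt0 e0 t0); exists N => n m Nn Nm.
have am : adm (phi n + (-1) *: phi m) by exact: admissible_lin.
have := trace_le am.
rewrite gradz_lin ?scaleN1r; [|by case: (aphi n)|by case: (aphi m)] => H.
apply: (le_trans _ (le_trans H _)); last first.
  by rewrite mulrC -ler_pdivlMr//; exact: hN.
rewrite le_eqVlt; apply/orP; left; apply/eqP; congr (nrm _ _); exact/funext.
Qed.

(** By the trace inequality the traces of an approximating sequence are Cauchy in L^2(Omega), so the
    set from which [traceV] chooses is inhabited. *)
Lemma traceVP w : inV Omega s w -> V_trace Omega s w (traceV Omega s w).
Proof.
move=> vw; apply: (@xgetPex _ (fun=> 0) [set u | V_trace Omega s w u]).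
have [Ew EG [phi [aphi c1 c2]]] := inV_approx vw.
have EOn n : EO (fun x => phi n (x, 0)) by apply: slice_EO; case: (aphi n).
have := trace_cauchy aphi (ncvg_cauchy hv (fun n => adm_Ev (aphi n)) EG c2).
move=> /(complete_L2R mO m1 p1 EOn)[u Eu cu].
exists u; split.
  split; first by have [/(_ tt)] := Eu.
  by rewrite (normOE Omega) (sqrte_sqint mO m1 p1 Eu) ltry.
exists phi; split; first by apply/(V_approxP _ Ew EG).
under eq_fun do rewrite (normOE Omega).
exact: (ncvg_L2dist mO m1 p1 EOn Eu cu).
Qed.

Lemma L2_EO f : L2 Omega f -> EO f.
Proof. by move=> [mf]; rewrite (normOE Omega) => /sqrte_lty h; split => // -[]. Qed.

Lemma trace_EO w : inV Omega s w -> EO (traceV Omega s w).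
Proof. by move=> /traceVP[/L2_EO]. Qed.

(* Two approximations of the gradient have the same traces in the limit, so the
   choice made by [traceV] does not matter. *)
Lemma trace_cvg w (phi : nat -> Z -> R) : inV Omega s w -> (forall n, adm (phi n)) ->
  ncvg ipv (fun n => gradz (phi n)) (gradQ Omega s w) ->
  ncvg ipO (fun n x => phi n (x, 0)) (traceV Omega s w).
Proof.
move=> vw aphi c; have [Ew EG _] := inV_approx vw; have t0 := trc_gt0.
have [Lu [psi [apsi' cu']]] := traceVP vw; have Eu := trace_EO vw.
have [apsi _ c'] := (V_approxP psi Ew EG).1 apsi'.
have EOn (f : nat -> Z -> R) n : (forall n, adm (f n)) -> EO (fun x => f n (x, 0)).
  by move=> af; apply: slice_EO; case: (af n).
have [_ cu] : EO (traceV Omega s w) /\ ncvg ipO (fun n x => psi n (x, 0)) (traceV Omega s w).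
  apply: (L2dist_ncvg mO m1 p1 (fun n => EOn psi n apsi)); first by case: Eu.
  by move: cu'; under eq_fun do rewrite (normOE Omega).
have Ed n := adm_Ev (aphi n); have Ep n := adm_Ev (apsi n).
apply: (@squeeze_cvgr _ _ _ _ (fun=> 0) (fun n => trc * (nrm ipv (gradz (phi n) - gradQ Omega s w) +
   nrm ipv (gradz (psi n) - gradQ Omega s w)) + nrm ipO ((fun x => psi n (x, 0)) - traceV Omega s w))).
- apply: nearW => n; rewrite nrm_ge0/=.
  apply: (le_trans (nrm_triangleB hO (EOn phi n aphi) (EOn psi n apsi) Eu)).
  rewrite lerD2r.
  have am : adm (phi n + (-1) *: psi n) by exact: admissible_lin.
  have := trace_le am.
  rewrite gradz_lin ?scaleN1r; [|by case: (aphi n)|by case: (apsi n)] => H.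
  apply: (le_trans _ (le_trans H _)).
    rewrite le_eqVlt; apply/orP; left; apply/eqP; congr (nrm _ _); exact/funext.
  rewrite ler_pM2l// (le_trans (nrm_triangleB hv (Ed n) EG (Ep n)))// lerD2l.
  by rewrite (nrmBC hv EG (Ep n)).
- exact: cvg_cst.
- exact: (cvg_comb3 trc c c' cu).
Qed.

End energy_space.

(** For a semidefinite form a limit is determined only through its pairings; vectors with equal
    pairings are interchangeable. *)
Lemma ncvg_weak_eq {R : realType} (H : lmodType R) (E : H -> Prop) (B : H -> H -> R) (u : nat -> H) x y :
  prehilbert E B -> (forall n, E (u n)) -> E x -> E y -> (forall h, E h -> B x h = B y h) ->
  ncvg B u x -> ncvg B u y.
Proof.
move=> hB Eu Ex Ey xy; rewrite /ncvg /nrm => c; apply: cvg_trans c.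
apply: near_eq_cvg; apply: nearW => n /=; congr Num.sqrt.
rewrite (ph_sqrB hB (Eu n) Ex) (ph_sqrB hB (Eu n) Ey) (ph_C hB _ x) (ph_C hB _ y) xy//.
by rewrite (xy x Ex) (ph_C hB y x) xy.
Qed.

Lemma ncvg_const {R : realType} (H : lmodType R) (E : H -> Prop) (B : H -> H -> R) x :
  prehilbert E B -> E x -> ncvg B (fun=> x) x.
Proof.
move=> hB Ex; rewrite /ncvg (_ : (fun n => _) = cst 0); first exact: cvg_cst.
apply/funext => n; rewrite subrr /nrm -(scale0r x) (ph_BZ hB)// ?mul0r ?sqrtr0//.
exact: (ph_Z hB).
Qed.

(** * The two bounds *)

Section bounds.
Context {R : realType} (d : nat) (Omega : set 'rV[R]_d) (s : R).
Hypotheses (d0 : (0 < d)%N) (oO : open Omega) (bO : bounded_set Omega) (nO : Omega !=set0).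
Hypotheses (s0 : 0 < s) (s1 : s < 1).
Local Notation Z := ('rV[R]_d * R)%type.
Local Notation ZM := ('rV[R]_d * measurableTypeR R)%type.
Local Notation leb1 := (@lebesgue_measure R).
Local Notation mu := (@leb R d \x leb1)%E.
Local Notation Q := (cyl Omega).
Local Notation adm := (admissible Omega).
Local Notation om0 := (om0 s).
Local Notation om1 := (om1 s).
Local Notation ips := (ip mu Q coordR (wt om0)).
Local Notation ipv := (ip mu Q (coordZ d) (wt om0)).
Local Notation Es := (EL2 mu Q coordR (wt om0)).
Local Notation Ev := (EL2 mu Q (coordZ d) (wt om0)).
Local Notation ipO := (ip (leb d) Omega coordR (cst 1)).
Local Notation EO := (EL2 (leb d) Omega coordR (cst 1)).
Local Notation grad := (gradQ Omega s).

Let mO : measurable Omega := open_measurableV oO.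
Let mQ : measurable (Q : set ZM) := measurable_cyl oO.
Let wom0 : weight om0 := weight_om0 s0 s1.
Let mW : measurable_fun (Q : set ZM) (wt om0).
Proof. by apply: measurable_wt; case: wom0. Qed.
Let W0 z : Q z -> 0 < wt om0 z.
Proof. by move=> /cyl_pos z0; rewrite /wt /om0 powR_gt0. Qed.
Let m1 : measurable_fun Omega (cst 1 : _ -> R). Proof. exact: measurable_cst. Qed.
Let p1 : forall x, Omega x -> 0 < (cst 1 x : R). Proof. by move=> x _; exact: ltr01. Qed.
Let hs := prehilbert_L2 mu mQ coordR mW W0.
Let hv := prehilbert_L2 mu mQ (coordZ d) mW W0.
Let hO := prehilbert_L2 (leb d) mO coordR m1 p1.

Let gradP := inV_approx oO bO s0 s1.
Let adEv phi : adm phi -> Ev (gradz phi) := adm_Ev oO bO s0 s1 (phi := phi).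
Let adEs phi : adm phi -> Es phi := adm_Es oO bO s0 s1 (phi := phi).

Lemma grad_Ev w : inV Omega s w -> Ev (grad w).
Proof. by move=> /gradP[]. Qed.

Lemma adm_V_grad phi : adm phi -> V_grad Omega s phi (gradz phi).
Proof.
move=> aphi; apply/(V_gradP oO bO s0 s1); split; [exact: adEs|exact: adEv|].
exists (fun=> phi); split => //.
- exact: (ncvg_const hs (adEs aphi)).
- exact: (ncvg_const hv (adEv aphi)).
Qed.

Lemma adm_inV phi : adm phi -> inV Omega s phi.
Proof. by move=> aphi; exists (gradz phi); exact: adm_V_grad. Qed.

Lemma grad_adm phi H : adm phi -> Ev H -> ipv (grad phi) H = ipv (gradz phi) H.
Proof.
move=> aphi; have vp := adm_inV aphi.
apply: (nrm_eq_ae mQ mW (grad_Ev vp) (adEv aphi)).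
exact: (V_grad_uniq oO bO s0 s1 (gradQP vp) (adm_V_grad aphi)).
Qed.

(** The constant sequence [phi] approximates itself, and [trace_cvg] identifies the limit of its
    traces with the chosen one, as far as pairings can tell. *)
Lemma trace_adm phi h : adm phi -> EO h -> ipO (traceV Omega s phi) h = ipO (fun x => phi (x, 0)) h.
Proof.
move=> aphi Eh; have vp := adm_inV aphi; have [sp _ _] := aphi.
have E0 : EO (fun x => phi (x, 0)) by exact: slice_EO.
have Et := trace_EO d0 oO bO nO s0 s1 vp.
have c : ncvg ipv (fun=> gradz phi) (grad phi).
  apply: (ncvg_weak_eq hv (fun=> adEv aphi) (adEv aphi) (grad_Ev vp)); last exact: (ncvg_const hv (adEv aphi)).
  by move=> H EH; rewrite grad_adm.
have c1 := ncvg_B hO (fun=> E0) Et Eh (trace_cvg d0 oO bO nO s0 s1 vp (fun=> aphi) c).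
by apply: (cvg_unique (@Rhausdorff R) c1); exact: cvg_cst.
Qed.

Lemma ipOE f h : ipO f h = \int[leb d]_(x in Omega) (f x * h x).
Proof. by apply: eq_Rintegral => x _; rewrite dotcR mul1r. Qed.

Context (g : 'rV[R]_d -> R) (w wt0 : Z -> R).
Hypotheses (Lg : L2 Omega g) (ws : weak_solution Omega s g w) (vwt : inV Omega s wt0).
Let Eg : EO g := L2_EO Lg.
Let vw : inV Omega s w := proj1 ws.

Lemma weak_sol eta : inV Omega s eta -> ipv (grad w) (grad eta) = ipO g (traceV Omega s eta).
Proof.
move=> ve; have := (proj2 ws) eta ve; rewrite ipvE -ipOE => /eqP.
by rewrite subr_eq0 => /eqP.
Qed.

Lemma weak_adm phi : adm phi -> ipv (grad w) (gradz phi) = ipO g (fun x => phi (x, 0)).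
Proof.
move=> aphi; have vp := adm_inV aphi.
rewrite (ph_C hv) -grad_adm//; last exact: grad_Ev.
by rewrite (ph_C hv) weak_sol// (ph_C hO) trace_adm// (ph_C hO).
Qed.

Let e := wt0 \- w.
Let eE : e = wt0 + (-1) *: w.
Proof. by apply/funext => z; rewrite /e !fctE scaleN1r. Qed.

Lemma inV_err : inV Omega s e.
Proof. by rewrite eE; have [] := gradQ_lin oO bO s0 s1 (-1) vwt vw. Qed.

Lemma grad_err H : Ev H -> ipv (grad e) H = ipv (grad wt0) H - ipv (grad w) H.
Proof.
move=> EH; rewrite eE; have [_ ->] := gradQ_lin oO bO s0 s1 (-1) vwt vw; last by [].
by rewrite mulN1r.
Qed.

Lemma errE : normQv Omega s (grad e) = (nrm ipv (grad e))%:E.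
Proof. by rewrite normQvE (sqrte_sqint mQ mW W0)//; exact: (grad_Ev inV_err). Qed.

Lemma M_minus_sqE eta : inV Omega s eta ->
  M_minus_sq Omega s g wt0 eta = 2 * ipv (grad e) (grad eta) - ipv (grad eta) (grad eta).
Proof.
move=> ve; have Ee := grad_Ev ve.
rewrite /M_minus_sq ipvE -ipOE -(weak_sol ve) normQvE (sqrte_sqint mQ mW W0 Ee)/=.
by rewrite (nrm_sqr hv Ee); congr (_ - _); rewrite -mulrBr; congr (_ * _); rewrite (grad_err Ee).
Qed.

Lemma M_minus_le eta : inV Omega s eta -> M_minus Omega s g wt0 eta <= nrm ipv (grad e).
Proof.
move=> ve; have Ee := grad_Ev ve; have E0 := grad_Ev inV_err.
rewrite /M_minus M_minus_sqE// /nrm ler_wsqrtr//.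
have := ph_ge0 hv (ph_B hv E0 Ee); rewrite (ph_sqrB hv E0 Ee).
have arith (p q r : R) : 0 <= p - 2 * q + r -> 2 * q - r <= p by lra.
exact: arith.
Qed.

Lemma M_minus_err : M_minus Omega s g wt0 e = nrm ipv (grad e).
Proof.
rewrite /M_minus (M_minus_sqE inV_err) /nrm; congr Num.sqrt.
by set a := ipv _ _; lra.
Qed.

Lemma sup_M_minus : ereal_sup [set (M_minus Omega s g wt0 eta)%:E | eta in inV Omega s] = normQv Omega s (grad e).
Proof.
rewrite errE; apply/eqP; rewrite eq_le; apply/andP; split.
  by apply: ge_ereal_sup => _ [eta ve <-]; rewrite lee_fin; exact: M_minus_le.
by apply: ereal_sup_ubound; exists e; [exact: inV_err|rewrite M_minus_err].
Qed.

Lemma friedrichs_nrm phi : adm phi -> nrm ips phi <= C_F Omega * nrm ipv (gradz phi).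
Proof.
move=> aphi; have Ep := adEs aphi; have Eg' := adEv aphi; have [sp _ _] := aphi.
have l0 := lambda1_gt0 d0 oO bO nO.
have := friedrichs_cyl_gsq d0 oO bO nO wom0 aphi.
rewrite (iQ_om0 Omega) (ip_EFin mQ mW W0 Eg').
have -> : iQ Omega om0 (fun z => phi z ^+ 2) = sqint mu Q coordR (wt om0) phi.
  by apply: eq_integral => z _; rewrite dotcR expr2.
rewrite (ip_EFin mQ mW W0 Ep) -EFinM lee_fin => H.
have c0 : 0 <= C_F Omega by exact: powR_ge0.
apply: (nrm_le Ep); first by rewrite mulr_ge0 ?nrm_ge0.
rewrite exprMn (nrm_sqr hv Eg').
have -> : C_F Omega ^+ 2 = (lambda1 Omega)^-1.
  rewrite /C_F -powR_mulrn ?powR_ge0// -powRrM -[RHS]powR_inv1 ?(ltW l0)//.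
  by congr (_ `^ _); field.
by rewrite mulrC ler_pdivlMr// mulrC.
Qed.

Section flux.
Context (y : Z -> Z) (hy : inYdiv Omega s y).
Let a : Z -> Z := fun z => gradQ Omega s wt0 z - z.2 `^ (2 * s - 1) *: y z.
Let b : Z -> R := fun z => z.2 `^ (2 * s - 1) * divQ Omega y z.

Lemma divQ_weak : weak_div Omega y (divQ Omega y).
Proof. by case: hy => _ ex _; apply: (@xgetPex _ (fun=> 0) [set q | weak_div Omega y q]). Qed.

Lemma flux_b_Es : Es b.
Proof.
have [_ _ hb] := hy; have [[md _] _] := divQ_weak; have [m1' _ _] := weight_om1 s0 s1.
split; first by case; apply: measurable_funM => //; exact: (measurable_wt m1').
rewrite (_ : sqint _ _ _ _ _ = (\int[lebQ]_(z in Q) (z.2 `^ (2 * s - 1) * (divQ Omega y z) ^+ 2)%:E)%E)//.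
apply: eq_integral => z /set_mem Qz; rewrite dotcR /b; congr EFin.
have := om01 s Qz; rewrite /wt /om1 => h.
transitivity ((om0 z.2 * z.2 `^ (2 * s - 1)) * (z.2 `^ (2 * s - 1) * divQ Omega y z ^+ 2)); first by ring.
by rewrite h mul1r.
Qed.

Lemma flux_a_mfc : mfc (Q : set ZM) (coordZ d) a.
Proof.
have [[my _] _ _] := hy; have [m1' _ _] := weight_om1 s0 s1.
have [mG _] := grad_Ev vwt; have mY := (measurable_fun_ZP y mQ).1 my.
move=> i; rewrite (_ : (fun x => _) = fun z => coZ i (grad wt0 z) - z.2 `^ (2 * s - 1) * coZ i (y z)).
  apply: measurable_funB; first exact: mG.
  by apply: measurable_funM; [exact: (measurable_wt m1')|exact: mY].
apply/funext => z; rewrite /a.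
by rewrite [LHS](coB (cs := coordZ d)); congr (_ - _); rewrite [LHS](co_scale (cs := coordZ d)).
Qed.

Lemma flux_identity h phi : Ev a -> flux_trace Omega y h -> adm phi ->
  ipv (grad e) (gradz phi) = ipv a (gradz phi) - ips b phi - ipO (h + g) (fun x => phi (x, 0)).
Proof.
move=> Ea [Lh fl] aphi; have Eh := L2_EO Lh; have [sp _ _] := aphi.
have E0 : EO (fun x => phi (x, 0)) by exact: slice_EO.
have Ep := adEv aphi; have Eb := flux_b_Es.
rewrite (grad_err Ep) (weak_adm aphi) (ph_BD hO Eh Eg E0).
have Ew := grad_Ev vwt.
(* Green's formula in weighted form: the gradient of [wt0] minus [a] is om1 y, and om0 om1 = 1
   removes the weights. *)
have : ipv (grad wt0) (gradz phi) - ipv a (gradz phi) + ips b phi = - ipO h (fun x => phi (x, 0)).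
  rewrite ipOE -(fl phi aphi).
  have i1 := EL2_integrable mQ mW W0 Ew Ep.
  have i2 := EL2_integrable mQ mW W0 Ea Ep.
  have i3 := EL2_integrable mQ mW W0 Eb (adEs aphi).
  rewrite /ip -RintegralB// -RintegralD//; last by apply: (integrableB mQ i1 i2).
  apply: eq_Rintegral => z /set_mem Qz.
  have h1 := om01 s Qz.
  rewrite dotcR dotzE /a /b -[z.2 `^ (2 * s - 1)]/(om1 z.2).
  rewrite -mulrBr -mulrDr.
  have -> : dotc (coordZ d) (gradQ Omega s wt0 z) (gradz phi z) -
    dotc (coordZ d) (gradQ Omega s wt0 z - om1 z.2 *: y z) (gradz phi z) = om1 z.2 * dotc (coordZ d) (y z) (gradz phi z).
    by rewrite -scaleNr dotcDl dotcZl; move: (dotc _ _ _) (dotc _ _ _) => p q; ring.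
  rewrite -mulrA -mulrDr mulrA h1 mul1r//.
move: (ipv (grad wt0) _) (ipv a _) (ips b _) (ipO h _) (ipO g _) => p1' p2 p3 p4 p5; lra.
Qed.

(** Green's formula is given for admissible functions, so [flux_identity] is applied to approximants
    of the error [e]; the limit is N^2 <= M N. *)
Lemma flux_bound h : Ev a -> flux_trace Omega y h ->
  nrm ipv (grad e) <= nrm ipv a + C_F Omega * nrm ips b + trc Omega s * nrm ipO (h + g).
Proof.
move=> Ea fl; have Eh := L2_EO (proj1 fl); have Ehg := ph_D hO Eh Eg.
have [Ee EG [phi [aphi _ c]]] := gradP inV_err.
set M := _ + _ + _; have M0 : 0 <= M.
  by rewrite !addr_ge0 ?mulr_ge0 ?nrm_ge0 ?powR_ge0//; exact: powR_ge0.
set N := nrm ipv (grad e).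
have c1 := ncvg_B hv (fun n => adEv (aphi n)) EG EG c.
have c2 := ncvg_nrm hv (fun n => adEv (aphi n)) EG c.
have : N ^+ 2 <= M * N.
  rewrite (nrm_sqr hv EG).
  have c3 : M * nrm ipv (gradz (phi n)) @[n --> \oo] --> M * N by apply: cvgM; [exact: cvg_cst|exact: c2].
  apply: (ler_cvg_to c1 c3); apply: nearW => n; rewrite (ph_C hv).
  have [sp _ _] := aphi n; have E0 := slice_EO oO bO 0 sp.
  rewrite (flux_identity Ea fl (aphi n)).
  have h1 := ph_CS hv Ea (adEv (aphi n)).
  have h2 := ph_CS hs flux_b_Es (adEs (aphi n)).
  have h3 := ph_CS hO Ehg E0.
  have h4 := ler_wpM2l (nrm_ge0 ips b) (friedrichs_nrm (aphi n)).
  have h5 := ler_wpM2l (nrm_ge0 ipO (h + g)) (trace_le d0 oO bO nO s0 s1 (aphi n)).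
  move: h1 h2 h3 h4 h5; rewrite /M.
  move: (ipv a _) (ips b _) (ipO (h + g) _) (nrm ipv a) (nrm ips b) (nrm ipO (h + g)) (nrm ips (phi n)) (nrm ipO (fun x => phi n (x, 0))) (nrm ipv (gradz (phi n))) (C_F Omega) (trc Omega s).
  move=> x1 x2 x3 n1 n2 n3 q2 q3 q1 C T; rewrite !ler_norml => /andP[_ h1] /andP[h2 _] /andP[h3 _] h4 h5.
  rewrite !mulrDl; apply: (@le_trans _ _ (n1 * q1 + n2 * q2 + n3 * q3)); first by lra.
  have -> : C * n2 * q1 = n2 * (C * q1) by ring.
  have -> : T * n3 * q1 = n3 * (T * q1) by ring.
  by rewrite !lerD.
have [->//|N0] := eqVneq N 0.
by rewrite expr2 ler_pM2r// lt_neqAle eq_sym N0 nrm_ge0.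
Qed.

(** Membership in Y^s controls y with the weight om0, whereas the first term of [M_plus] involves y
    with the weight om1. Where that term is infinite the bound is trivial; otherwise [flux_bound]
    applies. *)
Lemma err_le_M_plus : (normQv Omega s (grad e) <= M_plus Omega s g wt0 y)%E.
Proof.
rewrite errE /M_plus -/a -/b normQvE normQE (sqrte_sqint mQ mW W0 flux_b_Es) -/(trc Omega s).
have t0 : 0 < trc Omega s := trc_gt0 d0 oO bO nO s0 s1.
have r0 : (0 <= flux_residual Omega y g)%E.
  by apply: le_ereal_inf_tmp => _ [h _ <-]; exact: poweR_ge0.
have [Ea|nEa] := pselect (Ev a); last first.
  have -> : sqint mu Q (coordZ d) (wt om0) a = +oo%E.
    apply/eqP; rewrite -leye_eq leNgt; apply/negP => h; apply: nEa; split => //; exact: flux_a_mfc.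
  have y0 (x : \bar R) : (0 <= x -> +oo + x = +oo)%E by case: x.
  rewrite /Defs.sqrte poweRyr ?invr_eq0// !y0 ?leey// ?mule_ge0 ?lee_fin ?nrm_ge0 ?powR_ge0//.
  exact: ltW.
rewrite (sqrte_sqint mQ mW W0 Ea).
set N := nrm ipv (grad e); set A := nrm ipv a; set B := nrm ips b.
(* The residual is an infimum over traces [h], possibly over none. Comparing it with a real number
   reduces the claim to one inequality per [h]. *)
have -> : N%:E = (A%:E + (C_F Omega)%:E * B%:E + (trc Omega s)%:E * ((N - (A + C_F Omega * B)) / trc Omega s)%:E)%E.
  by rewrite -!EFinM -!EFinD; congr EFin; rewrite [trc _ _ * _]mulrC divfK ?gt_eqF// [RHS]addrC subrK.
apply: leeD => //; apply: lee_wpmul2l; first by rewrite lee_fin ltW.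
apply: le_ereal_inf_tmp => _ [h fl <-].
have Eh := L2_EO (proj1 fl); have Ehg := ph_D hO Eh Eg.
rewrite (normOE Omega) (sqrte_sqint mO m1 p1 Ehg) lee_fin ler_pdivrMr// lerBlDl mulrC.
rewrite mulrC [X in _ <= _ + X]mulrC; exact: flux_bound.
Qed.

End flux.
End bounds.

(** * The infimum over fluxes *)

Section line.
Context {R : realType}.
Local Notation leb1 := (@lebesgue_measure R).
Local Notation P := (`]0%R, +oo[%classic : set R).
Local Open Scope ereal_scope.

Lemma lebesgue_measure_shift (c : R) (A : set R) : measurable A ->
  pushforward leb1 ((fun t => t + c)%R : measurableTypeR R -> measurableTypeR R) A = leb1 A.
Proof.
have ms : measurable_fun setT ((fun t => t + c)%R : measurableTypeR R -> measurableTypeR R).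
  by apply: measurable_funD => //; exact: measurable_cst.
pose nu := measure_function_pushforward__canonical__measure_function_Measure
  [the measure _ _ of leb1] ms.
move=> mA; apply/esym/(@lebesgue_measure_unique R nu) => //= _ [[a b]] _ <-.
rewrite /pushforward (_ : _ @^-1` _ = `](a - c)%R, (b - c)%R]%classic).
  rewrite !lebesgue_measure_itv/= !lte_fin ltrD2r; case: ifP => // _.
  by rewrite -!EFinB; congr EFin; ring.
by apply/seteqP; split=> t /=; rewrite !in_itv/= ltrBlDr lerBrDr.
Qed.

Lemma integral_shift (c : R) (f : R -> \bar R) : measurable_fun setT f -> (forall t, 0 <= f t) ->
  \int[leb1]_t f (t + c)%R = \int[leb1]_t f t.
Proof.
move=> mf f0.
have ms : measurable_fun setT ((fun t => t + c)%R : measurableTypeR R -> measurableTypeR R).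
  by apply: measurable_funD => //; exact: measurable_cst.
have := @ge0_integral_pushforward _ _ (measurableTypeR R) (measurableTypeR R) R _ ms leb1 setT f measurableT mf (fun t _ => f0 t).
rewrite preimage_setT => <-.
by apply: eq_measure_integral => A mA _; exact: lebesgue_measure_shift.
Qed.

Lemma integral_opp (f : R -> \bar R) : measurable_fun setT f -> (forall t, 0 <= f t) ->
  \int[leb1]_t f (- t)%R = \int[leb1]_t f t.
Proof.
move=> mf f0.
have ms : measurable_fun setT ((fun t => - t)%R : measurableTypeR R -> measurableTypeR R).
  exact: measurableT_comp.
have := @ge0_integral_pushforward _ _ (measurableTypeR R) (measurableTypeR R) R _ ms leb1 setT f measurableT mf (fun t _ => f0 t).
rewrite preimage_setT => <-.
by apply: eq_measure_integral => A mA _; exact: lebesgue_measureN.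
Qed.

(** Lowering the left end to K exp(-M) provides any mass M while the right end K stays small. *)
Lemma int_inv (K M : R) : (0 < K)%R -> (0 < M)%R ->
  \int[leb1]_(c in `[(K * expR (- M))%R, K]) (c^-1)%:E = M%:E.
Proof.
move=> K0 M0; have a0 : (0 < K * expR (- M))%R by rewrite mulr_gt0 ?expR_gt0.
have aK : (K * expR (- M) < K)%R by rewrite gtr_pMr// expR_lt1 oppr_lt0.
have dF (x : R) : (0 < x)%R -> is_derive x 1%R (@ln R) (x^-1)%R by move=> x0; exact: is_derive1_ln.
have cF (x : R) : (0 < x)%R -> {for x, continuous (@ln R)} by move=> x0; exact: continuous_ln.
rewrite (@continuous_FTC2 R (fun t => t^-1)%R (@ln R))//.
- rewrite -EFinB lnM ?posrE ?expR_gt0// expRK; congr EFin; ring.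
- apply: continuous_in_subspaceT => x; rewrite inE/= in_itv/= => /andP[h _].
  by apply: inv_continuous; rewrite gt_eqF// (lt_le_trans a0 h).
- split.
  + move=> x; rewrite in_itv/= => /andP[h _].
    by have [] := dF x (lt_trans a0 h).
  + by apply: cvg_at_right_filter; exact: cF.
  + by apply: cvg_at_left_filter; exact: cF.
- move=> x; rewrite in_itv/= => /andP[h _]; rewrite derive1E.
  by have [_ ->] := dF x (lt_trans a0 h).
Qed.

(* Averaging the shifts over dc/c loses only 1/(q+1) against the total mass L:
   (1/c)(r-c)^q <= r^q/c + (1/r)(r-c)^q. *)
Section average.
Context (q tau K L B k : R) (f : R -> \bar R).
Hypotheses (q1 : (-1 < q)%R) (t0 : (0 < tau)%R) (tK : (tau <= K)%R) (L0 : (0 < L)%R).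
Hypothesis LE : \int[leb1]_(c in `[tau, K]) (c^-1)%:E = L%:E.
Hypotheses (mf : measurable_fun setT f) (f0 : forall t, 0 <= f t).
Hypotheses (fB : \int[leb1]_(r in `[tau, +oo[) ((r `^ q)%:E * f r) <= B%:E) (k0 : (0 < k)%R).

(** Extended by 0 to t <= 0, so that shifting the function on the half-line amounts to shifting the
    kernel on the whole line. *)
Let kern (t : R) : R := if (0 < t)%R then (t `^ q)%R else 0%R.

Let kern_ge0 t : (0 <= kern t)%R. Proof. by rewrite /kern; case: ifP => // _; exact: powR_ge0. Qed.

Let measurable_kern : measurable_fun setT kern.
Proof.
apply: measurable_fun_ifT; [exact: measurable_fun_ltr|exact: measurable_powR|exact: measurable_cst].
Qed.

Let D := (`[tau, K]%classic : set (measurableTypeR R)).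
Let mD : measurable D. Proof. exact: measurable_itv. Qed.
Let Dpos c : D c -> (0 < c)%R.
Proof. by rewrite /D/= in_itv/= => /andP[h _]; exact: lt_le_trans h. Qed.
Let mP : @measurable _ (measurableTypeR R) P. Proof. exact: measurable_itv. Qed.

Let measurable_invD : measurable_fun D (fun c : R => c^-1)%R.
Proof.
apply: (@measurable_funS _ _ _ _ P) => //; first by move=> c /Dpos c0; rewrite /= in_itv/= andbT.
by apply: continuous_measurable_pos => x x0; apply: inv_continuous; rewrite gt_eqF.
Qed.

Lemma shifted_integral c : \int[leb1]_(t in P) ((t `^ q)%:E * f (t + c)%R) = \int[leb1]_r ((kern (r - c))%:E * f r).
Proof.
have m1 : measurable_fun setT (fun r : R => (kern (r - c))%:E * f r).
  apply: emeasurable_funM => //; apply/measurable_EFinP; apply: measurableT_comp => //.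
  by apply: measurable_funB => //; exact: measurable_cst.
rewrite -(integral_shift c m1); last by move=> t; rewrite mule_ge0// lee_fin kern_ge0.
rewrite integral_mkcond; apply: eq_integral => t _; rewrite patchE addrK /kern.
have -> : (t \in P) = (0 < t)%R.
  by apply/idP/idP => [/set_mem|h]; [|apply: mem_set]; rewrite /= in_itv/= andbT.
by case: ifP => //; rewrite mul0e.
Qed.

Let pairF (p : measurableTypeR R * measurableTypeR R) : \bar R := (p.1^-1 * kern (p.2 - p.1))%:E * f p.2.

Let measurable_pairF : measurable_fun (D `*` setT) pairF.
Proof.
apply: emeasurable_funM; last by apply: measurable_funTS; exact: (measurableT_comp mf measurable_snd).
apply/measurable_EFinP; apply: measurable_funM.
  apply: (@measurable_comp _ _ _ _ _ _ D (fun c => c^-1)%R _ fst) => //.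
  - by move=> _ [[a b] [Da _] <-].
  - by apply: measurable_funTS; exact: measurable_fst.
apply: measurable_funTS; apply: measurableT_comp => //.
by apply: measurable_funB; [exact: measurable_snd|exact: measurable_fst].
Qed.

Let pairF_ge0 p : (D `*` setT) p -> 0 <= pairF p.
Proof.
move=> [Dp _]; rewrite mule_ge0// lee_fin mulr_ge0 ?invr_ge0 ?kern_ge0//.
by rewrite ltW//; exact: Dpos.
Qed.

Lemma kern_average_le r : (tau < r)%R -> \int[leb1]_(c in D) (c^-1 * kern (r - c))%:E <= (r `^ q * (L + (q + 1)^-1))%:E.
Proof.
move=> tr; have r0 := lt_trans t0 tr; have qp : (0 < q + 1)%R by move: q1; lra.
have mk : measurable_fun setT (fun c : R => kern (r - c)).
  by apply: measurableT_comp => //; apply: measurable_funB => //; exact: measurable_cst.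
apply: (@le_trans _ _ (\int[leb1]_(c in D) ((r `^ q)%:E * (c^-1)%:E + (r^-1)%:E * (kern (r - c) * \1_P c)%:E))).
  apply: ge0_le_integral => //.
  - by move=> c /Dpos c0; rewrite lee_fin mulr_ge0 ?invr_ge0 ?kern_ge0// ltW.
  - by apply/measurable_EFinP; apply: measurable_funM => //; exact: measurable_funTS.
  - apply: emeasurable_funD; apply: emeasurable_funM; try exact: measurable_cst.
      by apply/measurable_EFinP.
    apply/measurable_EFinP; apply: measurable_funTS; apply: measurable_funM => //.
  - move=> c Dc; have c0 := Dpos Dc; rewrite -!EFinM -EFinD lee_fin.
    rewrite indicE mem_set/= ?in_itv/= ?andbT// mulr1 /kern; case: ifPn => [rc|_]; last first.
      by rewrite !mulr0 addr0 mulr_ge0 ?powR_ge0// invr_ge0 ltW.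
    have rc' : (r - c <= r)%R by rewrite gerBl ltW.
    (* Multiplied by c r, the pointwise inequality is the monotonicity of the power q + 1 > 0. *)
    have H : ((r - c) `^ (q + 1) <= r `^ (q + 1))%R.
      by apply: ge0_ler_powR; rewrite ?nnegrE; [exact: ltW|exact: ltW|exact: ltW|].
    rewrite !powRDp// !powRr1 ?(ltW r0) ?(ltW rc)// in H.
    rewrite -(@ler_pM2r _ (c * r)%R) ?mulr_gt0//.
    have -> : (c^-1 * (r - c) `^ q * (c * r) = r * (r - c) `^ q)%R by field; rewrite gt_eqF.
    have -> : ((r `^ q * c^-1 + r^-1 * (r - c) `^ q) * (c * r) = r `^ q * r + c * (r - c) `^ q)%R.
      by field; rewrite !gt_eqF.
    by move: H; set u := ((r - c) `^ q)%R; set v := (r `^ q)%R; lra.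
rewrite ge0_integralD//; last 4 first.
- by move=> c /Dpos c0; rewrite -EFinM lee_fin mulr_ge0 ?powR_ge0// invr_ge0 ltW.
- by apply: emeasurable_funM; [exact: measurable_cst|apply/measurable_EFinP].
- by move=> c _; rewrite -EFinM lee_fin !mulr_ge0 ?kern_ge0// invr_ge0 ltW.
- apply: emeasurable_funM; first exact: measurable_cst.
  by apply/measurable_EFinP; apply: measurable_funTS; apply: measurable_funM => //; exact: measurable_indic.
rewrite ge0_integralZl_EFin ?powR_ge0//; last 2 first.
- by move=> c /Dpos c0; rewrite lee_fin invr_ge0 ltW.
- by apply/measurable_EFinP.
rewrite LE ge0_integralZl_EFin ?invr_ge0 ?(ltW r0)//; last 2 first.
- by move=> c _; rewrite lee_fin mulr_ge0 ?kern_ge0.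
- by apply/measurable_EFinP; apply: measurable_funTS; apply: measurable_funM => //; exact: measurable_indic.
rewrite mulrDr EFinD -EFinM leeD2l//.
have -> : (r `^ q * (q + 1)^-1)%:E = (r^-1)%:E * (r `^ (q + 1) / (q + 1))%:E.
  rewrite -EFinM; congr EFin; rewrite powRDp// powRr1 ?(ltW r0)//.
  by field; rewrite !gt_eqF.
apply: lee_wpmul2l; first by rewrite lee_fin invr_ge0 ltW.
apply: le_trans (int_powR_le q1 r0).
pose h (t : R) : \bar R := (kern t * \1_P (r - t))%:E.
have mh : measurable_fun setT h.
  apply/measurable_EFinP; apply: measurable_funM => //; apply: measurableT_comp; first exact: measurable_indic.
  by apply: measurable_funB => //; exact: measurable_cst.
have h0 t : 0 <= h t by rewrite lee_fin mulr_ge0 ?kern_ge0.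
apply: (@le_trans _ _ (\int[leb1]_c h (r - c)%R)).
  rewrite integral_mkcond; apply: ge0_le_integral => //.
  - by move=> c _; apply: erestrict_ge0 => ? _; rewrite lee_fin mulr_ge0 ?kern_ge0.
  - apply/(measurable_restrictT _ mD); apply/measurable_EFinP; apply: measurable_funTS; apply: measurable_funM => //.
  - by apply: measurableT_comp => //; apply: measurable_funB => //; exact: measurable_cst.
  - by move=> c _; rewrite patchE; case: ifP => _ //; rewrite /h subKr.
have -> : \int[leb1]_c h (r - c)%R = \int[leb1]_c h c.
  have mh2 : measurable_fun setT (fun t => h (r + t)%R).
    by apply: measurableT_comp => //; apply: measurable_funD => //; exact: measurable_cst.
  rewrite (integral_opp mh2)// -(integral_shift r mh h0).
  by apply: eq_integral => t _; rewrite addrC.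
rewrite [leRHS]integral_mkcond; apply: ge0_le_integral => //.
- have mr : @measurable _ (measurableTypeR R) (`]0%R, r]%classic : set R) by exact: measurable_itv.
  apply/(measurable_restrictT _ mr).
  by apply/measurable_EFinP; apply: measurable_funTS; exact: measurable_powR.
- move=> t _; rewrite patchE /h /kern indicE; case: ifPn => [tp|_]; last first.
    by rewrite mul0r; case: ifP => // _; rewrite lee_fin powR_ge0.
  case: ifPn => [_|tn]; first by rewrite lee_fin ler_piMr ?powR_ge0//; case: (_ \in _).
  rewrite memNset ?mulr0//= in_itv/= andbT subr_gt0 => tr'.
  by move/negP: tn; apply; apply: mem_set; rewrite /= in_itv/= tp ltW.
Qed.

(** Tonelli's theorem exchanges shift and height, and [kern_average_le] applies at each height r >
    tau; at lower heights the kernel vanishes since c >= tau. *)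
Lemma shift_average : \int[leb1]_(c in D) ((c^-1)%:E * \int[leb1]_(t in P) ((t `^ q)%:E * f (t + c)%R)) <=
  (L + (q + 1)^-1)%:E * B%:E.
Proof.
have qp : (0 < q + 1)%R by move: q1; lra.
have Lq : (0 <= L + (q + 1)^-1)%R by apply: addr_ge0; [exact: ltW|rewrite invr_ge0; exact: ltW].
have -> : \int[leb1]_(c in D) ((c^-1)%:E * \int[leb1]_(t in P) ((t `^ q)%:E * f (t + c)%R)) =
    \int[leb1]_(c in D) \int[leb1]_r pairF (c, r).
  apply: eq_integral => c /set_mem Dc; rewrite shifted_integral -ge0_integralZl_EFin//.
  - by apply: eq_integral => r _; rewrite /pairF /= EFinM muleA.
  - by move=> t _; rewrite mule_ge0// lee_fin kern_ge0.
  - apply: emeasurable_funM => //; apply/measurable_EFinP; apply: measurableT_comp => //.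
    by apply: measurable_funB => //; exact: measurable_cst.
  - by rewrite invr_ge0 ltW//; exact: Dpos.
rewrite -(@tonelli1 _ _ _ (measurableTypeR R) (measurableTypeR R) leb1 leb1 D setT mD measurableT pairF measurable_pairF pairF_ge0).
rewrite (@tonelli2 _ _ _ (measurableTypeR R) (measurableTypeR R) leb1 leb1 D setT mD measurableT pairF measurable_pairF pairF_ge0).
apply: (@le_trans _ _ ((L + (q + 1)^-1)%:E * \int[leb1]_(r in `[tau, +oo[) ((r `^ q)%:E * f r))); last first.
  exact: lee_wpmul2l.
have mtau : @measurable _ (measurableTypeR R) (`[tau, +oo[%classic : set R) by exact: measurable_itv.
have mg : measurable_fun (`[tau, +oo[%classic : set R) (fun r => (r `^ q)%:E * f r).
  apply: emeasurable_funM; last exact: measurable_funTS.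
  by apply/measurable_EFinP; apply: measurable_funTS; exact: measurable_powR.
rewrite -ge0_integralZl_EFin//; last first.
- by move=> r _; rewrite mule_ge0// lee_fin powR_ge0.
rewrite [leRHS]integral_mkcond; apply: ge0_le_integral => //.
- by move=> r _; apply: integral_ge0 => c Dc; exact: pairF_ge0.
- exact: (@measurable_tonelli2 _ _ _ (measurableTypeR R) (measurableTypeR R) leb1 D setT mD measurableT pairF measurable_pairF pairF_ge0).
- apply/(measurable_restrictT _ mtau); apply: emeasurable_funM => //; exact: measurable_cst.
move=> r _; rewrite patchE; case: ifPn => [rt|rt].
  have [tr|rt'] := ltP tau r; last first.
    have p0 : 0 <= (L + (q + 1)^-1)%:E * ((r `^ q)%:E * f r).
      by rewrite mule_ge0 ?lee_fin// mule_ge0 ?lee_fin ?powR_ge0.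
    rewrite integral0_eq// => c Dc; rewrite /pairF /= /kern subr_gt0 ltNge (le_trans rt')/= ?mulr0 ?mul0e//.
    by move: Dc; rewrite /D/= in_itv/= => /andP[].
  rewrite /pairF /= ge0_integralZr//; last 2 first.
  - apply/measurable_EFinP; apply: measurable_funM => //; apply: measurable_funTS; apply: measurableT_comp => //.
    by apply: measurable_funB => //; exact: measurable_cst.
  - by move=> c /Dpos c0; rewrite lee_fin mulr_ge0 ?invr_ge0 ?kern_ge0// ltW.
  rewrite muleA -EFinM; apply: lee_wpmul2r => //.
  by rewrite mulrC; exact: kern_average_le.
rewrite integral0_eq// => c Dc; rewrite /pairF /= /kern subr_gt0 ltNge ifN ?mulr0 ?mul0e// negbK.
move: Dc rt; rewrite /D/= in_itv/= => /andP[tc _] /negP rt; apply: (le_trans _ tc).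
by rewrite leNgt; apply/negP => tr; apply: rt; apply: mem_set; rewrite /= in_itv/= andbT ltW.
Qed.

(** If every shift exceeded the bound M, the average would be at least L M = (L + 1/(q+1)) (B + k),
    above what [shift_average] allows. The slack k > 0 makes the contradiction strict. *)
Lemma shift_pigeonhole : exists2 c, (tau <= c <= K)%R &
  \int[leb1]_(t in P) ((t `^ q)%:E * f (t + c)%R) <= ((1 + (q + 1)^-1 / L) * (B + k))%:E.
Proof.
have qp : (0 < q + 1)%R by move: q1; lra.
apply: contrapT => H.
have B0 : (0 <= B)%R.
  rewrite -lee_fin; apply: le_trans fB; apply: integral_ge0 => r _.
  by rewrite mule_ge0// lee_fin powR_ge0.
set M := ((1 + _) * _)%R in H.
have M0 : (0 <= M)%R.
  have h1 : (0 <= 1 + (q + 1)^-1 / L)%R.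
    by apply: addr_ge0 => //; apply: divr_ge0; [rewrite invr_ge0; exact: ltW|exact: ltW].
  by rewrite /M mulr_ge0// addr_ge0// ltW.
have : (L * M)%:E <= (L + (q + 1)^-1)%:E * B%:E.
  apply: le_trans shift_average.
  have -> : (L * M)%:E = \int[leb1]_(c in D) ((c^-1)%:E * M%:E).
    rewrite ge0_integralZr ?lee_fin//; first by rewrite LE EFinM.
    - by apply/measurable_EFinP.
    - by move=> c /Dpos c0; rewrite lee_fin invr_ge0 ltW.
  apply: ge0_le_integral => //.
  - by move=> c /Dpos c0; rewrite mule_ge0 ?lee_fin// invr_ge0 ltW.
  - by apply: emeasurable_funM; [apply/measurable_EFinP|exact: measurable_cst].
  - have e c : D c -> (c^-1)%:E * (\int[leb1]_(t in P) ((t `^ q)%:E * f (t + c)%R)) = \int[leb1]_r pairF (c, r).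
      move=> Dc; rewrite shifted_integral -ge0_integralZl_EFin//.
      + by apply: eq_integral => r _; rewrite /pairF /= EFinM muleA.
      + by move=> t _; rewrite mule_ge0// lee_fin kern_ge0.
      + apply: emeasurable_funM => //; apply/measurable_EFinP; apply: measurableT_comp => //.
        by apply: measurable_funB => //; exact: measurable_cst.
      + by rewrite invr_ge0 ltW//; exact: Dpos.
    apply: (eq_measurable_fun (fun c => \int[leb1]_r pairF (c, r))).
      by move=> c /set_mem Dc; rewrite e.
    exact: (@measurable_tonelli1 _ _ _ (measurableTypeR R) (measurableTypeR R) leb1 D setT mD measurableT pairF measurable_pairF pairF_ge0).
  - move=> c Dc; apply: lee_wpmul2l; first by rewrite lee_fin invr_ge0 ltW//; exact: Dpos.
    rewrite leNgt; apply/negP => h; apply: H; exists c; last exact: ltW.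
    by move: Dc; rewrite /D/= in_itv/=.
rewrite -EFinM lee_fin /M.
have -> : (L * ((1 + (q + 1)^-1 / L) * (B + k)) = (L + (q + 1)^-1) * (B + k))%R.
  by field; rewrite !gt_eqF.
rewrite ler_pM2l ?addr_gt0 ?invr_gt0// => h; move: k0 h; lra.
Qed.

End average.
End line.

(** * Cutoff and shift of admissible functions *)

Section modifications.
Context {R : realType} (d : nat) (Omega : set 'rV[R]_d).
Local Notation Z := ('rV[R]_d * R)%type.
Local Notation adm := (admissible Omega).

(** Equal to 1 up to t = T and to 0 from t = 2 T on, with a derivative of order 1/T. *)
Definition chi (T t : R) : R := 1 - step (T^-1 * t - 1).

Let chi_arg (T t : R) : is_derive t 1 (fun t => T^-1 * t - 1) T^-1.
Proof.
have h := is_deriveB (is_deriveZ T^-1 (is_derive_id t (1 : R))) (is_derive_cst (1 : R) t (1 : R)).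
by apply: is_derive_eq h _; rewrite subr0 /GRing.scale/= mulr1.
Qed.

Lemma smooth_chi T : smooth (chi T).
Proof.
have sA : smooth (fun t : R => T^-1 * t - 1).
  apply: (@smoothD R R (fun t => T^-1 * t) (cst (- 1))); [exact: (smoothZ T^-1 (@smooth_id R))|exact: smooth_cst].
have s1 := smooth_comp (@smooth_step R) sA.
rewrite (_ : chi T = cst 1 \+ (fun t => (-1) * (step \o (fun t : R => T^-1 * t - 1)) t)).
  by apply: smoothD; [exact: smooth_cst|exact: smoothZ].
by apply/funext => t; rewrite /= mulN1r.
Qed.

Lemma chi_le1 T t : `|chi T t| <= 1.
Proof. by rewrite /chi ger0_norm ?subr_ge0 ?step_le1// gerBl step_ge0. Qed.

Lemma chi_at0 T : chi T 0 = 1.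
Proof. by rewrite /chi mulr0 sub0r step_eq0 ?subr0// oppr_le0. Qed.

Lemma chi_eq0 T t : 0 < T -> 2 * T <= t -> chi T t = 0.
Proof.
move=> T0 Tt; rewrite /chi step_eq1 ?subrr// lerBrDr -(@ler_pM2l _ T)// mulrA divff ?gt_eqF// mul1r.
by rewrite mulrC.
Qed.

Lemma chi_derive_bound : exists2 C : R, 0 <= C & forall T t, 0 < T -> `|'D_1 (chi T) t| <= C / T.
Proof.
have [C C0 hC] := @step_derive_bound R; exists C => // T t T0.
have [dA eA] := chi_arg T t.
have h := is_derive_comp_line dA (smooth_derivable (x := T^-1 * t - 1) (v := 1) (@smooth_step R)).
have [_ ->] := is_deriveB (is_derive_cst (1 : R) t (1 : R)) h.
by rewrite sub0r normrN normrM eA derive1E normfV (gtr0_norm T0) ler_wpM2r ?invr_ge0 ?(ltW T0).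
Qed.

Definition cutoff (T : R) (f : Z -> R) (z : Z) : R := chi T z.2 * f z.

Lemma smooth_cutoff T f : smooth f -> smooth (cutoff T f).
Proof.
move=> sf; have sX : smooth (fun z : Z => chi T z.2).
  apply: (@smooth_affine R Z R (chi T) snd snd) => //; last exact: smooth_chi.
  by move=> z; exact: cvg_snd.
exact: (smoothM sX sf).
Qed.

Lemma adm_cutoff T f : adm f -> adm (cutoff T f).
Proof.
move=> /admissibleP[sf bf zf]; apply/admissibleP; split; first exact: smooth_cutoff.
- rewrite (_ : cutoff T f = f \* (fun z => chi T z.2)); first exact: bsuppM.
  by apply/funext => z; rewrite /cutoff /= mulrC.
- by move=> x t bx t0; rewrite /cutoff zf// mulr0.
Qed.

Lemma gsq_cutoff_eq0 T f z : 0 < T -> 2 * T < z.2 -> gsq (cutoff T f) z = 0.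
Proof.
move=> T0 Tz; pose K : set Z := [set z | z.2 <= 2 * T].
have cK : closed K.
  apply: (@closed_comp _ _ (snd : Z -> R) [set t | t <= 2 * T]); last exact: closed_le.
  by move=> y _; exact: cvg_snd.
have nK : ~ K z by rewrite /K/= leNgt Tz.
have f0 y : ~ K y -> cutoff T f y = 0.
  by rewrite /K/= => /negP; rewrite -ltNge => /ltW h; rewrite /cutoff chi_eq0// mul0r.
rewrite /gsq dotzE /dotc big1// => i _.
by rewrite /= coZ_gradz (derive_eq0_out _ cK f0 nK) mul0r.
Qed.

Lemma dxsq_cutoff T f z : smooth f -> dxsq (cutoff T f) z <= dxsq f z.
Proof.
move=> sf; case: z => x t; rewrite /dxsq (gradz_slices x t sf) (gradz_slices x t (smooth_cutoff T sf)).
rewrite /= (_ : (fun x0 => cutoff T f (x0, t)) = chi T t *: (fun x => f (x, t)))//.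
have st := smooth_sliceZ t sf.
have -> : gradx (chi T t *: (fun x => f (x, t))) x = chi T t *: gradx (fun x => f (x, t)) x.
  apply/rowP => i; rewrite !mxE deriveZ//; exact: smooth_derivable.
rewrite !dotE dotcZl dotcC dotcZl mulrA ler_piMl ?dotc_ge0// -expr2.
by rewrite -real_normK ?num_real// expr_le1// chi_le1.
Qed.

(** Young's inequality with parameter 1/T: (p + q)^2 <= (1 + 1/T) p^2 + (1 + T) q^2, where q carries
    the factor C/T; then 1 + T <= 2 T leaves a coefficient of order 1/T. *)
Lemma dtsq_cutoff T C f z : 1 <= T -> (forall t, `|'D_1 (chi T) t| <= C / T) -> smooth f ->
  dtsq (cutoff T f) z <= (1 + T^-1) * dtsq f z + 2 * C ^+ 2 / T * f z ^+ 2.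
Proof.
move=> T1 hC sf; have T0 : 0 < T by exact: lt_le_trans T1.
case: z => x t; rewrite /dtsq (gradz_slices x t sf) (gradz_slices x t (smooth_cutoff T sf)).
rewrite /= (_ : (fun x0 => cutoff T f (x, x0)) = chi T \* (fun t => f (x, t)))//.
have st := smooth_slice_t x sf.
have [_ ->] := is_deriveM (DeriveDef (smooth_derivable (x := t) (v := 1) (smooth_chi T)) erefl)
  (DeriveDef (smooth_derivable (x := t) (v := 1) st) erefl).
rewrite /GRing.scale/=; have := chi_le1 T t; have := hC t.
move: (chi T t) ('D_1 (chi T) t) ('D_1 (fun t0 => f (x, t0)) t) (f (x, t)) => c c' b a hc' hc.
have i0 : 0 < T^-1 by rewrite invr_gt0.
have i1 : T^-1 <= 1 by rewrite invf_le1.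
have c2 : c ^+ 2 <= 1 by rewrite -real_normK ?num_real// expr_le1.
have c'2 : c' ^+ 2 <= C ^+ 2 * T^-1 ^+ 2.
  rewrite -exprMn -[leLHS]real_normK ?num_real// lerXn2r// nnegrE//.
  exact: le_trans (normr_ge0 _) hc'.
have e : (1 + T^-1) * (c * b) ^+ 2 + (1 + T) * (a * c') ^+ 2 - (c * b + a * c') ^+ 2 = T * (T^-1 * (c * b) - a * c') ^+ 2.
  by field; rewrite gt_eqF.
have e0 : 0 <= T * (T^-1 * (c * b) - a * c') ^+ 2 by rewrite mulr_ge0 ?sqr_ge0// ltW.
have h1 : (c * b) ^+ 2 <= b ^+ 2 by rewrite exprMn ler_piMl ?sqr_ge0.
have h2 : (1 + T) * (a * c') ^+ 2 <= 2 * C ^+ 2 / T * a ^+ 2.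
  apply: (@le_trans _ _ ((1 + T) * (a ^+ 2 * (C ^+ 2 * T^-1 ^+ 2)))).
    by rewrite ler_wpM2l ?exprMn ?ler_wpM2l ?sqr_ge0// addr_ge0// ltW.
  have -> : (1 + T) * (a ^+ 2 * (C ^+ 2 * T^-1 ^+ 2)) = (a * C) ^+ 2 * T^-1 * (T^-1 + 1).
    by field; rewrite gt_eqF.
  have -> : 2 * C ^+ 2 / T * a ^+ 2 = (a * C) ^+ 2 * T^-1 * 2 by ring.
  apply: ler_wpM2l; first by rewrite mulr_ge0 ?sqr_ge0 ?(ltW i0).
  by rewrite -[2]/(1 + 1) lerD2r.
have h3 : (1 + T^-1) * (c * b) ^+ 2 <= (1 + T^-1) * b ^+ 2 by rewrite ler_wpM2l// addr_ge0// ltW.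
move: e e0 h3 h2.
by set p := T * _; set p1 := _ * (c * b) ^+ 2; set p2 := (1 + T) * _; set p3 := _ ^+ 2; set p4 := _ * b ^+ 2; set p5 := _ * a ^+ 2; lra.
Qed.

Definition shiftt (c : R) (f : Z -> R) (z : Z) : R := f (z.1, z.2 + c).

Let shift_line c (h : R) (v z : Z) : ((h *: v + z).1, (h *: v + z).2 + c) = h *: v + (z.1, z.2 + c) :> Z.
Proof. by congr pair; rewrite /= addrA. Qed.

Lemma smooth_shiftt c f : smooth f -> smooth (shiftt c f).
Proof.
apply: (@smooth_affine R Z Z f (fun z => (z.1, z.2 + c)) id).
  move=> z; have h1 : fst y @[y --> z] --> z.1 by exact: cvg_fst.
  have h2 : snd y + c @[y --> z] --> z.2 + c by apply: cvgD; [exact: cvg_snd|exact: cvg_cst].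
  exact: (cvg_pair h1 h2).
exact: shift_line.
Qed.

Lemma gsq_shiftt c f z : gsq (shiftt c f) z = gsq f (z.1, z.2 + c).
Proof.
rewrite /gsq; suff -> : gradz (shiftt c f) z = gradz f (z.1, z.2 + c) by [].
have D v : 'D_v (shiftt c f) z = 'D_v f (z.1, z.2 + c).
  by have [_] := derive_affine f (A := fun z => (z.1, z.2 + c)) (fun h => shift_line c h v z).
by congr pair; [apply/rowP => i; rewrite !mxE D|rewrite D].
Qed.

Lemma adm_shiftt c f : 0 <= c -> adm f -> adm (shiftt c f).
Proof.
move=> c0 /admissibleP[sf [M M0 hM] zf]; apply/admissibleP; split; first exact: smooth_shiftt.
- exists (M + c); first by rewrite ltr_wpDr.
  move=> z nz; apply: hM => /sboxP H; apply: nz; apply/sboxP => -[i|].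
    by apply: (le_trans (H (Some i))); rewrite lerDl.
  have := H None => /= h; rewrite (_ : z.2 = (z.2 + c) - c); last by rewrite addrK.
  by rewrite (le_trans (ler_normB _ _))// (ger0_norm c0) lerD2r.
- by move=> x t bx t0; rewrite /shiftt zf//= ltr_wpDr.
Qed.

End modifications.

(** * The regularised weights *)

Section weights.
Context {R : realType} (s : R).
Hypotheses (s0 : 0 < s) (s1 : s < 1).
Local Notation leb1 := (@lebesgue_measure R).
Local Notation P := (`]0%R, +oo[%classic : set R).
Local Notation om0 := (om0 s).
Local Notation om1 := (om1 s).

(* The weight om0 / (1 + e om0^2). *)
Definition aeps (e t : R) : R := (om1 t + e * om0 t)^-1.

Let om_gt0 t : 0 < t -> 0 < om0 t /\ 0 < om1 t.
Proof. by move=> t0; rewrite /om0 /om1 !powR_gt0. Qed.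

Let om01_1 t : 0 < t -> om0 t * om1 t = 1.
Proof. by move=> t0; rewrite /om0 /om1 powR_inv_weight. Qed.

Let den_gt0 e t : 0 < e -> 0 < t -> 0 < om1 t + e * om0 t.
Proof. by move=> e0 /om_gt0[h0 h1]; rewrite addr_gt0// mulr_gt0. Qed.

Lemma aeps_gt0 e t : 0 < e -> 0 < t -> 0 < aeps e t.
Proof. by move=> e0 t0; rewrite invr_gt0 den_gt0. Qed.

Lemma aepsE e t : 0 < e -> 0 < t -> aeps e t * (1 + e * om0 t ^+ 2) = om0 t.
Proof.
move=> e0 t0; have h := om01_1 t0; have d0 := den_gt0 e0 t0; have [p0 p1] := om_gt0 t0.
have -> : 1 + e * om0 t ^+ 2 = om0 t * (om1 t + e * om0 t) by rewrite mulrDr h; ring.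
by rewrite /aeps mulrCA mulVf ?mulr1// gt_eqF.
Qed.

Lemma aeps_le e t : 0 < e -> 0 < t -> aeps e t <= om0 t.
Proof.
move=> e0 t0; rewrite -[leRHS](aepsE e0 t0) ler_peMr ?(ltW (aeps_gt0 e0 t0))//.
by rewrite lerDl mulr_ge0 ?sqr_ge0// ltW.
Qed.

Lemma measurable_aeps e : 0 < e -> measurable_fun P (aeps e).
Proof.
move=> e0; apply: continuous_measurable_pos => t t0.
apply: (continuous_comp (f := fun t => om1 t + e * om0 t) (g := @GRing.inv R)); last first.
  by apply: inv_continuous; rewrite gt_eqF// den_gt0.
apply: cvgD; first exact: powR_continuous.
by apply: cvgM; [exact: cvg_cst|exact: powR_continuous].
Qed.

Lemma weight_aeps e : 0 < e -> weight (aeps e).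
Proof.
move=> e0; apply: (weight_le (om2 := om0)) => //.
- exact: measurable_aeps.
- by move=> t; exact: aeps_gt0.
- by move=> t; exact: aeps_le.
- exact: weight_om0.
Qed.

(** 1/aeps = om1 + e om0 is at most om1 + om0. The bound is uniform in e, so the length of the
    shifts can be fixed before e. *)
Lemma int_inv_aeps e c : 0 < e -> e <= 1 -> 0 < c ->
  (\int[leb1]_(t in `]0%R, c]) ((aeps e t)^-1)%:E <= (c `^ (2 * s) / (2 * s) + c `^ (2 - 2 * s) / (2 - 2 * s))%:E)%E.
Proof.
move=> e0 e1 c0.
have mi : @measurable _ (measurableTypeR R) (`]0%R, c]%classic : set R) by exact: measurable_itv.
have mp p : measurable_fun (`]0%R, c]%classic : set (measurableTypeR R)) (fun t : R => t `^ p).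
  by apply: measurable_funTS; exact: measurable_powR.
have h1 : (\int[leb1]_(t in `]0%R, c]) (om1 t)%:E <= (c `^ (2 * s) / (2 * s))%:E)%E.
  have := @int_powR_le R (2 * s - 1) c; rewrite subrK; apply => //; move: s0; lra.
have h0 : (\int[leb1]_(t in `]0%R, c]) (om0 t)%:E <= (c `^ (2 - 2 * s) / (2 - 2 * s))%:E)%E.
  have := @int_powR_le R (1 - 2 * s) c; rewrite (_ : 1 - 2 * s + 1 = 2 - 2 * s); last by ring.
  apply => //; move: s1; lra.
rewrite EFinD; apply: le_trans (leeD h1 h0).
rewrite -ge0_integralD//; last 4 first.
- by move=> t _; rewrite lee_fin powR_ge0.
- by apply/measurable_EFinP; exact: mp.
- by move=> t _; rewrite lee_fin powR_ge0.
- by apply/measurable_EFinP; exact: mp.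
apply: ge0_le_integral => //.
- by move=> t /itvoc_sub_pos; rewrite /= in_itv/= andbT => t0; rewrite lee_fin invr_ge0 ltW// aeps_gt0.
- apply/measurable_EFinP; rewrite (_ : (fun t => (aeps e t)^-1) = fun t => om1 t + e * om0 t).
    by apply: measurable_funD; [exact: mp|apply: measurable_funM; [exact: measurable_cst|exact: mp]].
  by apply/funext => t; rewrite invrK.
- by apply: emeasurable_funD; apply/measurable_EFinP; exact: mp.
- move=> t /itvoc_sub_pos; rewrite /= in_itv/= andbT => t0.
  rewrite -EFinD lee_fin invrK lerD2l ler_piMl//; exact: powR_ge0.
Qed.

Lemma weight_inv_aeps e : 0 < e -> e <= 1 -> weight (fun t => (aeps e t)^-1).
Proof.
move=> e0 e1; split.
- rewrite (_ : (fun t => (aeps e t)^-1) = fun t => om1 t + e * om0 t); last by apply/funext => t; rewrite invrK.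
  apply: measurable_funD; first exact: measurable_powR_pos.
  by apply: measurable_funM; [exact: measurable_cst|exact: measurable_powR_pos].
- by move=> t t0; rewrite invr_gt0 aeps_gt0.
- by move=> K K0; exact: le_lt_trans (int_inv_aeps e0 e1 K0) (ltry _).
Qed.

(** The direction in which om0 is monotone depends on the sign of 1 - 2s; the sum of the two end
    values covers both cases. *)
Lemma om0_bound (a b t : R) : 0 < a -> a <= t -> t <= b -> om0 t <= om0 a + om0 b.
Proof.
move=> a0 at' tb; have t0 := lt_le_trans a0 at'; have b0 := lt_le_trans t0 tb.
have [q0|q0] := leP 0 (1 - 2 * s).
  apply: (@le_trans _ _ (om0 b)); last by rewrite lerDr powR_ge0.
  by rewrite /om0; apply: ge0_ler_powR => //; rewrite nnegrE ltW.
apply: (@le_trans _ _ (om0 a)); last by rewrite lerDl powR_ge0.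
rewrite /om0 -[1 - _]opprK !(powRN _ (- (1 - _))) lef_pV2 ?posrE ?powR_gt0//.
by apply: ge0_ler_powR; rewrite ?nnegrE ?oppr_ge0 ?(ltW a0) ?(ltW t0) ?(ltW q0).
Qed.

Lemma small_power (p c : R) : 0 < p -> 0 < c -> exists2 K : R, 0 < K & forall t, 0 < t -> t <= K -> t `^ p / p <= c.
Proof.
move=> p0 c0; exists ((c * p) `^ p^-1); first by rewrite powR_gt0// mulr_gt0.
move=> t t0 tK; rewrite ler_pdivrMr//.
have := @ge0_ler_powR R p (ltW p0) t ((c * p) `^ p^-1); rewrite !nnegrE (ltW t0) powR_ge0 => /(_ isT isT tK).
by rewrite -powRrM mulVf ?gt_eqF// powRr1// ltW// mulr_gt0.
Qed.

End weights.

Lemma cube_le {R : realFieldType} (a b : R) : 0 <= a -> a <= 1 -> a <= b / 4 ->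
  (1 + a) * (1 + a) * (1 + a) <= (1 + b) ^+ 2.
Proof.
move=> a0 a1 ab; have h2 : a ^+ 2 <= a by rewrite expr2 ler_piMl.
have h3 : a ^+ 3 <= a ^+ 2 by rewrite exprS ler_piMl// sqr_ge0.
have -> : (1 + a) * (1 + a) * (1 + a) = 1 + 3 * a + 3 * a ^+ 2 + a ^+ 3 by ring.
have -> : (1 + b) ^+ 2 = 1 + 2 * b + b ^+ 2 by ring.
have := sqr_ge0 b; move: h2 h3 ab a0.
by move: (a ^+ 2) (a ^+ 3) (b ^+ 2) => u v p; lra.
Qed.

Lemma mul3rA {R : comPzRingType} (a b : R) : a * (a * (a * b)) = a * a * a * b.
Proof. by ring. Qed.

Lemma half_quarters {R : realFieldType} (a : R) : a / 4 + a / 4 = a / 2.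
Proof. by field. Qed.

Lemma add_div_div {R : fieldType} (a b : R) : a != 0 -> b != 0 -> 1 + a^-1 / (a^-1 / b) = 1 + b.
Proof. by move=> a0 b0; rewrite invf_div mulrCA divff ?invr_eq0// mulr1. Qed.

Lemma half_mul {R : realFieldType} (a b t : R) : t <= 1 -> 0 <= b ->
  a ^+ 2 / 2 * ((1 + t) * b) <= a ^+ 2 * b.
Proof.
move=> t1 b0; rewrite [leLHS]mulrA ler_wpM2r// -mulrA ler_piMr ?sqr_ge0//.
by rewrite ler_pdivrMl// mulr1 -[2]/(1 + 1) lerD2l.
Qed.

(** * Comparison of the energies *)

Section comparison.
Context {R : realType} (d : nat) (Omega : set 'rV[R]_d) (s : R).
Hypotheses (d0 : (0 < d)%N) (oO : open Omega) (bO : bounded_set Omega) (nO : Omega !=set0).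
Hypotheses (s0 : 0 < s) (s1 : s < 1).
Local Notation Z := ('rV[R]_d * R)%type.
Local Notation ZM := ('rV[R]_d * measurableTypeR R)%type.
Local Notation leb1 := (@lebesgue_measure R).
Local Notation P := (`]0%R, +oo[%classic : set R).
Local Notation mu := (@leb R d \x leb1)%E.
Local Notation Q := (cyl Omega).
Local Notation adm := (admissible Omega).
Local Notation om0 := (om0 s).
Local Notation om1 := (om1 s).
Local Notation ipO := (ip (leb d) Omega coordR (cst 1)).
Local Notation EO := (EL2 (leb d) Omega coordR (cst 1)).
Let mO : measurable Omega := open_measurableV oO.
Let mQ : measurable (Q : set ZM) := measurable_cyl oO.
Let wom0 : weight om0 := weight_om0 s0 s1.
Let mW : measurable_fun (Q : set ZM) (wt om0).
Proof. by apply: measurable_wt; case: wom0. Qed.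
Let W0 z : Q z -> 0 < wt om0 z.
Proof. by move=> /cyl_pos z0; rewrite /wt /om0 powR_gt0. Qed.
Let m1 : measurable_fun Omega (cst 1 : _ -> R). Proof. exact: measurable_cst. Qed.
Let p1 : forall x, Omega x -> 0 < (cst 1 x : R). Proof. by move=> x _; exact: ltr01. Qed.
Let hv := prehilbert_L2 mu mQ (coordZ d) mW W0.
Let hO := prehilbert_L2 (leb d) mO coordR m1 p1.

Local Notation energy om phi := (nrm (ip mu Q (coordZ d) (wt om)) (gradz phi)).
Local Notation aeps := (aeps s).

Lemma energyE om phi : weight om -> adm phi -> iQ Omega om (gsq phi) = (energy om phi ^+ 2)%:E.
Proof.
move=> wom /admissibleP[sf bf _].
have E := bsupp_grad_EQ oO bO wom sf bf; have [mom pom _] := wom.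
have mo : measurable_fun (Q : set ZM) (wt om) by exact: measurable_wt.
have o0 z : Q z -> 0 < wt om z by move=> /cyl_pos; exact: pom.
rewrite (nrm_sqr (prehilbert_L2 mu mQ (coordZ d) mo o0) E) -(ip_EFin mQ mo o0 E).
by apply: eq_integral => z _; rewrite /gsq dotzE.
Qed.

Lemma energy_cutoff : exists2 D : R, 0 <= D & forall om T phi, weight om -> 1 <= T -> adm phi ->
  energy om (cutoff T phi) ^+ 2 <= (1 + D / T) * energy om phi ^+ 2.
Proof.
have l0 := lambda1_gt0 d0 oO bO nO; set lam := lambda1 Omega in l0.
have [C C0 hC] := @chi_derive_bound R.
have D0 : 0 <= 1 + 2 * C ^+ 2 / lam by rewrite addr_ge0// divr_ge0 ?mulr_ge0 ?sqr_ge0// ltW.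
exists (1 + 2 * C ^+ 2 / lam) => // om T phi wom T1 aphi.
have T0 : 0 < T by exact: lt_le_trans T1.
have i0 : 0 <= T^-1 by rewrite invr_ge0 ltW.
have c0 : 0 <= 2 * C ^+ 2 / T by rewrite !mulr_ge0 ?sqr_ge0.
have [sf _ _] := aphi; have mg := measurable_gsq sf; have mq := measurable_sq sf.
have pp1 : 0 <= 1 + T^-1 by rewrite addr_ge0.
have q0 z : 0 <= phi z ^+ 2 by exact: sqr_ge0.
have g0 := gsq_ge0 phi.
have e1 := energyE wom (adm_cutoff T aphi); have e2 := energyE wom aphi.
suff : (iQ Omega om (gsq (cutoff T phi)) <= (1 + (1 + 2 * C ^+ 2 / lam) / T)%:E * iQ Omega om (gsq phi))%E.
  by rewrite e1 e2 -EFinM lee_fin.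
clear e1.
apply: (@le_trans _ _ (iQ Omega om (fun z => (1 + T^-1) * gsq phi z + (2 * C ^+ 2 / T) * phi z ^+ 2))).
  apply: iQ_le => //.
  - by apply: measurable_gsq; exact: smooth_cutoff.
  - by apply: measurable_funD; apply: measurable_funM => //; exact: measurable_cst.
  - exact: gsq_ge0.
  - move=> z _; rewrite !gsqE mulrDr -addrA; apply: lerD.
      by rewrite (le_trans (dxsq_cutoff T z sf))// ler_peMl ?dxsq_ge0// lerDl.
    by apply: dtsq_cutoff => // t; exact: hC.
rewrite iQD//; last 4 first.
- by apply: measurable_funM => //; exact: measurable_cst.
- by apply: measurable_funM => //; exact: measurable_cst.
- by move=> z; rewrite mulr_ge0.
- by move=> z; rewrite mulr_ge0.
rewrite iQZ// iQZ//.
have H := friedrichs_cyl_gsq d0 oO bO nO wom aphi.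
have -> : (2 * C ^+ 2 / T)%:E = ((2 * C ^+ 2 / T / lam)%:E * lam%:E)%E.
  by rewrite -EFinM divfK// gt_eqF.
rewrite -muleA e2.
have : ((2 * C ^+ 2 / T / lam)%:E * (lam%:E * iQ Omega om (fun z => (phi z ^+ 2)%R)) <=
  (2 * C ^+ 2 / T / lam)%:E * (energy om phi ^+ 2)%:E)%E.
  by apply: lee_wpmul2l; [rewrite lee_fin divr_ge0// ltW|rewrite -e2].
move=> h; apply: (le_trans (leeD2l _ h)).
rewrite -!EFinM -EFinD lee_fin -mulrDl.
rewrite le_eqVlt; apply/orP; left; apply/eqP; congr (_ * _); field.
by rewrite !gt_eqF.
Qed.

Lemma trace_dist om phi c : weight om -> weight (fun t => (om t)^-1) -> 0 < c -> adm phi ->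
  forall I : R, (\int[leb1]_(t in `]0%R, c]) ((om t)^-1)%:E <= I%:E)%E ->
  nrm ipO ((fun x => phi (x, c)) - (fun x => phi (x, 0))) ^+ 2 <= I * energy om phi ^+ 2.
Proof.
move=> wom wi c0 aphi I hI; have [sf _ _] := aphi.
have E : EO ((fun x => phi (x, c)) - (fun x => phi (x, 0))).
  by apply: (ph_B hO); exact: slice_EO.
rewrite (nrm_sqr hO E) -lee_fin -(ip_EFin mO m1 p1 E) EFinM -(energyE wom aphi).
apply: le_trans (_ : _ <= (\int[leb1]_(t in `]0%R, c]) ((om t)^-1)%:E) * iQ Omega om (gsq phi))%E _; last first.
  by apply: lee_wpmul2r => //; apply: iQ_ge0 => //; exact: gsq_ge0.
apply: le_trans (trace_shift oO wom wi c0 aphi).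
by rewrite le_eqVlt; apply/orP; left; apply/eqP; apply: eq_integral => x _; rewrite dotcR mul1r expr2.
Qed.

(** On [tau, b] om0 is at most B, so om0/aeps = 1 + e om0^2 <= 1 + theta once e B^2 <= theta. *)
Lemma weight_comparison (theta tau b : R) : 0 < theta -> 0 < tau -> tau <= b ->
  exists2 e : R, 0 < e <= 1 & forall t, tau <= t -> t <= b -> om0 t <= (1 + theta) * aeps e t.
Proof.
move=> th0 tau0 taub; pose B := om0 tau + om0 b.
have B0 : 0 < B by rewrite addr_gt0// powR_gt0// (lt_le_trans tau0).
exists (Num.min 1 (theta / B ^+ 2)).
  by rewrite lt_min ltr01 divr_gt0 ?exprn_gt0//= ge_min lexx.
set e := Num.min _ _ => t taut tb; have t0 := lt_le_trans tau0 taut.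
have e0 : 0 < e by rewrite lt_min ltr01 divr_gt0 ?exprn_gt0.
rewrite -[leLHS](aepsE s e0 t0) mulrC ler_pM2r ?aeps_gt0// lerD2l.
apply: (@le_trans _ _ (theta / B ^+ 2 * B ^+ 2)); last by rewrite divfK// gt_eqF// exprn_gt0.
apply: ler_pM; rewrite ?(ltW e0) ?sqr_ge0// ?ge_min ?lexx ?orbT//.
by rewrite lerXn2r ?nnegrE ?powR_ge0 ?(ltW B0)//; exact: om0_bound.
Qed.

(** A shift by c >= tau sees only heights above tau, and the gradient vanishes beyond 2 T; in
    between the weights are comparable. The mass L of dc/c is such that the loss 1 + 1/((q+1) L) of
    [shift_pigeonhole], with q = 1 - 2s, is exactly 1 + theta. *)
Lemma shift_energy (theta tau K T e k : R) phi : 0 < theta -> 0 < tau -> 0 < T ->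
  tau <= K -> 0 < e -> 0 < k ->
  (\int[leb1]_(c in `[tau, K]) (c^-1)%:E = ((2 - 2 * s)^-1 / theta)%:E)%E ->
  (forall t, tau <= t -> t <= 2 * T -> om0 t <= (1 + theta) * aeps e t) ->
  adm phi -> (forall z, 2 * T < z.2 -> gsq phi z = 0) ->
  exists2 c, tau <= c <= K & energy om0 (shiftt c phi) ^+ 2 <= (1 + theta) * ((1 + theta) * energy (aeps e) phi ^+ 2 + k).
Proof.
move=> th0 tau0 T0 tauK e0 k0 LE hom aphi gz; have [sf _ _] := aphi.
have wa := weight_aeps s0 s1 e0.
have ss : 0 < 2 - 2 * s by move: s1; lra.
pose f (t : R) : \bar R := (\int[leb d]_(x in Omega) (gsq phi (x, t))%:E)%E.
have mg := measurable_gsq sf.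
have mf : measurable_fun [set: measurableTypeR R] f.
  have m : measurable_fun (Omega `*` setT : set ZM) (EFin \o gsq phi) by apply/measurable_EFinP; exact: measurable_funTS.
  by apply: (@measurable_tonelli2 _ _ _ 'rV[R]_d (measurableTypeR R) (leb d) Omega setT mO measurableT _ m) => z _; rewrite lee_fin gsq_ge0.
have f0 t : (0 <= f t)%E by apply: integral_ge0 => x _; rewrite lee_fin gsq_ge0.
have fB : (\int[leb1]_(r in `[tau, +oo[) ((r `^ (1 - 2 * s))%:E * f r) <= ((1 + theta) * energy (aeps e) phi ^+ 2)%:E)%E.
  have th1 : 0 <= 1 + theta by rewrite addr_ge0// ltW.
  rewrite EFinM -(energyE wa aphi) (iQ_tonelli2 oO wa mg (gsq_ge0 phi)).
  have mP : @measurable _ (measurableTypeR R) P by exact: measurable_itv.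
  have mt : @measurable _ (measurableTypeR R) (`[tau, +oo[%classic : set R) by exact: measurable_itv.
  have ma : measurable_fun (P : set (measurableTypeR R)) (fun t => ((aeps e t)%:E * f t)%E).
    apply: emeasurable_funM; last exact: measurable_funTS.
    by apply/measurable_EFinP; exact: measurable_aeps.
  have <- : (\int[leb1]_(t in P) ((1 + theta)%:E * ((aeps e t)%:E * f t)) =
      (1 + theta)%:E * \int[leb1]_(t in P) ((aeps e t)%:E * f t))%E.
    apply: ge0_integralZl_EFin => //; move=> t; rewrite /= in_itv/= andbT => t0.
    by apply: mule_ge0; [rewrite lee_fin ltW// aeps_gt0|exact: f0].
  rewrite [leLHS]integral_mkcond [leRHS]integral_mkcond; apply: ge0_le_integral => //.
  - by move=> t _; apply: erestrict_ge0 => r _; rewrite mule_ge0// lee_fin powR_ge0.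
  - apply/(measurable_restrictT _ mt); apply: emeasurable_funM; last exact: measurable_funTS.
    by apply/measurable_EFinP; apply: measurable_funTS; exact: measurable_powR.
  - by apply/(measurable_restrictT _ mP); apply: emeasurable_funM => //; exact: measurable_cst.
  move=> t _; rewrite !patchE; case: ifPn => [/set_mem|_]; last first.
    case: ifPn => [/set_mem|_]//; rewrite /= in_itv/= andbT => t0.
    by rewrite !mule_ge0 ?lee_fin// ltW// aeps_gt0.
  rewrite /= in_itv/= andbT => taut; have t0 := lt_le_trans tau0 taut.
  rewrite mem_set ?muleA -?EFinM; last by rewrite /= in_itv/= andbT.
  have [tT|Tt] := leP t (2 * T).
    by apply: lee_wpmul2r => //; rewrite lee_fin; exact: hom.
  have -> : f t = 0%E by apply: integral0_eq => x _; rewrite gz.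
  by rewrite !mule0.
have q1 : -1 < 1 - 2 * s by move: s1; lra.
have L0 : 0 < (2 - 2 * s)^-1 / theta by rewrite divr_gt0// invr_gt0.
have [c hc H] := shift_pigeonhole q1 tau0 L0 LE mf f0 fB k0.
exists c => //; move: hc => /andP[tc _].
have ash : adm (shiftt c phi) by apply: adm_shiftt => //; rewrite (le_trans (ltW tau0)).
rewrite -lee_fin -(energyE wom0 ash).
have ms : measurable_fun [set: ZM] (gsq (shiftt c phi)) by apply: measurable_gsq; exact: smooth_shiftt.
rewrite (iQ_tonelli2 oO wom0 ms (gsq_ge0 _)).
have Ef t : (\int[leb d]_(x in Omega) (gsq (shiftt c phi) (x, t))%:E = f (t + c)%R)%E.
  by apply: eq_integral => x _; rewrite gsq_shiftt.
rewrite (_ : (\int[leb1]_(t in P) _)%E = (\int[leb1]_(t in P) ((t `^ (1 - 2 * s))%:E * f (t + c)%R))%E); last first.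
  by apply: eq_integral => t _; rewrite Ef.
apply: (le_trans H); rewrite le_eqVlt; apply/orP; left; apply/eqP; congr EFin; congr (_ * _).
have -> : 1 - 2 * s + 1 = 2 - 2 * s by ring.
by rewrite add_div_div// gt_eqF.
Qed.

(** All parameters are fixed before [phi]: [th] from eta, then K so that shifts up to K move traces
    little, T for the cutoff, tau from the mass of dc/c, and last [e]. The additive [k] pays for the
    slack in the choice of the shift. *)
Lemma shift_compare (eta : R) : 0 < eta -> exists2 e : R, 0 < e <= 1 &
  forall phi k, adm phi -> 0 < k -> exists phi2 : Z -> R, [/\ adm phi2,
    energy om0 phi2 <= (1 + eta) * energy (aeps e) phi + k &
    nrm ipO ((fun x => phi2 (x, 0)) - (fun x => phi (x, 0))) <= eta * energy (aeps e) phi].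
Proof.
(* Three factors 1 + th accumulate, from the cutoff, the weight comparison and the averaging;
   [cube_le] keeps their product below (1 + eta)^2. *)
move=> eta0; pose th := Num.min 1 (eta / 4).
have th0 : 0 < th by rewrite lt_min ltr01 divr_gt0.
have th1 : th <= 1 by rewrite ge_min lexx.
have th4 : th <= eta / 4 by rewrite ge_min lexx orbT.
have ss2 : 0 < 2 * s by rewrite mulr_gt0.
have ss : 0 < 2 - 2 * s by move: s1; lra.
have e4 : 0 < eta ^+ 2 / 4 by rewrite divr_gt0// exprn_gt0.
have [K1 K10 hK1] := small_power ss2 e4; have [K2 K20 hK2] := small_power ss e4.
pose K := Num.min K1 K2; have K0 : 0 < K by rewrite lt_min K10.
have [D D0 hD] := energy_cutoff.
pose T := Num.max (1 + K) (D / th).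
have T1 : 1 <= T by rewrite le_max lerDl (ltW K0).
have T0 : 0 < T by exact: lt_le_trans T1.
have DT : D / T <= th by rewrite ler_pdivrMr// mulrC -ler_pdivrMr// le_max lexx orbT.
have M0 : 0 < (2 - 2 * s)^-1 / th by rewrite divr_gt0// invr_gt0.
set M := (2 - 2 * s)^-1 / th in M0.
pose tau := K * expR (- M).
have tau0 : 0 < tau by rewrite mulr_gt0// expR_gt0.
have tauK : tau <= K by rewrite ler_piMr ?(ltW K0)// expR_le1 oppr_le0 ltW.
have KT : K <= 2 * T.
  apply: (@le_trans _ _ T); last by rewrite ler_peMl ?(ltW T0)// ler1n.
  by rewrite le_max lerDr ler01.
have [e /andP[e0 e1] he] := weight_comparison th0 tau0 (le_trans tauK KT).
exists e; first by rewrite e0.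
move=> phi k aphi k0.
have wa := weight_aeps s0 s1 e0; have wi := weight_inv_aeps s0 s1 e0 e1.
set n := energy (aeps e) phi; have n0 : 0 <= n by exact: nrm_ge0.
have ac := adm_cutoff T aphi.
have En : energy (aeps e) (cutoff T phi) ^+ 2 <= (1 + th) * n ^+ 2.
  by apply: (le_trans (hD _ _ _ wa T1 aphi)); rewrite ler_wpM2r ?sqr_ge0// lerD2l.
have k20 : 0 < k ^+ 2 / 2 by rewrite divr_gt0// exprn_gt0.
have [c /andP[tc cK] hc] := shift_energy th0 tau0 T0 tauK e0 k20 (int_inv K0 M0) he ac (fun z => gsq_cutoff_eq0 phi T0).
have c0 : 0 < c by exact: lt_le_trans tc.
have as2 : adm (shiftt c (cutoff T phi)) by exact: (adm_shiftt (ltW c0)).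
exists (shiftt c (cutoff T phi)); split => //.
- have Es2 := adm_Ev oO bO s0 s1 as2.
  have r0 : 0 <= (1 + eta) * n + k by rewrite addr_ge0 ?(ltW k0)// mulr_ge0// addr_ge0// ltW.
  apply: (nrm_le Es2 r0); rewrite -(nrm_sqr hv Es2) (le_trans hc)//.
  apply: (@le_trans _ _ ((1 + th) * ((1 + th) * ((1 + th) * n ^+ 2) + k ^+ 2 / 2))).
    by rewrite ler_wpM2l ?addr_ge0 ?(ltW th0)// lerD2r ler_wpM2l// addr_ge0// ltW.
  have a1 : (1 + th) * (1 + th) * (1 + th) <= (1 + eta) ^+ 2.
    by apply: cube_le; rewrite ?(ltW th0).
  have a2 : (1 + th) * (k ^+ 2 / 2) <= k ^+ 2.
    have := sqr_ge0 k; set p := k ^+ 2 => p0.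
    by rewrite mulrA ler_pdivrMr// mulrC ler_wpM2l// -[2]/(1 + 1) lerD2l.
  apply: (@le_trans _ _ ((1 + eta) ^+ 2 * n ^+ 2 + k ^+ 2)).
    rewrite mulrDr; apply: lerD => //.
    by rewrite mul3rA ler_wpM2r ?sqr_ge0.
  rewrite -exprMn sqrrD lerD2r lerDl mulrn_wge0// mulr_ge0 ?(ltW k0)// mulr_ge0// addr_ge0 ?(ltW eta0)//.
- have I2 : (\int[leb1]_(t in `]0%R, c]) ((aeps e t)^-1)%:E <= (eta ^+ 2 / 2)%:E)%E.
    apply: (le_trans (int_inv_aeps s0 s1 e0 e1 c0)); rewrite lee_fin.
    have h1 : c <= K1 by rewrite (le_trans cK)// ge_min lexx.
    have h2 : c <= K2 by rewrite (le_trans cK)// ge_min lexx orbT.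
    apply: (le_trans (lerD (hK1 c c0 h1) (hK2 c c0 h2))).
    by rewrite half_quarters.
  have H := trace_dist wa wi c0 ac I2.
  have [sc _ _] := ac; have [sf _ _] := aphi; have [s2 _ _] := as2.
  (* [chi] is 1 at t = 0, so the cutoff has the trace of [phi]; the trace of the shifted function is
     its value at height c. *)
  have -> : (fun x => shiftt c (cutoff T phi) (x, 0)) - (fun x => phi (x, 0)) =
    (fun x => cutoff T phi (x, c)) - (fun x => cutoff T phi (x, 0)).
    by apply/funext => x; rewrite !fctE /shiftt /= add0r /cutoff /= chi_at0 mul1r.
  have E1 : EO ((fun x => cutoff T phi (x, c)) - (fun x => cutoff T phi (x, 0))).
    by apply: (ph_B hO); exact: slice_EO.
  apply: (nrm_le E1); first by rewrite mulr_ge0// ltW.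
  rewrite (nrm_sqr hO E1) in H; apply: (le_trans H); rewrite [leRHS]exprMn.
  apply: (@le_trans _ _ (eta ^+ 2 / 2 * ((1 + th) * n ^+ 2))).
    by apply: (ler_wpM2l _ En); rewrite divr_ge0 ?sqr_ge0.
  by apply: half_mul; rewrite ?sqr_ge0.
Qed.

End comparison.

Lemma comparison_arith {R : realFieldType} (a b eta n k delta p q : R) :
  0 <= a -> 0 <= n -> 0 < k -> (a + b) * eta <= delta ->
  p <= a * ((1 + eta) * n + k / (a + 1)) -> - (b * (eta * n)) <= p - q ->
  q <= (a + delta) * n + k.
Proof.
move=> a0 n0 k0 h1 h2 h3.
have h4 : a * (k / (a + 1)) <= k.
  by rewrite mulrCA ler_piMr ?(ltW k0)// ler_pdivrMr ?mul1r ?lerDl// ltr_wpDl.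
have := ler_wpM2r n0 h1; move: h2 h3 h4.
rewrite mulrDr; move: (a * (k / _)) => u.
have -> : a * ((1 + eta) * n) = a * n + a * (eta * n) by ring.
have -> : (a + b) * eta * n = a * (eta * n) + b * (eta * n) by ring.
rewrite mulrDl; move: (a * n) (a * (eta * n)) (b * (eta * n)) (delta * n) => *; lra.
Qed.

Lemma sub_double_le {R : realFieldType} (a b c : R) : b <= c -> a - 2 * a + b <= c - a.
Proof. lra. Qed.

Lemma square_factor {R : comPzRingType} (a b c q : R) :
  a * (b * c * (b * c * q)) = a * b * (b * c) * (c * q).
Proof. ring. Qed.

Lemma factor_swap {R : comPzRingType} (a b c : R) : a * b * c * a = b * (c * a ^+ 2).
Proof. ring. Qed.

Lemma sqr_diff {R : comPzRingType} (a b : R) : (a + b) ^+ 2 - a ^+ 2 = b * (2 * a + b).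
Proof. ring. Qed.

(** * Nearly optimal fluxes *)

Section infimum.
Context {R : realType} (d : nat) (Omega : set 'rV[R]_d) (s : R).
Hypotheses (d0 : (0 < d)%N) (oO : open Omega) (bO : bounded_set Omega) (nO : Omega !=set0).
Hypotheses (s0 : 0 < s) (s1 : s < 1).
Local Notation Z := ('rV[R]_d * R)%type.
Local Notation ZM := ('rV[R]_d * measurableTypeR R)%type.
Local Notation leb1 := (@lebesgue_measure R).
Local Notation P := (`]0%R, +oo[%classic : set R).
Local Notation mu := (@leb R d \x leb1)%E.
Local Notation Q := (cyl Omega).
Local Notation adm := (admissible Omega).
Local Notation om0 := (om0 s).
Local Notation om1 := (om1 s).
Local Notation ipv := (ip mu Q (coordZ d) (wt om0)).
Local Notation Ev := (EL2 mu Q (coordZ d) (wt om0)).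
Local Notation ipO := (ip (leb d) Omega coordR (cst 1)).
Local Notation EO := (EL2 (leb d) Omega coordR (cst 1)).
Local Notation grad := (gradQ Omega s).

Let mO : measurable Omega := open_measurableV oO.
Let mQ : measurable (Q : set ZM) := measurable_cyl oO.
Let wom0 : weight om0 := weight_om0 s0 s1.
Let mW : measurable_fun (Q : set ZM) (wt om0).
Proof. by apply: measurable_wt; case: wom0. Qed.
Let W0 z : Q z -> 0 < wt om0 z.
Proof. by move=> /cyl_pos z0; rewrite /wt /om0 powR_gt0. Qed.
Let m1 : measurable_fun Omega (cst 1 : _ -> R). Proof. exact: measurable_cst. Qed.
Let p1 : forall x, Omega x -> 0 < (cst 1 x : R). Proof. by move=> x _; exact: ltr01. Qed.
Let hv := prehilbert_L2 mu mQ (coordZ d) mW W0.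
Let hO := prehilbert_L2 (leb d) mO coordR m1 p1.

Local Notation energy om phi := (nrm (ip mu Q (coordZ d) (wt om)) (gradz phi)).
Local Notation aeps := (aeps s).
Context (g : 'rV[R]_d -> R) (w wt0 : Z -> R).
Hypotheses (Lg : L2 Omega g) (ws : weak_solution Omega s g w) (vwt : inV Omega s wt0).
Let Eg : EO g := L2_EO Lg.
Let vw : inV Omega s w := proj1 ws.
Let EG : Ev (grad w) := grad_Ev oO bO s0 s1 vw.
Local Notation N0 := (nrm ipv (grad w)).
Local Notation ell phi := (ipO g (fun x => phi (x, 0))).

Let ellE phi : adm phi -> ell phi = ipv (grad w) (gradz phi).
Proof. by move=> aphi; rewrite (weak_adm d0 oO bO nO s0 s1 Lg ws aphi). Qed.

Let EO0 phi : adm phi -> EO (fun x => phi (x, 0)).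
Proof. by case=> sf _ _; exact: slice_EO. Qed.

(** [ell] is bounded by N0 in the energy with weight om0, so it is estimated at the modified
    function [phi2]; the change of its value is controlled by the distance of the traces. *)
Lemma trace_functional_bound (delta : R) : 0 < delta -> exists2 e : R, 0 < e <= 1 &
  forall phi, adm phi -> ell phi <= (N0 + delta) * energy (aeps e) phi.
Proof.
move=> de0; set G0 := N0; have G00 : 0 <= G0 by exact: nrm_ge0.
set g0 := nrm ipO g; have g00 : 0 <= g0 by exact: nrm_ge0.
have S0 : 0 < G0 + g0 + 1 by rewrite ltr_wpDl// addr_ge0.
(* The energy contributes an error N0 eta and the trace an error |g| eta; together they stay below
   delta. *)
pose eta := delta / (G0 + g0 + 1); have eta0 : 0 < eta by rewrite divr_gt0.
have etaE : (G0 + g0) * eta <= delta.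
  by rewrite /eta mulrCA ler_piMr ?(ltW de0)// ler_pdivrMr// mul1r lerDl.
have [e he H] := shift_compare d0 oO bO nO s0 s1 eta0; exists e => // phi aphi.
set n := energy (aeps e) phi; have n0 : 0 <= n by exact: nrm_ge0.
apply/ler_addgt0Pr => k k0.
have k1 : 0 < k / (G0 + 1) by rewrite divr_gt0// ltr_wpDl.
have [phi2 [aphi2 h1 h2]] := H phi _ aphi k1.
have E2 := EO0 aphi2; have E1 := EO0 aphi.
have a1 : ell phi2 <= G0 * ((1 + eta) * n + k / (G0 + 1)).
  rewrite (ellE aphi2); apply: (le_trans (ler_norm _)).
  apply: (le_trans (ph_CS hv EG (adm_Ev oO bO s0 s1 aphi2))).
  exact: ler_wpM2l.
have a2 : ell phi2 - ell phi >= - (g0 * (eta * n)).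
  have := ph_CS hO Eg (ph_B hO E2 E1).
  rewrite (ph_C hO g) (ph_BB hO E2 E1 Eg) (ph_C hO _ g) (ph_C hO _ g) ler_norml => /andP[h _].
  by apply: le_trans h; rewrite lerN2 ler_wpM2l.
exact: (comparison_arith G00 n0 k0 etaE a1 a2).
Qed.

Section minimiser.
Context (e C : R).
Hypotheses (e0 : 0 < e) (e1 : e <= 1) (C0 : 0 <= C).
Hypothesis lC : forall phi, adm phi -> ell phi <= C * energy (aeps e) phi.
Let wa := weight_aeps s0 s1 e0.
Let mA : measurable_fun (Q : set ZM) (wt (aeps e)).
Proof. by apply: measurable_wt; case: wa. Qed.
Let A0 z : Q z -> 0 < wt (aeps e) z.
Proof. by move=> /cyl_pos z0; rewrite /wt aeps_gt0. Qed.
Local Notation ipe := (ip mu Q (coordZ d) (wt (aeps e))).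
Local Notation Ee := (EL2 mu Q (coordZ d) (wt (aeps e))).
Let he := prehilbert_L2 mu mQ (coordZ d) mA A0.

Let adEe phi : adm phi -> Ee (gradz phi).
Proof. by move=> /admissibleP[sf bf _]; exact: (bsupp_grad_EQ oO bO wa). Qed.

(** The representation theorem for [ell] on the gradients of admissible functions. Along the
    approximating sequence N^2 is the limit of ell phi_n, so N^2 <= C N. *)
Lemma minimiser_exists : exists F : Z -> Z, [/\ Ee F, nrm ipe F <= C &
  forall phi, adm phi -> ipe F (gradz phi) = ell phi].
Proof.
have ex0 : exists phi, adm phi.
  exists (cst 0); apply/admissibleP; split => //; first exact: smooth_cst.
  by exists 1.
have lD (a : R) p q : adm p -> adm q -> ell (p + a *: q) = ell p + a * ell q.
  move=> ap aq; have Ep := EO0 ap; have Eq := EO0 aq.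
  transitivity (ipO ((fun x => p (x, 0)) + a *: (fun x => q (x, 0))) g); first exact: (ph_C hO).
  by rewrite (ph_BD hO Ep (ph_Z hO a Eq) Eg) (ph_BZ hO a Eq Eg); congr (_ + _ * _); exact: (ph_C hO).
have LD (a : R) p q : adm p -> adm q -> gradz (p + a *: q) = gradz p + a *: gradz q.
  by move=> [sp _ _] [sq _ _]; exact: gradz_lin.
have cpl : ncomplete Ee ipe by exact: (complete_L2 (cs := coordZ d) mQ mA A0).
have [phi [F [aphi EF cF HF]]] := riesz_minimizer he ex0 (fun a p q => @admissible_lin _ _ _ a p q) adEe LD lD lC cpl.
exists F; split => //.
have c1 := ncvg_B he (fun n => adEe (aphi n)) EF EF cF.
have c2 := ncvg_nrm he (fun n => adEe (aphi n)) EF cF.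
set N := nrm ipe F; have : N ^+ 2 <= C * N.
  rewrite (nrm_sqr he EF).
  have c3 : C * nrm ipe (gradz (phi n)) @[n --> \oo] --> C * N by apply: cvgM; [exact: cvg_cst|exact: c2].
  apply: (ler_cvg_to c1 c3); apply: nearW => n /=.
  rewrite (ph_C he) HF//; exact: lC.
have [->//|Nn0] := eqVneq N 0.
by rewrite expr2 ler_pM2r// lt_neqAle eq_sym Nn0 nrm_ge0.
Qed.

Section flux.
Context (F : Z -> Z) (EF : Ee F) (FC : nrm ipe F <= C).
Hypothesis HF : forall phi, adm phi -> ipe F (gradz phi) = ell phi.

(** The flux of the minimiser; [H] below is y/om0, the field that [M_plus] compares with the
    gradient of [wt0]. *)
Let y (z : Z) : Z := aeps e z.2 *: F z.
Let H (z : Z) : Z := z.2 `^ (2 * s - 1) *: y z.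

Let coy i z : coZ i (y z) = aeps e z.2 * coZ i (F z).
Proof. exact: (co_scale (cs := coordZ d)). Qed.

Let doty (v : Z -> Z) z : dotz (y z) (v z) = wt (aeps e) z * dotc (coordZ d) (F z) (v z).
Proof. by rewrite dotzE dotcZl. Qed.

Let my i : measurable_fun (Q : set ZM) (fun z => coZ i (y z)).
Proof.
rewrite (_ : (fun z => _) = fun z => wt (aeps e) z * coZ i (F z)); last by apply/funext => z; rewrite coy.
by apply: measurable_funM => //; case: EF => + _; exact.
Qed.

Let ip_y phi : adm phi -> \int[mu]_(z in Q) dotz (y z) (gradz phi z) = ell phi.
Proof. by move=> aphi; rewrite -HF//; apply: eq_Rintegral => z _; rewrite doty. Qed.

Let test_y0 xi : test_fun Q xi -> \int[mu]_(z in Q) dotz (y z) (gradz xi z) = 0.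
Proof.
move=> tx; rewrite (ip_y (test_adm oO tx)).
have xi0 x : xi (x, 0) = 0 by apply: (test_fun_out tx) => /cylP[]; rewrite ltxx.
by rewrite ipOE /Rintegral integral0_eq// => x _; rewrite xi0 mulr0.
Qed.

(** A test function on [Q] vanishes at t = 0, so the equation for [F] tested with it has zero
    right-hand side. *)
Lemma minimal_weak_div : weak_div Omega y (cst 0).
Proof.
split; last first.
  move=> xi tx; rewrite [LHS](test_y0 tx) (_ : (\int[_]_(z in _) _) = 0) ?oppr0//.
  by rewrite /Rintegral integral0_eq// => z _; rewrite mul0r.
split; first exact: measurable_cst.
by move=> K cK KQ; rewrite (_ : _ \o _ = cst 0%E)//; exact: integrable0.
Qed.

Let delta := divQ Omega y.

Let delta_weak : weak_div Omega y delta.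
Proof. by apply: (@xgetPex _ (fun=> 0) [set q | weak_div Omega y q]); exists (cst 0); exact: minimal_weak_div. Qed.

Let md : measurable_fun (Q : set ZM) delta. Proof. by case: delta_weak => -[]. Qed.

(** [divQ] chooses some divergence; that it agrees with the zero one almost everywhere is the
    fundamental lemma. *)
Let delta0 : {ae mu, forall z, Q z -> delta z = 0}.
Proof.
have [ld hd] := delta_weak.
apply: (fundamental_lemma (open_cyl oO) ld) => xi tx.
by have := hd xi tx; rewrite [LHS](test_y0 tx) => /eqP; rewrite eq_sym oppr_eq0 => /eqP.
Qed.

Let om1_div (om : R -> R) : measurable_fun P om ->
  (\int[mu]_(z in Q) (om z.2 * delta z ^+ 2)%:E = 0)%E.
Proof.
move=> mom; rewrite -[RHS](integral0 mu (Q : set ZM)); apply: ae_eq_integral => //.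
- apply/measurable_EFinP; apply: measurable_funM; first exact: (measurable_wt mom).
  exact: measurable_funX.
- by apply: ae_mono delta0 => z hz Qz; rewrite hz// expr0n/= mulr0.
Qed.

(** The first bound gives om0 |y|^2 <= aeps |F|^2 / e, hence y in Y^s; the second gives om0 |H|^2 <=
    aeps |F|^2, hence |||H||| is at most the norm of F. *)
Let aeps_om z : Q z -> om0 z.2 * aeps e z.2 <= e^-1 /\ om1 z.2 * aeps e z.2 <= 1.
Proof.
move=> Qz; have z0 := cyl_pos Qz; have h := aepsE s e0 z0; have h1 := om01 s Qz; rewrite /wt in h1.
have o0 : 0 < om0 z.2 by exact: powR_gt0.
have o1 : 0 < om1 z.2 by exact: powR_gt0.
have a0 := aeps_gt0 s e0 z0; have al := aeps_le s e0 z0; split; last first.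
  by rewrite -h1 mulrC ler_pM2r.
rewrite -[leRHS]mul1r ler_pdivlMr// -(ler_pM2r o0) mul1r -[leRHS]h.
rewrite factor_swap.
by rewrite ler_pM2l// lerDr.
Qed.

Lemma minimal_inYdiv : inYdiv Omega s y.
Proof.
split; last 1 first.
- by rewrite [X in (X < _)%E](_ : _ = 0%E) ?ltry//; exact: (om1_div (measurable_powR_pos (2 * s - 1))).
- split; first exact: (measurable_fun_ZP y mQ).2.
  rewrite normQvE; apply: poweR_lty.
  apply: (@le_lt_trans _ _ ((e^-1)%:E * sqint mu Q (coordZ d) (wt (aeps e)) F)%E); last first.
    by rewrite (ip_EFin mQ mA A0 EF) -EFinM ltry.
  rewrite /sqint -ge0_integralZl_EFin//.
  + apply: ge0_le_integral => //.
    * by move=> z Qz; rewrite lee_fin mulr_ge0 ?dotc_ge0// ltW// W0.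
    * by apply: measurable_Wdotc.
    * apply: emeasurable_funM; first exact: measurable_cst.
      by apply: measurable_Wdotc => //; case: EF.
    * move=> z Qz; rewrite /y dotcZl dotcC dotcZl -EFinM lee_fin.
      have [h _] := aeps_om Qz; have := A0 Qz; rewrite /wt => a0.
      have := dotc_ge0 (coordZ d) (F z); move: (dotc _ _ _) => q q0.
      rewrite [leLHS]mulrA; apply: (ler_wpM2r _ h).
      by rewrite mulr_ge0// ltW.
  + by move=> z Qz; rewrite lee_fin mulr_ge0 ?dotc_ge0// ltW// A0.
  + by apply: measurable_Wdotc => //; case: EF.
  + by rewrite invr_ge0 ltW.
- by exists (cst 0); exact: minimal_weak_div.
Qed.

(** The equation for [F] tested with [eta] is Green's formula with trace -g, the chosen divergence
    being zero almost everywhere. *)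
Lemma minimal_flux_trace : flux_trace Omega y (- g).
Proof.
split.
  split; first by apply: measurableT_comp => //; case: Lg.
  rewrite (normOE Omega) (sqrte_sqint mO m1 p1) ?ltry//; exact: (ph_N hO Eg).
move=> eta aeta; have E0 := EO0 aeta.
rewrite -ipOE -(ph_BN hO)//; last exact: (ph_N hO Eg).
rewrite opprK -(ip_y aeta) /Rintegral; congr fine; apply: ae_eq_integral => //.
- apply/measurable_EFinP; apply: measurable_funD.
    rewrite (_ : (fun z => _) = fun z => dotc (coordZ d) (y z) (gradz eta z)); last by apply/funext => z; rewrite dotzE.
    by apply: measurable_dotc => //; case: (adEe aeta).
  by apply: measurable_funM => //; case: (adm_Es oO bO s0 s1 aeta) => /(_ tt).
- apply/measurable_EFinP.
  rewrite (_ : (fun z => _) = fun z => dotc (coordZ d) (y z) (gradz eta z)); last by apply/funext => z; rewrite dotzE.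
  by apply: measurable_dotc => //; case: (adEe aeta).
- by apply: ae_mono delta0 => z hz Qz; rewrite -/delta hz// mul0r addr0.
Qed.

Lemma minimal_flux_residual : (flux_residual Omega y g <= 0)%E.
Proof.
apply: ereal_inf_lbound; exists (- g); first exact: minimal_flux_trace.
rewrite /normO (eq_integral (cst 0%E)) ?integral0 /Defs.sqrte ?poweR0r ?invr_eq0//.
by move=> x _; rewrite !fctE addNr expr0n.
Qed.

Lemma minimal_H_Ev : Ev H /\ ipv H H <= C ^+ 2.
Proof.
have mH : mfc (Q : set ZM) (coordZ d) H.
  move=> i; rewrite (_ : (fun z => _) = fun z => wt om1 z * coZ i (y z)).
    apply: measurable_funM => //; apply: measurable_wt; exact: measurable_powR_pos.
  by apply/funext => z; exact: (co_scale (cs := coordZ d)).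
have le : (sqint mu Q (coordZ d) (wt om0) H <= sqint mu Q (coordZ d) (wt (aeps e)) F)%E.
  apply: ge0_le_integral => //.
  - by move=> z Qz; rewrite lee_fin mulr_ge0 ?dotc_ge0// ltW// W0.
  - exact: measurable_Wdotc.
  - by apply: measurable_Wdotc => //; case: EF.
  - move=> z Qz; rewrite /H /y scalerA dotcZl dotcC dotcZl lee_fin.
    have [_ h] := aeps_om Qz; have := A0 Qz; have := om01 s Qz; rewrite /wt -/(om1 z.2) => h1 a0.
    have := dotc_ge0 (coordZ d) (F z); move: (dotc _ _ _) => q q0.
    rewrite square_factor.
    by rewrite h1 mul1r ler_piMl// mulr_ge0// ltW.
have FC2 : ipe F F <= C ^+ 2 by rewrite -(nrm_sqr he EF) lerXn2r ?nnegrE ?nrm_ge0.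
rewrite (ip_EFin mQ mA A0 EF) in le.
have EH : Ev H by split => //; exact: (le_lt_trans le (ltry _)).
by split => //; apply: le_trans FC2; rewrite -lee_fin -(ip_EFin mQ mW W0 EH).
Qed.

(** Since om0 H = aeps F, the field H has the same pairings with admissible gradients as grad w.
    Hence its inner product with grad w is N0^2, and |||grad w - H|||^2 = |||H|||^2 - N0^2 <= C^2 -
    N0^2. *)
Lemma minimal_dist : nrm ipv (grad wt0 - H) <= nrm ipv (grad (wt0 \- w)) + Num.sqrt (C ^+ 2 - N0 ^+ 2).
Proof.
have [EH HC] := minimal_H_Ev.
have Ewt := grad_Ev oO bO s0 s1 vwt.
have Herr := grad_err oO bO s0 s1 ws vwt.
have Eerr := grad_Ev oO bO s0 s1 (inV_err oO bO s0 s1 ws vwt).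
have Ed := ph_B hv Ewt EG.
apply: (le_trans (nrm_triangleB hv Ewt EG EH)); apply: lerD.
  rewrite le_eqVlt; apply/orP; left; apply/eqP; rewrite /nrm; congr Num.sqrt.
  by rewrite (ph_BB hv Ewt EG Ed) -(Herr _ Ed) (ph_C hv _ (grad wt0 - _)) (ph_BB hv Ewt EG Eerr) -Herr.
rewrite /nrm ler_wsqrtr// -/(nrm ipv (grad w)) (nrm_sqr hv EG).
have [_ _ [phi [aphi _ c]]] := inV_approx oO bO s0 s1 vw.
have cH := ncvg_B hv (fun n => adm_Ev oO bO s0 s1 (aphi n)) EG EH c.
have cG := ncvg_B hv (fun n => adm_Ev oO bO s0 s1 (aphi n)) EG EG c.
have HG : ipv (grad w) H = ipv (grad w) (grad w).
  apply: (cvg_unique (@Rhausdorff R) cH); apply: cvg_trans cG.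
  apply: near_eq_cvg; apply: nearW => n /=.
  rewrite (ph_C hv) -(ellE (aphi n)) -HF// (ph_C hv _ H).
  apply: eq_Rintegral => z /set_mem Qz.
  rewrite /H /y scalerA dotcZl mulrA; congr (_ * _).
  by have := om01 s Qz; rewrite /wt mulrA => ->; rewrite mul1r.
rewrite (ph_sqrB hv EG EH) HG.
exact: sub_double_le.
Qed.

Lemma minimal_M_plus : (M_plus Omega s g wt0 y <=
  normQv Omega s (grad (wt0 \- w)%R) + (Num.sqrt (C ^+ 2 - N0 ^+ 2))%:E)%E.
Proof.
have [EH _] := minimal_H_Ev; have Ewt := grad_Ev oO bO s0 s1 vwt.
rewrite (errE oO bO s0 s1 ws vwt) -EFinD /M_plus.
have -> : normQ Omega s (fun z => z.2 `^ (2 * s - 1) * divQ Omega y z) = 0%E.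
  rewrite /normQ (_ : (\int[_]_(z in _) _)%E = 0%E) /Defs.sqrte ?poweR0r ?invr_eq0//.
  rewrite -[RHS](om1_div (measurable_powR_pos (2 * s - 1))); apply: eq_integral => z /set_mem Qz.
  have := om01 s Qz; rewrite /wt /om1 -/delta => h.
  by rewrite exprMn expr2 !mulrA h mul1r.
rewrite mule0 adde0 -[leRHS]adde0; apply: leeD; last first.
  by apply: mule_ge0_le0; [rewrite lee_fin mulr_ge0// powR_ge0|exact: minimal_flux_residual].
rewrite normQvE (sqrte_sqint mQ mW W0 (ph_B hv Ewt EH)) lee_fin.
exact: minimal_dist.
Qed.

End flux.
End minimiser.

Lemma inf_M_plus : normQv Omega s (grad (wt0 \- w)) = ereal_inf [set M_plus Omega s g wt0 y | y in inYdiv Omega s].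
Proof.
apply/eqP; rewrite eq_le; apply/andP; split.
  by apply: le_ereal_inf_tmp => _ [y hy <-]; exact: (err_le_M_plus d0 oO bO nO s0 s1 Lg ws vwt hy).
apply/lee_addgt0Pr => k k0.
set G0 := N0; have G00 : 0 <= G0 by exact: nrm_ge0.
have S0 : 0 < 2 * G0 + 1 by rewrite ltr_wpDl// mulr_ge0.
(* So that (N0 + de)^2 - N0^2 = de (2 N0 + de) <= de (2 N0 + 1) <= k^2. *)
pose de := Num.min 1 (k ^+ 2 / (2 * G0 + 1)).
have de0 : 0 < de by rewrite lt_min ltr01 divr_gt0// exprn_gt0.
have [e /andP[e0 e1] hl] := trace_functional_bound de0.
have C0 : 0 <= G0 + de by rewrite addr_ge0// ltW.
have [F [EF FC HF]] := minimiser_exists e0 C0 hl.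
apply: (@le_trans _ _ (normQv Omega s (grad (wt0 \- w)%R) + (Num.sqrt ((G0 + de) ^+ 2 - G0 ^+ 2))%:E)%E).
  apply: le_trans (minimal_M_plus e0 C0 EF FC HF).
  by apply: ereal_inf_lbound; exists (fun z => aeps e z.2 *: F z) => //; exact: (minimal_inYdiv e0 EF HF).
rewrite leeD2l// lee_fin -(ger0_norm (ltW k0)) -sqrtr_sqr ler_wsqrtr//.
rewrite sqr_diff.
apply: (@le_trans _ _ (de * (2 * G0 + 1))).
  by rewrite ler_pM2l// lerD2l ge_min lexx.
by rewrite -ler_pdivlMr// ge_min lexx orbT.
Qed.

End infimum.

Unset Implicit Arguments.

Theorem theorem2 (R : realType) (d : nat) (Omega : set 'rV[R]_d) (s : R)
    (g : 'rV[R]_d -> R) (w wt : 'rV[R]_d * R -> R) :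
  (0 < d)%N ->
  open Omega -> bounded_set Omega -> connected Omega -> Omega !=set0 ->
  lipschitz_boundary Omega ->
  0 < s -> s < 1 ->
  L2 Omega g ->
  weak_solution Omega s g w ->
  inV Omega s wt ->
  let err := normQv Omega s (gradQ Omega s (wt \- w)) in
  (forall y eta, inYdiv Omega s y -> inV Omega s eta ->
     ((M_minus Omega s g wt eta)%:E <= err)%E /\
     (err <= M_plus Omega s g wt y)%E) /\
  ereal_sup [set (M_minus Omega s g wt eta)%:E | eta in inV Omega s] = err /\
  err = ereal_inf [set M_plus Omega s g wt y | y in inYdiv Omega s].
Proof.
move=> d0 oO bO _ nO _ s0 s1 Lg ws vwt err; split; last split.
- move=> y eta hy veta; split; last exact: (err_le_M_plus d0 oO bO nO s0 s1 Lg ws vwt hy).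
  by rewrite /err (errE oO bO s0 s1 ws vwt) lee_fin (M_minus_le oO bO s0 s1 ws vwt veta).
- exact: (sup_M_minus oO bO s0 s1 ws vwt).
- exact: (inf_M_plus d0 oO bO nO s0 s1 Lg ws vwt).
Qed.
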